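(* Fix $\bar\tau_0,\bar\tau_1>0$, $n\ge1$, $\lambda_i>0$ with $\sum_{i=1}^n\lambda_i=1$, $a_i>0$, $\mu_i=\mathcal N(m_i,\Sigma_i)\in\mathcal G_d^1$, and use the notation of the context. Let $x$ be any real-analytic local chart of $\mathcal G_d^1$ near the Gaussian Wasserstein barycenter $\nu_{\mathrm{BW}}$ (the unique minimizer of $\Phi_\infty$ over $\mathcal G_d^1$), and write $x_{\mathrm{BW}}$ for its coordinate. Set $$H_\infty:=D_x^2(\Phi_\infty\circ x^{-1})(x_{\mathrm{BW}}),$$ which is positive definite. Then there exists $\kappa_*<\infty$ such that for every $\kappa\ge\kappa_*$ the minimizer $\nu_\kappa$ of $\Phi_\kappa$ over $\mathcal G_d^1$ is unique; consequently the minimizer of $(b,\nu)\mapsto\mathsf F_\kappa(b,\nu)$ over $b>0$, $\nu\in\mathcal G_d^1$ is also unique. Its coordinate $x_\kappa=x(\nu_\kappa)$ depends real analytically on $\varepsilon=\kappa^{-1}$ near $0$ and satisfies, as $\kappa\to\infty$, $$x_\kappa=x_{\mathrm{BW}}-\frac1\kappa H_\infty^{-1}\nabla_x\bigl(\Phi_1\circ x^{-1}\bigr)(x_{\mathrm{BW}})+O(\kappa^{-2}).$$ The corresponding mass satisfies $$b_\kappa(\nu_\kappa)=Z_0^{1/\theta}-\frac{Z_0^{1/\theta-1}}{\bar\tau_0\kappa}M_1(\nu_{\mathrm{BW}})+O(\kappa^{-2}).$$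
   Context: $\mathbb S^d$, $\mathbb S_{++}^d$: real symmetric, resp. positive-definite, $d\times d$ matrices. $\mathcal G_d^1=\{\mathcal N(m,\Sigma):m\in\mathbb R^d,\Sigma\in\mathbb S_{++}^d\}$, identified with the open set $\mathbb R^d\times\mathbb S_{++}^d$, tangent vectors $(\dot m,H)\in\mathbb R^d\times\mathbb S^d$. For finite nonnegative Borel measures, $\mathrm{KL}(\rho\mid\eta)=\int(r\log r-r+1)\,d\eta$ if $\rho\ll\eta$, $r=d\rho/d\eta$, and $+\infty$ otherwise, and $\mathsf U_{\tau_0,\tau_1}(\alpha,\beta)=\inf_\gamma\{\int\|x-y\|^2d\gamma+\tau_0\mathrm{KL}(\gamma_0\mid\alpha)+\tau_1\mathrm{KL}(\gamma_1\mid\beta)\}$ over finite nonnegative Borel measures $\gamma$ on $\mathbb R^d\times\mathbb R^d$ with marginals $\gamma_0,\gamma_1$. For $\kappa>0$ set $\mathsf F_\kappa(b,\nu)=\sum_i\lambda_i\mathsf U_{\kappa\bar\tau_0,\kappa\bar\tau_1}(a_i\mu_i,b\nu)$; $\bar s=\bar\tau_0+\bar\tau_1$, $\theta=\bar\tau_0/\bar s$, $\bar a=\sum_i\lambda_ia_i$. Define $$A_i^{(\kappa)}(\nu)=\inf_{p,q\in\mathcal P(\mathbb R^d)}\{W_2^2(p,q)+\kappa\bar\tau_0\mathrm{KL}(p\mid\mu_i)+\kappa\bar\tau_1\mathrm{KL}(q\mid\nu)\},$$ $\mathsf Z_\kappa(\nu)=\sum_i\lambda_ia_i^\theta e^{-A_i^{(\kappa)}(\nu)/(\kappa\bar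 s)}$, $b_\kappa(\nu)=\mathsf Z_\kappa(\nu)^{1/\theta}$, $\Phi_\kappa(\nu)=\inf_{b>0}\mathsf F_\kappa(b,\nu)$, which equals $\kappa\bar\tau_0(\bar a-\mathsf Z_\kappa(\nu)^{1/\theta})$ and is attained only at $b=b_\kappa(\nu)$. Let $\mathcal W(p,q)=W_2^2(p,q)$, $\mathcal W_i(\nu)=\mathcal W(\mu_i,\nu)$, $c_i=\lambda_ia_i^\theta$, $Z_0=\sum_ic_i$, $p_\theta=1/\theta$, $M_1(\nu)=\sum_ic_i\mathcal W_i(\nu)$, $M_2(\nu)=\sum_ic_i\mathcal W_i(\nu)^2$, $\Phi_\infty(\nu)=Z_0^{1/\theta-1}M_1(\nu)$. With the Fisher--Rao metric $g_{\mathrm{FR},\mu}(\xi,\xi)=\dot m^\top\Sigma^{-1}\dot m+\frac12\operatorname{tr}(\Sigma^{-1}H\Sigma^{-1}H)$ at $\mu=\mathcal N(m,\Sigma)$, $\xi=(\dot m,H)$, and $\|\cdot\|_{\mathrm{FR},\mu,*}$ the dual norm on covectors, let $$\mathcal C_i(\nu)=-\frac1{2\bar\tau_0}\|D_1\mathcal W(\mu_i,\nu)\|_{\mathrm{FR},\mu_i,*}^2-\frac1{2\bar\tau_1}\|D_2\mathcal W(\mu_i,\nu)\|_{\mathrm{FR},\nu,*}^2,\qquad \mathcal C(\nu)=\sum_ic_i\mathcal C_i(\nu),$$ where $D_1,D_2$ are differentials in the first and second arguments, and $$\Phi_1(\nu)=Z_0^{p_\theta-1}\mathcal C(\nu)-\frac{Z_0^{p_\theta-1}}{2\bar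 s}M_2(\nu)-\frac{p_\theta-1}{2\bar s}Z_0^{p_\theta-2}M_1(\nu)^2.$$ *)

(* Defs.v *)
From HB Require Import structures.
From mathcomp Require Import all_boot all_order all_algebra.
From mathcomp Require Import all_classical all_reals all_analysis measurable_realfun.

Set Implicit Arguments.
Unset Strict Implicit.
Unset Printing Implicit Defensive.

Import Order.TTheory GRing.Theory Num.Theory.
Import numFieldTopology.Exports numFieldNormedType.Exports.

Local Open Scope classical_set_scope.
Local Open Scope ring_scope.

(** R^d as a measurable space: d-tuples with the product sigma-algebra of the
    Borel sigma-algebra of R, which is the Borel sigma-algebra of R^d. *)
Notation Rn R d := (d.-tuple (measurableTypeR R)).

Section Lebesgue_tuple.
Context {R : realType}.

Section cons_measure.
Context (d : nat) (m : {sigma_finite_measure set (Rn R d) -> \bar R}).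

Definition consx (z : measurableTypeR R * Rn R d) : Rn R d.+1 :=
  [the d.+1.-tuple (measurableTypeR R) of z.1 :: z.2].

Lemma measurable_consx : measurable_fun setT consx.
Proof. by apply: measurable_cons; [exact: measurable_fst|exact: measurable_snd]. Qed.

Definition cons_measure : set (Rn R d.+1) -> \bar R :=
  pushforward (lebesgue_measure \x m)%E consx.

Let consT A : measurable A -> measurable (consx @^-1` A).
Proof. by move=> mA; rewrite -[X in measurable X]setTI; exact: measurable_consx. Qed.

Let cons0 : cons_measure set0 = 0%E.
Proof. by rewrite /cons_measure /pushforward preimage_set0 measure0. Qed.

Let cons_ge0 A : (0 <= cons_measure A)%E.
Proof. by rewrite /cons_measure /pushforward; exact: measure_ge0. Qed.

Let cons_sigma_additive : semi_sigma_additive cons_measure.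
Proof.
move=> F mF tF mUF; rewrite /cons_measure /pushforward preimage_bigcup.
apply: measure_semi_sigma_additive.
- by move=> n; exact: consT.
- apply/trivIsetP => /= i j _ _ ij; rewrite -preimage_setI.
  by move/trivIsetP : tF => /(_ _ _ _ _ ij) ->//; rewrite preimage_set0.
- by rewrite -preimage_bigcup; exact: consT.
Qed.

HB.instance Definition _ := isMeasure.Build _ _ _ cons_measure
  cons0 cons_ge0 cons_sigma_additive.

Let unconsx (u : Rn R d.+1) : measurableTypeR R * Rn R d :=
  (thead u, [tuple of behead u]).

Let measurable_unconsx : measurable_fun setT unconsx.
Proof.
by apply/measurable_fun_pairP; split;
  [exact: measurable_tnth|exact: measurable_behead].
Qed.

Let consxK z : unconsx (consx z) = z.
Proof. by case: z => x t; congr pair; exact: val_inj. Qed.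

Let cons_sigma_finite : sigma_finite setT cons_measure.
Proof.
have /sigma_finiteP[F [TF ndF Foo]] := sigma_finiteT (@lebesgue_measure R).
have /sigma_finiteP[G [TG ndG Goo]] := sigma_finiteT m.
exists (fun i => unconsx @^-1` (F i `*` G i)).
  apply/esym/seteqP; split=> // u _.
  have [i _ Fi] : (\bigcup_i F i) (unconsx u).1 by rewrite -TF.
  have [j _ Gj] : (\bigcup_i G i) (unconsx u).2 by rewrite -TG.
  exists (maxn i j) => //; split.
  - by move: Fi; exact/subsetPset/ndF/leq_maxl.
  - by move: Gj; exact/subsetPset/ndG/leq_maxr.
move=> i; have [mF ?] := Foo i; have [mG ?] := Goo i; split.
  by rewrite -[X in measurable X]setTI; apply: measurable_unconsx => //;
    exact: measurableX.
rewrite /cons_measure /pushforward -comp_preimage.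
rewrite (_ : unconsx \o consx = id); last by apply/funext => z /=; rewrite consxK.
by rewrite preimage_id product_measure1E// lte_mul_pinfty// ge0_fin_numE.
Qed.

HB.instance Definition _ := Measure_isSigmaFinite.Build _ _ _ cons_measure
  cons_sigma_finite.

End cons_measure.

Fixpoint lebesgue_tuple (d : nat) : {sigma_finite_measure set (Rn R d) -> \bar R} :=
  match d with
  | 0 => [the {sigma_finite_measure set (Rn R 0) -> \bar R} of
           @dirac _ (Rn R 0) [tuple] R]
  | d'.+1 => [the {sigma_finite_measure set (Rn R d'.+1) -> \bar R} of
               cons_measure (lebesgue_tuple d')]
  end.

End Lebesgue_tuple.

Section Gaussians.
Context {R : realType} {d : nat}.

(** Pairs (m, Sigma); [gaussians] cuts out R^d x S_{++}^d. *)
Definition gparam := ('cV[R]_d * 'M[R]_d)%type.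

Definition sympd k (M : 'M[R]_k) : Prop :=
  M^T = M /\ forall v : 'cV[R]_k, v != 0 -> 0 < (v^T *m M *m v) 0 0.

Definition gaussians : set gparam := [set p | sympd p.2].

Definition colx (x : Rn R d) : 'cV[R]_d := \col_i (tnth x i : R).

Definition gauss_pdf (p : gparam) (x : Rn R d) : R :=
  (Num.sqrt ((pi *+ 2) ^+ d * \det p.2))^-1 *
  expR (- 2^-1 * ((colx x - p.1)^T *m invmx p.2 *m (colx x - p.1)) 0 0).

Definition gauss_density_measure (p : gparam) (A : set (Rn R d)) : \bar R :=
  (\int[lebesgue_tuple d]_(x in A) (gauss_pdf p x)%:E)%E.

Lemma gauss_pdf_ge0 p x : 0 <= gauss_pdf p x.
Proof. by rewrite mulr_ge0 ?expR_ge0// invr_ge0 sqrtr_ge0. Qed.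

Lemma measurable_gauss_pdf p :
  measurable_fun setT (gauss_pdf p : Rn R d -> measurableTypeR R).
Proof.
apply: measurable_funM; first exact: measurable_cst.
apply: measurableT_comp; first exact: measurable_expR.
apply: measurable_funM; first exact: measurable_cst.
have mc i : measurable_fun setT
    (fun x : Rn R d => (colx x - p.1) i 0 : measurableTypeR R).
  under eq_fun do rewrite !mxE.
  by apply: measurable_funB; [exact: measurable_tnth|exact: measurable_cst].
under eq_fun do rewrite mxE.
apply: measurable_sum => j; apply: measurable_funM; last exact: mc.
under eq_fun do rewrite mxE.
apply: measurable_sum => i; apply: measurable_funM; last exact: measurable_cst.
by under eq_fun do rewrite mxE; exact: mc.
Qed.

Section gauss_density_measure.
Variable p : gparam.

Let gauss0 : gauss_density_measure p set0 = 0%E.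
Proof. by rewrite /gauss_density_measure integral_set0. Qed.

Let gauss_ge0 A : (0 <= gauss_density_measure p A)%E.
Proof. by apply: integral_ge0 => x _; rewrite lee_fin gauss_pdf_ge0. Qed.

Let gauss_sigma_additive : semi_sigma_additive (gauss_density_measure p).
Proof.
move=> /= A mA tA mUA.
rewrite /gauss_density_measure ge0_integral_bigcup//=.
- apply: is_cvg_ereal_nneg_natsum_cond => n _ _.
  by apply: integral_ge0 => x _; rewrite lee_fin gauss_pdf_ge0.
- by apply/measurable_EFinP; apply: measurable_funTS; exact: measurable_gauss_pdf.
- by move=> x _; rewrite lee_fin gauss_pdf_ge0.
Qed.

HB.instance Definition _ := isMeasure.Build _ _ _ (gauss_density_measure p)
  gauss0 gauss_ge0 gauss_sigma_additive.

End gauss_density_measure.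

(** The law N(m, Sigma).  When Sigma is positive definite the density has total
    mass 1 and [mnormalize] changes nothing; it only makes the definition a
    probability for every pair (m, Sigma), degenerate ones being junk. *)
Definition gauss (p : gparam) : probability (Rn R d) R :=
  [the probability (Rn R d) R of
    mnormalize (gauss_density_measure p) (@dirac _ (Rn R d) [tuple 0 | i < d] R)].

End Gaussians.
Arguments gparam : clear implicits.
Arguments gaussians : clear implicits.

Section Entropy_transport.
Context {R : realType}.
Local Open Scope ereal_scope.

Section KL.
Context {dT} {T : measurableType dT}.

(** [ln 0 = 0] in the library, so the integrand is 1 where the derivative
    vanishes; the derivative is finite everywhere and nonnegative eta-a.e. *)
Definition KL (rho eta : {finite_measure set T -> \bar R}) : \bar R :=
  if `[< rho `<< eta >] then
    \int[eta]_x
      (let r := fine (Radon_Nikodym (charge_of_finite_measure rho) eta x) in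
       r * ln r - r + 1)%R%:E
  else +oo.

End KL.

Section marginals.
Context {d1 d2} {T1 : measurableType d1} {T2 : measurableType d2}.
Variable g : {finite_measure set (T1 * T2)%type -> \bar R}.

Definition marginal1 : set T1 -> \bar R := pushforward g fst.
Definition marginal2 : set T2 -> \bar R := pushforward g snd.

Let m10 : marginal1 set0 = 0. Proof. exact: measure0. Qed.
Let m1_ge0 A : 0 <= marginal1 A. Proof. exact: measure_ge0. Qed.
Let m1_sigma_additive : semi_sigma_additive marginal1.
Proof. exact: measure_semi_sigma_additive. Qed.
HB.instance Definition _ := isMeasure.Build _ _ _ marginal1
  m10 m1_ge0 m1_sigma_additive.
Let m1_fin : fin_num_fun marginal1.
Proof.
by move=> A mA; apply: fin_num_measure; rewrite -[X in measurable X]setTI;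
  exact: measurable_fst.
Qed.
HB.instance Definition _ := Measure_isFinite.Build _ _ _ marginal1 m1_fin.

Let m20 : marginal2 set0 = 0. Proof. exact: measure0. Qed.
Let m2_ge0 A : 0 <= marginal2 A. Proof. exact: measure_ge0. Qed.
Let m2_sigma_additive : semi_sigma_additive marginal2.
Proof. exact: measure_semi_sigma_additive. Qed.
HB.instance Definition _ := isMeasure.Build _ _ _ marginal2
  m20 m2_ge0 m2_sigma_additive.
Let m2_fin : fin_num_fun marginal2.
Proof.
by move=> A mA; apply: fin_num_measure; rewrite -[X in measurable X]setTI;
  exact: measurable_snd.
Qed.
HB.instance Definition _ := Measure_isFinite.Build _ _ _ marginal2 m2_fin.

End marginals.

Context {d : nat}.

Definition sqdist (x y : Rn R d) : R :=
  (\sum_(i < d) ((tnth x i : R) - (tnth y i : R)) ^+ 2)%R.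

Definition transport_cost
    (g : {finite_measure set (Rn R d * Rn R d)%type -> \bar R}) : \bar R :=
  \int[g]_z (sqdist z.1 z.2)%:E.

Definition UOT (tau0 tau1 : R)
    (alpha beta : {finite_measure set (Rn R d) -> \bar R}) : \bar R :=
  ereal_inf [set transport_cost g + tau0%:E * KL (marginal1 g) alpha
                 + tau1%:E * KL (marginal2 g) beta
            | g in [set: {finite_measure set (Rn R d * Rn R d)%type -> \bar R}]].

(** Values of measures off the sigma-algebra are meaningless, hence the
    restriction to measurable sets. *)
Definition coupling (p q : probability (Rn R d) R)
    (g : probability (Rn R d * Rn R d)%type R) : Prop :=
  forall A : set (Rn R d), measurable A ->
    marginal1 g A = p A /\ marginal2 g A = q A.

Definition W2sq (p q : probability (Rn R d) R) : \bar R :=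
  ereal_inf [set transport_cost g | g in coupling p q].

End Entropy_transport.

Section Calculus.
Context {R : realType}.

Definition multilinear (V W : lmodType R) k (M : ('I_k -> V) -> W) : Prop :=
  forall (v : 'I_k -> V) (i : 'I_k) (c : R) (u w : V),
    M (dfwith v i (c *: u + w)) = c *: M (dfwith v i u) + M (dfwith v i w).

(** [f] is given on a neighbourhood of [p] in [S] by a convergent power series
    whose k-th term is the diagonal of a k-linear map.  For S open in an affine
    subspace this is real-analyticity of the restriction of [f] to [S]. *)
Definition analytic_within (V W : normedModType R) (S : set V) (f : V -> W)
    (p : V) : Prop :=
  exists (M : forall k, ('I_k -> V) -> W) (C r : R),
    [/\ 0 < r,
        forall k, multilinear (M k),
        forall k v, `|M k v| <= C * r ^- k * \prod_(i < k) `|v i| &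
        forall y, S y -> `|y - p| < r ->
          (fun n => \sum_(0 <= k < n) M k (fun=> y - p)) @ \oo --> f y].

Definition gradient N (f : 'cV[R]_N -> R) (x : 'cV[R]_N) : 'cV[R]_N :=
  \col_i 'D_(delta_mx i 0) f x.

Definition hessian N (f : 'cV[R]_N -> R) (x : 'cV[R]_N) : 'M[R]_N :=
  \matrix_(i, j) 'D_(delta_mx i 0) (fun y => gradient f y j 0) x.

Definition twice_differentiable N (f : 'cV[R]_N -> R) (x : 'cV[R]_N) : Prop :=
  (\forall y \near x, differentiable f y) /\ differentiable (gradient f) x.

(** [x] is a chart with domain [U], and [xinv] its inverse on x(U).  The
    dimension N is forced to be that of R^d x S^d. *)
Definition analytic_chart d N (U : set (gparam R d)) (x : gparam R d -> 'cV[R]_N)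
    (xinv : 'cV[R]_N -> gparam R d) : Prop :=
  [/\ exists2 O, open O & U = O `&` gaussians R d,
      open (x @` U),
      {in U, cancel x xinv},
      forall p, U p -> analytic_within (gaussians R d) x p &
      forall v, (x @` U) v -> analytic_within setT xinv v].

End Calculus.

Definition argmin {T : Type} {disp} {E : porderType disp} (A : set T)
    (f : T -> E) : set T :=
  [set t | A t /\ forall s, A s -> (f t <= f s)%O].

Section Fisher_Rao.
Context {R : realType} {d : nat}.
Implicit Types p q xi : gparam R d.

Definition tangent : set (gparam R d) := [set xi | xi.2^T = xi.2].

Definition fisher_rao p xi : R :=
  (xi.1^T *m invmx p.2 *m xi.1) 0 0 +
  2^-1 * \tr (invmx p.2 *m xi.2 *m invmx p.2 *m xi.2).

Definition fr_dual_norm p (l : gparam R d -> R) : R :=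
  sup [set `|l xi| | xi in [set xi | tangent xi /\ fisher_rao p xi <= 1]].

Definition Wass p q : R := fine (W2sq (gauss p) (gauss q)).

(** Only evaluated on tangent [xi]: since Sigma + t H stays symmetric positive
    definite for small t, the derivative does not see the junk values of [gauss]. *)
Definition D1Wass p q xi : R := 'D_xi (fun p' => Wass p' q) p.
Definition D2Wass p q xi : R := 'D_xi (Wass p) q.

End Fisher_Rao.

Section Barycenter.
Context {R : realType} {d n : nat}.
Variables (tau0 tau1 : R) (lam : 'I_n -> R) (a : 'I_n -> {posnum R})
  (mu : 'I_n -> gparam R d).

Definition sbar : R := tau0 + tau1.
Definition theta : R := tau0 / sbar.

Definition Fobj (kappa : R) (bnu : {posnum R} * gparam R d) : \bar R :=
  (\sum_(i < n) (lam i)%:E *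
     UOT (kappa * tau0) (kappa * tau1)
       (mscale ((a i)%:num%:nng)%R (gauss (mu i)))
       (mscale (bnu.1%:num%:nng)%R (gauss bnu.2)))%E.

Definition Phi (kappa : R) (nu : gparam R d) : \bar R :=
  ereal_inf [set Fobj kappa (b, nu) | b in [set: {posnum R}]].

Definition Acost (kappa : R) (i : 'I_n) (nu : gparam R d) : \bar R :=
  ereal_inf [set (W2sq pq.1 pq.2
                  + (kappa * tau0)%:E * KL pq.1 (gauss (mu i))
                  + (kappa * tau1)%:E * KL pq.2 (gauss nu))%E
            | pq in [set: probability (Rn R d) R * probability (Rn R d) R]].

Definition Zpart (kappa : R) (nu : gparam R d) : R :=
  \sum_(i < n) lam i * (a i)%:num `^ theta *
    fine (expeR (- (Acost kappa i nu * ((kappa * sbar)^-1)%:E))).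

Definition bmass (kappa : R) (nu : gparam R d) : R := Zpart kappa nu `^ theta^-1.

Definition cw (i : 'I_n) : R := lam i * (a i)%:num `^ theta.
Definition Z0 : R := \sum_(i < n) cw i.
Definition M1 (nu : gparam R d) : R := \sum_(i < n) cw i * Wass (mu i) nu.
Definition M2 (nu : gparam R d) : R := \sum_(i < n) cw i * Wass (mu i) nu ^+ 2.

Definition Phi_inf (nu : gparam R d) : R := Z0 `^ (theta^-1 - 1) * M1 nu.

Definition Ci (i : 'I_n) (nu : gparam R d) : R :=
  - (2 * tau0)^-1 * fr_dual_norm (mu i) (D1Wass (mu i) nu) ^+ 2
  - (2 * tau1)^-1 * fr_dual_norm nu (D2Wass (mu i) nu) ^+ 2.

Definition Ctot (nu : gparam R d) : R := \sum_(i < n) cw i * Ci i nu.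

Definition Phi1 (nu : gparam R d) : R :=
  Z0 `^ (theta^-1 - 1) * Ctot nu
  - Z0 `^ (theta^-1 - 1) / (2 * sbar) * M2 nu
  - (theta^-1 - 1) / (2 * sbar) * Z0 `^ (theta^-1 - 2) * M1 nu ^+ 2.

End Barycenter.

(* Main.v *)
(** For Gaussian marginals both transport problems are solved by quadratic potentials: an
admissible pair [(S, r)] gives a dual lower bound [lnE], attained when [S] is matched. The optimality
system, written with [e = 1 / kappa], is analytic also at [e = 0], where it is the barycenter equation.
Its differential there is injective, so a Newton iteration on power series gives an analytic curve of
solutions through the barycenter. Perturbing the dual pair bounds the objective below with a gain
of order [|H|^2 / (1 + |H|) + |h|^2 / (1 + |h|)], so the curve is the unique minimizer. The system
differentiated at [e = 0] reads [Hess Phi_inf (nu') = - d Phi_1]. *)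

From HB Require Import structures.
From mathcomp Require Import all_boot all_order perm all_algebra.
From mathcomp Require Import all_classical all_reals all_analysis measurable_realfun.
From mathcomp Require Import ring lra.
Require Import Defs.

Set Implicit Arguments.
Unset Strict Implicit.
Unset Printing Implicit Defensive.

Import Order.TTheory GRing.Theory Num.Theory.
Import numFieldTopology.Exports numFieldNormedType.Exports.

Local Open Scope classical_set_scope.
Local Open Scope ring_scope.

Notation mfunT := (measurable_fun setT).
Notation nmodT := normedModType.
Notation Gd := (gaussians _ _).
Notation fmeas R T := {finite_measure set T%type -> \bar R}.
Notation scaled m P := (mscale (m%:num%:nng)%R P).

(** Three obstacles shape the proof. Competitors range over a non-compact set, so minimality is not
    drawn from compactness: for every competitor a dual pair with a smaller partition sum is
    exhibited. The gain must persist up to distances of order [1 / e], where a perturbation of [S]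
    proportional to the displacement would leave the positive cone; damping it by [1 + |H|] gives up
    quadratic growth and leaves linear growth. Still farther away, scalar choices of [S] suffice.
    The calculus of convergent power series used here is closed under sums, products and [expR].
    Inverses, resolvents and logarithms of determinants therefore enter as additional unknowns with
    equations of their own, and symmetric matrices are replaced by all matrices, with a summand that
    controls the antisymmetric part. Finally, the functionals are meaningful only on positive
    definite covariances, so differentials are expansions with quadratic remainder within that set;
    they become derivatives of functions on an open set only in a chart. *)

Lemma eq_ler {disp} {T : porderType disp} (x y : T) : x = y -> (x <= y)%O. Proof. by move=> ->. Qed.

Lemma normD_leM {R : numDomainType} {V : normedZmodType R} (x y : V) (a b c : R) :
 `|x| <= a * c -> `|y| <= b * c -> `|x + y| <= (a + b) * c.
Proof. by move=> h1 h2; rewrite mulrDl (le_trans (ler_normD _ _))// lerD. Qed.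

Lemma sum_gt0 {R : numDomainType} {n} (f : 'I_n -> R) : (0 < n)%N -> (forall i, 0 < f i) -> 0 < \sum_i f i.
Proof.
by move=> hn f0; rewrite (bigD1 (Ordinal hn))//= ltr_pwDl// sumr_ge0// => i _; exact/ltW.
Qed.

Ltac nonneg := repeat (first [done | exact: sqr_ge0 | exact: exprn_ge0 | apply: mulr_ge0 | apply: divr_ge0
 | apply: addr_ge0 | rewrite invr_ge0 | (apply: ltW; done)]).

(** * Dot product, Frobenius form and positive definite matrices, in the maximum norm of the
    entries *)

Section matrix_norm.
Context {R : realType}.

Lemma mx_norm_ge_entry m n (A : 'M[R]_(m, n)) i j : `|A i j| <= `|A|.
Proof.
rewrite {2}/Num.norm /= mx_normrE.
exact: (le_bigmax _ (fun ij : 'I_m * 'I_n => `|A ij.1 ij.2|) (i, j)).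
Qed.

Lemma mx_norm_le m n (A : 'M[R]_(m, n)) e :
 0 <= e -> (forall i j, `|A i j| <= e) -> `|A| <= e.
Proof.
move=> e0 H; rewrite /Num.norm /= mx_normrE; apply/bigmax_leP; split => // -[i j] _.
Qed.

Lemma mx_normT m n (A : 'M[R]_(m, n)) : `|A^T| = `|A|.
Proof.
apply/eqP; rewrite eq_le; apply/andP; split; apply: mx_norm_le => // i j.
 by rewrite mxE; exact: mx_norm_ge_entry.
by have := mx_norm_ge_entry A^T j i; rewrite mxE.
Qed.

Lemma mx_normM m n p (A : 'M[R]_(m, n)) (B : 'M[R]_(n, p)) :
 `|A *m B| <= n%:R * `|A| * `|B|.
Proof.
apply: mx_norm_le => [|i j]; first by rewrite !mulr_ge0.
rewrite mxE (le_trans (ler_norm_sum _ _ _))//.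
rewrite -mulrA mulr_natl -[X in _ *+ X]card_ord -sumr_const.
apply: ler_sum => k _; rewrite normrM ler_pM// ?mx_norm_ge_entry//.
Qed.

Lemma tr_norm n (A : 'M[R]_n) : `|\tr A| <= n%:R * `|A|.
Proof.
rewrite (le_trans (ler_norm_sum _ _ _))//.
rewrite mulr_natl -[X in _ *+ X]card_ord -sumr_const.
by apply: ler_sum => k _; exact: mx_norm_ge_entry.
Qed.

Lemma tr_mxM_norm n (A B : 'M[R]_n) : `|\tr (A *m B)| <= n%:R ^+ 2 * `|A| * `|B|.
Proof.
rewrite (le_trans (tr_norm _))// expr2 -!mulrA ler_wpM2l// mulrA.
exact: mx_normM.
Qed.

Definition dotc n (u v : 'cV[R]_n) : R := (u^T *m v) 0 0.

Lemma dotcE n (u v : 'cV[R]_n) : dotc u v = \sum_i u i 0 * v i 0.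
Proof. by rewrite /dotc mxE; apply: eq_bigr => i _; rewrite mxE. Qed.

Lemma dotcC n (u v : 'cV[R]_n) : dotc u v = dotc v u.
Proof. by rewrite !dotcE; apply: eq_bigr => i _; rewrite mulrC. Qed.

Lemma dotcDl n (u v w : 'cV[R]_n) : dotc (u + v) w = dotc u w + dotc v w.
Proof. by rewrite /dotc linearD/= mulmxDl mxE. Qed.

Lemma dotcDr n (u v w : 'cV[R]_n) : dotc w (u + v) = dotc w u + dotc w v.
Proof. by rewrite /dotc mulmxDr mxE. Qed.

Lemma dotcZl n a (u w : 'cV[R]_n) : dotc (a *: u) w = a * dotc u w.
Proof. by rewrite /dotc linearZ/= -scalemxAl mxE. Qed.

Lemma dotcZr n a (u w : 'cV[R]_n) : dotc w (a *: u) = a * dotc w u.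
Proof. by rewrite /dotc -scalemxAr mxE. Qed.

Lemma dotcNl n (u w : 'cV[R]_n) : dotc (- u) w = - dotc u w.
Proof. by rewrite -scaleN1r dotcZl mulN1r. Qed.

Lemma dotcNr n (u w : 'cV[R]_n) : dotc w (- u) = - dotc w u.
Proof. by rewrite -scaleN1r dotcZr mulN1r. Qed.

Lemma dotcBl n (u v w : 'cV[R]_n) : dotc (u - v) w = dotc u w - dotc v w.
Proof. by rewrite dotcDl dotcNl. Qed.

Lemma dotcBr n (u v w : 'cV[R]_n) : dotc w (u - v) = dotc w u - dotc w v.
Proof. by rewrite dotcDr dotcNr. Qed.

Lemma dotc0l n (u : 'cV[R]_n) : dotc 0 u = 0.
Proof. by rewrite -(scale0r u) dotcZl mul0r. Qed.

Lemma dotc0r n (u : 'cV[R]_n) : dotc u 0 = 0.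
Proof. by rewrite dotcC dotc0l. Qed.

Lemma dotc_mulmx n m (M : 'M[R]_(n, m)) u v : dotc u (M *m v) = dotc (M^T *m u) v.
Proof. by rewrite /dotc trmx_mul trmxK mulmxA. Qed.

Lemma dotc_mulmxl n m (M : 'M[R]_(n, m)) u v : dotc (M *m v) u = dotc v (M^T *m u).
Proof. by rewrite /dotc trmx_mul mulmxA. Qed.

Lemma dotc_ge0 n (u : 'cV[R]_n) : 0 <= dotc u u.
Proof. by rewrite dotcE sumr_ge0// => i _; rewrite -expr2 sqr_ge0. Qed.

Lemma dotc_eq0 n (u : 'cV[R]_n) : (dotc u u == 0) = (u == 0).
Proof.
apply/eqP/eqP => [|->]; last by rewrite dotc0r.
rewrite dotcE => /eqP; rewrite psumr_eq0; last by move=> i _; rewrite -expr2 sqr_ge0.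
move=> /allP H; apply/matrixP => i j; rewrite ord1 mxE.
by have := H i; rewrite mem_index_enum => /(_ isT)/=; rewrite -expr2 sqrf_eq0 => /eqP.
Qed.

Lemma dotc_gt0 n (u : 'cV[R]_n) : u != 0 -> 0 < dotc u u.
Proof. by move=> u0; rewrite lt_neqAle dotc_ge0 andbT eq_sym dotc_eq0. Qed.

Lemma dotc_norm n (u v : 'cV[R]_n) : `|dotc u v| <= n%:R * `|u| * `|v|.
Proof.
rewrite /dotc (le_trans (mx_norm_ge_entry _ _ _))// (le_trans (mx_normM _ _))//.
by rewrite mx_normT.
Qed.

Lemma sqr_norm_le_dotc n (u : 'cV[R]_n) : `|u| ^+ 2 <= dotc u u.
Proof.
rewrite -[leRHS]sqr_sqrtr ?dotc_ge0// ler_sqr ?nnegrE ?sqrtr_ge0//.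
apply: mx_norm_le => [|i j]; first exact: sqrtr_ge0.
rewrite ord1 -sqrtr_sqr ler_sqrt ?dotc_ge0// dotcE (bigD1 i)//= -expr2 lerDl.
by rewrite sumr_ge0// => k _; rewrite -expr2 sqr_ge0.
Qed.

Lemma dotc_tr n (u v : 'cV[R]_n) : dotc u v = \tr (v *m u^T).
Proof. by rewrite mxtrace_mulC /dotc /mxtrace big_ord1. Qed.

Lemma dotc_CS n (u v : 'cV[R]_n) : dotc u v ^+ 2 <= dotc u u * dotc v v.
Proof.
have [->|v0] := eqVneq v 0; first by rewrite !dotc0r expr0n mulr0.
have vv := dotc_gt0 v0.
have := dotc_ge0 (dotc v v *: u - dotc u v *: v).
rewrite !(dotcBl,dotcBr,dotcZl,dotcZr) (dotcC v u).
set a := dotc u u; set b := dotc u v; set c := dotc v v in vv *.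
rewrite (_ : _ - _ = c * (a * c - b ^+ 2)); last by ring.
by rewrite pmulr_rge0// subr_ge0.
Qed.

Definition fro n (X : 'M[R]_n) : R := \tr (X^T *m X).

Lemma froE n (X : 'M[R]_n) : fro X = \sum_j \sum_i X i j ^+ 2.
Proof.
rewrite /fro /mxtrace; apply: eq_bigr => j _; rewrite mxE; apply: eq_bigr => i _.
by rewrite mxE expr2.
Qed.

Lemma fro_ge0 n (X : 'M[R]_n) : 0 <= fro X.
Proof. by rewrite froE; do 2 apply: sumr_ge0 => ? _; rewrite sqr_ge0. Qed.

Lemma sqr_norm_le_fro n (X : 'M[R]_n) : `|X| ^+ 2 <= fro X.
Proof.
rewrite -[leRHS]sqr_sqrtr ?fro_ge0// ler_sqr ?nnegrE ?sqrtr_ge0//.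
apply: mx_norm_le => [|i j]; first exact: sqrtr_ge0.
rewrite -sqrtr_sqr ler_sqrt ?fro_ge0// froE (bigD1 j)//= (bigD1 i)//= -addrA lerDl.
by rewrite addr_ge0//; do ?[apply: sumr_ge0 => ? _]; rewrite ?sqr_ge0.
Qed.

Lemma fro_eq0 n (X : 'M[R]_n) : fro X <= 0 -> X = 0.
Proof.
move=> H; apply/eqP; rewrite -normr_eq0 -sqrf_eq0 eq_le sqr_ge0 andbT.
exact: le_trans (sqr_norm_le_fro X) H.
Qed.

Implicit Types n : nat.

Lemma sympdE n (M : 'M[R]_n) : sympd M ->
 M^T = M /\ forall v : 'cV[R]_n, v != 0 -> 0 < dotc v (M *m v).
Proof. by move=> [sM H]; split => // v /H; rewrite /dotc mulmxA. Qed.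

Lemma sympdP n (M : 'M[R]_n) :
 M^T = M -> (forall v : 'cV[R]_n, v != 0 -> 0 < dotc v (M *m v)) -> sympd M.
Proof. by move=> sM H; split => // v /H; rewrite /dotc mulmxA. Qed.

Lemma sympd_sym n (M : 'M[R]_n) : sympd M -> M^T = M. Proof. by case. Qed.

Lemma sympd_ge0 n (M : 'M[R]_n) : sympd M -> forall v, 0 <= dotc v (M *m v).
Proof.
move=> /sympdE[_ H] v; have [->|/H/ltW//] := eqVneq v 0.
by rewrite dotc0l.
Qed.

Lemma sympd_unit n (M : 'M[R]_n) : sympd M -> M \in unitmx.
Proof.
move=> /sympdE[sM H]; rewrite -unitmx_tr -row_free_unit -kermx_eq0.
apply/rowV0P => v /sub_kermxP vM.
apply/eqP; apply/negP => /negP v0.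
have : v^T != 0 by rewrite -(trmxK 0) (inj_eq trmx_inj) trmx0.
move=> /H; have : (v *m M^T)^T = 0 by rewrite vM trmx0.
by rewrite trmx_mul trmxK => ->; rewrite dotc0r ltxx.
Qed.

Lemma sympd_congr n (M L : 'M[R]_n) : sympd M -> L \in unitmx ->
 sympd (L^T *m M *m L).
Proof.
move=> /sympdE[sM H] uL; apply: sympdP.
 by rewrite !trmx_mul trmxK sM mulmxA.
move=> v v0; rewrite -!mulmxA dotc_mulmx trmxK; apply: H.
by apply: contra v0 => /eqP /(congr1 (mulmx (invmx L))); rewrite mulKmx// mulmx0 => ->.
Qed.

Lemma sympd_inv n (M : 'M[R]_n) : sympd M -> sympd (invmx M).
Proof.
move=> pM; have uM := sympd_unit pM.
have := sympd_congr pM (L := invmx M); rewrite unitmx_inv => /(_ uM).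
by rewrite trmx_inv (sympd_sym pM) mulVmx// mul1mx.
Qed.

Lemma sympd_congr' n (M S : 'M[R]_n) : sympd M -> sympd S -> sympd (S *m M *m S).
Proof.
by move=> pM pS; have := sympd_congr pM (sympd_unit pS); rewrite (sympd_sym pS).
Qed.

Lemma sympdD n (A B : 'M[R]_n) : sympd A -> sympd B -> sympd (A + B).
Proof.
move=> /sympdE[sA hA] /sympdE[sB hB]; apply: sympdP; first by rewrite linearD/= sA sB.
by move=> v v0; rewrite mulmxDl dotcDr addr_gt0 ?hA ?hB.
Qed.

Lemma sympdZ n a (A : 'M[R]_n) : 0 < a -> sympd A -> sympd (a *: A).
Proof.
move=> a0 /sympdE[sA hA]; apply: sympdP; first by rewrite linearZ/= sA.
by move=> v v0; rewrite -scalemxAl dotcZr mulr_gt0 ?hA.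
Qed.

Lemma sympd1 n : sympd (1%:M : 'M[R]_n).
Proof.
apply: sympdP; first by rewrite trmx1.
by move=> v v0; rewrite mul1mx dotc_gt0.
Qed.

Lemma sympd_scalar n a : 0 < a -> sympd (a%:M : 'M[R]_n).
Proof. by move=> a0; rewrite -scalemx1; apply: sympdZ => //; exact: sympd1. Qed.

(** Testing [M] on [(1, 0)] gives [a]; testing it on [(- a^-1 r v, v)], which annihilates the first
    row, gives the form of the Schur complement at [v]. *)
Lemma sympd_block n (a : R) (r : 'rV[R]_n) (D : 'M[R]_n) :
 sympd (block_mx a%:M r r^T D : 'M[R]_(1 + n)) ->
 0 < a /\ sympd (D - a^-1 *: (r^T *m r)).
Proof.
set M := block_mx _ _ _ _ => /sympdE[sM H].
have a0 : 0 < a.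
 have : (col_mx 1%:M 0 : 'cV[R]_(1 + n)) != 0.
 apply/eqP => /matrixP/(_ (lshift _ 0) 0); rewrite col_mxEu !mxE/= => /eqP.
 by rewrite oner_eq0.
 move=> /H; rewrite /M mul_block_col !mulmx1 !mulmx0 !addr0.
 rewrite /dotc tr_col_mx mul_row_col trmx1 mul1mx trmx0 mul0mx addr0.
 by rewrite mxE eqxx mulr1n.
split => //; apply: sympdP.
 move: sM; rewrite /M tr_block_mx => /eq_block_mx[_ _ _ sD].
 by rewrite linearB/= sD linearZ/= trmx_mul trmxK.
move=> v v0.
have : (col_mx (- a^-1 *: (r *m v)) v : 'cV[R]_(1 + n)) != 0.
 by apply: contra v0 => /eqP; rewrite -[0]col_mx0 => /eq_col_mx[_ ->].
move=> /H; rewrite /M mul_block_col.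
have -> : a%:M *m (- a^-1 *: (r *m v)) + r *m v = 0.
 rewrite mul_scalar_mx scalerA mulrN divff ?gt_eqF// scaleN1r.
 by rewrite addNr.
rewrite /dotc tr_col_mx mul_row_col mulmx0 add0r.
rewrite mulmxBl -!scalemxAr -!scalemxAl -!mulmxA scaleNr.
by rewrite addrC.
Qed.

Lemma sympd_blockE n (M : 'M[R]_(1 + n)) : M^T = M ->
 exists a r D, M = block_mx a%:M r r^T D.
Proof.
move=> sM; exists (ulsubmx M 0 0), (ursubmx M), (drsubmx M).
rewrite -[LHS]submxK; congr block_mx; first exact: mx11_scalar.
by rewrite trmx_ursub sM.
Qed.

(** Cholesky factorisation by induction on the size, through the Schur complement. It takes the
    place of the spectral theorem: the sign of the determinant, trace bounds and the Cauchy-Schwarz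
    inequality of a positive form are all read from [L]. *)
Lemma sympd_factor n (M : 'M[R]_n) : sympd M ->
 exists2 L : 'M[R]_n, L \in unitmx & M = L *m L^T.
Proof.
elim: n M => [|n IH] M pM.
 by exists 1%:M; rewrite ?unitmx1//; apply/matrixP => -[].
have [a [r [D eM]]] := sympd_blockE (M := M : 'M[R]_(1 + n)) (sympd_sym pM).
have [a0 /IH[L uL eL]] : 0 < a /\ sympd (D - a^-1 *: (r^T *m r)).
 by apply: sympd_block; rewrite -eM.
pose b := Num.sqrt a; have b0 : 0 < b by rewrite sqrtr_gt0.
have bb : b * b = a by rewrite -expr2 sqr_sqrtr// ltW.
pose B : 'M[R]_(1 + n) := block_mx b%:M 0 (b^-1 *: r^T) L.
have eB : block_mx a%:M r r^T D = B *m B^T.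
 rewrite /B (tr_block_mx b%:M) mulmx_block !trmx0 !mulmx0 !mul0mx !addr0.
 rewrite linearZ/= trmxK tr_scalar_mx -scalar_mxM bb; congr block_mx.
 - by rewrite mul_scalar_mx scalerA divff ?gt_eqF// scale1r.
 - by rewrite mul_mx_scalar scalerA divff ?gt_eqF// scale1r.
 - rewrite -scalemxAl -scalemxAr scalerA -invfM bb -eL.
 by rewrite addrC subrK.
exists B; last by rewrite eM; exact: eB.
rewrite unitmxE (@det_lblock _ 1 n) det_scalar1 unitrM -(unitmxE L) uL andbT unitfE.
by rewrite gt_eqF.
Qed.

Lemma sympd_det n (M : 'M[R]_n) : sympd M -> 0 < \det M.
Proof.
move=> /sympd_factor[L uL ->]; rewrite det_mulmx det_tr -expr2 lt_neqAle sqr_ge0.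
by rewrite andbT eq_sym sqrf_eq0 -unitfE -unitmxE.
Qed.

(** Cauchy-Schwarz for [L^T u] and [L^-1 v] with [M = L L^T]; the two factors cancel in the dot
    product on the left. *)
Lemma sympd_CS n (M : 'M[R]_n) u v : sympd M ->
 dotc u v ^+ 2 <= dotc u (M *m u) * dotc v (invmx M *m v).
Proof.
move=> pM; have [L uL eM] := sympd_factor pM.
have -> : dotc u v = dotc (L^T *m u) (invmx L *m v).
 by rewrite dotc_mulmxl trmxK mulKVmx.
have -> : dotc u (M *m u) = dotc (L^T *m u) (L^T *m u).
 by rewrite eM -mulmxA dotc_mulmx.
have -> : invmx M = (invmx L)^T *m invmx L.
 apply: (can_inj (mulKmx (sympd_unit pM))); rewrite mulmxV ?sympd_unit// eM.
 by rewrite trmx_inv -mulmxA (mulmxA L^T) mulmxV ?unitmx_tr// mul1mx mulmxV.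
rewrite -[X in dotc v X]mulmxA [X in _ <= _ * X]dotc_mulmx trmxK.
exact: dotc_CS.
Qed.

Lemma sympd_tr_ge n (M : 'M[R]_n) (v : 'cV[R]_n) : sympd M ->
 dotc v (M *m v) <= \tr M * dotc v v.
Proof.
move=> /sympd_factor[L uL ->]; rewrite -mulmxA dotc_mulmx.
rewrite dotcE mxtrace_mulC.
under eq_bigr do rewrite -expr2.
have -> : \tr (L^T *m L) = \sum_i dotc (col i L) (col i L).
 apply: eq_bigr => i _; rewrite dotcE mxE; apply: eq_bigr => j _.
 by rewrite !mxE.
rewrite mulr_suml; apply: ler_sum => i _.
have -> : (L^T *m v) i 0 = dotc (col i L) v.
 by rewrite dotcE mxE; apply: eq_bigr => j _; rewrite !mxE.
exact: dotc_CS.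
Qed.

Lemma sympd_tr_ge0 n (M : 'M[R]_n) : sympd M -> 0 <= \tr M.
Proof. by move=> /sympd_factor[L uL ->]; rewrite mxtrace_mulC; exact: fro_ge0. Qed.

Lemma sympd_lower n (M : 'M[R]_n) : sympd M ->
 exists2 c : R, 0 < c & forall v, c * dotc v v <= dotc v (M *m v).
Proof.
(* [sympd_CS] with both vectors equal to [v], and the trace of [invmx M] as an upper bound for its
   form, give the constant [1 / \tr (invmx M)]. The added 1 keeps it meaningful in dimension 0. *)
move=> pM; set t := \tr (invmx M) + 1.
have t0 : 0 < t by rewrite /t ltr_wpDl// sympd_tr_ge0//; exact: sympd_inv.
exists t^-1 => [|v]; first by rewrite invr_gt0.
have [->|v0] := eqVneq v 0; first by rewrite !dotc0l mulr0.
have vv := dotc_gt0 v0.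
rewrite mulrC ler_pdivrMr// -(ler_pM2r vv) -expr2 (le_trans (sympd_CS v v pM))//.
rewrite -mulrA ler_wpM2l ?sympd_ge0// (le_trans (sympd_tr_ge _ (sympd_inv pM)))//.
by rewrite ler_wpM2r ?(ltW vv)// lerDl.
Qed.

Lemma dotc_mulmx_norm n (D : 'M[R]_n) v :
 `|dotc v (D *m v)| <= n%:R ^+ 2 * `|D| * dotc v v.
Proof.
rewrite (le_trans (dotc_norm _ _))//.
have n0 : 0 <= n%:R * `|v| by rewrite mulr_ge0.
apply: le_trans (ler_wpM2l n0 (mx_normM D v)) _.
have -> : n%:R * `|v| * (n%:R * `|D| * `|v|) = n%:R ^+ 2 * `|D| * `|v| ^+ 2 by ring.
by rewrite ler_wpM2l ?sqr_norm_le_dotc// mulr_ge0// sqr_ge0.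
Qed.

Lemma sympd_near n (M : 'M[R]_n) : sympd M ->
 exists2 e : R, 0 < e &
 forall N : 'M[R]_n, N^T = N -> `|N - M| <= e -> sympd N.
Proof.
move=> pM; have [c c0 hc] := sympd_lower pM.
exists (c / (n%:R ^+ 2 + 1)); first by rewrite divr_gt0// ltr_wpDl// sqr_ge0.
move=> N sN hN; apply: sympdP => // v v0.
rewrite (_ : N = M + (N - M)); last by rewrite addrC subrK.
rewrite mulmxDl dotcDr.
have := dotc_mulmx_norm (N - M) v; rewrite ler_norml => /andP[h _].
have vv := dotc_gt0 v0.
apply: lt_le_trans (lerD (hc v) h).
rewrite -mulNr -mulrDl mulr_gt0// subr_gt0.
have n0 : 0 < n%:R ^+ 2 + 1 :> R by rewrite ltr_wpDl// sqr_ge0.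
apply: le_lt_trans (ler_wpM2l (sqr_ge0 _) hN) _.
by rewrite mulrCA gtr_pMr// ltr_pdivrMr// mul1r ltrDl.
Qed.

Lemma trmx_PXQ_factor n (P Q X L : 'M[R]_n) : P = L *m L^T ->
 \tr (X^T *m P *m X *m Q) = \sum_i dotc ((row i (L^T *m X))^T) (Q *m (row i (L^T *m X))^T).
Proof.
move=> ->.
have -> : X^T *m (L *m L^T) *m X *m Q = (L^T *m X)^T *m ((L^T *m X) *m Q).
 by rewrite trmx_mul trmxK !mulmxA.
rewrite mxtrace_mulC; apply: eq_bigr => i _.
rewrite /dotc trmxK mulmxA [RHS]mxE mxE; apply: eq_bigr => j _.
rewrite !mxE; congr (_ * _).
by apply: eq_bigr => k _; rewrite !mxE.
Qed.

(** Source of the strict convexity used later: with [P = L L^T] the trace is the sum of the forms of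
    [Q] on the rows of [L^T X], and what remains is the sum of the forms of [P] on the columns of
    [X]. *)
Lemma tr_PXQ_ge n (P Q : 'M[R]_n) : sympd P -> sympd Q ->
 exists2 c : R, 0 < c & forall X, c * fro X <= \tr (X^T *m P *m X *m Q).
Proof.
move=> pP pQ; have [L uL eP] := sympd_factor pP.
have [c c0 hc] := sympd_lower pQ; have [e e0 he] := sympd_lower pP.
exists (c * e); first by rewrite mulr_gt0.
move=> X; rewrite (trmx_PXQ_factor Q X eP).
have -> : fro X = \sum_j dotc (col j X) (col j X).
 by rewrite froE; apply: eq_bigr => j _; rewrite dotcE; apply: eq_bigr => i _;
 rewrite !mxE expr2.
apply: le_trans (ler_sum _ (fun i _ => hc _)).
rewrite -mulr_sumr -mulrA ler_pM2l//.
have -> : \sum_i dotc (row i (L^T *m X))^T (row i (L^T *m X))^T =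
 \sum_j dotc (col j X) (P *m col j X).
 under eq_bigr do rewrite dotcE.
 rewrite exchange_big/=; apply: eq_bigr => j _.
 rewrite eP -mulmxA dotc_mulmx dotcE; apply: eq_bigr => i _.
 by rewrite !mxE; congr (_ * _); apply: eq_bigr => k _; rewrite !mxE.
by rewrite mulr_sumr; apply: ler_sum => j _.
Qed.

Lemma tr_mulmx_ge0 n (P Q : 'M[R]_n) : sympd P -> sympd Q -> 0 <= \tr (P *m Q).
Proof.
move=> pP pQ; have [L uL eP] := sympd_factor pP.
have := trmx_PXQ_factor Q 1%:M eP; rewrite trmx1 mul1mx mulmx1 => ->.
by apply: sumr_ge0 => i _; exact: sympd_ge0.
Qed.

Lemma tr_mulmx_lower n (P Q : 'M[R]_n) c : sympd P ->
 (forall v, c * dotc v v <= dotc v (Q *m v)) -> c * \tr P <= \tr (P *m Q).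
Proof.
move=> pP hc; have [L uL eP] := sympd_factor pP.
have := trmx_PXQ_factor Q 1%:M eP; rewrite trmx1 mul1mx mulmx1 => ->.
have := trmx_PXQ_factor 1%:M 1%:M eP; rewrite trmx1 mul1mx !mulmx1 => ->.
by rewrite mulr_sumr; apply: ler_sum => i _; rewrite mul1mx.
Qed.

End matrix_norm.

(** * Change of variables for Lebesgue measure under positive definite affine maps *)

Section affine_lebesgue.
Context {R : realType}.

Let lam := @lebesgue_measure R.

Lemma ge0_integral_lebesgue_affine (a c : R) (f : measurableTypeR R -> \bar R) :
 0 < a -> mfunT f -> (forall x, 0 <= f x)%E ->
 (a%:E * \int[lam]_x f (a * x + c)%R)%E = (\int[lam]_x f x)%E.
Proof.
move=> a0 mf f0.
pose phi (x : measurableTypeR R) : measurableTypeR R := a * x + c.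
have mphi : mfunT phi.
 by apply: measurable_funD => //; exact: measurable_funM.
pose anng : {nonneg R} := NngNum (ltW a0).
pose pf : {measure set (measurableTypeR R) -> \bar R} :=
 measure_function_pushforward__canonical__measure_function_Measure lam mphi.
transitivity (\int[mscale anng pf]_x f x)%E.
 rewrite ge0_integral_mscale//=; congr (_ * _)%E.
 by rewrite ge0_integral_pushforward.
apply: eq_measure_integral => A mA _.
(* The rescaled image measure needs comparison with Lebesgue measure on half-open intervals only;
   uniqueness extends the equality to all measurable sets. *)
apply/esym/lebesgue_measure_unique => // _ [[p q] /= _ <-].
rewrite /mscale/= /pushforward.
have -> : phi @^-1` `]p, q]%classic = `](p - c) / a, (q - c) / a]%classic.
 apply/seteqP; split => x /=; rewrite /phi !in_itv/=.
 by rewrite ltr_pdivrMr// ler_pdivlMr// ltrBlDr lerBrDr !(mulrC x).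
 by rewrite ltr_pdivrMr// ler_pdivlMr// ltrBlDr lerBrDr !(mulrC x).
rewrite /lam !lebesgue_measure_itv/= !lte_fin ltr_pM2r ?invr_gt0// ltrD2r.
case: ifP => _; last by rewrite mule0.
rewrite -!EFinD -EFinM; congr EFin; field.
by rewrite gt_eqF.
Qed.

Definition tup d (v : 'cV[R]_d) : Rn R d := [tuple (v i 0 : measurableTypeR R) | i < d].

Lemma tupK d : cancel (@tup d) colx.
Proof. by move=> v; apply/matrixP => i j; rewrite mxE tnth_mktuple ord1. Qed.

Lemma colxK d : cancel colx (@tup d).
Proof. by move=> x; apply/eq_from_tnth => i; rewrite tnth_mktuple mxE. Qed.

Definition aff d (T : 'M[R]_d) (b : 'cV[R]_d) (x : Rn R d) : Rn R d :=
 tup (T *m colx x + b).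

Lemma measurable_aff d (T : 'M[R]_d) b : mfunT (aff T b).
Proof.
apply/measurable_fun_tnthP => i /=.
rewrite (_ : _ \o _ = fun x : Rn R d => (\sum_j T i j * tnth x j + b i 0)%R :
 measurableTypeR R).
 apply: measurable_funD => //; apply: measurable_sum => j.
 by apply: measurable_funM => //; exact: measurable_tnth.
apply/funext => x /=; rewrite tnth_mktuple !mxE; congr (_ + _).
by apply: eq_bigr => j _; rewrite mxE.
Qed.

Lemma colx_consx d (z : measurableTypeR R * Rn R d) :
 colx (consx z) = col_mx (z.1 : R)%:M (colx z.2) :> 'cV[R]_(1 + d).
Proof.
apply/matrixP => i j; rewrite ord1 mxE.
case: (split_ordP i) => k ->.
 by rewrite col_mxEu ord1 mxE eqxx mulr1n.
rewrite col_mxEd mxE /consx /= (_ : rshift 1 k = lift ord0 k); last exact: val_inj.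
by rewrite tnthS.
Qed.

Lemma tup_col_mx d (a : R) (v : 'cV[R]_d) :
 tup (col_mx a%:M v : 'cV[R]_(1 + d)) = consx ((a : measurableTypeR R), tup v).
Proof.
by apply: (can_inj (@colxK _)); rewrite tupK colx_consx/= tupK.
Qed.

Lemma ge0_integral_lebesgue_tupleS d (f : Rn R d.+1 -> \bar R) :
 mfunT f -> (forall x, 0 <= f x)%E ->
 (\int[lebesgue_tuple d.+1]_x f x =
 \int[lam]_x \int[lebesgue_tuple d]_t f (consx (x, t)))%E.
Proof.
move=> mf f0.
have mfc : mfunT (f \o @consx R d).
 by apply: measurableT_comp => //; exact: measurable_consx.
rewrite [LHS](ge0_integral_pushforward (@measurable_consx R d))//=.
by rewrite preimage_setT fubini_tonelli1.
Qed.

Lemma measurable_consx1 d (t : Rn R d) :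
 mfunT (fun x : measurableTypeR R => consx (x, t)).
Proof. by apply: measurable_cons; [exact: measurable_id|exact: measurable_cst]. Qed.

Lemma measurable_consx2 d (x : measurableTypeR R) :
 mfunT (fun t : Rn R d => consx (x, t)).
Proof. by apply: measurable_cons; [exact: measurable_cst|exact: measurable_id]. Qed.

Lemma lebesgue_tuple_fubini d (g : measurableTypeR R * Rn R d -> \bar R) :
 mfunT g -> (forall z, 0 <= g z)%E ->
 (\int[lam]_x \int[lebesgue_tuple d]_t g (x, t) =
 \int[lebesgue_tuple d]_t \int[lam]_x g (x, t))%E.
Proof. by move=> mg g0; rewrite fubini_tonelli. Qed.

Lemma ge0_integral_lebesgue_tupleS' d (f : Rn R d.+1 -> \bar R) :
 mfunT f -> (forall x, 0 <= f x)%E ->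
 (\int[lebesgue_tuple d.+1]_x f x =
 \int[lebesgue_tuple d]_t \int[lam]_x f (consx (x, t)))%E.
Proof.
move=> mf f0; rewrite ge0_integral_lebesgue_tupleS//.
rewrite (@lebesgue_tuple_fubini d (fun z => f (consx z)))//.
by apply: (measurableT_comp mf); exact: measurable_consx.
Qed.

(* With the first coordinate [x] and the others [t], the block form of [T] gives
 [T (x, t) = (a z, S t + r^T z)] where [z = x + a^-1 r t] and [S] is the Schur
 complement, so the map is a shear followed by a shear and a rescaling. *)
Lemma ge0_integral_lebesgue_aff d (T : 'M[R]_d) b (f : Rn R d -> \bar R) :
 sympd T -> mfunT f -> (forall x, 0 <= f x)%E ->
 ((\det T)%:E * \int[lebesgue_tuple d]_x f (aff T b x) =
 \int[lebesgue_tuple d]_x f x)%E.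
Proof.
elim: d T b f => [|d IH] T b f pT mf f0.
 rewrite det_mx00 mul1e; apply: eq_integral => x _.
 by rewrite (tuple0 x) (tuple0 (aff _ _ _)).
have [a [r [D eM]]] := sympd_blockE (M := T) (sympd_sym pT).
have [a0 pS] : 0 < a /\ sympd (D - a^-1 *: (r^T *m r)).
 by apply: sympd_block; rewrite -eM.
set S := D - _ in pS.
have detT : \det T = a * \det S.
 pose Y : 'M[R]_(1 + d) := block_mx a%:M r 0 S.
 pose X : 'M[R]_(1 + d) := block_mx 1%:M 0 (a^-1 *: r^T) 1%:M.
 have -> : T = X *m Y.
 rewrite eM; apply: esym; rewrite /X mulmx_block !mul1mx !mul0mx !addr0.
 rewrite mul_mx_scalar scalerA divff ?gt_eqF// scale1r -scalemxAl.
 by rewrite addrC subrK.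
 rewrite (@det_mulmx _ (1 + d)) det_lblock det_ublock !det1 !mul1r.
 by rewrite det_scalar1.
pose b0 : R := b ord0 0; pose b1 : 'cV[R]_d := dsubmx (b : 'cV[R]_(1 + d)).
have eb : b = col_mx b0%:M b1 :> 'cV[R]_(1 + d).
 rewrite -[LHS](@vsubmxK _ 1 d); congr col_mx; rewrite [LHS]mx11_scalar mxE.
 by congr (b _ _)%:M; exact: val_inj.
pose T1 : 'M[R]_(1 + d) := block_mx a%:M 0 r^T S.
have aff1E (x : measurableTypeR R) (t : Rn R d) : aff T1 b (consx (x, t)) =
 consx ((a * x + b0 : measurableTypeR R)%R, aff S ((x : R) *: r^T + b1) t).
 rewrite /aff -tup_col_mx; congr tup.
 rewrite [in LHS]eb colx_consx/= (mul_block_col a%:M) add_col_mx mul0mx addr0.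
 congr col_mx; first by rewrite -scalar_mxM -raddfD.
 by rewrite mul_mx_scalar addrA [_ *: _ + _]addrC.
pose s (t : Rn R d) : R := (a^-1 *: (r *m colx t)) 0 0.
have affE (x : measurableTypeR R) (t : Rn R d) : aff T b (consx (x, t)) =
 aff T1 b (consx ((1 * x + s t : measurableTypeR R)%R, t)).
 rewrite /aff; congr tup; congr (_ + _).
 rewrite [in LHS]eM !colx_consx/= mul1r !(mul_block_col a%:M) mul0mx addr0.
 transitivity (col_mx (a%:M *m x%:M + r *m colx t) (r^T *m x%:M + D *m colx t)).
 exact: (@mul_block_col _ 1 d 1 d).
 have h1 : a%:M *m x%:M + r *m colx t = a%:M *m (x + s t)%:M :> 'M[R]_1.
 rewrite -!scalar_mxM [r *m _]mx11_scalar -raddfD/= /s; congr (_%:M).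
 by rewrite mulrDr; congr (_ + _); rewrite [in RHS]mxE mulrA divff ?gt_eqF// mul1r.
 have h2 : r^T *m x%:M + D *m colx t = r^T *m (x + s t)%:M + S *m colx t.
 rewrite !mul_mx_scalar scalerDl -addrA; congr (_ + _).
 rewrite /s mxE /S mulmxBl -scalemxAl -mulmxA [r *m _]mx11_scalar.
 rewrite mul_mx_scalar scalerA [_%:M 0 0]mxE eqxx mulr1n.
 by rewrite addrCA subrr addr0.
 by rewrite h1 h2.
have mfa (M : 'M[R]_d.+1) c : mfunT (fun x => f (aff M c x)).
 by apply: (measurableT_comp mf); exact: measurable_aff.
have mfac (M : 'M[R]_d.+1) c : mfunT (fun z => f (aff M c (consx z))).
 by apply: (measurableT_comp (mfa M c)); exact: measurable_consx.
rewrite ge0_integral_lebesgue_tupleS'//.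
transitivity ((\det T)%:E *
 \int[lam]_x \int[lebesgue_tuple d]_t f (aff T1 b (consx (x, t))))%E.
 congr (_ * _)%E.
 transitivity (\int[lebesgue_tuple d]_t \int[lam]_x f (aff T1 b (consx (x, t))))%E;
 last exact/esym/(@lebesgue_tuple_fubini d (fun z => f (aff T1 b (consx z)))).
 apply: eq_integral => t _.
 rewrite -(@ge0_integral_lebesgue_affine 1 (s t)
 (fun x => f (aff T1 b (consx (x, t)))))//; last first.
 exact: (measurableT_comp (mfa T1 b) (measurable_consx1 t)).
 by rewrite mul1e; apply: eq_integral => x _; rewrite affE.
have mfc : mfunT (f \o @consx R d).
 by apply: (measurableT_comp mf); exact: measurable_consx.
pose h (x : measurableTypeR R) := (\int[lebesgue_tuple d]_t f (consx (x, t)))%E.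
rewrite detT EFinM -muleA -ge0_integralZl_EFin//; last 3 first.
- by move=> x _; exact: integral_ge0.
- exact: (measurable_fun_fubini_tonelli_F (fun z => f (aff T1 b (consx z)))).
- exact/ltW/sympd_det.
transitivity (a%:E * \int[lam]_x h (a * x + b0)%R)%E.
 congr (_ * _)%E; apply: eq_integral => x _.
 under eq_integral do rewrite aff1E.
 rewrite (IH _ _ (fun t => f (consx ((a * x + b0 : measurableTypeR R)%R, t))))//.
 exact: (measurableT_comp mf (measurable_consx2 _)).
rewrite ge0_integral_lebesgue_affine//.
- by rewrite ge0_integral_lebesgue_tupleS.
- exact: (measurable_fun_fubini_tonelli_F (fun z => f (consx z))).
- by move=> x; exact: integral_ge0.
Qed.

End affine_lebesgue.

(** * Existence of the barycenter factors; geometric means of positive definite matrices *)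

Section barycenter_existence.
Context {R : realType}.

Lemma sympd_norm_le_tr d (M : 'M[R]_d) : sympd M -> `|M| <= \tr M.
Proof.
move=> pM; have t0 := sympd_tr_ge0 pM; have [L uL eM] := sympd_factor pM.
have eE i j : M i j = dotc (row i L)^T (row j L)^T.
 by rewrite eM mxE dotcE; apply: eq_bigr => k _; rewrite !mxE.
have de i : 0 <= M i i by rewrite eE dotc_ge0.
have dl i : M i i <= \tr M.
 by rewrite /mxtrace (bigD1 i)//= lerDl sumr_ge0.
apply: mx_norm_le => // i j.
rewrite -(ler_pXn2r (n := 2))// ?nnegrE//.
rewrite real_normK ?num_real// eE (le_trans (dotc_CS _ _))// -!eE expr2.
by rewrite ler_pM.
Qed.

Lemma sympd_lower_inv_norm d (S : 'M[R]_d) c : sympd S -> 0 < c ->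
 (forall v, c * dotc v v <= dotc v (S *m v)) -> `|invmx S| <= d%:R / c.
Proof.
move=> pS c0 h; apply: le_trans (sympd_norm_le_tr (sympd_inv pS)) _; have := tr_mulmx_lower (sympd_inv pS) h.
by rewrite mulVmx ?sympd_unit// mxtrace1 ler_pdivlMr// mulrC.
Qed.

Lemma invmxB d (A B : 'M[R]_d) : A \in unitmx -> B \in unitmx ->
 invmx A - invmx B = invmx A *m (B - A) *m invmx B.
Proof.
by move=> uA uB; rewrite mulmxBr mulmxBl mulVmx// mul1mx mulmxK.
Qed.

(** The resolvent identity used once on each side. The exact inverse stays in the middle of the
    remainder, so a norm bound on it is enough. *)
Lemma invmxD_expand d (S H : 'M[R]_d) s : S \in unitmx -> S + s *: H \in unitmx ->
 let Y := invmx S in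
 invmx (S + s *: H) = Y - s *: (Y *m H *m Y)
 + s ^+ 2 *: (Y *m H *m invmx (S + s *: H) *m H *m Y).
Proof.
move=> uS uX Y; set X := invmx (S + s *: H).
have e1 : X = Y - s *: (Y *m H *m X).
 have := invmxB uX uS; rewrite -/X -/Y opprD addNKr mulmxN mulNmx => e.
 have := invmxB uS uX; rewrite -/X -/Y addrAC subrr add0r => e'.
 by rewrite -[LHS](subrK Y) addrC -[X - Y]opprB e' -scalemxAr -scalemxAl.
have e2 : X = Y - s *: (X *m H *m Y).
 have := invmxB uX uS; rewrite -/X -/Y opprD addNKr mulmxN mulNmx => e'.
 by rewrite -[LHS](subrK Y) addrC e' -scalemxAr -scalemxAl.
rewrite {1}e1 {1}e2 mulmxBr scalerBr opprB addrA addrAC; congr (_ + _).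
by rewrite -scalemxAr scalerA -expr2 !mulmxA.
Qed.

(** First-order condition without derivatives: for [t = D * s] with [s] small the left side is
    [s * D ^+ 2], which beats [C * s ^+ 2 * D ^+ 2] unless [D = 0]. *)
Lemma linear_term_eq0 (D C t0 : R) : 0 < t0 ->
 (forall t, `|t| <= t0 -> t * D <= C * t ^+ 2) -> D = 0.
Proof.
move=> t00 h; apply/eqP; apply: contraT => D0.
have C1 : 0 < `|C| + 1 by rewrite ltr_wpDl.
pose s := Num.min (t0 / `|D|) (`|C| + 1)^-1.
have s0 : 0 < s by rewrite lt_min invr_gt0 C1 divr_gt0 ?normr_gt0.
have := h (D * s); rewrite normrM (gtr0_norm s0) mulrC -ler_pdivlMr ?normr_gt0// ge_min lexx => /(_ isT).
have -> : C * (D * s) ^+ 2 = C * s * (D * s * D) by ring.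
rewrite ler_pMl; last by rewrite mulrAC mulr_gt0// -expr2 exprn_even_gt0.
rewrite leNgt => /negP[]; apply: (@le_lt_trans _ _ (`|C| * (`|C| + 1)^-1)).
 apply: (@le_trans _ _ (`|C| * s)); first by rewrite ler_wpM2r ?ler_norm// ltW.
 by rewrite ler_wpM2l// ge_min lexx orbT.
by rewrite ltr_pdivrMr// mul1r ltrDl.
Qed.

Lemma lipschitz_within_continuous (V W : nmodT R) (A : set V) (f : V -> W) C :
 (forall v w, A v -> A w -> `|f v - f w| <= C * `|v - w|) ->
 {within A, continuous f}.
Proof.
move=> h; apply/subspace_continuousP => v Av; apply/cvgrPdist_lt => e e0.
near=> w.
have Aw : A w by near: w; exact: withinT.
apply: le_lt_trans (h v w Av Aw) _.
apply: (@le_lt_trans _ _ ((`|C| + 1) * `|v - w|)).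
 by rewrite ler_wpM2r// (le_trans (ler_norm _))// lerDl.
rewrite mulrC -ltr_pdivlMr ?ltr_wpDl//.
near: w; apply: cvg_within; apply: cvgr_dist_lt => //.
by rewrite divr_gt0// ltr_wpDl.
Unshelve. all: by end_near. Qed.

Lemma lipschitz_continuous (V W : nmodT R) (f : V -> W) C :
 (forall v w, `|f v - f w| <= C * `|v - w|) -> continuous f.
Proof.
move=> h; apply/continuous_subspace_setT; apply: (@lipschitz_within_continuous _ _ _ _ C) => v w _ _; exact: h.
Qed.

Lemma closed_lipschitz_ge0 (V : nmodT R) (f : V -> R) C :
 (forall v w, `|f v - f w| <= C * `|v - w|) -> closed [set v | 0 <= f v].
Proof.
move=> h; apply: (@preimage_closed _ _ f [set t | 0 <= t]); last exact: closed_ge.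
by move=> v _; exact: (lipschitz_continuous h).
Qed.

Lemma closed_lipschitz_eq0 (V W : nmodT R) (f : V -> W) C :
 (forall v w, `|f v - f w| <= C * `|v - w|) -> closed [set v | f v = 0].
Proof.
move=> h; have -> : [set v | f v = 0] = [set v | 0 <= - `|f v|].
 apply/seteqP; split => v /=; first by move=> ->; rewrite normr0 oppr0.
 by rewrite oppr_ge0 normr_le0 => /eqP.
apply: (@closed_lipschitz_ge0 _ _ C) => v w.
by rewrite opprK addrC (le_trans (ler_dist_dist _ _))// distrC.
Qed.

Section minimization.
Context {d n : nat}.
Variables (c : 'I_n -> R) (A : 'I_n -> 'M[R]_d).
Hypotheses (c0 : forall i, 0 < c i) (pA : forall i, sympd (A i)).

(** A family of matrices is flattened into one row vector, so that a closed bounded set of families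
    becomes compact. *)
Let dec (v : 'rV[R]_(n * (d * d))) (i : 'I_n) : 'M[R]_d := vec_mx (row i (vec_mx v)).
Let enc (S : 'I_n -> 'M[R]_d) : 'rV[R]_(n * (d * d)) := mxvec (\matrix_i mxvec (S i)).

Let encK S i : dec (enc S) i = S i.
Proof. by rewrite /dec /enc mxvecK rowK mxvecK. Qed.

Let decB v w i : dec (v - w) i = dec v i - dec w i.
Proof. by rewrite /dec !linearB. Qed.

Let dec_norm v i : `|dec v i| <= `|v|.
Proof.
apply: mx_norm_le => // j k; rewrite /dec !mxE.
exact: mx_norm_ge_entry.
Qed.

Let norm_dec v e : 0 <= e -> (forall i, `|dec v i| <= e) -> `|v| <= e.
Proof.
move=> e0 h; rewrite -(vec_mxK v); apply: mx_norm_le => // i j; rewrite ord1.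
case/mxvec_indexP: j => i' k; rewrite mxvecE.
have := h i'; rewrite /dec => h1; rewrite -[vec_mx v](mxvecK) mxvecK.
have -> : vec_mx v i' k = mxvec (dec v i') 0 k by rewrite /dec vec_mxK [RHS]mxE.
case/mxvec_indexP: k => k l; rewrite mxvecE.
exact: le_trans (mx_norm_ge_entry _ _ _) h1.
Qed.

Let Z0 := \sum_i c i.
(** Dual form of the barycenter problem. The derivative of [G] in [S i] is [- c i] times
    [S i ^-1 A i S i ^-1], so the multiplier of the linear constraint in [feas] is the common value
    of these matrices: the barycenter covariance. *)
Let G (S : 'I_n -> 'M[R]_d) := \sum_i c i * \tr (invmx (S i) *m A i).

(** The lower bound [dl] keeps inverses bounded, hence [G] Lipschitz, and the constraint bounds the
    traces, so the set is compact. The bound must then be shown to be inactive at the minimum. *)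
Let feas (dl : R) (S : 'I_n -> 'M[R]_d) :=
 [/\ forall i, (S i)^T = S i,
 forall i v, dl * dotc v v <= dotc v (S i *m v) &
 \sum_i c i *: S i = Z0%:M].

Let feas_pd dl S : 0 < dl -> feas dl S -> forall i, sympd (S i).
Proof.
move=> dl0 [h1 h2 _] i; apply: sympdP => // v v0.
by apply: lt_le_trans (h2 i v); rewrite mulr_gt0// dotc_gt0.
Qed.

Let closed_feas dl : closed [set v | feas dl (dec v)].
Proof.
have -> : [set v | feas dl (dec v)] =
 (\bigcap_(i in setT) [set v | (dec v i)^T - dec v i = 0]) `&`
 (\bigcap_(p in setT) [set v | 0 <= dotc p.2 (dec v p.1 *m p.2) - dl * dotc p.2 p.2])
 `&` [set v | \sum_i c i *: dec v i - Z0%:M = 0].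
 apply/seteqP; split => v /=.
 move=> [h1 h2 h3]; split; last by rewrite h3 subrr.
 split; first by move=> i _ /=; rewrite h1 subrr.
 by move=> [i x] _ /=; rewrite subr_ge0.
 move=> [[h1 h2] h3]; split.
 - by move=> i; apply/eqP; rewrite -subr_eq0; apply/eqP/h1.
 - by move=> i x; have := h2 (i, x) I; rewrite /= subr_ge0.
 - by apply/eqP; rewrite -subr_eq0; apply/eqP.
apply: closedI; first apply: closedI.
- apply: closed_bigI => i _.
 apply: (@closed_lipschitz_eq0 _ _ _ 2) => v w.
 have -> : (dec v i)^T - dec v i - ((dec w i)^T - dec w i) =
 (dec (v - w) i)^T - dec (v - w) i.
 by apply/matrixP => j k; rewrite decB !mxE; ring.
 rewrite (le_trans (ler_normB _ _))// mx_normT.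
 have := dec_norm (v - w) i; lra.
- apply: closed_bigI => -[i x] _ /=.
 apply: (@closed_lipschitz_ge0 _ _ (d%:R ^+ 2 * dotc x x)) => v w.
 have -> : dotc x (dec v i *m x) - dl * dotc x x - (dotc x (dec w i *m x) - dl * dotc x x) =
 dotc x (dec (v - w) i *m x) by rewrite decB mulmxBl dotcBr; ring.
 rewrite (le_trans (dotc_mulmx_norm _ _))// mulrAC ler_wpM2l//.
 by rewrite mulr_ge0// ?sqr_ge0// dotc_ge0.
- apply: (@closed_lipschitz_eq0 _ _ _ Z0) => v w.
 rewrite opprB addrA subrK.
 rewrite -sumrB (le_trans (ler_norm_sum _ _ _))// mulr_suml; apply: ler_sum => i _.
 by rewrite -scalerBr -decB normrZ gtr0_norm// ler_wpM2l// ltW.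
Qed.

Let bounded_feas dl : 0 < dl -> bounded_set [set v | feas dl (dec v)].
Proof.
move=> dl0; exists (\sum_i d%:R * Z0 / c i); split; first exact: num_real.
move=> x xgt v /= hv; apply: (le_trans _ (ltW xgt)).
have Z00 : 0 <= Z0 by apply: sumr_ge0 => i _; exact: ltW.
have pos i : 0 <= d%:R * Z0 / c i by rewrite divr_ge0// ?mulr_ge0// ltW.
apply: norm_dec; first exact: sumr_ge0.
move=> i; have pS := feas_pd dl0 hv.
apply: le_trans (sympd_norm_le_tr (pS i)) _.
rewrite (bigD1 i)//= -[leLHS]addr0 lerD//; last exact: sumr_ge0.
rewrite ler_pdivlMr// mulrC; case: hv => _ _ hv.
have -> : d%:R * Z0 = \tr (\sum_i c i *: dec v i) by rewrite hv mxtrace_scalar mulr_natl.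
rewrite raddf_sum (bigD1 i)//= mxtraceZ lerDl; apply: sumr_ge0 => j _.
by rewrite mxtraceZ mulr_ge0 ?(ltW (c0 j))// sympd_tr_ge0.
Qed.

Let continuous_G dl : 0 < dl -> {within [set v | feas dl (dec v)], continuous (G \o dec)}.
Proof.
move=> dl0.
pose C := \sum_i c i * (d%:R ^+ 2 * (d%:R * (d%:R * (d%:R / dl) * (d%:R / dl))) * `|A i|).
apply: (@lipschitz_within_continuous _ _ _ _ C) => v w hv hw /=.
rewrite /G -sumrB (le_trans (ler_norm_sum _ _ _))// /C mulr_suml; apply: ler_sum => i _.
rewrite -mulrBr normrM gtr0_norm// -!mulrA ler_wpM2l ?(ltW (c0 i))//.
rewrite -linearB/= -mulmxBl (le_trans (tr_mxM_norm _ _))//.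
have pv := feas_pd dl0 hv i; have pw := feas_pd dl0 hw i.
rewrite invmxB ?sympd_unit//.
have nv : `|invmx (dec v i)| <= d%:R / dl.
 by apply: sympd_lower_inv_norm => //; case: hv.
have nw : `|invmx (dec w i)| <= d%:R / dl.
 by apply: sympd_lower_inv_norm => //; case: hw.
set X := _ *m _ *m _.
suff : `|X| <= d%:R * (d%:R * (d%:R / dl) * `|v - w|) * (d%:R / dl).
 move=> h; have := ler_wpM2l (mulr_ge0 (sqr_ge0 (d%:R : R)) (normr_ge0 (A i))) h.
 move=> h1; apply: (@le_trans _ _ (d%:R ^+ 2 * `|A i| * `|X|)).
 by rewrite mulrAC.
 by apply: le_trans h1 _; apply: eq_ler; ring.
rewrite /X (le_trans (mx_normM _ _))// ler_pM ?mulr_ge0// ler_wpM2l//.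
rewrite (le_trans (mx_normM _ _))// ler_pM ?mulr_ge0// ?ler_wpM2l//.
by rewrite -decB (le_trans (dec_norm _ _))// distrC.
Qed.

(** Comparing the minimum of [G] with the value at the identity bounds every [\tr (invmx (S i))],
    which keeps each [S i] above [2 * dl] and leaves room for perturbations in both directions.
    Moving two of the matrices against each other then forces the equality. *)
Lemma barycenter_factors_exist : (0 < n)%N -> exists S : 'I_n -> 'M[R]_d,
 [/\ forall i, sympd (S i), \sum_i c i *: S i = (\sum_i c i)%:M &
 forall i j, invmx (S i) *m A i *m invmx (S i) = invmx (S j) *m A j *m invmx (S j)].
Proof.
move=> n0.
have ha i : {a : R | 0 < a & forall v, a * dotc v v <= dotc v (A i *m v)} :=
 cid2 (sympd_lower (pA i)).
pose a i := s2val (ha i).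
have a0 i : 0 < a i := s2valP (ha i).
have hA i v : a i * dotc v v <= dotc v (A i *m v) := s2valP' (ha i) v.
pose g := G (fun=> 1%:M) + 1.
have g0 : 0 < g.
 rewrite /g ltr_wpDl//; apply: sumr_ge0 => i _.
 rewrite mulr_ge0 ?(ltW (c0 i))// tr_mulmx_ge0//.
 by apply: sympd_inv; exact: sympd1.
(* At the minimum [c i * a i * \tr (invmx (S i))] is at most [g], so [S i] is bounded below by
   [dli i]. The number [dl] is at most half of each [dli i], and at most 1 so that the identity is
   feasible. *)
pose dli i := c i * a i / g.
have dli0 i : 0 < dli i by rewrite divr_gt0// mulr_gt0.
pose D := 1 + \sum_i (dli i)^-1.
have D1 : 1 <= D by rewrite /D lerDl sumr_ge0// => i _; rewrite invr_ge0 ltW.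
have D0 : 0 < D by exact: lt_le_trans D1.
pose dl := D^-1 / 2.
have dl0 : 0 < dl by rewrite divr_gt0// invr_gt0.
have dl2 i : 2 * dl <= dli i.
 rewrite /dl mulrC divfK// -[leRHS]invrK lef_pV2// ?posrE ?invr_gt0//.
 rewrite /D (bigD1 i)//= addrCA lerDl addr_ge0// sumr_ge0// => j _.
 by rewrite invr_ge0 ltW.
have dl1 : dl <= 1.
 rewrite /dl ler_pdivrMr// mul1r (@le_trans _ _ 1)// ?ler1n//.
 by rewrite invf_le1.
have feas1 : feas dl (fun=> 1%:M).
 split; first by move=> i; rewrite trmx1.
 by move=> i v; rewrite mul1mx ler_piMl// dotc_ge0.
 by rewrite -scaler_suml scalemx1.
have [] := @compact_EVT_min _ _ (G \o dec) _ _
 (bounded_closed_compact (bounded_feas dl0) (@closed_feas dl)) (continuous_G dl0).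
 by exists (enc (fun=> 1%:M)) => /=; congr (feas dl _): feas1; apply/funext => i; rewrite encK.
move=> v; rewrite inE/= => hv vmin.
pose S := dec v; pose Y i := invmx (S i).
have pS := feas_pd dl0 hv.
have [sS lS eS] := hv.
have minS S' : feas dl S' -> G S <= G S'.
 have -> : S' = dec (enc S') by apply/funext => i; rewrite encK.
 by move=> h; apply: vmin; rewrite inE.
have trY i : \tr (Y i) <= (dli i)^-1.
 have h1 := tr_mulmx_lower (sympd_inv (pS i)) (hA i).
 have h2 : c i * \tr (Y i *m A i) <= g.
 apply: (@le_trans _ _ (G S)); last first.
 by rewrite /g (le_trans (minS _ feas1))// lerDl.
 rewrite /G (bigD1 i)//= lerDl sumr_ge0// => j _.
 by rewrite mulr_ge0 ?(ltW (c0 j))// tr_mulmx_ge0//; apply: sympd_inv; exact: pS.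
 rewrite /dli invf_div ler_pdivlMr ?mulr_gt0//.
 apply: le_trans h2; rewrite mulrC -mulrA ler_pM2l//.
have lS2 i x : 2 * dl * dotc x x <= dotc x (S i *m x).
 apply: (@le_trans _ _ (dli i * dotc x x)); first by rewrite ler_wpM2r ?dotc_ge0.
 have [->|x0] := eqVneq x 0; first by rewrite !dotc0l mulr0.
 have xx := dotc_gt0 x0.
 have h1 : dotc x x ^+ 2 <= dotc x (S i *m x) * ((dli i)^-1 * dotc x x).
 apply: le_trans (sympd_CS x x (pS i)) _.
 rewrite ler_wpM2l ?(sympd_ge0 (pS i))//.
 apply: le_trans (sympd_tr_ge x (sympd_inv (pS i))) _.
 by rewrite ler_wpM2r ?(ltW xx)//; exact: trY.
 rewrite mulrC -ler_pdivlMr//; move: h1.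
 by rewrite expr2 mulrA ler_pM2r.
exists S; split => // i j.
have [->//|ij] := eqVneq i j.
pose H := Y i *m A i *m Y i - Y j *m A j *m Y j.
have sY k : (Y k)^T = Y k by exact/sympd_sym/sympd_inv/pS.
have sH : H^T = H.
 by rewrite /H linearB/= !trmx_mul !sY !(sympd_sym (pA _)) !mulmxA.
(* [S i] moves by [t H / c i] and [S j] by [- t H / c j], which preserves the constraint. With [H]
   the difference of the two matrices to be equated, the slope of [G] is [- fro H]. *)
pose w k := (k == i)%:R / c i - (k == j)%:R / c j.
pose S' t k := S k + (t * w k) *: H.
pose t0 := dl / (1 + \sum_k `|w k| * (d%:R ^+ 2 * `|H|)).
have W0 k : 0 <= `|w k| * (d%:R ^+ 2 * `|H|) by rewrite !mulr_ge0.
have W1 : 0 < 1 + \sum_k `|w k| * (d%:R ^+ 2 * `|H|) by rewrite ltr_pwDl// sumr_ge0.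
have t00 : 0 < t0 by rewrite divr_gt0.
have fS' t : `|t| <= t0 -> feas dl (S' t).
 move=> tt0; split.
 - by move=> k; rewrite /S' linearD/= linearZ/= sH sS.
 - move=> k x; rewrite /S' mulmxDl dotcDr -scalemxAl dotcZr.
 have h1 := lS2 k x.
 have h2 : `|t * w k * dotc x (H *m x)| <= dl * dotc x x.
 rewrite !normrM; apply: (@le_trans _ _ (`|t| * (`|w k| * (d%:R ^+ 2 * `|H|)) * dotc x x)).
 rewrite -!mulrA ler_wpM2l// ler_wpM2l//.
 by have := dotc_mulmx_norm H x; rewrite -!mulrA.
 rewrite ler_wpM2r ?dotc_ge0//.
 apply: (@le_trans _ _ (t0 * (1 + \sum_k `|w k| * (d%:R ^+ 2 * `|H|)))).
 rewrite ler_pM// (bigD1 k)//= addrCA lerDl addr_ge0// sumr_ge0//.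
 by rewrite /t0 divfK// gt_eqF.
 by move: h2; rewrite ler_norml => /andP[h2 _]; lra.
 - rewrite /S'; under eq_bigr do rewrite scalerDr scalerA.
 rewrite big_split/= eS -scaler_suml.
 rewrite (_ : \sum_k _ = 0) ?scale0r ?addr0//.
 rewrite (bigD1 i)//= (bigD1 j)/=; last by rewrite eq_sym.
 rewrite big1; last first.
 move=> k /andP[ki kj]; rewrite /w (negPf ki) (negPf kj) !mul0r subrr.
 by rewrite !mulr0.
 rewrite /w !eqxx (negPf ij) eq_sym (negPf ij) !mul0r subr0 sub0r.
 rewrite addr0 !mul1r mulrN mulrN !(mulrCA (c _)) !divff ?gt_eqF//.
 by rewrite mulr1 subrr.
pose E k : R := d%:R ^+ 2 * (d%:R / dl) * `|H *m (Y k *m A k) *m (Y k *m H)|.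
have exp t k : `|t| <= t0 -> \tr (invmx (S' t k) *m A k) <=
 \tr (Y k *m A k) - t * w k * \tr (H *m (Y k *m A k *m Y k)) + (t * w k) ^+ 2 * E k.
 move=> /fS' f'; have pS' := feas_pd dl0 f' k.
 have [_ lS' _] := f'.
 have := invmxD_expand (sympd_unit (pS k)) (sympd_unit pS').
 rewrite -/(S' t k) -/(S k) -/(Y k) /= => ->.
 rewrite mulmxDl mulmxBl -!scalemxAl linearD/= linearB/= !linearZ/=.
 apply: lerD.
 rewrite lerD2l; apply: eq_ler; congr (_ *: - _).
 by rewrite -!mulmxA mxtrace_mulC !mulmxA.
 rewrite ler_wpM2l ?sqr_ge0//.
 set X := invmx (S' t k).
 have -> : \tr (Y k *m H *m X *m H *m Y k *m A k) =
 \tr (X *m (H *m (Y k *m A k) *m (Y k *m H))).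
 by rewrite -[Y k *m H *m X]mulmxA -!mulmxA mulmxA mxtrace_mulC !mulmxA.
 apply: le_trans (ler_norm _) _; apply: le_trans (tr_mxM_norm _ _) _.
 by rewrite /E ler_wpM2r// ler_wpM2l// sympd_lower_inv_norm// => x.
suff : H = 0 by move/eqP; rewrite subr_eq0 => /eqP.
apply: fro_eq0; rewrite (@linear_term_eq0 (fro H) (\sum_k c k * (w k ^+ 2 * E k)) t0)//.
move=> t tt0; have := minS _ (fS' _ tt0).
have : G (S' t) <= \sum_k c k * (\tr (Y k *m A k) -
 t * w k * \tr (H *m (Y k *m A k *m Y k)) + (t * w k) ^+ 2 * E k).
 by apply: ler_sum => k _; rewrite ler_pM2l//; exact: exp.
move=> /[swap] /le_trans /[apply].
under [X in _ <= X -> _]eq_bigr do rewrite mulrDr mulrBr.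
rewrite big_split sumrB/= -/(G S) -addrA lerDl -subr_ge0.
rewrite [X in - X](_ : _ = t * fro H); last first.
 rewrite /fro sH {2}/H mulmxBr linearB/= mulrBr.
 rewrite (bigD1 i)//= (bigD1 j)/=; last by rewrite eq_sym.
 rewrite big1; last first.
 move=> k /andP[ki kj]; rewrite /w (negPf ki) (negPf kj) !mul0r subrr.
 by rewrite !mulr0 mul0r mulr0.
 rewrite /w !eqxx (negPf ij) eq_sym (negPf ij) !mul0r subr0 sub0r.
 rewrite addr0 !mul1r; field; rewrite !gt_eqF//.
move=> h; apply: le_trans h _.
apply: eq_ler; rewrite addrC; congr (_ - _).
by rewrite mulr_suml; apply: eq_bigr => k _; ring.
Qed.

End minimization.

(** Two matrices with unit weights: [P + Q = 2] makes [P] and [Q] commute, and [Q^-1 P] is the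
    solution. Its positivity is read from [Q^-1 P = Q^-1 (P Q P + Q P Q) Q^-1 / 2], a congruence of
    a positive matrix. *)
Lemma sympd_geomean d (A B : 'M[R]_d) : sympd A -> sympd B ->
 exists2 S, sympd S & S *m B *m S = A.
Proof.
move=> pA pB; pose M (i : 'I_2) := if i == 0 then A else B.
have pM i : sympd (M i) by rewrite /M; case: ifP.
have [S [pS eS /(_ 0 1)]] := @barycenter_factors_exist d 2 (fun=> 1) M (fun=> ltr01) pM isT.
rewrite /M/=; move: eS; rewrite !big_ord_recl !big_ord0 !addr0 !scale1r.
rewrite (_ : lift ord0 ord0 = 1); last exact: val_inj.
set P := S 0; set Q := S 1 => PQ e.
have pP : sympd P by exact: pS.
have pQ : sympd Q by exact: pS.
have uP := sympd_unit pP; have uQ := sympd_unit pQ.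
have comm : P *m Q = Q *m P.
 have -> : Q = (1 + 1)%:M - P by rewrite -PQ addrC addKr.
 by rewrite mulmxBl mulmxBr scalar_mxC.
have comm' : invmx Q *m P = P *m invmx Q.
 apply: (can_inj (mulKmx uQ)); rewrite mulKVmx// mulmxA -comm -mulmxA mulmxV//.
 by rewrite mulmx1.
exists (invmx Q *m P); last first.
 transitivity (P *m (invmx Q *m B *m invmx Q) *m P); first by rewrite {1}comm' !mulmxA.
 by rewrite -e !mulmxA mulmxV// mul1mx mulmxKV.
have -> : invmx Q *m P = 2^-1 *: (invmx Q *m (P *m Q *m P + Q *m P *m Q) *m invmx Q).
 have -> : P *m Q *m P + Q *m P *m Q = 2 *: (P *m Q).
 rewrite -[Q *m P]comm -mulmxDr PQ mul_mx_scalar.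
 by congr (_ *: _); rewrite -natr1.
 rewrite -scalemxAr -scalemxAl scalerA mulVf// scale1r comm !mulmxA mulVmx// mul1mx.
 by rewrite -comm'; congr (_ *m _).
apply: sympdZ; first by rewrite invr_gt0.
by apply: sympd_congr'; [apply: sympdD; exact: sympd_congr'|exact: sympd_inv].
Qed.

Lemma sympd_sqrt d (A : 'M[R]_d) : sympd A -> exists2 S, sympd S & S *m S = A.
Proof.
by move=> /sympd_geomean/(_ (@sympd1 _ _))[S pS e]; exists S; rewrite // -e mulmx1.
Qed.

End barycenter_existence.

(** * Expansions and lower bounds for the determinant and its logarithm *)

Section determinant_expansion.
Context {R : realType}.

Lemma prod1D_expand (I : Type) (r : seq I) (x : I -> R) e :
 0 <= e -> e <= 1 -> (forall i, `|x i| <= e) ->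
 `|\prod_(i <- r) (1 + x i) - 1 - \sum_(i <- r) x i| <= 4 ^+ size r * e ^+ 2.
Proof.
move=> e0 e1 hx; elim: r => [|i r IH].
 by rewrite !big_nil subrr subr0 normr0 mul1r sqr_ge0.
rewrite !big_cons [size _]/= exprS.
set P := \prod_(j <- r) _ in IH *; set S := \sum_(j <- r) _ in IH *.
have hS : `|S| <= (size r)%:R * e.
 rewrite /S (le_trans (ler_norm_sum _ _ _))//.
 apply: (@le_trans _ _ (\sum_(j <- r) e)); first exact: ler_sum.
 by rewrite big_const_seq count_predT iter_addr_0 mulr_natl.
have s4 : (size r)%:R <= 4 ^+ size r :> R.
 by rewrite -natrX ler_nat ltnW// ltn_expl.
have -> : (1 + x i) * P - 1 - (x i + S) = x i * S + (1 + x i) * (P - 1 - S) by ring.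
apply: le_trans (ler_normD _ _) _; rewrite !normrM.
have h1 : `|x i| * `|S| <= e * (4 ^+ size r * e).
 by rewrite ler_pM// (le_trans hS)// ler_wpM2r.
have h2 : `|1 + x i| * `|P - 1 - S| <= 2 * (4 ^+ size r * e ^+ 2).
 rewrite ler_pM// (le_trans (ler_normD _ _))// normr1.
 by have := hx i; lra.
have p4 : 0 <= 4 ^+ size r * e ^+ 2 by rewrite mulr_ge0// ?exprn_ge0.
rewrite expr2 in h2 p4 *.
nra.
Qed.

(** In the Leibniz formula the identity contributes [1 + \tr X] up to second order. Any other
    permutation moves some [i] and also its image, hence has two off-diagonal factors, each at most
    the norm of [X]. *)
Lemma det1D_expand d : exists2 C : R, 0 <= C &
 forall X : 'M[R]_d, `|X| <= 1 -> `|\det (1%:M + X) - 1 - \tr X| <= C * `|X| ^+ 2.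
Proof.
exists (4 ^+ d + \sum_(s | (s : {perm 'I_d}) != perm_one 'I_d) 2 ^+ d).
 by rewrite addr_ge0 ?exprn_ge0// sumr_ge0// => s _; rewrite exprn_ge0.
move=> X X1; rewrite /determinant (bigD1 (perm_one 'I_d))//= odd_perm1 expr0 mul1r.
have -> : \prod_i (1%:M + X) i (perm_one 'I_d i) = \prod_i (1 + X i i).
 by apply: eq_bigr => i _; rewrite perm1 !mxE eqxx.
set P := \prod_i _; set Q := \sum_(s | _) _.
have -> : P + Q - 1 - \tr X = (P - 1 - \tr X) + Q by ring.
rewrite mulrDl mulr_suml.
apply: le_trans (ler_normD _ _) _; apply: lerD.
 have := @prod1D_expand _ (enum 'I_d) (fun i => X i i) `|X| (normr_ge0 _) X1
 (fun i => mx_norm_ge_entry X i i).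
 by rewrite !big_enum/= size_enum_ord.
rewrite /Q.
apply: le_trans (ler_norm_sum _ _ _) _; apply: ler_sum => s s1.
rewrite normrM normrX normrN1 expr1n mul1r normr_prod.
have [i si] : exists i, s i != i.
 apply/existsP; rewrite -negb_forall; apply: contra s1 => /forallP h.
 by apply/eqP/permP => i; rewrite perm1; apply/eqP/h.
have ssi : s (s i) != s i by rewrite (inj_eq perm_inj).
have big k : `|(1%:M + X) k (s k)| <= 2.
 rewrite !mxE (le_trans (ler_normD _ _))//.
 have := le_trans (mx_norm_ge_entry X k (s k)) X1.
 by case: eqP => _; rewrite ?normr1 ?normr0; lra.
have small k : s k != k -> `|(1%:M + X) k (s k)| <= `|X|.
 by move=> sk; rewrite !mxE eq_sym (negPf sk) mulr0n add0r mx_norm_ge_entry.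
rewrite (bigD1 i)//= (bigD1 (s i))//= mulrA mulrC ler_pM//.
- by apply: prodr_ge0.
- apply: (@le_trans _ _ (\prod_(k < d | (k != i) && (k != s i)) 2)).
 by apply: ler_prod => k _; rewrite normr_ge0 big.
 rewrite big_const iter_mulr_1 ler_weXn2l ?ler1n//.
 by rewrite -[leqRHS](card_ord d) max_card.
- by rewrite expr2 ler_pM// small.
Qed.

Lemma ln1D_expand (y : R) : `|y| <= 2^-1 -> `|ln (1 + y) - y| <= 2 * y ^+ 2.
Proof.
rewrite ler_norml => /andP[y1 y2].
have y0 : 0 < 1 + y by lra.
have h1 : ln (1 + y) <= y by apply: le_ln1Dx; lra.
have h2 : - ln (1 + y) <= - (y / (1 + y)).
 rewrite -lnV ?posrE//.
 rewrite [X in ln X](_ : _ = 1 + (- (y / (1 + y)))); last by field; rewrite gt_eqF.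
 by apply: le_ln1Dx; rewrite ltrN2 ltr_pdivrMr//; lra.
have h3 : y / (1 + y) = y - y ^+ 2 / (1 + y) by field; rewrite gt_eqF.
have h4 : y ^+ 2 / (1 + y) <= 2 * y ^+ 2.
 by rewrite ler_pdivrMr//; have := sqr_ge0 y; nra.
by rewrite ler_norml; apply/andP; split; have := sqr_ge0 y; lra.
Qed.

(** The radius and the constant depend on the dimension only; this makes the gain estimates uniform
    in the Gaussians and in [kappa]. *)
Lemma lndet1D_expand d : exists dC : R * R, [/\ 0 < dC.1, dC.1 <= 1, 0 <= dC.2 &
 forall X : 'M[R]_d, `|X| <= dC.1 -> 0 < \det (1%:M + X) /\
 `|ln (\det (1%:M + X)) - \tr X| <= dC.2 * `|X| ^+ 2].
Proof.
have [C C0 hC] := det1D_expand d.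
pose K : R := d%:R + C; have K0 : 0 <= K by rewrite addr_ge0.
pose dl := (2 * (K + 1))^-1; have dl0 : 0 < dl by rewrite invr_gt0 mulr_gt0// ltr_wpDl.
have dl1 : dl <= 1 by rewrite invf_le1 ?mulr_gt0 ?ltr_wpDl//; lra.
exists (dl, C + 2 * K ^+ 2); split => //=.
 by rewrite addr_ge0// mulr_ge0// sqr_ge0.
move=> X hX; have X1 : `|X| <= 1 by exact: le_trans dl1.
have hd := hC X X1; pose y := \det (1%:M + X) - 1.
have hy : `|y| <= K * `|X|.
 have -> : y = (y - \tr X) + \tr X by rewrite subrK.
 apply: le_trans (ler_normD _ _) _; rewrite /K mulrDl addrC lerD ?tr_norm//.
 apply: le_trans hd _; rewrite ler_wpM2l// expr2 ler_piMl//.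
have y2 : `|y| <= 2^-1.
 apply: le_trans hy _; apply: (@le_trans _ _ (K * dl)); first by rewrite ler_wpM2l.
 by rewrite /dl ler_pdivrMr ?mulr_gt0 ?ltr_wpDl//; lra.
have -> : \det (1%:M + X) = 1 + y by rewrite /y; ring.
split; first by move: y2; rewrite ler_norml => /andP[? _]; lra.
have -> : ln (1 + y) - \tr X = (ln (1 + y) - y) + (y - \tr X) by ring.
apply: le_trans (ler_normD _ _) _; rewrite mulrDl addrC lerD//.
apply: le_trans (ln1D_expand y2) _.
rewrite -mulrA -exprMn ler_wpM2l// -real_normK ?num_real//.
by rewrite ler_pXn2r ?nnegrE// mulr_ge0.
Qed.

(** Induction through the Schur complement of [1 + A], which is [1 + D'] with
    [D' = D - r^T r / (1 + a)]. What the trace loses is compensated by the factor [1 + a], since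
    [\tr (r^T r) <= a * \tr D] by positivity of the Schur complement of [A]. *)
Lemma det1D_sympd_ge d (A : 'M[R]_d) : sympd A -> 1 + \tr A <= \det (1%:M + A).
Proof.
elim: d A => [|d IH] A pA.
 by rewrite det_mx00 /mxtrace big_ord0 addr0.
have [a [r [D eA]]] := sympd_blockE (M := A) (sympd_sym pA).
have [a0 pS] : 0 < a /\ sympd (D - a^-1 *: (r^T *m r)).
 by apply: sympd_block; rewrite -eA.
pose D' := D - (1 + a)^-1 *: (r^T *m r).
have rr v : dotc v (r^T *m r *m v) = ((r *m v) 0 0) ^+ 2.
 rewrite -mulmxA dotc_mulmx trmxK dotcE big_ord1 -expr2.
 by [].
have sD : D^T = D.
 have := sympd_sym pS; rewrite linearB/= linearZ/= trmx_mul trmxK => /eqP.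
 by rewrite subr_eq subrK => /eqP.
have pD' : sympd D'.
 have /sympdE[_ hS] := pS.
 apply: sympdP => [|v v0]; first by rewrite /D' linearB/= linearZ/= trmx_mul trmxK sD.
 apply: lt_le_trans (hS v v0) _.
 rewrite /D' !mulmxBl !dotcBr lerD2l lerN2 -!scalemxAl !dotcZr ler_wpM2r//.
 by rewrite rr sqr_ge0.
 by rewrite lef_pV2 ?posrE//; lra.
have detA : \det (1%:M + A) = (1 + a) * \det (1%:M + D').
 pose X : 'M[R]_(1 + d) := block_mx 1%:M 0 ((1 + a)^-1 *: r^T) 1%:M.
 pose Y : 'M[R]_(1 + d) := block_mx (1 + a)%:M r 0 (1%:M + D').
 have a1 : 1 + a != 0 by rewrite gt_eqF//; lra.
 have -> : 1%:M + A = X *m Y.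
 rewrite eA -[1%:M](@submxK _ 1 d 1 d) (_ : block_mx _ _ _ _ = block_mx 1%:M 0 0 1%:M);
 last by rewrite -scalar_mx_block submxK.
 transitivity (block_mx (1%:M + a%:M) (0 + r) (0 + r^T) (1%:M + D)).
 exact: (@add_block_mx _ 1 d 1 d).
 rewrite /X mulmx_block !mul1mx !mul0mx !addr0 !add0r.
 rewrite mul_mx_scalar scalerA divff// scale1r -raddfD -scalemxAl.
 by rewrite /D' addrCA (addrC _ (D - _)) subrK.
 by rewrite (@det_mulmx _ (1 + d)) det_lblock det_ublock !det1 !mul1r det_scalar1.
have trA : \tr A = a + \tr D.
 by rewrite eA (@mxtrace_block _ 1 d) mxtrace_scalar.
have rD : \tr (r^T *m r) <= a * \tr D.
 have := sympd_tr_ge0 pS.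
 rewrite linearB/= linearZ/= subr_ge0 mulrC ler_pdivrMr//.
 by rewrite mulrC.
rewrite detA trA; have := IH _ pD'.
rewrite {1}/D' linearB/= linearZ/=.
set t := \tr (r^T *m r) in rD *; set e := \tr D in rD *.
move=> h; apply: (@le_trans _ _ ((1 + a) * (1 + (e - t / (1 + a))))); last first.
 rewrite ler_pM2l; [by rewrite [t / _]mulrC|lra].
have -> : (1 + a) * (1 + (e - t / (1 + a))) = (1 + a) * (1 + e) - t.
 by field; rewrite gt_eqF//; lra.
lra.
Qed.

End determinant_expansion.

Lemma expR_le_quadratic {R : realType} (y : R) : `|y| <= 2^-1 ->
 expR y <= 1 + y + 2 * y ^+ 2.
Proof.
rewrite ler_norml => /andP[y1 y2].
have h : 1 - y <= expR (- y) by exact: expR_ge1Dx.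
have y0 : 0 < 1 - y by lra.
have -> : expR y = (expR (- y))^-1 by rewrite expRN invrK.
apply: (@le_trans _ _ (1 - y)^-1); first by rewrite lef_pV2 ?posrE ?expR_gt0.
rewrite -[_^-1]mul1r ler_pdivrMr//; have := sqr_ge0 y; nra.
Qed.

Lemma tr_le {R : realType} {d : nat} (X : 'M[R]_d) x : `|X| <= x -> `|\tr X| <= d%:R * x.
Proof. by move=> hx; apply: le_trans (tr_norm _) _; rewrite ler_wpM2l. Qed.

(** * Expansions with quadratic remainder, within a set and along curves *)

Section jets.
Context {R : realType}.

Definition linW (W W' : lmodType R) (f : W -> W') :=
 forall (a : R) (u v : W), f (a *: u + v) = a *: f u + f v.

Lemma linW0 (W W' : lmodType R) (f : W -> W') : linW f -> f 0 = 0.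
Proof.
move=> h; have := h (-1) 0 0; rewrite scaleN1r oppr0 addr0 scaleN1r addNr => ->//.
Qed.

Lemma linW_B (A B : nmodT R) (F : A -> B) u v : linW F -> F (u - v) = F u - F v.
Proof. by move=> h; rewrite -scaleN1r addrC h scaleN1r addrC. Qed.

Lemma pair_norm_le (V W : nmodT R) (x : V * W) : `|x.1| <= `|x| /\ `|x.2| <= `|x|.
Proof. by rewrite prod_normE /= !le_max !lexx orbT. Qed.

Lemma quad_differentiable (V W : nmodT R) (f : V -> W) (x : V) (L : V -> W) (K C r : R) :
 linW L -> (forall v, `|L v| <= K * `|v|) -> 0 < r ->
 (forall h, `|h| < r -> `|f (x + h) - f x - L h| <= C * `|h| ^+ 2) ->
 differentiable f x /\ forall v, 'D_v f x = L v.
Proof.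
move=> hL hK r0 h.
pose L' : {linear V -> W} := HB.pack L (GRing.isLinear.Build R V W _ L hL).
have K0 : 0 < `|K| + 1 by rewrite ltr_wpDl.
have cL : continuous L'.
 apply: (@lipschitz_continuous R V W L' (`|K| + 1)) => v w.
 rewrite -linearB; apply: le_trans (hK _) _; rewrite ler_wpM2r//.
 by have := ler_norm K; lra.
have C0 : 0 < `|C| + 1 by rewrite ltr_wpDl.
have e : f \o shift x = cst (f x) + L' +o_ 0 id.
 apply/eqaddoP => eps e0; near=> v => /=.
 have vr : `|v| < r by near: v; apply: nbhs0_lt.
 have ve : `|v| < eps / (`|C| + 1) by near: v; apply: nbhs0_lt; exact: divr_gt0.
 have := h v vr; rewrite [x + v]addrC -[f (v + x) - f x - L v]addrA -opprD.
 move=> /le_trans; apply; rewrite expr2 mulrA ler_wpM2r//.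
 rewrite ltr_pdivlMr// in ve; apply: le_trans (ltW ve); rewrite mulrC ler_wpM2l//.
 by have := ler_norm C; lra.
have dE := diff_unique cL e.
have df : differentiable f x by apply/diff_locallyP; rewrite dE.
by split=> // v; rewrite deriveE// dE.
Unshelve. all: by end_near. Qed.

(** Differentiability within [D] with remainder [O(|h|^2)]. The set [D] matters because functionals
    of Gaussians are junk off the positive definite covariances, and a quadratic remainder is what
    yields [O(kappa^-2)]. Linearity of [L] is asked for only where a derivative is extracted. *)
Definition qexp {V W : nmodT R} (D : set V) (f : V -> W) (x : V) (L : V -> W) : Prop :=
 (exists K : R, forall v, `|L v| <= K * `|v|) /\
 exists C r : R, 0 < r /\ forall y, D y -> `|y - x| < r -> `|f y - f x - L (y - x)| <= C * `|y - x| ^+ 2.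

Lemma qexp_ext (V W : nmodT R) (D : set V) (f g : V -> W) x L L' : D x ->
 (forall y, D y -> f y = g y) -> (forall v, L v = L' v) -> qexp D f x L -> qexp D g x L'.
Proof.
move=> Dx fg LL [[K hK] [C [r [r0 h]]]]; split; first by exists K => v; rewrite -LL.
by exists C, r; split => // y Dy yr; rewrite -!fg// -LL; exact: h.
Qed.

Lemma qexpW (V W : nmodT R) (D D' : set V) (f : V -> W) x L : D' `<=` D -> qexp D f x L -> qexp D' f x L.
Proof. by move=> DD [h [C [r [r0 hr]]]]; split => //; exists C, r; split => // y /DD; exact: hr. Qed.

Lemma qexp_cst (V W : nmodT R) (D : set V) (a : W) (x : V) : qexp D (fun=> a) x (fun=> 0).
Proof.
split; first by exists 0 => v; rewrite normr0 mul0r.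
by exists 0, 1; split => // y _ _; rewrite !subrr normr0 mul0r.
Qed.

Lemma qexpD (V W : nmodT R) (D : set V) (f g : V -> W) x L L' : qexp D f x L -> qexp D g x L' ->
 qexp D (fun y => f y + g y) x (fun v => L v + L' v).
Proof.
move=> [[K hK] [C [r [r0 h]]]] [[K' hK'] [C' [r' [r'0 h']]]]; split.
 by exists (K + K') => v; apply: le_trans (ler_normD _ _) _; rewrite mulrDl lerD.
exists (C + C'), (Num.min r r'); split; first by rewrite lt_min r0.
move=> y Dy; rewrite lt_min => /andP[e1 e2].
have -> : f y + g y - (f x + g x) - (L (y - x) + L' (y - x)) =
 (f y - f x - L (y - x)) + (g y - g x - L' (y - x)).
 by rewrite !opprD [RHS]addrACA [f y - f x + _]addrACA.
by apply: le_trans (ler_normD _ _) _; rewrite mulrDl lerD ?h ?h'.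
Qed.

Lemma qexp_lipschitz (V W : nmodT R) (D : set V) (f : V -> W) x L : qexp D f x L ->
 exists K r : R, [/\ 0 <= K, 0 < r & forall y, D y -> `|y - x| < r -> `|f y - f x| <= K * `|y - x|].
Proof.
move=> [[K hK] [C [r [r0 h]]]]; exists (`|K| + `|C|), (Num.min 1 r); split; first by rewrite addr_ge0.
 by rewrite lt_min ltr01.
move=> y Dy; rewrite lt_min => /andP[e1 e2].
have -> : f y - f x = L (y - x) + (f y - f x - L (y - x)) by rewrite [RHS]addrC subrK.
apply: normD_leM.
 by apply: le_trans (hK _) _; rewrite ler_wpM2r// ler_norm.
apply: le_trans (h y Dy e2) _; rewrite expr2 mulrA ler_wpM2r//.
by apply: le_trans (ler_wpM2r (normr_ge0 _) (ler_norm C)) _; rewrite ler_piMr// ltW.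
Qed.

Lemma qexp_bil (V W1 W2 W : nmodT R) (D : set V) (B : W1 -> W2 -> W) (K : R) f g x L L' :
 (forall u v w, B (u + v) w = B u w + B v w) -> (forall u v w, B u (v + w) = B u v + B u w) ->
 (forall u v, `|B u v| <= K * `|u| * `|v|) -> qexp D f x L -> qexp D g x L' ->
 qexp D (fun y => B (f y) (g y)) x (fun v => B (f x) (L' v) + B (L v) (g x)).
Proof.
move=> Dl Dr hB qf qg; have [Kf [rf [Kf0 rf0 lf]]] := qexp_lipschitz qf.
have [Kg [rg [Kg0 rg0 lg]]] := qexp_lipschitz qg.
move: qf qg => [[Kl hK] [C [r [r0 h]]]] [[Kl' hK'] [C' [r' [r'0 h']]]].
have K0 u v : `|B u v| <= `|K| * `|u| * `|v|.
 by apply: le_trans (hB u v) _; rewrite ler_wpM2r// ler_wpM2r// ler_norm.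
have B0l w : B 0 w = 0 by apply: (addrI (B 0 w)); rewrite -Dl !addr0.
have B0r w : B w 0 = 0 by apply: (addrI (B w 0)); rewrite -Dr !addr0.
have Nl u w : B (- u) w = - B u w by apply: (addrI (B u w)); rewrite -Dl !subrr.
have Nr u w : B w (- u) = - B w u by apply: (addrI (B w u)); rewrite -Dr !subrr.
split.
 exists (`|K| * `|f x| * `|Kl'| + `|K| * `|Kl| * `|g x|) => v.
 apply: normD_leM; apply: le_trans (K0 _ _) _.
 rewrite -!mulrA ler_wpM2l// ler_wpM2l//; apply: le_trans (hK' v) _; by rewrite ler_wpM2r// ler_norm.
 rewrite -!mulrA ler_wpM2l// [`|g x| * _]mulrC mulrA ler_wpM2r//.
 by apply: le_trans (hK v) _; rewrite ler_wpM2r// ler_norm.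
exists (`|K| * Kf * Kg + `|K| * `|f x| * `|C'| + `|K| * `|C| * `|g x|),
 (Num.min (Num.min rf rg) (Num.min r r')); split; first by rewrite !lt_min rf0 rg0 r0.
move=> y Dy; rewrite !lt_min => /andP[/andP[y1 y2] /andP[y3 y4]].
set v := y - x; set df := f y - f x; set dg := g y - g x.
have -> : B (f y) (g y) - B (f x) (g x) - (B (f x) (L' v) + B (L v) (g x)) =
 B df dg + B (f x) (dg - L' v) + B (df - L v) (g x).
 have -> : f y = f x + df by rewrite /df addrC subrK.
 have -> : g y = g x + dg by rewrite /dg addrC subrK.
 rewrite Dl !Dr (Dl df) (Nl (L v)) (Nr (L' v)).
 have zz (z1 z2 z3 z4 p q : W) : z1 + z2 + (z3 + z4) - z1 - (p + q) = z4 + (z2 - p) + (z3 - q).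
 apply/eqP; rewrite subr_eq subr_eq; apply/eqP.
 by rewrite -[z4 + _ + _]addrA -[z4 + _ + (p + q)]addrA [_ + _ + (p + q)]addrACA !subrK [RHS]addrC [z4 + _]addrC !addrA.
 exact: zz.
have n1 : `|df| <= Kf * `|v| by exact: lf.
have n2 : `|dg| <= Kg * `|v| by exact: lg.
have n3 : `|df - L v| <= `|C| * `|v| ^+ 2.
 by apply: le_trans (h y Dy y3) _; rewrite ler_wpM2r ?sqr_ge0// ler_norm.
have n4 : `|dg - L' v| <= `|C'| * `|v| ^+ 2.
 by apply: le_trans (h' y Dy y4) _; rewrite ler_wpM2r ?sqr_ge0// ler_norm.
apply: normD_leM; last first.
 by apply: le_trans (K0 _ _) _; rewrite -!mulrA ler_wpM2l// [`|g x| * _]mulrC mulrA ler_wpM2r.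
apply: normD_leM; apply: le_trans (K0 _ _) _.
 have -> : `|K| * Kf * Kg * `|v| ^+ 2 = `|K| * (Kf * `|v| * (Kg * `|v|)) by rewrite expr2 -!mulrA; congr (_ * (_ * _)); rewrite mulrCA.
 by rewrite -mulrA ler_wpM2l// ler_pM.
by rewrite -!mulrA ler_wpM2l// ler_wpM2l.
Qed.

Lemma qexp_sum (V W : nmodT R) (D : set V) n (f : 'I_n -> V -> W) x L : D x ->
 (forall i, qexp D (f i) x (L i)) -> qexp D (fun y => \sum_i f i y) x (fun v => \sum_i L i v).
Proof.
move=> Dx; elim: n f L => [|n IH] f L h.
 by apply: (qexp_ext _ _ _ (qexp_cst D 0 x)) => // *; rewrite big_ord0.
apply: (qexp_ext _ _ _ (qexpD (IH _ _ (fun i => h (widen_ord (leqnSn n) i))) (h ord_max))) => // *;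
by rewrite big_ord_recr.
Qed.

Lemma qexp_mx (V : nmodT R) (D : set V) p q s (f : V -> 'M[R]_(p, q)) (g : V -> 'M[R]_(q, s)) x L L' :
 qexp D f x L -> qexp D g x L' -> qexp D (fun y => f y *m g y) x (fun v => f x *m L' v + L v *m g x).
Proof.
apply: (@qexp_bil _ _ _ _ _ (fun x y => x *m y) q%:R).
- by move=> *; rewrite mulmxDl.
- by move=> *; rewrite mulmxDr.
- by move=> u v; exact: mx_normM.
Qed.

Lemma qexp_R (V : nmodT R) (D : set V) (f g : V -> R) x (L L' : V -> R) :
 qexp D (f : V -> R^o) x L -> qexp D (g : V -> R^o) x L' ->
 qexp D (fun y => f y * g y : R^o) x (fun v => f x * L' v + L v * g x).
Proof.
apply: (@qexp_bil _ R^o R^o R^o _ (fun x y => x * y) 1).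
- by move=> *; rewrite mulrDl.
- by move=> *; rewrite mulrDr.
- by move=> u v; rewrite mul1r normrM.
Qed.

Lemma qexp_lin (V W U : nmodT R) (D : set V) (F : W -> U) (K : R) f x L :
 (forall u v, F (u - v) = F u - F v) -> (forall u, `|F u| <= K * `|u|) ->
 qexp D f x L -> qexp D (fun y => F (f y)) x (fun v => F (L v)).
Proof.
move=> FB hF [[Kl hK] [C [r [r0 h]]]].
have hF' u : `|F u| <= `|K| * `|u| by apply: le_trans (hF u) _; rewrite ler_wpM2r// ler_norm.
split.
 exists (`|K| * Kl) => v; apply: le_trans (hF' _) _; by rewrite -mulrA ler_wpM2l.
exists (`|K| * C), r; split => // y Dy yr; rewrite -!FB; apply: le_trans (hF' _) _.
by rewrite -mulrA ler_wpM2l// h.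
Qed.

Lemma qexp_tr (V : nmodT R) (D : set V) d (f : V -> 'M[R]_d) x L : qexp D f x L ->
 qexp D (fun y => \tr (f y) : R^o) x (fun v => \tr (L v)).
Proof.
apply: (@qexp_lin _ _ R^o _ (fun M => \tr M) d%:R) => [u v|u]; first by rewrite linearB.
exact: tr_le.
Qed.

Lemma qexpZ (V W : nmodT R) (D : set V) (k : R) (f : V -> W) x L : qexp D f x L ->
 qexp D (fun y => k *: f y) x (fun v => k *: L v).
Proof.
by apply: (@qexp_lin _ _ _ _ (fun u => k *: u) `|k|) => [u v|u]; rewrite ?scalerBr// normrZ.
Qed.

Lemma qexpB (V W : nmodT R) (D : set V) (f g : V -> W) x L L' : D x -> qexp D f x L -> qexp D g x L' ->
 qexp D (fun y => f y - g y) x (fun v => L v - L' v).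
Proof.
move=> Dx hf hg; apply: (qexp_ext Dx _ _ (qexpD hf (qexpZ (-1) hg))) => *; by rewrite scaleN1r.
Qed.

Lemma qexp_dotc (V : nmodT R) (D : set V) d (f g : V -> 'cV[R]_d) x L L' : D x ->
 qexp D f x L -> qexp D g x L' ->
 qexp D (fun y => dotc (f y) (g y) : R^o) x (fun v => dotc (f x) (L' v) + dotc (L v) (g x)).
Proof.
move=> Dx; apply: (@qexp_bil _ _ _ R^o _ (fun x y => dotc x y) d%:R).
- by move=> *; rewrite dotcDl.
- by move=> *; rewrite dotcDr.
- by move=> u v; exact: dotc_norm.
Qed.

Lemma qexp_id1 (V W : nmodT R) (D : set (V * W)) (x : V * W) : qexp D (fun q => q.1) x (fun v => v.1).
Proof.
split; first by exists 1 => v; rewrite mul1r; have [] := pair_norm_le v.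
by exists 0, 1; split => // y _ _; rewrite /= subrr normr0 mul0r.
Qed.

Lemma qexp_id2 (V W : nmodT R) (D : set (V * W)) (x : V * W) : qexp D (fun q => q.2) x (fun v => v.2).
Proof.
split; first by exists 1 => v; rewrite mul1r; have [] := pair_norm_le v.
by exists 0, 1; split => // y _ _; rewrite /= subrr normr0 mul0r.
Qed.

Lemma qexp_comp (V W U : nmodT R) (D : set W) (E : set V) (g : W -> U) (f : V -> W) x Lg Lf :
 (forall u v, Lg (u - v) = Lg u - Lg v) -> E x -> (forall y, E y -> D (f y)) ->
 qexp D g (f x) Lg -> qexp E f x Lf -> qexp E (fun y => g (f y)) x (fun v => Lg (Lf v)).
Proof.
move=> LgB Ex ED [[K hK] [C [r [r0 h]]]] qf; have [K1 [r1 [K10 r10 l1]]] := qexp_lipschitz qf.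
move: qf => [[K2 hK2] [C2 [r2 [r20 h2]]]].
have hK' u : `|Lg u| <= `|K| * `|u| by apply: le_trans (hK u) _; rewrite ler_wpM2r// ler_norm.
split; first by exists (`|K| * K2) => v; apply: le_trans (hK' _) _; rewrite -mulrA ler_wpM2l.
exists (`|C| * K1 ^+ 2 + `|K| * `|C2|), (Num.min (Num.min r1 r2) (r / (K1 + 1))); split.
 by rewrite !lt_min r10 r20 divr_gt0// ltr_wpDl.
move=> y Ey; rewrite !lt_min => /andP[/andP[y1 y2] y3].
have fy := l1 y Ey y1.
have fr : `|f y - f x| < r.
 apply: le_lt_trans fy _; rewrite ltr_pdivlMr ?ltr_wpDl// in y3; apply: le_lt_trans y3.
 by rewrite mulrC ler_wpM2l// lerDl.
have -> : g (f y) - g (f x) - Lg (Lf (y - x)) =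
 g (f y) - g (f x) - Lg (f y - f x) + Lg (f y - f x - Lf (y - x)).
 by rewrite (LgB (f y - f x)) addrA subrK.
apply: normD_leM.
 apply: le_trans (h _ (ED _ Ey) fr) _; apply: (@le_trans _ _ (`|C| * `|f y - f x| ^+ 2)).
 by rewrite ler_wpM2r ?sqr_ge0// ler_norm.
 by rewrite -mulrA ler_wpM2l// -exprMn; apply: lerXn2r; rewrite ?nnegrE//; apply: mulr_ge0.
apply: le_trans (hK' _) _; rewrite -mulrA ler_wpM2l//; apply: le_trans (h2 _ Ey y2) _.
by rewrite ler_wpM2r ?sqr_ge0// ler_norm.
Qed.

Lemma qexp_differentiable (V W : nmodT R) (E : set V) (f : V -> W) x L : open E -> E x -> linW L ->
 qexp E f x L -> differentiable f x /\ forall v, 'D_v f x = L v.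
Proof.
move=> oE Ex hL [[K hK] [C [r [r0 h]]]].
have [e /= e0 he] : \forall e \near 0^'+, ball x e `<=` E by exact: open_subball.
have [e' [e'0 he']] : exists e' : R, 0 < e' /\ ball x e' `<=` E.
 exists (e / 2); split; first by rewrite divr_gt0.
 apply: he => /=; last by rewrite divr_gt0.
 by rewrite sub0r normrN gtr0_norm ?divr_gt0// ltr_pdivrMr// ltr_pMr// ltr1n.
apply: (quad_differentiable (K := K) (C := C) (r := Num.min r e')) => //.
 by rewrite lt_min r0.
move=> v; rewrite lt_min => /andP[v1 v2].
have := h (x + v); rewrite [x + v - x]addrC addKr; apply => //; apply: he'.
by rewrite -ball_normE /ball_/= opprD addNKr normrN.
Qed.

Lemma qexp_unique (V W : nmodT R) (E : set V) (f : V -> W) x L L' : open E -> E x -> linW L ->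
 linW L' -> qexp E f x L -> qexp E f x L' -> forall v, L v = L' v.
Proof.
move=> oE Ex l l' q q' v.
by have [_ <-] := qexp_differentiable oE Ex l q; have [_ <-] := qexp_differentiable oE Ex l' q'.
Qed.

(** Value and slope at 0 are parameters, so that two computations of one curve can be equated by
    [jet_unique]; this is how identities in [e] are differentiated. *)
Definition jet {V : nmodT R} (F : R -> V) (a b : V) : Prop :=
 exists C r : R, 0 < r /\ forall e, `|e| < r -> `|F e - a - e *: b| <= C * e ^+ 2.

Lemma jetP {V : nmodT R} (F : R -> V) a b :
 jet F a b <-> F 0 = a /\ qexp setT F 0 (fun t => t *: b).
Proof.
split=> [[C [r [r0 h]]]|[<- [_ [C [r [r0 h]]]]]]; last first.
 by exists C, r; split => // e er; have := h e I; rewrite subr0 real_normK ?num_real//; exact.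
have e0 : F 0 = a.
 have z : `|0 : R| < r by rewrite normr0.
 by have := h 0 z; rewrite scale0r subr0 expr0n mulr0 normr_le0 subr_eq0 => /eqP.
split => //; split; first by exists `|b| => t; rewrite normrZ mulrC.
by exists C, r; split => // e _; rewrite subr0 e0 real_normK ?num_real//; exact: h.
Qed.

Lemma jet_ext {V : nmodT R} (F G : R -> V) a b (r : R) : 0 < r ->
 (forall e, `|e| < r -> F e = G e) -> jet F a b -> jet G a b.
Proof.
move=> r0 h [C [r' [r'0 hC]]]; exists C, (Num.min r r'); split; first by rewrite lt_min r0.
by move=> e; rewrite lt_min => /andP[e1 e2]; rewrite -h//; exact: hC.
Qed.

Lemma jet_conv {V : nmodT R} (F G : R -> V) a b a' b' (r : R) : jet F a b -> 0 < r ->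
 (forall e, `|e| < r -> F e = G e) -> a = a' -> b = b' -> jet G a' b'.
Proof. by move=> h r0 e <- <-; exact: jet_ext r0 e h. Qed.

Lemma jet_unique {V : nmodT R} (F : R -> V) a b a' b' : jet F a b -> jet F a' b' ->
 a = a' /\ b = b'.
Proof.
move=> /jetP[<- h] /jetP[<- h']; split => //.
have l (c : V) : linW (fun t : R => t *: c) by move=> k u v; rewrite scalerDl scalerA.
by have := qexp_unique openT I (l b) (l b') h h' 1; rewrite !scale1r.
Qed.

Lemma jet_qexp {V : nmodT R} (F : R -> V) a L b : qexp setT F 0 L -> F 0 = a ->
 (forall t, L t = t *: b) -> jet F a b.
Proof. by move=> h e0 hL; apply/jetP; split => //; apply: (qexp_ext _ _ hL h). Qed.

Lemma jet_cst {V : nmodT R} (a : V) : jet (fun=> a) a 0.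
Proof. by apply: (jet_qexp (qexp_cst setT a 0)) => // t; rewrite scaler0. Qed.

Lemma jet_id : jet (fun e : R => e : R^o) 0 1.
Proof.
by exists 0, 1; split => // e _; rewrite subr0 /GRing.scale/= mulr1 subrr normr0 mul0r.
Qed.

Lemma jetD {V : nmodT R} (F G : R -> V) a b a' b' : jet F a b -> jet G a' b' ->
 jet (fun e => F e + G e) (a + a') (b + b').
Proof.
by move=> /jetP[<- h] /jetP[<- h']; apply: (jet_qexp (qexpD h h')) => // t; rewrite scalerDr.
Qed.

Lemma jet_bil {V W U : nmodT R} (B : V -> W -> U) (K : R) (F : R -> V) (G : R -> W) a b a' b' :
 (forall x y z, B (x + y) z = B x z + B y z) -> (forall x y z, B x (y + z) = B x y + B x z) ->
 (forall (k : R) x y, B (k *: x) y = k *: B x y) -> (forall (k : R) x y, B x (k *: y) = k *: B x y) ->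
 (forall x y, `|B x y| <= K * `|x| * `|y|) ->
 jet F a b -> jet G a' b' -> jet (fun e => B (F e) (G e)) (B a a') (B a b' + B b a').
Proof.
move=> Dl Dr Zl Zr hB /jetP[<- h] /jetP[<- h'].
by apply: (jet_qexp (qexp_bil Dl Dr hB h h')) => // t; rewrite Zl Zr scalerDr.
Qed.

Lemma jetM p q s (F : R -> 'M[R]_(p, q)) (G : R -> 'M[R]_(q, s)) a b a' b' : jet F a b -> jet G a' b' ->
 jet (fun e => F e *m G e) (a *m a') (a *m b' + b *m a').
Proof.
apply: (@jet_bil _ _ _ (fun x y => x *m y) q%:R).
- by move=> *; rewrite mulmxDl.
- by move=> *; rewrite mulmxDr.
- by move=> *; rewrite scalemxAl.
- by move=> *; rewrite scalemxAr.
- by move=> x y; exact: mx_normM.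
Qed.

Lemma jetZ (V : nmodT R) (f : R -> R) (F : R -> V) (x y : R) a b : jet (f : R -> R^o) x y -> jet F a b ->
 jet (fun e => f e *: F e) (x *: a) (x *: b + y *: a).
Proof.
apply: (@jet_bil R^o V V (fun x y => (x : R) *: y) 1).
- by move=> *; rewrite scalerDl.
- by move=> *; rewrite scalerDr.
- by move=> k u v; rewrite /GRing.scale/= -[in RHS]/(_ *: _) scalerA.
- by move=> k u v; rewrite !scalerA mulrC.
- by move=> u v; rewrite mul1r normrZ.
Qed.

Lemma jetZc (V : nmodT R) (k : R) (F : R -> V) a b : jet F a b -> jet (fun e => k *: F e) (k *: a) (k *: b).
Proof. by move=> /jetP[<- h]; apply: (jet_qexp (qexpZ k h)) => // t; rewrite !scalerA mulrC. Qed.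

Lemma jetZid (V : nmodT R) (k : R) (F : R -> V) a b : jet F a b ->
 jet (fun e => (k * e) *: F e) 0 (k *: a).
Proof.
move=> h; have h1 : jet (fun e => k * e : R^o) 0 k.
 by have := @jetZc R^o k _ _ _ jet_id; rewrite /GRing.scale/= mulr0 mulr1.
by have := jetZ h1 h; rewrite !scale0r add0r.
Qed.

Lemma jetB (V : nmodT R) (F G : R -> V) a b a' b' : jet F a b -> jet G a' b' ->
 jet (fun e => F e - G e) (a - a') (b - b').
Proof.
by move=> /jetP[<- h] /jetP[<- h']; apply: (jet_qexp (qexpB I h h')) => // t; rewrite scalerBr.
Qed.

Lemma jet_sum (V : nmodT R) n (F : 'I_n -> R -> V) a b : (forall i, jet (F i) (a i) (b i)) ->
 jet (fun e => \sum_i F i e) (\sum_i a i) (\sum_i b i).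
Proof.
move=> h; have h' i := (jetP _ _ _).1 (h i).
apply: (jet_qexp (qexp_sum I (fun i => (h' i).2))) => [|t]; last by rewrite scaler_sumr.
by apply: eq_bigr => i _; rewrite (h' i).1.
Qed.

Lemma jet_trmx p q (F : R -> 'M[R]_(p, q)) a b : jet F a b -> jet (fun e => (F e)^T) a^T b^T.
Proof.
move=> /jetP[<- h]; apply: (jet_qexp (qexp_lin (F := trmx) (K := 1) _ _ h)) => //; last first.
- by move=> t; rewrite linearZ.
- by move=> u; rewrite mx_normT mul1r.
- by move=> u v; rewrite linearB.
Qed.

Lemma jet_tr d (F : R -> 'M[R]_d) a b : jet F a b -> jet (fun e => \tr (F e) : R^o) (\tr a) (\tr b).
Proof. by move=> /jetP[<- h]; apply: (jet_qexp (qexp_tr h)) => // t; rewrite mxtraceZ. Qed.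

Lemma jet_perturb {V : nmodT R} (F G : R -> V) a b (C r : R) : 0 < r ->
 (forall e, `|e| < r -> `|G e - F e| <= C * e ^+ 2) -> jet F a b -> jet G a b.
Proof.
move=> r0 h [C' [r' [r'0 h']]]; exists (C + C'), (Num.min r r'); split; first by rewrite lt_min r0.
move=> e; rewrite lt_min => /andP[e1 e2].
have -> : G e - a - e *: b = (G e - F e) + (F e - a - e *: b) by rewrite [RHS]addrA [G e - F e + _]addrA subrK.
by apply: le_trans (ler_normD _ _) _; rewrite mulrDl lerD ?h ?h'.
Qed.

Lemma jet_bound {V : nmodT R} (F : R -> V) a b : jet F a b ->
 exists K r : R, [/\ 0 <= K, 0 < r & forall e, `|e| < r -> `|F e - a| <= K * `|e|].
Proof.
move=> /jetP[<- /qexp_lipschitz[K [r [K0 r0 h]]]]; exists K, r; split => // e.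
by have := h e I; rewrite subr0; exact.
Qed.

Lemma jet_lndet0 d (X : R -> 'M[R]_d) b : jet X 0 b ->
 jet (fun e => ln (\det (1%:M + X e)) : R^o) 0 (\tr b).
Proof.
move=> hX; have h1 := jet_tr hX; rewrite linear0 in h1; have [K [r [K0 r0 hK]]] := jet_bound hX.
have [[dl Cl] [/= dl0 _ Cl0 hln]] := @lndet1D_expand R d.
apply: (jet_perturb (r := Num.min r (dl / (K + 1))) (C := Cl * K ^+ 2)) h1.
 by rewrite lt_min r0 divr_gt0// ltr_wpDl.
move=> e; rewrite lt_min => /andP[e1 e2]; have := hK e e1; rewrite subr0 => h2.
have h3 : `|X e| <= dl.
 apply: le_trans h2 _; rewrite ltr_pdivlMr ?ltr_wpDl// in e2; apply: le_trans (ltW e2).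
 by rewrite mulrC ler_wpM2l// lerDl.
have [_] := hln _ h3; move=> /le_trans; apply; rewrite -mulrA ler_wpM2l//.
by rewrite -[e ^+ 2]real_normK ?num_real// -exprMn lerXn2r ?nnegrE ?mulr_ge0.
Qed.

Lemma jet_lndet d (k : R) (X : R -> 'M[R]_d) a b : jet X a b ->
 jet (fun e => ln (\det (1%:M + (k * e) *: X e)) : R^o) 0 (k * \tr a).
Proof. by move=> hX; have := jet_lndet0 (jetZid k hX); rewrite mxtraceZ. Qed.

Lemma jet_exp (f : R -> R) (b : R) : jet (f : R -> R^o) 0 b -> jet (fun e => expR (f e) : R^o) 1 b.
Proof.
move=> hf; have [K [r [K0 r0 hK]]] := jet_bound hf.
have h1 := jetD (@jet_cst R^o 1) hf; rewrite addr0 add0r in h1.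
apply: (jet_perturb (r := Num.min r (2^-1 / (K + 1))) (C := 2 * K ^+ 2)) h1.
 by rewrite lt_min r0 !divr_gt0// ltr_wpDl.
move=> e; rewrite lt_min => /andP[e1 e2]; have := hK e e1; rewrite subr0 => h2.
have h3 : `|f e| <= 2^-1.
 apply: le_trans h2 _; rewrite ltr_pdivlMr ?ltr_wpDl// in e2; apply: le_trans (ltW e2).
 by rewrite mulrC ler_wpM2l// lerDl.
have h4 := expR_le_quadratic h3; have h5 := expR_ge1Dx (f e).
have h6 : 2 * f e ^+ 2 <= 2 * K ^+ 2 * e ^+ 2.
 rewrite -mulrA ler_wpM2l// -[f e ^+ 2]real_normK ?num_real// -[e ^+ 2]real_normK ?num_real// -exprMn.
 by rewrite lerXn2r// nnegrE mulr_ge0.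
by rewrite ger0_norm; move: h4 h5 h6; move: (expR _) (_ ^+ 2) (_ * _ ^+ 2) => *; lra.
Qed.

End jets.

(** * Gaussian integrals on tuples *)

Section gaussian_integral.
Context {R : realType}.

Lemma integral_gauss_half :
 (\int[@lebesgue_measure R]_x (expR (- 2^-1 * x ^+ 2))%:E = (Num.sqrt (pi *+ 2))%:E)%E.
Proof.
have s20 : 0 < (Num.sqrt 2)^-1 :> R by rewrite invr_gt0 sqrtr_gt0.
have mg : mfunT (EFin \o @gauss_fun R).
 by apply/measurable_EFinP; exact: measurable_gauss_fun.
have := @ge0_integral_lebesgue_affine R (Num.sqrt 2)^-1 0 (EFin \o @gauss_fun R) s20 mg.
move=> /(_ (fun x => _)) H.
have {}H := H (fun x => gauss_fun_ge0 x).
move: H; rewrite integralT_gauss => H.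
have -> : Num.sqrt (pi *+ 2) = Num.sqrt 2 * Num.sqrt pi :> R.
 by rewrite -sqrtrM// mulr_natl.
rewrite EFinM -H muleA -EFinM divff ?mul1e; last by rewrite gt_eqF// sqrtr_gt0.
apply: eq_integral => x _; rewrite /= /gauss_fun addr0 exprMn exprVn sqr_sqrtr//.
by rewrite mulNr.
Qed.

Lemma measurable_dotc_colx d (w m : 'cV[R]_d) :
 mfunT (fun x : Rn R d => dotc w (colx x - m)).
Proof.
rewrite (_ : (fun _ => _) = (fun x : Rn R d => \sum_i w i 0 * (tnth x i - m i 0))).
 apply: measurable_sum => i; apply: measurable_funM; first exact: measurable_cst.
 by apply: measurable_funB; [exact: measurable_tnth|exact: measurable_cst].
by apply/funext => x; rewrite dotcE; apply: eq_bigr => i _; rewrite !mxE.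
Qed.

Lemma measurable_quad_colx d (J : 'M[R]_d) (m : 'cV[R]_d) :
 mfunT (fun x : Rn R d => dotc (colx x - m) (J *m (colx x - m))).
Proof.
rewrite (_ : (fun _ => _) = (fun x : Rn R d =>
 \sum_i dotc (delta_mx i 0) (colx x - m) * dotc (row i J)^T (colx x - m))).
 by apply: measurable_sum => i; apply: measurable_funM; exact: measurable_dotc_colx.
apply/funext => x; rewrite [LHS]dotcE; apply: eq_bigr => i _; congr (_ * _).
 by rewrite /dotc trmx_delta -rowE [RHS]mxE.
by rewrite /dotc trmxK -row_mul [RHS]mxE.
Qed.

Lemma dotc_col_mx m n (a c : 'cV[R]_m) (b e : 'cV[R]_n) :
 dotc (col_mx a b) (col_mx c e) = dotc a c + dotc b e.
Proof. by rewrite /dotc tr_col_mx mul_row_col mxE. Qed.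

Lemma integral_std_gauss d :
 (\int[lebesgue_tuple d]_x (expR (- 2^-1 * dotc (colx x) (colx x)))%:E =
 (Num.sqrt ((pi *+ 2) ^+ d : R))%:E)%E.
Proof.
have mq n : mfunT
 (fun x : Rn R n => (expR (- 2^-1 * dotc (colx x) (colx x)))%:E).
 apply/measurable_EFinP; apply: measurableT_comp; first exact: measurable_expR.
 apply: measurable_funM; first exact: measurable_cst.
 have := @measurable_quad_colx n 1%:M 0; congr measurable_fun.
 by apply/funext => x; rewrite subr0 mul1mx.
elim: d => [|d IH].
 rewrite [LHS](integral_dirac _ measurableT (mq 0))/= diracE in_setT mul1e dotcE.
 by rewrite big_ord0 mulr0 expR0 expr0 sqrtr1.
rewrite ge0_integral_lebesgue_tupleS//.
have e (x : measurableTypeR R) :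
 (\int[lebesgue_tuple d]_t (expR (- 2^-1 * dotc (colx (consx (x, t)))
 (colx (consx (x, t)))))%:E =
 (Num.sqrt ((pi *+ 2) ^+ d))%:E * (expR (- 2^-1 * x ^+ 2))%:E)%E.
 rewrite -IH muleC -ge0_integralZl_EFin ?expR_ge0//.
 apply: eq_integral => t _; rewrite -EFinM -expRD -mulrDr; congr (expR (_ * _))%:E.
 rewrite colx_consx/= [LHS](@dotc_col_mx 1 d); congr (_ + _).
 by rewrite dotcE big_ord1 mxE eqxx mulr1n expr2.
 exact: mq.
under eq_integral do rewrite e.
rewrite ge0_integralZl_EFin ?sqrtr_ge0//; last first.
 apply/measurable_EFinP; apply: measurableT_comp; first exact: measurable_expR.
 apply: measurable_funM; first exact: measurable_cst.
 exact: measurable_funX.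
rewrite integral_gauss_half -EFinM exprS [in RHS]mulrC sqrtrM// exprn_ge0//.
by rewrite mulrn_wge0// pi_ge0.
Qed.

Lemma measurable_exp_quad d (J : 'M[R]_d) (m : 'cV[R]_d) : mfunT
 (fun x : Rn R d => expR (- 2^-1 * dotc (colx x - m) (J *m (colx x - m)))).
Proof.
apply: measurableT_comp; first exact: measurable_expR.
apply: measurable_funM; first exact: measurable_cst.
exact: measurable_quad_colx.
Qed.

(** Substitution by the positive square root of [J], whose determinant is the square root of
    [\det J], reduces to the standard Gaussian. *)
Lemma integral_exp_quad d (J : 'M[R]_d) (m : 'cV[R]_d) : sympd J ->
 (\int[lebesgue_tuple d]_x (expR (- 2^-1 * dotc (colx x - m) (J *m (colx x - m))))%:E =
 (Num.sqrt ((pi *+ 2) ^+ d / \det J))%:E)%E.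
Proof.
move=> pJ; have [S pS eS] := sympd_sqrt pJ.
pose g (x : Rn R d) := (expR (- 2^-1 * dotc (colx x) (colx x)))%:E.
have mg : mfunT g.
 apply/measurable_EFinP; have := @measurable_exp_quad d 1%:M 0; congr measurable_fun.
 by apply/funext => x; rewrite subr0 mul1mx.
have dS := sympd_det pS.
have := ge0_integral_lebesgue_aff (- (S *m m)) pS mg (fun x => _).
move=> /(_ (fun x => expR_ge0 _)).
rewrite /g integral_std_gauss => H.
have -> : Num.sqrt ((pi *+ 2) ^+ d / \det J) = (\det S)^-1 * Num.sqrt ((pi *+ 2) ^+ d).
 have p0 : 0 <= (pi *+ 2 : R) ^+ d by rewrite exprn_ge0// mulrn_wge0// pi_ge0.
 rewrite (sqrtrM _ p0) [LHS]mulrC; congr (_ * _).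
 by rewrite -eS det_mulmx -expr2 sqrtrV ?sqr_ge0// sqrtr_sqr gtr0_norm.
move: H; set I := (\int[_]_x _)%E => H.
rewrite EFinM -H muleA -EFinM mulVf ?gt_eqF// mul1e {H}/I.
apply: eq_integral => x _; rewrite /aff tupK -mulmxBr; congr (expR (_ * _))%:E.
by rewrite -eS -mulmxA [LHS]dotc_mulmx (sympd_sym pS).
Qed.

Lemma gauss_pdfE d (p : gparam R d) (x : Rn R d) :
 gauss_pdf p x = (Num.sqrt ((pi *+ 2) ^+ d * \det p.2))^-1 *
 expR (- 2^-1 * dotc (colx x - p.1) (invmx p.2 *m (colx x - p.1))).
Proof. by rewrite /gauss_pdf /dotc mulmxA. Qed.

Lemma gauss_cst_gt0 d (p : gparam R d) : Gd p ->
 0 < Num.sqrt ((pi *+ 2) ^+ d * \det p.2).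
Proof.
move=> hp; rewrite sqrtr_gt0 mulr_gt0 ?sympd_det// exprn_gt0//.
by rewrite mulrn_wgt0// pi_gt0.
Qed.

Lemma gauss_pdf_gt0 d (p : gparam R d) x : Gd p -> 0 < gauss_pdf p x.
Proof. by move=> hp; rewrite mulr_gt0 ?expR_gt0// invr_gt0 gauss_cst_gt0. Qed.

Lemma integral_gauss_pdf d (p : gparam R d) : Gd p ->
 (\int[lebesgue_tuple d]_x (gauss_pdf p x)%:E = 1)%E.
Proof.
move=> hp; have pJ : sympd (invmx p.2) by exact: sympd_inv.
under eq_integral do rewrite gauss_pdfE EFinM.
rewrite ge0_integralZl_EFin ?invr_ge0 ?sqrtr_ge0//; last first.
 by apply/measurable_EFinP; exact: measurable_exp_quad.
rewrite integral_exp_quad// -EFinM det_inv invrK mulVf// gt_eqF//.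
exact: gauss_cst_gt0.
Qed.

Lemma gaussE d (p : gparam R d) (A : set (Rn R d)) : Gd p ->
 (gauss p A = \int[lebesgue_tuple d]_(x in A) (gauss_pdf p x)%:E)%E.
Proof.
move=> hp; rewrite /gauss /= /mnormalize.
have e : [the {measure set (Rn R d) -> \bar R} of gauss_density_measure p] setT = 1%E.
 exact: integral_gauss_pdf.
by rewrite e onee_eq0/= invr1 mule1.
Qed.

End gaussian_integral.

(** * Measures given by a density, and their Radon-Nikodym derivatives *)

Section density.
Context {R : realType} {dT : measure_display} {T : measurableType dT}.
Variables (rho : fmeas R T)
 (eta : {sigma_finite_measure set T -> \bar R}) (r : T -> R).
Hypotheses (mr : mfunT r) (r0 : forall x, 0 <= r x).
Hypothesis rhoE : forall A, measurable A -> rho A = (\int[eta]_(x in A) (r x)%:E)%E.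

Lemma density_dominates : rho `<< eta.
Proof.
apply/null_content_dominatesP => A mA A0; rewrite rhoE//.
by apply: null_set_integral => //; exact/measurable_EFinP/measurable_funTS.
Qed.

Lemma density_ae_eq_SF D : measurable D ->
 ae_eq eta D (Radon_Nikodym_SigmaFinite.f rho eta) (EFin \o r).
Proof.
move=> mD; have dom := density_dominates.
apply: integral_ae_eq => //.
- apply: (integrableS measurableT) => //.
 exact: Radon_Nikodym_SigmaFinite.f_integrable.
- exact/measurable_EFinP/measurable_funTS.
- by move=> A _ mA; rewrite -Radon_Nikodym_SigmaFinite.f_integral// rhoE.
Qed.

Lemma ge0_integral_density D (f : T -> \bar R) : measurable D ->
 measurable_fun D f -> (forall x, 0 <= f x)%E ->
 (\int[rho]_(x in D) f x = \int[eta]_(x in D) (f x * (r x)%:E))%E.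
Proof.
move=> mD mf f0; have dom := density_dominates.
rewrite -(Radon_Nikodym_SigmaFinite.change_of_variables dom f0)//.
apply: ae_eq_integral => //.
- apply: emeasurable_funM => //; apply: measurable_funTS.
 exact: measurable_int (Radon_Nikodym_SigmaFinite.f_integrable dom).
- by apply: emeasurable_funM => //; exact/measurable_EFinP/measurable_funTS.
- by apply: ae_eqe_mul2l; exact: density_ae_eq_SF.
Qed.

Lemma density_ae_eq_RN :
 ae_eq eta setT (Radon_Nikodym (charge_of_finite_measure rho) eta) (EFin \o r).
Proof.
apply: ae_eq_trans (density_ae_eq_SF measurableT); apply: ae_eq_sym.
exact: (ae_eq_Radon_Nikodym_SigmaFinite density_dominates).
Qed.

End density.

Lemma sqrtr_expR_ln {R : realType} (x : R) : 0 < x -> Num.sqrt x = expR (2^-1 * ln x).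
Proof.
move=> x0; apply/eqP; rewrite -(eqrXn2 (n := 2)) ?sqrtr_ge0 ?expR_ge0//.
rewrite sqr_sqrtr ?(ltW x0)// expr2 -expRD -mulrDl.
have -> : 2^-1 + 2^-1 = 1 :> R by lra.
by rewrite mul1r lnK.
Qed.

(** * Gaussian laws: density ratios, second moments, affine images *)

Section gaussian_measure.
Context {R : realType} {d : nat}.
Implicit Types p q : gparam R d.

Lemma measurable_gauss_pdfT p : mfunT (fun x : Rn R d => gauss_pdf p x).
Proof. exact: measurable_gauss_pdf. Qed.

Lemma ge0_integral_gauss p D (f : Rn R d -> \bar R) : Gd p ->
 measurable D -> measurable_fun D f -> (forall x, 0 <= f x)%E ->
 (\int[gauss p]_(x in D) f x = \int[lebesgue_tuple d]_(x in D) (f x * (gauss_pdf p x)%:E))%E.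
Proof.
move=> hp mD mf f0; apply: ge0_integral_density => //.
- exact: measurable_gauss_pdfT.
- by move=> A mA; exact: gaussE.
Qed.

Definition gauss_ratio q p (x : Rn R d) : R := gauss_pdf q x / gauss_pdf p x.

Lemma measurable_gauss_ratio q p : Gd p ->
 mfunT (gauss_ratio q p).
Proof.
(* The inverse of the positive density is written as the exponential of minus its logarithm, a
   composition of measurable functions. *)
move=> hp; rewrite (_ : gauss_ratio q p = fun x => expR (ln (gauss_pdf p x) * -1) * gauss_pdf q x).
 apply: measurable_funM; last exact: measurable_gauss_pdfT.
 apply: measurableT_comp; first exact: measurable_expR.
 apply: measurable_funM; last exact: measurable_cst.
 apply: measurableT_comp; [exact: measurable_ln|exact: measurable_gauss_pdfT].
by apply/funext => x; rewrite mulrN1 expRN lnK ?posrE ?gauss_pdf_gt0// mulrC.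
Qed.

Lemma gauss_ratio_gt0 q p x : Gd q -> Gd p -> 0 < gauss_ratio q p x.
Proof. by move=> hq hp; rewrite divr_gt0// gauss_pdf_gt0. Qed.

Lemma gauss_ratio_density q p A : Gd q -> Gd p ->
 measurable A -> (gauss q A = \int[gauss p]_(x in A) (gauss_ratio q p x)%:E)%E.
Proof.
move=> hq hp mA; rewrite ge0_integral_gauss//.
- rewrite gaussE//; apply: eq_integral => x _; rewrite -EFinM divfK//.
 by rewrite gt_eqF// gauss_pdf_gt0.
- by apply/measurable_EFinP; apply: measurable_funTS; exact: measurable_gauss_ratio.
- by move=> x; rewrite lee_fin ltW// gauss_ratio_gt0.
Qed.

Lemma gauss_ratioE q p x : Gd q -> Gd p ->
 gauss_ratio q p x = Num.sqrt (\det p.2 / \det q.2) *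
 expR (- 2^-1 * (dotc (colx x - q.1) (invmx q.2 *m (colx x - q.1)) -
 dotc (colx x - p.1) (invmx p.2 *m (colx x - p.1)))).
Proof.
move=> hq hp; rewrite /gauss_ratio !gauss_pdfE mulrBr expRD.
have p0 : 0 < (pi *+ 2 : R) ^+ d by rewrite exprn_gt0// mulrn_wgt0// pi_gt0.
have dq := sympd_det hq; have dp := sympd_det hp.
rewrite [X in _ = _ * (_ * X)]expRN.
rewrite !sqrtrM ?(ltW p0) ?(ltW dp)// sqrtrV ?(ltW dq)//.
have e0 := expR_gt0 (- 2^-1 * dotc (colx x - p.1) (invmx p.2 *m (colx x - p.1))).
have s1 : 0 < Num.sqrt ((pi *+ 2 : R) ^+ d) by rewrite sqrtr_gt0.
have s2 : 0 < Num.sqrt (\det p.2) by rewrite sqrtr_gt0.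
have s3 : 0 < Num.sqrt (\det q.2) by rewrite sqrtr_gt0.
by field; rewrite !gt_eqF.
Qed.

(** Tilting by a quadratic exponential adds [M] to the precision matrix: up to a constant the
    integrand is the density ratio of another Gaussian, whose total mass is 1. *)
Lemma gauss_exp_quad p (M : 'M[R]_d) : Gd p -> sympd (invmx p.2 + M) ->
 (\int[gauss p]_x (expR (- 2^-1 * dotc (colx x - p.1) (M *m (colx x - p.1))))%:E =
 (Num.sqrt (\det (1%:M + p.2 *m M)))^-1%:E)%E.
Proof.
move=> hp hM; pose q : gparam R d := (p.1, invmx (invmx p.2 + M)).
have hq : Gd q by exact: sympd_inv.
have dq := sympd_det hq; have dp := sympd_det hp.
have e x : (expR (- 2^-1 * dotc (colx x - p.1) (M *m (colx x - p.1))))%:E =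
 ((Num.sqrt (\det p.2 / \det q.2))^-1%:E * (gauss_ratio q p x)%:E)%E.
 rewrite -EFinM gauss_ratioE// mulKf; last first.
 by rewrite gt_eqF// sqrtr_gt0 divr_gt0.
 congr (expR (_ * _))%:E; rewrite /= invmxK mulmxDl dotcDr.
 by rewrite addrAC subrr add0r.
under eq_integral do rewrite e.
rewrite ge0_integralZl_EFin ?invr_ge0 ?sqrtr_ge0//; last 2 first.
- by move=> x _; rewrite lee_fin ltW// gauss_ratio_gt0.
- by apply/measurable_EFinP; exact: measurable_gauss_ratio.
rewrite -gauss_ratio_density// probability_setT mule1; congr ((Num.sqrt _)^-1)%:E.
rewrite /q/= det_inv invrK -det_mulmx mulmxDr mulmxV//.
exact: sympd_unit.
Qed.

Lemma det1_gt0 p (M : 'M[R]_d) : Gd p -> sympd (invmx p.2 + M) ->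
 0 < \det (1%:M + p.2 *m M).
Proof.
move=> hp pM; have up := sympd_unit hp.
have -> : 1%:M + p.2 *m M = p.2 *m (invmx p.2 + M) by rewrite mulmxDr mulmxV.
by rewrite det_mulmx mulr_gt0// sympd_det.
Qed.

Let quad p B (x : Rn R d) := dotc (colx x - p.1) (B *m (colx x - p.1)).

(** The moment is squeezed rather than differentiated under the integral: [1 + y <= expR y] compares
    it with the exponential moments of [gauss_exp_quad] at [s] and at [- s], whose expansions in [s]
    are known. *)
Lemma integral_gauss_quad p (B : 'M[R]_d) : Gd p -> sympd B ->
 (\int[gauss p]_x (dotc (colx x - p.1) (B *m (colx x - p.1)))%:E = (\tr (p.2 *m B))%:E)%E.
Proof.
move=> hp pB; rewrite -/(quad p B).
have q0 x : 0 <= quad p B x by exact: sympd_ge0.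
have mq : mfunT (quad p B) by exact: measurable_quad_colx.
pose X := p.2 *m B.
have hj : jet (fun s => expR (- 2^-1 * ln (\det (1%:M + s *: X))) : R^o) 1 (- 2^-1 * \tr X).
 have h := jetZc (- 2^-1) (jet_lndet 1 (jet_cst X)); rewrite scaler0 mul1r in h.
 by apply: (jet_ext ltr01) (jet_exp h) => s _; rewrite mul1r.
have [C0 [r1 [r10 hC]]] := hj; pose C := `|C0| + 1; have C1 : 0 < C by rewrite ltr_wpDl.
have [e e0 he] := sympd_near (sympd_inv hp).
pose s0 := Num.min (r1 / 2) (e / (`|B| + 1)).
have s00 : 0 < s0 by rewrite lt_min !divr_gt0// ltr_wpDl.
have small s : `|s| <= s0 -> [/\ sympd (invmx p.2 + s *: B), 0 < \det (1%:M + s *: X) &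
 (Num.sqrt (\det (1%:M + s *: X)))^-1 <= 1 - 2^-1 * s * \tr X + C * s ^+ 2].
 rewrite le_min => /andP[s1 s2]; have pM : sympd (invmx p.2 + s *: B).
 apply: he; first by rewrite linearD/= linearZ/= (sympd_sym pB) (sympd_sym (sympd_inv hp)).
 rewrite addrC addKr normrZ; rewrite ler_pdivlMr ?ltr_wpDl// in s2; apply: le_trans s2.
 by rewrite ler_wpM2l// lerDl.
 have D0 : 0 < \det (1%:M + s *: X) by rewrite scalemxAr; exact: det1_gt0.
 split=> //; rewrite sqrtr_expR_ln// -expRN -mulNr.
 have : `|s| < r1 by apply: le_lt_trans s1 _; rewrite ltr_pdivrMr// ltr_pMr// ltr1n.
 move=> /hC; rewrite ler_norml => /andP[_]; rewrite /GRing.scale/=.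
 have : C0 * s ^+ 2 <= C * s ^+ 2 by rewrite ler_wpM2r ?sqr_ge0// /C; have := ler_norm C0; lra.
 by move: (expR _) (C0 * _) (C * _) => *; lra.
pose U := (\int[gauss p]_x (quad p B x)%:E)%E.
have mqs s : mfunT (fun x => (expR (- 2^-1 * (s * quad p B x)))%:E).
 apply/measurable_EFinP; apply: measurableT_comp; first exact: measurable_expR.
 by do 2 (apply: measurable_funM; first exact: measurable_cst).
have hI s : `|s| <= s0 -> (\int[gauss p]_x (expR (- 2^-1 * (s * quad p B x)))%:E =
 (Num.sqrt (\det (1%:M + s *: X)))^-1%:E)%E.
 move=> /small[h1 h2 _]; have := gauss_exp_quad hp h1.
 rewrite -scalemxAr => <-; apply: eq_integral => x _.
 by rewrite /quad -scalemxAl dotcZr.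
have mlin s : mfunT (fun x => (2^-1 * s * quad p B x)%:E).
 by apply/measurable_EFinP; apply: measurable_funM; first exact: measurable_cst.
have intlin s : 0 <= s -> (\int[gauss p]_x (2^-1 * s * quad p B x)%:E = (2^-1 * s)%:E * U)%E.
 move=> s_ge0; under eq_integral do rewrite EFinM.
 rewrite ge0_integralZl_EFin ?mulr_ge0//; first by move=> x _; rewrite lee_fin.
 exact/measurable_EFinP.
have int1 : (\int[gauss p]_x (1%E : \bar R) = 1)%E.
 by rewrite integral_cst// mul1e; exact: probability_setT.
(* The negative parameter gives the upper bound, and with it the finiteness of [U]; the positive
   parameter gives the lower bound. *)
have upper s : 0 < s -> s <= s0 -> (U <= (\tr X + 2 * C * s)%:E)%E.
 move=> s_gt0 ss0; have sN : `|- s| <= s0 by rewrite normrN gtr0_norm.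
 have : (1 + (2^-1 * s)%:E * U <= (1 + 2^-1 * s * \tr X + C * s ^+ 2)%:E)%E.
 rewrite -int1 -intlin ?(ltW s_gt0)// -ge0_integralD//; last first.
 by move=> x _; rewrite lee_fin !mulr_ge0// ltW.
 apply: (@le_trans _ _ (\int[gauss p]_x (expR (- 2^-1 * (- s * quad p B x)))%:E)%E).
 apply: ge0_le_integral => //.
 - by move=> x _; rewrite adde_ge0// lee_fin !mulr_ge0// ltW.
 - exact: emeasurable_funD.
 - by move=> x _; rewrite -EFinD lee_fin mulrA mulrNN expR_ge1Dx.
 rewrite hI// lee_fin; have [_ _] := small _ sN.
 by rewrite sqrrN mulrN mulNr opprK.
 case: (U) => [u| |].
 - rewrite -EFinM -EFinD !lee_fin => h.
 rewrite -(ler_pM2l s_gt0); rewrite expr2 in h *; lra.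
 - by rewrite gt0_muley ?lte_fin ?mulr_gt0.
 - by rewrite leNye.
have lower s : 0 < s -> s <= s0 -> ((\tr X - 2 * C * s)%:E <= U)%E.
 move=> s_gt0 ss0; have sN : `|s| <= s0 by rewrite gtr0_norm.
 have : (1 <= (1 - 2^-1 * s * \tr X + C * s ^+ 2)%:E + (2^-1 * s)%:E * U)%E.
 rewrite -[X in (X <= _)%E]int1 -intlin ?(ltW s_gt0)//.
 apply: (@le_trans _ _ (\int[gauss p]_x ((expR (- 2^-1 * (s * quad p B x)))%:E +
 (2^-1 * s * quad p B x)%:E))%E).
 apply: ge0_le_integral => //.
 - exact: emeasurable_funD.
 - move=> x _; rewrite -EFinD lee_fin.
 by have := expR_ge1Dx (- 2^-1 * (s * quad p B x)); lra.
 rewrite ge0_integralD//.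
 - by rewrite leeD2r// hI// lee_fin; have [_ _] := small _ sN.
 - by move=> x _; rewrite lee_fin !mulr_ge0// ltW.
 case: (U) => [u| |].
 - rewrite -EFinM -EFinD !lee_fin => h.
 rewrite -(ler_pM2l s_gt0); rewrite expr2 in h *; lra.
 - by rewrite leey.
 - by rewrite gt0_muleNy ?lte_fin ?mulr_gt0// addeNy leeNy_eq.
rewrite -[LHS]/U.
have [u eU] : exists u, U = u%:E.
 exists (fine U); rewrite fineK// fin_numE; apply/andP; split.
 apply/eqP => U0; have := lower s0 s00 (lexx _); by rewrite U0 leeNy_eq.
 apply/eqP => U0; have := upper s0 s00 (lexx _); by rewrite U0 leye_eq.
rewrite eU; congr (_%:E); apply/eqP; rewrite eq_le.
have pick t : 0 < t -> exists2 s, 0 < s <= s0 & 2 * C * s <= t.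
 move=> t0; exists (Num.min s0 (t / (2 * C))).
 by rewrite lt_min s00 divr_gt0 ?mulr_gt0//= ge_min lexx.
 rewrite mulrC -ler_pdivlMr ?mulr_gt0//.
 by rewrite ge_min lexx orbT.
apply/andP; split; apply/ler_addgt0Pr => t t0; have [s /andP[s1 s2] s3] := pick t t0.
 by have := upper s s1 s2; rewrite eU lee_fin; lra.
by have := lower s s1 s2; rewrite eU lee_fin; lra.
Qed.

Lemma gauss_pushforward p q (T : 'M[R]_d) (A : set (Rn R d)) :
 Gd p -> sympd T -> q.2 = T *m p.2 *m T -> measurable A ->
 gauss q A = gauss p (aff T (q.1 - T *m p.1) @^-1` A).
Proof.
move=> hp pT eq2 mA; set b := q.1 - T *m p.1.
have hq : Gd q by rewrite /gaussians/= eq2; exact: sympd_congr'.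
have mpre : measurable (aff T b @^-1` A).
 by rewrite -[X in measurable X]setTI; exact: measurable_aff.
pose f := (fun x => (gauss_pdf q x)%:E) \_ A.
transitivity (\int[lebesgue_tuple d]_x f x)%E.
 by transitivity (\int[lebesgue_tuple d]_(x in A) (gauss_pdf q x)%:E)%E;
 [exact: gaussE|exact: integral_mkcond].
transitivity (\int[lebesgue_tuple d]_x
 (((fun x => (gauss_pdf p x)%:E) \_ (aff T b @^-1` A)) x))%E; last first.
 transitivity (\int[lebesgue_tuple d]_(x in aff T b @^-1` A) (gauss_pdf p x)%:E)%E;
 [exact/esym/integral_mkcond|exact/esym/gaussE].
have mf : mfunT f.
 apply/(measurable_restrictT _ mA); apply: measurable_funTS.
 by apply/measurable_EFinP; exact: measurable_gauss_pdfT.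
have f0 x : (0 <= f x)%E.
 by rewrite /f patchE; case: ifP => // _; rewrite lee_fin gauss_pdf_ge0.
rewrite -(ge0_integral_lebesgue_aff b pT mf f0).
have dT := sympd_det pT; have dp := sympd_det hp.
rewrite -ge0_integralZl_EFin ?(ltW dT)//; last first.
 by apply: (measurableT_comp mf); exact: measurable_aff.
apply: eq_integral => x _; rewrite /f !patchE.
have -> : (x \in aff T b @^-1` A) = (aff T b x \in A).
 by apply/idP/idP; rewrite !inE.
case: ifP => _; last by rewrite mule0.
rewrite -EFinM; congr EFin; rewrite !gauss_pdfE mulrA; congr (_ * expR (_ * _)).
 rewrite eq2 !det_mulmx.
 have -> : (pi *+ 2 : R) ^+ d * (\det T * \det p.2 * \det T) =
 (\det T) ^+ 2 * ((pi *+ 2) ^+ d * \det p.2) by ring.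
 rewrite sqrtrM ?sqr_ge0// sqrtr_sqr gtr0_norm// invfM mulrA divff ?mul1r//.
 by rewrite gt_eqF.
have -> : colx (aff T b x) - q.1 = T *m (colx x - p.1).
 by rewrite /aff tupK /b mulmxBr addrCA [q.1 + _]addrC addrK.
have uT := sympd_unit pT; have up := sympd_unit hp.
rewrite dotc_mulmxl (sympd_sym pT) mulmxA; congr dotc; rewrite mulmxA; congr (_ *m _).
apply: (can_inj (mulmxK up)); apply: (can_inj (mulmxK uT)).
rewrite mulVmx// mul1mx -[T *m invmx q.2 *m T *m p.2 *m T]mulmxA.
rewrite -!mulmxA [T *m (p.2 *m T)]mulmxA -eq2 mulVmx ?mulmx1//.
exact: sympd_unit.
Qed.

End gaussian_measure.

(** * Relative entropy through densities, and its Young inequality *)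

Section KL_density.
Context {R : realType} {dT : measure_display} {T : measurableType dT}.
Variables (rho eta : fmeas R T).

Lemma KL_density (r : T -> R) : mfunT r -> (forall x, 0 <= r x) ->
 (forall A, measurable A -> rho A = (\int[eta]_(x in A) (r x)%:E)%E) ->
 KL rho eta = (\int[eta]_x (r x * ln (r x) - r x + 1)%:E)%E.
Proof.
move=> mr r0 rhoE; have dom := density_dominates mr rhoE.
rewrite /KL; case: asboolP => // _.
apply: ae_eq_integral => //.
- apply/measurable_EFinP.
 have mf : mfunT
 (fine \o Radon_Nikodym (charge_of_finite_measure rho) eta).
 by apply: measurableT_comp => //; exact: measurable_int (Radon_Nikodym_integrable _).
 apply: measurable_funD; last exact: measurable_cst.
 apply: measurable_funB => //; apply: measurable_funM => //.
 by apply: measurableT_comp => //; exact: measurable_ln.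
- apply/measurable_EFinP.
 apply: measurable_funD; last exact: measurable_cst.
 apply: measurable_funB => //; apply: measurable_funM => //.
 by apply: measurableT_comp => //; exact: measurable_ln.
- have := density_ae_eq_RN mr rhoE.
 by apply: filterS => x /= h _; rewrite h.
Qed.

(** Provides a version of the derivative that is finite and nonnegative at every point, so that
    later inequalities hold pointwise and not just almost everywhere. *)
Lemma KL_density_exists : KL rho eta != +oo%E -> exists r : T -> R,
 [/\ mfunT r, forall x, 0 <= r x &
 forall A, measurable A -> rho A = (\int[eta]_(x in A) (r x)%:E)%E].
Proof.
rewrite /KL; case: asboolP => [dom _|]; last by rewrite eqxx.
exists (fine \o Radon_Nikodym_SigmaFinite.f rho eta); split.
- apply: measurableT_comp => //.
 exact: measurable_int (Radon_Nikodym_SigmaFinite.f_integrable dom).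
- by move=> x /=; rewrite fine_ge0// Radon_Nikodym_SigmaFinite.f_ge0.
- move=> A mA; rewrite (Radon_Nikodym_SigmaFinite.f_integral dom)//.
 by apply: eq_integral => x _ /=; rewrite fineK// Radon_Nikodym_SigmaFinite.f_fin_num.
Qed.

End KL_density.

(** Fenchel-Young inequality for the entropy, whose conjugate is [expR s - 1]; [entropy_eq] is the
    equality case [r = expR s]. *)
Lemma entropy_young {R : realType} (r s : R) : 0 <= r ->
 r * s + 1 <= r * ln r - r + 1 + expR s.
Proof.
rewrite le_eqVlt => /predU1P[<-|r0].
 by rewrite !mul0r !subr0 !add0r lerDl expR_ge0.
have x0 : 0 < expR s / r by rewrite divr_gt0// expR_gt0.
have : ln (1 + (expR s / r - 1)) <= expR s / r - 1 by apply: le_ln1Dx; rewrite ltrBrDr addNr.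
rewrite addrC subrK ln_div ?posrE ?expR_gt0// expRK => h.
have : r * (s - ln r) <= r * (expR s / r - 1) by rewrite ler_pM2l.
by rewrite !mulrBr mulr1 mulrCA divff ?gt_eqF// mulr1; lra.
Qed.

Lemma entropy_eq {R : realType} (s : R) :
 expR s * ln (expR s) - expR s + 1 + expR s = expR s * s + 1.
Proof. by rewrite expRK addrAC subrK. Qed.

Lemma entropy_ge0 {R : realType} (r : R) : 0 <= r -> 0 <= r * ln r - r + 1.
Proof.
by move=> r0; have := entropy_young 0 r0; rewrite mulr0 expR0; lra.
Qed.

Lemma split_le {R : realDomainType} (a b c k a1 a2 b1 b2 k1 k2 : R) :
 a = a1 - a2 -> b = b1 - b2 -> k = k1 - k2 -> a + b <= c + k ->
 a1 + b1 + k2 <= c + a2 + b2 + k1.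
Proof. by move=> -> -> ->; lra. Qed.

Lemma max_posneg {R : realDomainType} (x : R) : x = Num.max x 0 - Num.max (- x) 0.
Proof.
case: (leP 0 x) => h; first by rewrite max_r ?subr0// oppr_le0.
by rewrite max_l ?oppr_ge0 ?(ltW h)// sub0r opprK.
Qed.

(** * Weak duality for entropy transport *)

Section duality.
Context {R : realType} {d : nat}.
Variables (g : fmeas R (Rn R d * Rn R d)).
Variables (rho0 rho1 alpha beta : fmeas R (Rn R d)).
Hypothesis g1 : forall A, measurable A -> marginal1 g A = rho0 A.
Hypothesis g2 : forall A, measurable A -> marginal2 g A = rho1 A.
Variables (t0 t1 k : R) (phi psi : Rn R d -> R).
Hypotheses (t00 : 0 < t0) (t10 : 0 < t1).
Hypotheses (mphi : mfunT phi) (mpsi : mfunT psi).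

Local Open Scope ereal_scope.

Let pos (f : Rn R d -> R) x : \bar R := (Num.max (f x) 0)%:E.
Let neg (f : Rn R d -> R) x : \bar R := (Num.max (- f x)%R 0)%:E.

Let pos_ge0 f x : 0 <= pos f x. Proof. by rewrite lee_fin le_max lexx orbT. Qed.
Let neg_ge0 f x : 0 <= neg f x. Proof. by rewrite lee_fin le_max lexx orbT. Qed.

Let mpos f : mfunT f -> mfunT (pos f).
Proof.
move=> mf; apply/measurable_EFinP; apply: measurable_maxr => //.
Qed.

Let mneg f : mfunT f -> mfunT (neg f).
Proof.
move=> mf; apply/measurable_EFinP; apply: measurable_maxr => //.
exact: measurableT_comp.
Qed.

Lemma ge0_integral_fst (f : Rn R d -> \bar R) : mfunT f ->
 (forall x, 0 <= f x) -> \int[g]_z f z.1 = \int[rho0]_x f x.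
Proof.
move=> mf f0; transitivity (\int[marginal1 g]_x f x).
 by rewrite [RHS]ge0_integral_pushforward.
by apply: eq_measure_integral => A mA _; exact: g1.
Qed.

Lemma ge0_integral_snd (f : Rn R d -> \bar R) : mfunT f ->
 (forall x, 0 <= f x) -> \int[g]_z f z.2 = \int[rho1]_x f x.
Proof.
move=> mf f0; transitivity (\int[marginal2 g]_x f x).
 by rewrite [RHS]ge0_integral_pushforward.
by apply: eq_measure_integral => A mA _; exact: g2.
Qed.

Lemma measurable_sqdist :
 mfunT (fun z : Rn R d * Rn R d => (sqdist z.1 z.2)%:E).
Proof.
apply/measurable_EFinP; apply: measurable_sum => i; apply: measurable_funX.
apply: measurable_funB.
 by apply: (measurableT_comp (measurable_tnth i)).
by apply: (measurableT_comp (measurable_tnth i)).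
Qed.

Lemma sqdist_ge0 (x y : Rn R d) : (0 <= sqdist x y)%R.
Proof. by apply: sumr_ge0 => i _; exact: sqr_ge0. Qed.

Lemma KL_ge0 {dT} {T : measurableType dT} (rho eta : fmeas R T) :
 0 <= KL rho eta.
Proof.
have [->//|/KL_density_exists[r [mr r0 rE]]] := eqVneq (KL rho eta) +oo.
rewrite (KL_density mr r0 rE); apply: integral_ge0 => x _.
by rewrite lee_fin entropy_ge0.
Qed.

(** Marginals are identified on measurable sets only, so they need not be equal as set functions; a
    common density shows that the entropy does not see the difference. *)
Lemma KL_ext {dT} {T : measurableType dT} (rho rho' eta eta' : fmeas R T) :
 (forall A, measurable A -> rho A = rho' A) -> (forall A, measurable A -> eta A = eta' A) ->
 KL rho eta = KL rho' eta'.
Proof.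
move=> e f; have aux (m m' n n' : fmeas R T) :
 (forall A, measurable A -> m A = m' A) -> (forall A, measurable A -> n A = n' A) ->
 KL m n != +oo -> KL m n = KL m' n'.
 move=> em en /KL_density_exists[r [mr r0 rE]]; rewrite (KL_density mr r0 rE).
 rewrite (KL_density (rho := m') (eta := n') mr r0).
 by apply: eq_measure_integral => A mA _; exact: en.
 move=> A mA; rewrite -em// rE//.
 by apply: eq_measure_integral => B mB _; exact: en.
have [h|h] := eqVneq (KL rho eta) +oo; last exact: aux.
have [->//|h'] := eqVneq (KL rho' eta') +oo.
by apply/esym/aux => // A mA; rewrite ?e ?f.
Qed.

(* Both sides are kept nonnegative since [f] need not be integrable. *)
Lemma KL_young (rho eta : fmeas R (Rn R d)) (t : R) (f : Rn R d -> R) :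
 (0 < t)%R -> mfunT f -> KL rho eta != +oo ->
 t%:E * eta setT + \int[rho]_x neg f x <=
 t%:E * KL rho eta + t%:E * (\int[eta]_x (expR (- (f x / t)))%:E) + \int[rho]_x pos f x /\
 \int[rho]_x neg f x <= t%:E * KL rho eta + t%:E * (\int[eta]_x (expR (- (f x / t)))%:E).
Proof.
move=> t_gt0 mf /KL_density_exists[r [mr r0 rE]].
have me : mfunT (fun x => (expR (- (f x / t)))%:E : \bar R).
 apply/measurable_EFinP; apply: measurableT_comp; first exact: measurable_expR.
 by apply: measurableT_comp => //; apply: measurable_funM.
have mh : mfunT (fun x => (r x * ln (r x) - r x + 1)%:E : \bar R).
 apply/measurable_EFinP; apply: measurable_funD => //.
 apply: measurable_funB => //; apply: measurable_funM => //.
 by apply: measurableT_comp => //; exact: measurable_ln.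
have h0 x : 0 <= (r x * ln (r x) - r x + 1)%:E by rewrite lee_fin entropy_ge0.
have rint (u : Rn R d -> \bar R) : mfunT u -> (forall x, 0 <= u x) ->
 \int[rho]_x u x = \int[eta]_x (u x * (r x)%:E).
 by move=> mu u0; apply: ge0_integral_density.
have mr' : mfunT (EFin \o r) by exact/measurable_EFinP.
have mp : mfunT (fun x => pos f x * (r x)%:E).
 by apply: emeasurable_funM => //; exact: mpos.
have mn : mfunT (fun x => neg f x * (r x)%:E).
 by apply: emeasurable_funM => //; exact: mneg.
have p0 x : 0 <= pos f x * (r x)%:E by rewrite mule_ge0// lee_fin.
have n0 x : 0 <= neg f x * (r x)%:E by rewrite mule_ge0// lee_fin.
rewrite (rint _ (mpos mf))// (rint _ (mneg mf))//.
have eT : eta setT = \int[eta]_x (1%E : \bar R) by rewrite integral_cst// mul1e.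
rewrite (KL_density mr r0 rE) eT.
rewrite -!ge0_integralZl_EFin ?(ltW t_gt0)//.
have mt1 : mfunT (fun x => t%:E * (r x * ln (r x) - r x + 1)%:E).
 exact: emeasurable_funM.
have mt2 : mfunT (fun x => t%:E * (expR (- (f x / t)))%:E).
 exact: emeasurable_funM.
have tt1 x : 0 <= t%:E * (r x * ln (r x) - r x + 1)%:E.
 by rewrite mule_ge0// lee_fin ltW.
have tt2 x : 0 <= t%:E * (expR (- (f x / t)))%:E.
 by rewrite mule_ge0// lee_fin ?expR_ge0// ltW.
have young x s : (t * (r x * s) + t <= t * (r x * ln (r x) - r x + 1) + t * expR s)%R.
 have := entropy_young s (r0 x); rewrite -(ler_pM2l t_gt0); lra.
split.
 rewrite -!ge0_integralD//; last 3 first.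
 - by move=> x _; rewrite adde_ge0.
 - exact: emeasurable_funD.
 - by move=> x _; rewrite mule1 lee_fin ltW.
 apply: ge0_le_integral => //.
 - by move=> x _; rewrite adde_ge0// mule1 lee_fin ltW.
 - by apply: emeasurable_funD => //; exact: emeasurable_funM.
 - by do 2 apply: emeasurable_funD => //.
 - move=> x _; rewrite mule1 -!EFinM -!EFinD lee_fin.
 have := young x (- (f x / t))%R; have := max_posneg (f x).
 set a := Num.max _ _; set b := Num.max _ _ => e.
 have -> : (t * (r x * - (f x / t)) = - (f x * r x))%R by field; rewrite gt_eqF.
 by rewrite e mulrBl; lra.
(* For the second bound Young's inequality is applied to the negative part of [f], together with
   [expR (f^- / t) <= 1 + expR (- f / t)]; the summand 1 cancels the mass term. *)
rewrite -ge0_integralD//; apply: ge0_le_integral => //.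
- exact: emeasurable_funD.
- move=> x _; rewrite -!EFinM -!EFinD lee_fin.
 set b := Num.max _ _.
 have b0 : (0 <= b)%R by rewrite /b le_max lexx orbT.
 have := young x (b / t)%R.
 have -> : (t * (r x * (b / t)) = b * r x)%R by field; rewrite gt_eqF.
 have : (t * expR (b / t) <= t + t * expR (- (f x / t)))%R.
 have -> : (t + t * expR (- (f x / t)) = t * (1 + expR (- (f x / t))))%R by ring.
 rewrite ler_pM2l//.
 rewrite /b; case: (leP (- f x)%R 0%R) => _.
 by rewrite mul0r expR0 lerDl expR_ge0.
 by rewrite mulNr lerDr.
 lra.
Qed.

(** The inequality between potentials and cost is integrated against [g], and Young's inequality is
    applied to each marginal. Keeping the slack [k] as a multiple of the mass of [g] lets one bound
    serve both problems: unbalanced transport, where [k] is made 0, and the probability version,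
    where the mass is 1. *)
Lemma duality_bound :
 (forall x y, (phi x + psi y <= sqdist x y + k)%R) ->
 \int[alpha]_x (expR (- (phi x / t0)))%:E < +oo ->
 \int[beta]_x (expR (- (psi x / t1)))%:E < +oo ->
 t0%:E * alpha setT + t1%:E * beta setT <=
 transport_cost g + t0%:E * KL rho0 alpha + t1%:E * KL rho1 beta +
 (t0%:E * (\int[alpha]_x (expR (- (phi x / t0)))%:E) +
 t1%:E * (\int[beta]_x (expR (- (psi x / t1)))%:E)) + k%:E * g setT.
Proof.
move=> hc I0 I1.
set J0 := integral alpha _ _ in I0 *; set J1 := integral beta _ _ in I1 *.
have J00 : 0 <= J0 by apply: integral_ge0 => x _; rewrite lee_fin expR_ge0.
have J10 : 0 <= J1 by apply: integral_ge0 => x _; rewrite lee_fin expR_ge0.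
have C0 : 0 <= transport_cost g.
 by apply: integral_ge0 => x _; rewrite lee_fin sqdist_ge0.
have gfin : g setT \is a fin_num by exact: fin_num_measure.
have K0 := KL_ge0 rho0 alpha; have K1 := KL_ge0 rho1 beta.
have tK0 : 0 <= t0%:E * KL rho0 alpha by rewrite mule_ge0// lee_fin ltW.
have tK1 : 0 <= t1%:E * KL rho1 beta by rewrite mule_ge0// lee_fin ltW.
have tJ0 : 0 <= t0%:E * J0 by rewrite mule_ge0// lee_fin ltW.
have tJ1 : 0 <= t1%:E * J1 by rewrite mule_ge0// lee_fin ltW.
have top (a b c : \bar R) : 0 <= a -> 0 <= b -> 0 <= c -> a = +oo \/ b = +oo \/ c = +oo ->
 a + b + c + (t0%:E * J0 + t1%:E * J1) + k%:E * g setT = +oo.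
 move=> a0 b0 c0 h.
 have -> : a + b + c = +oo.
 move: h => [->|[->|->]].
 - by rewrite !addye// gt_eqF// (lt_le_trans ltNy0).
 - by rewrite addey ?addye// ?gt_eqF// (lt_le_trans ltNy0).
 - by rewrite addey// gt_eqF// (lt_le_trans ltNy0)// adde_ge0.
 have gk : k%:E * g setT \is a fin_num by rewrite fin_numM.
 rewrite addye ?addye//; first by move: gk; rewrite fin_numE => /andP[].
 by rewrite gt_eqF// (lt_le_trans ltNy0)// adde_ge0.
have [KL0|KL0] := eqVneq (KL rho0 alpha) +oo.
 have e : t0%:E * KL rho0 alpha = +oo by rewrite KL0 gt0_muley// lte_fin.
 by rewrite (top _ _ _ C0 tK0 tK1 (or_intror (or_introl e))) leey.
have [KL1|KL1] := eqVneq (KL rho1 beta) +oo.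
 have e : t1%:E * KL rho1 beta = +oo by rewrite KL1 gt0_muley// lte_fin.
 by rewrite (top _ _ _ C0 tK0 tK1 (or_intror (or_intror e))) leey.
have [Cy|Cy] := eqVneq (transport_cost g) +oo.
 by rewrite (top _ _ _ C0 tK0 tK1 (or_introl Cy)) leey.
have [y1 y2] := KL_young t00 mphi KL0; have [y3 y4] := KL_young t10 mpsi KL1.
rewrite -/J0 in y1 y2; rewrite -/J1 in y3 y4.
have fin (a : \bar R) : 0 <= a -> a != +oo -> exists2 x : R, a = x%:E & (0 <= x)%R.
 by case: a => // x x0 _; exists x.
have [c ec c0] := fin _ C0 Cy.
have [k0 ek0 k00] := fin _ K0 KL0; have [k1 ek1 k10] := fin _ K1 KL1.
have [j0 ej0 j00] := fin _ J00 (negbT (lt_eqF I0)).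
have [j1 ej1 j10] := fin _ J10 (negbT (lt_eqF I1)).
have [ga ega] : exists ga, g setT = ga%:E by exists (fine (g setT)); rewrite fineK.
have [al eal] : exists al, alpha setT = al%:E.
 by exists (fine (alpha setT)); rewrite fineK// fin_num_measure.
have [be ebe] : exists be, beta setT = be%:E.
 by exists (fine (beta setT)); rewrite fineK// fin_num_measure.
rewrite ek0 ej0 eal in y1 y2; rewrite ek1 ej1 ebe in y3 y4.
have int_ge0 (m : {measure set (Rn R d) -> \bar R}) f :
 0 <= \int[m]_x pos f x /\ 0 <= \int[m]_x neg f x.
 by split; apply: integral_ge0.
have [P0 N0] := int_ge0 rho0 phi; have [P1 N1] := int_ge0 rho1 psi.
(* The order of the finiteness proofs matters: negative parts are finite by Young's inequality, then
   positive parts by the integrated cost inequality, and only then are all terms compared as real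
   numbers. *)
have [n0 en0 n00] : exists2 x : R, \int[rho0]_x neg phi x = x%:E & (0 <= x)%R.
 apply: fin => //; rewrite lt_eqF// (le_lt_trans y2)//.
 by rewrite -!EFinM -EFinD ltry.
have [n1 en1 n10] : exists2 x : R, \int[rho1]_x neg psi x = x%:E & (0 <= x)%R.
 apply: fin => //; rewrite lt_eqF// (le_lt_trans y4)//.
 by rewrite -!EFinM -EFinD ltry.
have mz1 (f : Rn R d -> \bar R) : mfunT f ->
 mfunT (fun z : Rn R d * Rn R d => f z.1).
 by move=> mf; exact: (measurableT_comp mf measurable_fst).
have mz2 (f : Rn R d -> \bar R) : mfunT f ->
 mfunT (fun z : Rn R d * Rn R d => f z.2).
 by move=> mf; exact: (measurableT_comp mf measurable_snd).
have kT (a : R) : (0 <= a)%R -> \int[g]_z a%:E = (a * ga)%:E.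
 by move=> a0; rewrite integral_cst// EFinM -ega.
have km0 : (0 <= Num.max k 0 :> R)%R by rewrite le_max lexx orbT.
have kn0 : (0 <= Num.max (- k) 0 :> R)%R by rewrite le_max lexx orbT.
have ek := max_posneg k.
have step : \int[g]_z (pos phi z.1) + \int[g]_z (pos psi z.2) +
 \int[g]_z (Num.max (- k)%R 0)%:E <=
 transport_cost g + \int[g]_z (neg phi z.1) + \int[g]_z (neg psi z.2) +
 \int[g]_z (Num.max k 0%R)%:E.
 have mc := measurable_sqdist.
 have s0 (z : Rn R d * Rn R d) : 0 <= (sqdist z.1 z.2)%:E.
 by rewrite lee_fin sqdist_ge0.
 have h1 := mz1 _ (mpos mphi); have h2 := mz2 _ (mpos mpsi).
 have h3 := mz1 _ (mneg mphi); have h4 := mz2 _ (mneg mpsi).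
 rewrite /transport_cost.
 rewrite -(ge0_integralD g measurableT (f1 := fun z => pos phi z.1))//.
 rewrite -(ge0_integralD g measurableT (f2 := fun=> (Num.max (- k)%R 0)%:E))//; last 2 first.
 - by move=> z _; rewrite adde_ge0.
 - exact: emeasurable_funD.
 rewrite -(ge0_integralD g measurableT (f2 := fun z => neg phi z.1))//.
 rewrite -(ge0_integralD g measurableT (f2 := fun z => neg psi z.2))//; last 2 first.
 - by move=> z _; rewrite adde_ge0.
 - exact: emeasurable_funD.
 rewrite -(ge0_integralD g measurableT (f2 := fun=> (Num.max k 0%R)%:E))//; last 2 first.
 - by move=> z _; rewrite !adde_ge0.
 - by do 2 apply: emeasurable_funD => //.
 apply: ge0_le_integral => //.
 - by move=> z _; rewrite !adde_ge0.
 - by do 2 apply: emeasurable_funD => //.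
 - by do 3 apply: emeasurable_funD => //.
 - move=> z _; rewrite -!EFinD lee_fin.
 exact: (split_le (max_posneg (phi z.1)) (max_posneg (psi z.2)) ek (hc z.1 z.2)).
rewrite ec !kT// (ge0_integral_fst (mpos mphi))// (ge0_integral_snd (mpos mpsi))//
 (ge0_integral_fst (mneg mphi))// (ge0_integral_snd (mneg mpsi))// en0 en1 in step.
have [p0 ep0 p00] : exists2 x : R, \int[rho0]_x pos phi x = x%:E & (0 <= x)%R.
 apply: fin => //; apply: contraTneq step => ->.
 rewrite -!EFinD [+oo + integral _ _ _]addye; last by rewrite gt_eqF// (lt_le_trans ltNy0).
 by rewrite addye// leye_eq.
have [p1 ep1 p10] : exists2 x : R, \int[rho1]_x pos psi x = x%:E & (0 <= x)%R.
 apply: fin => //; apply: contraTneq step => ->.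
 by rewrite -!EFinD ep0 addey ?addye// leye_eq.
rewrite ep0 ep1 in step; rewrite ep0 en0 in y1; rewrite ep1 en1 in y3.
rewrite ec ek0 ek1 ej0 ej1 eal ebe ega.
move: y1 y3 step; rewrite -!EFinM -!EFinD !lee_fin => y1 y3 step.
have e : (k * ga = Num.max k 0 * ga - Num.max (- k) 0 * ga)%R by rewrite -mulrBl -ek.
rewrite e; lra.
Qed.

End duality.

(** * Integrals with their finite values; the exact entropy of an exponential density *)

Section finite_integrals.
Context {R : realType} {dT : measure_display} {T : measurableType dT}.
Implicit Types rho eta : fmeas R T.

Definition fint (rho : {measure set T -> \bar R}) (f : T -> R) (v : R) : Prop :=
 rho.-integrable setT (EFin \o f) /\ (\int[rho]_x (f x)%:E = v%:E)%E.

Lemma fint_cst (rho : fmeas R T) (a b : R) :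
 rho setT = b%:E -> fint rho (fun=> a) (a * b).
Proof.
move=> rb; split; first exact: finite_measure_integrable_cst.
by rewrite integral_cst// EFinM -rb.
Qed.

Lemma fintD (rho : {measure set T -> \bar R}) (f h : T -> R) (v w : R) :
 fint rho f v -> fint rho h w -> fint rho (fun x => f x + h x) (v + w).
Proof.
move=> [f1 f2] [h1 h2]; split.
 by have := integrableD measurableT f1 h1; apply: eq_integrable => // x _.
under eq_integral do rewrite EFinD.
by rewrite integralD_EFin// f2 h2.
Qed.

Lemma fintZ (rho : {measure set T -> \bar R}) (f : T -> R) (v a : R) :
 fint rho f v -> fint rho (fun x => a * f x) (a * v).
Proof.
move=> [f1 f2]; split.
 by have := integrableZl measurableT a f1; apply: eq_integrable => // x _.
under eq_integral do rewrite EFinM.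
by rewrite integralZl// f2.
Qed.

Lemma fint_le (rho : {measure set T -> \bar R}) (f h : T -> R) (v w : R) :
 fint rho f v -> fint rho h w -> (forall x, f x <= h x) -> v <= w.
Proof.
move=> [f1 f2] [h1 h2] fh; rewrite -lee_fin -f2 -h2.
by apply: le_integral => // x _; rewrite lee_fin.
Qed.

Lemma fint_ge0 (rho : {measure set T -> \bar R}) (f : T -> R) (v : R) : mfunT f ->
 (forall x, 0 <= f x) -> (\int[rho]_x (f x)%:E = v%:E)%E -> fint rho f v.
Proof.
move=> mf f0 fv; split => //; apply/integrableP; split; first exact/measurable_EFinP.
under eq_integral do rewrite /= ger0_norm//.
by rewrite fv ltry.
Qed.

Lemma fint_bounded (rho : {measure set T -> \bar R}) (f h : T -> R) (v : R) : mfunT f ->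
 (forall x, `|f x| <= h x) -> fint rho h v -> exists w, fint rho f w.
Proof.
move=> mf fh [h1 h2].
have fi : rho.-integrable setT (EFin \o f).
 apply: le_integrable h1 => //; first exact/measurable_EFinP.
 by move=> x _ /=; rewrite lee_fin (le_trans (fh x))// ler_norm.
exists (fine (\int[rho]_x (f x)%:E)); split => //.
by rewrite fineK// integrable_fin_num.
Qed.

Lemma fint_posneg (rho : {measure set T -> \bar R}) (f : T -> R) (v : R) : fint rho f v ->
 exists a b, [/\ (\int[rho]_x (Num.max (f x) 0)%:E = a%:E)%E,
 (\int[rho]_x (Num.max (- f x) 0)%:E = b%:E)%E & v = a - b].
Proof.
move=> [f1 f2].
have pE x : ((EFin \o f)^\+ x = (Num.max (f x) 0)%:E)%E by rewrite funeposE/= EFin_max.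
have nE x : ((EFin \o f)^\- x = (Num.max (- f x) 0)%:E)%E by rewrite funenegE/= EFin_max.
have p1 := integrable_funepos measurableT f1; have n1 := integrable_funeneg measurableT f1.
exists (fine (\int[rho]_x (Num.max (f x) 0)%:E)), (fine (\int[rho]_x (Num.max (- f x) 0)%:E)).
have ip : (\int[rho]_x (Num.max (f x) 0)%:E \is a fin_num)%E.
 have := integrable_fin_num measurableT p1.
 by under eq_integral do rewrite pE.
have inn : (\int[rho]_x (Num.max (- f x) 0)%:E \is a fin_num)%E.
 have := integrable_fin_num measurableT n1.
 by under eq_integral do rewrite nE.
rewrite !fineK//; split => //.
have := f2; rewrite integralE.
under eq_integral do rewrite pE.
under [X in (_ - X)%E]eq_integral do rewrite nE.
by move=> e; apply: EFin_inj; rewrite -e EFinB !fineK.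
Qed.

(** Equality case of [KL_young]: the density is exactly [expR (- f / t)]. As [f] changes sign, its
    positive and negative parts are put on opposite sides, so that every integrand stays
    nonnegative. *)
Lemma KL_exact rho eta (f : T -> R) (t v : R) : 0 < t -> mfunT f ->
 (forall A, measurable A -> rho A = (\int[eta]_(x in A) (expR (- (f x / t)))%:E)%E) ->
 fint rho f v ->
 (t%:E * KL rho eta = (t * fine (eta setT) - t * fine (rho setT) - v)%:E)%E.
Proof.
move=> t0 mf rE fv.
have me : mfunT (fun x => expR (- (f x / t))).
 apply: measurableT_comp; first exact: measurable_expR.
 by apply: measurableT_comp => //; apply: measurable_funM.
have e0 x : 0 <= expR (- (f x / t)) by exact: expR_ge0.
rewrite (KL_density me e0 rE).
have mh : mfunT (fun x => (expR (- (f x / t)) * ln (expR (- (f x / t)))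
 - expR (- (f x / t)) + 1)%:E).
 apply/measurable_EFinP; apply: measurable_funD => //.
 apply: measurable_funB => //; apply: measurable_funM => //.
 by apply: measurableT_comp => //; exact: measurable_ln.
have h0 x : (0 <= (expR (- (f x / t)) * ln (expR (- (f x / t)))
 - expR (- (f x / t)) + 1)%:E)%E by rewrite lee_fin entropy_ge0.
have [a [b [ea eb ->]]] := fint_posneg fv.
have mp : mfunT (fun x => (Num.max (f x) 0)%:E).
 by apply/measurable_EFinP; apply: measurable_maxr.
have mn : mfunT (fun x => (Num.max (- f x) 0)%:E).
 by apply/measurable_EFinP; apply: measurable_maxr => //; exact: measurableT_comp.
have p0 x : (0 <= (Num.max (f x) 0)%:E)%E by rewrite lee_fin le_max lexx orbT.
have n0 x : (0 <= (Num.max (- f x) 0)%:E)%E by rewrite lee_fin le_max lexx orbT.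
have me' : mfunT (fun x => (expR (- (f x / t)))%:E).
 exact/measurable_EFinP.
move: ea eb; rewrite (ge0_integral_density me rE measurableT mp p0).
rewrite (ge0_integral_density me rE measurableT mn n0) => ea eb.
have eR : (\int[eta]_x (expR (- (f x / t)))%:E = (fine (rho setT))%:E)%E.
 by rewrite -rE// fineK// fin_num_measure.
have eT : (\int[eta]_x (1%E : \bar R) = (fine (eta setT))%:E)%E.
 by rewrite integral_cst// mul1e fineK// fin_num_measure.
set H := (\int[eta]_x _)%E.
have H0 : (0 <= H)%E by exact: integral_ge0.
have mpe : mfunT (fun x => ((Num.max (f x) 0)%:E * (expR (- (f x / t)))%:E)%E).
 exact: emeasurable_funM.
have mne : mfunT (fun x => ((Num.max (- f x) 0)%:E * (expR (- (f x / t)))%:E)%E).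
 exact: emeasurable_funM.
have p0e x : (0 <= (Num.max (f x) 0)%:E * (expR (- (f x / t)))%:E)%E.
 by rewrite mule_ge0// lee_fin.
have n0e x : (0 <= (Num.max (- f x) 0)%:E * (expR (- (f x / t)))%:E)%E.
 by rewrite mule_ge0// lee_fin.
have key : (t%:E * H + (t * fine (rho setT))%:E + a%:E = (t * fine (eta setT))%:E + b%:E)%E.
 rewrite !EFinM -eR -eT -ea -eb /H -!ge0_integralZl_EFin ?(ltW t0)//.
 have m1 : mfunT (fun x => (t%:E * (expR (- (f x / t)) * ln (expR (- (f x / t)))
 - expR (- (f x / t)) + 1)%:E)%E) by exact: emeasurable_funM.
 have m2 : mfunT (fun x => (t%:E * (expR (- (f x / t)))%:E)%E).
 exact: emeasurable_funM.
 have q1 x : (0 <= t%:E * (expR (- (f x / t)) * ln (expR (- (f x / t)))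
 - expR (- (f x / t)) + 1)%:E)%E by rewrite mule_ge0// lee_fin ltW.
 have q2 x : (0 <= t%:E * (expR (- (f x / t)))%:E)%E by rewrite mule_ge0// lee_fin// ltW.
 rewrite -!ge0_integralD//; last 3 first.
 - by move=> x _; rewrite mule1 lee_fin ltW.
 - by move=> x _; rewrite adde_ge0.
 - exact: emeasurable_funD.
 apply: eq_integral => x _; rewrite mule1 -!EFinM -!EFinD; congr EFin.
 have := entropy_eq (- (f x / t)).
 set E := expR _; set p := Num.max _ _; set n := Num.max _ _ => e.
 have fE : f x = p - n := max_posneg (f x).
 have : t * (E * ln E - E + 1) + t * E = t - f x * E.
 by rewrite -mulrDr e; field; rewrite gt_eqF.
 by move=> ->; rewrite fE; ring.
case: H H0 key => [h| |] H0 key //.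
 move: key; rewrite -!EFinM -!EFinD => key1; have := EFin_inj key1 => key; congr EFin; lra.
by move: key; rewrite gt0_muley ?lte_fin// !addye.
Qed.

Lemma KL_exact_mass rho eta (f : T -> R) (t v a b : R) : 0 < t -> mfunT f ->
 (forall A, measurable A -> rho A = (\int[eta]_(x in A) (expR (- (f x / t)))%:E)%E) ->
 fint rho f v -> eta setT = a%:E -> rho setT = b%:E ->
 (t%:E * KL rho eta = (t * a - t * b - v)%:E)%E.
Proof. by move=> t0 mf rE fv ea eb; rewrite (KL_exact t0 mf rE fv) ea eb. Qed.

End finite_integrals.

(** * First and second Gaussian moments; quadratic potentials *)

Section gaussian_moments.
Context {R : realType} {d : nat}.
Implicit Types p q : gparam R d.

Lemma fint_gauss_cst p (a : R) : fint (gauss p) (fun=> a) a.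
Proof.
by rewrite -[X in fint _ _ X]mulr1; apply: fint_cst; exact: probability_setT.
Qed.

Lemma fint_quad p (B : 'M[R]_d) : Gd p -> B^T = B ->
 fint (gauss p) (fun x => dotc (colx x - p.1) (B *m (colx x - p.1))) (\tr (p.2 *m B)).
Proof.
move=> hp sB.
have fq (C : 'M[R]_d) : sympd C ->
 fint (gauss p) (fun x => dotc (colx x - p.1) (C *m (colx x - p.1))) (\tr (p.2 *m C)).
 move=> pC; apply: fint_ge0; last exact: integral_gauss_quad.
 exact: measurable_quad_colx.
 by move=> x; exact: sympd_ge0.
(* A symmetric [B] is a difference of two positive definite matrices, [B + c] and [c], to each of
   which [integral_gauss_quad] applies. *)
pose c : R := d%:R ^+ 2 * `|B| + 1.
have c0 : 0 < c by rewrite ltr_wpDl// mulr_ge0// sqr_ge0.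
have p1 : sympd (c%:M : 'M[R]_d) by exact: sympd_scalar.
have p2 : sympd (B + c%:M).
 apply: sympdP => [|v v0]; first by rewrite linearD/= sB tr_scalar_mx.
 rewrite mulmxDl dotcDr mul_scalar_mx dotcZr.
 have := dotc_mulmx_norm B v; rewrite ler_norml => /andP[h _].
 have := dotc_gt0 v0; rewrite /c mulrDl mul1r; lra.
have := fintD (fq _ p2) (fintZ (-1) (fq _ p1)).
rewrite mulN1r mulmxDr linearD/= addrK => h.
congr (fint _ _ _): h; apply/funext => x; rewrite mulN1r mulmxDl dotcDr.
by rewrite addrK.
Qed.

Lemma measurable_dotc p (w : 'cV[R]_d) :
 mfunT (fun x : Rn R d => dotc w (colx x - p.1)).
Proof. exact: measurable_dotc_colx. Qed.

Lemma dotc_sum_le (w v : 'cV[R]_d) : 2 * `|dotc w v| <= dotc w w + dotc v v.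
Proof.
have h1 := dotc_ge0 (w + v); have h2 := dotc_ge0 (w - v).
rewrite !(dotcDl, dotcDr, dotcNl, dotcNr) (dotcC v w) in h1 h2.
by rewrite -[2]ger0_norm// -normrM ler_norml; apply/andP; split; lra.
Qed.

Lemma dotc_shift (M : 'M[R]_d) (z w : 'cV[R]_d) t : sympd M ->
 dotc (z - t *: (M *m w)) (invmx M *m (z - t *: (M *m w))) =
 dotc z (invmx M *m z) - 2 * t * dotc w z + t ^+ 2 * dotc w (M *m w).
Proof.
move=> pM; have uM := sympd_unit pM.
have e1 : dotc (M *m w) (invmx M *m z) = dotc w z.
 by rewrite dotc_mulmxl (sympd_sym pM) mulKVmx.
have e2 : dotc (M *m w) w = dotc w (M *m w) by exact: dotcC.
have e3 : dotc z w = dotc w z by exact: dotcC.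
rewrite mulmxBr -scalemxAr (mulKmx uM) !(dotcBl, dotcBr, dotcZl, dotcZr) e1 e2 e3; ring.
Qed.

(** The mean [L] of the linear form satisfies [1 + t L <= expR (t ^+ 2 * s / 2)] for small [t] of
    both signs, by the exponential moment of a translated Gaussian; hence it vanishes by
    [linear_term_eq0]. *)
Lemma fint_lin p (w : 'cV[R]_d) : Gd p ->
 fint (gauss p) (fun x => dotc w (colx x - p.1)) 0.
Proof.
move=> hp; pose f (x : Rn R d) := dotc w (colx x - p.1).
have mf : mfunT f by exact: measurable_dotc.
have hc a := fint_gauss_cst p a.
have [L fL] : exists L, fint (gauss p) f L.
 apply: (fint_bounded mf (h := fun x => dotc w w + dotc (colx x - p.1) (1%:M *m (colx x - p.1)))).
 move=> x; have := dotc_sum_le w (colx x - p.1); rewrite mul1mx -/(f x).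
 by have := normr_ge0 (f x); lra.
 by apply: (fintD (hc _)); apply: fint_quad; rewrite ?trmx1.
suff -> : 0 = L by [].
apply/esym; pose s := dotc w (p.2 *m w).
have s0 : 0 <= s by exact: (sympd_ge0 hp).
have up := sympd_unit hp.
have expi t : fint (gauss p) (fun x => expR (t * f x)) (expR (2^-1 * t ^+ 2 * s)).
 pose q : gparam R d := (p.1 + t *: (p.2 *m w), p.2).
 have hq : Gd q by exact: hp.
 have e x : expR (t * f x) = expR (2^-1 * t ^+ 2 * s) * gauss_ratio q p x.
 rewrite gauss_ratioE//= divff ?gt_eqF ?sympd_det// sqrtr1 mul1r -expRD.
 congr expR; rewrite opprD addrA.
 by rewrite dotc_shift// -/s -/(f x); field.
 have -> : (fun x => expR (t * f x)) = (fun x => expR (2^-1 * t ^+ 2 * s) * gauss_ratio q p x).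
 exact/funext.
 rewrite -[X in fint _ _ X]mulr1; apply: fintZ; apply: fint_ge0.
 - exact: measurable_gauss_ratio.
 - by move=> x; exact/ltW/gauss_ratio_gt0.
 - by rewrite -gauss_ratio_density// probability_setT.
apply: (@linear_term_eq0 _ _ s (s + 1)^-1); first by rewrite invr_gt0; lra.
move=> t tt0.
have h : 1 + t * L <= expR (2^-1 * t ^+ 2 * s).
 apply: (fint_le (fintD (hc 1) (fintZ t fL)) (expi t)) => x.
 exact: expR_ge1Dx.
have t1 : `|t| * (s + 1) <= 1 by rewrite -ler_pdivlMr ?mul1r//; lra.
have t2 : t ^+ 2 * s <= 1.
 rewrite -[t ^+ 2]real_normK ?num_real//.
 have : `|t| <= 1 by apply: le_trans t1; rewrite ler_peMr//; lra.
 have := normr_ge0 t; rewrite expr2; nra.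
have ts0 : 0 <= t ^+ 2 * s by rewrite mulr_ge0// sqr_ge0.
have h2 : `|2^-1 * t ^+ 2 * s| <= 2^-1 by rewrite ger0_norm; lra.
have := expR_le_quadratic h2; nra.
Qed.

Definition qpot a (w v : 'cV[R]_d) (K : 'M[R]_d) (x : Rn R d) : R :=
 a + 2 * dotc w (colx x - v) + dotc (colx x - v) (K *m (colx x - v)).

Lemma measurable_qpot a w v K : mfunT (qpot a w v K).
Proof.
apply: measurable_funD; last exact: measurable_quad_colx.
apply: measurable_funD; first exact: measurable_cst.
by apply: measurable_funM; [exact: measurable_cst|exact: measurable_dotc_colx].
Qed.

Lemma fint_qpot p a w (K : 'M[R]_d) : Gd p -> K^T = K ->
 fint (gauss p) (qpot a w p.1 K) (a + \tr (p.2 *m K)).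
Proof.
move=> hp sK; have hc := fint_gauss_cst p a.
have := fintD (fintD hc (fintZ 2 (fint_lin w hp))) (fint_quad hp sK).
by rewrite mulr0 addr0.
Qed.

Lemma sqdistE (x y : Rn R d) : sqdist x y = dotc (colx x - colx y) (colx x - colx y).
Proof. by rewrite dotcE; apply: eq_bigr => i _; rewrite !mxE expr2. Qed.

(** A completed square: the potentials add up to the cost minus a positive form that vanishes
    exactly on the graph [x - u = S (y - v)]. It contains both dual feasibility ([qpot_le]) and
    complementary slackness ([qpot_graph]). *)
Lemma qpot_sum (S : 'M[R]_d) (u v : 'cV[R]_d) (x y : Rn R d) : sympd S ->
 let xi := colx x - u in let ze := colx y - v in let r := u - v in
 qpot (dotc r r) r u (1%:M - invmx S) x + qpot 0 (- r) v (1%:M - S) y =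
 sqdist x y - dotc (xi - S *m ze) (invmx S *m (xi - S *m ze)).
Proof.
move=> pS xi ze r; rewrite /qpot -/xi -/ze sqdistE.
have -> : colx x - colx y = r + xi - ze.
 by rewrite /r /xi /ze; apply/matrixP => i j; rewrite !mxE; ring.
clearbody xi ze r; clear x y u v.
have uS := sympd_unit pS.
rewrite !mulmxBl !mul1mx mulmxBr (mulKmx uS).
rewrite !(dotcDl, dotcDr, dotcNl, dotcNr).
rewrite [dotc (S *m ze) (invmx S *m xi)]dotc_mulmxl (sympd_sym pS) (mulKVmx uS).
rewrite [dotc (S *m ze) ze]dotcC (dotcC xi r) (dotcC ze r) (dotcC ze xi).
ring.
Qed.

Lemma qpot_le (S : 'M[R]_d) (u v : 'cV[R]_d) (x y : Rn R d) : sympd S ->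
 qpot (dotc (u - v) (u - v)) (u - v) u (1%:M - invmx S) x +
 qpot 0 (- (u - v)) v (1%:M - S) y <= sqdist x y.
Proof.
by move=> pS; rewrite qpot_sum// gerBl; exact: (sympd_ge0 (sympd_inv pS)).
Qed.

Lemma qpot_graph (S : 'M[R]_d) (u v : 'cV[R]_d) (y : Rn R d) : sympd S ->
 qpot (dotc (u - v) (u - v)) (u - v) u (1%:M - invmx S) (aff S (u - S *m v) y) +
 qpot 0 (- (u - v)) v (1%:M - S) y = sqdist (aff S (u - S *m v) y) y.
Proof.
move=> pS; rewrite qpot_sum//.
have -> : colx (aff S (u - S *m v) y) - u - S *m (colx y - v) = 0.
 rewrite /aff tupK mulmxBr; apply/matrixP => i j; rewrite !mxE; ring.
by rewrite dotc0l subr0.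
Qed.

End gaussian_moments.

Lemma invmx_mulmx {R : comUnitRingType} n (A B : 'M[R]_n) : A \in unitmx -> B \in unitmx ->
 invmx (A *m B) = invmx B *m invmx A.
Proof.
move=> uA uB; have uAB : A *m B \in unitmx by rewrite unitmx_mul uA.
by rewrite -[RHS](mulKmx uAB) -mulmxA (mulmxA B) mulmxV// mul1mx mulmxV// mulmx1.
Qed.

(** * Masses of exponentials of quadratic potentials *)

Section gaussian_exponentials.
Context {R : realType} {d : nat}.
Implicit Types p q : gparam R d.

(** The mass of [N(m, Sg)] tilted by [expR (- eta / 2 * qpot)], when the potential is centred at
    [m - eta Sg w]. This centre makes the linear terms cancel, so it is also the mean of the tilted
    law, whatever [K] is. *)
Definition gmass (eta a : R) (w : 'cV[R]_d) (Sg K : 'M[R]_d) : R :=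
 expR (- (2^-1 * eta * a) - 2^-1 * eta ^+ 2 * dotc w (Sg *m w)) /
 Num.sqrt (\det (1%:M + eta *: (Sg *m K))).

Lemma gmass_gt0 p eta a w (K : 'M[R]_d) : Gd p -> sympd (invmx p.2 + eta *: K) ->
 0 < gmass eta a w p.2 K.
Proof.
move=> hp pM; rewrite divr_gt0 ?expR_gt0// sqrtr_gt0 scalemxAr.
exact: det1_gt0.
Qed.

Lemma exp_qpot p (eta a : R) w (K : 'M[R]_d) x : Gd p ->
 sympd (invmx p.2 + eta *: K) ->
 let v := p.1 - eta *: (p.2 *m w) in
 expR (- (2^-1 * eta * qpot a w v K x)) =
 gmass eta a w p.2 K * gauss_ratio (v, invmx (invmx p.2 + eta *: K)) p x.
Proof.
move=> hp pM v; have hq : Gd (v, invmx (invmx p.2 + eta *: K)) by exact: sympd_inv.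
have uM := sympd_unit pM; have up := sympd_unit hp.
rewrite gauss_ratioE//= invmxK /gmass det_inv invrK -det_mulmx mulmxDr mulmxV//.
rewrite -scalemxAr mulrA divfK ?gt_eqF ?sqrtr_gt0//; last by rewrite scalemxAr det1_gt0.
rewrite -expRD; congr expR.
have -> : colx x - p.1 = (colx x - v) - eta *: (p.2 *m w).
 by rewrite /v opprB addrA addrAC addrK.
rewrite dotc_shift// /qpot; move: (colx x - v) => z.
have -> : (invmx p.2 + eta *: K) *m z = invmx p.2 *m z + eta *: (K *m z).
 by rewrite mulmxDl -scalemxAl.
by rewrite dotcDr dotcZr; field.
Qed.

End gaussian_exponentials.

Lemma addrBK_l (V : zmodType) (a u b : V) : a + (u - b) - u = a - b.
Proof. by rewrite addrA addrAC addrK. Qed.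

(** * Couplings carried by the graph of an affine map *)

Section graph_coupling.
Context {R : realType} {d : nat}.
Implicit Types p q : gparam R d.

Definition graph_map (S : 'M[R]_d) b (y : Rn R d) : Rn R d * Rn R d := (aff S b y, y).

Lemma measurable_graph_map (S : 'M[R]_d) b : mfunT (graph_map S b).
Proof. apply/measurable_fun_pairP; split; first exact: measurable_aff.
exact: measurable_id. Qed.

HB.instance Definition _ S b :=
 isMeasurableFun.Build _ _ _ _ (graph_map S b) (measurable_graph_map S b).

Definition graph_coupling q (S : 'M[R]_d) (u : 'cV[R]_d) : probability (Rn R d * Rn R d)%type R :=
 distribution (gauss q) (graph_map S (u - S *m q.1)).

Lemma graph_marginal1 q S u A : Gd q -> sympd S -> measurable A ->
 graph_coupling q S u (fst @^-1` A) = gauss (u, S *m q.2 *m S) A.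
Proof. by move=> hq pS mA; rewrite (gauss_pushforward hq pS). Qed.

Lemma graph_marginal2 q S u A : graph_coupling q S u (snd @^-1` A) = gauss q A.
Proof. by []. Qed.

Lemma fint_graph1 q S u a w K : Gd q -> sympd S -> K^T = K ->
 fint (gauss q) (fun y => qpot a w u K (aff S (u - S *m q.1) y))
 (a + \tr (S *m q.2 *m S *m K)).
Proof.
move=> hq pS sK; have sS := sympd_sym pS.
have sK' : (S *m K *m S)^T = S *m K *m S by rewrite !trmx_mul sS sK mulmxA.
have := fint_qpot a (S *m w) hq sK'.
have -> : \tr (q.2 *m (S *m K *m S)) = \tr (S *m q.2 *m S *m K).
 by rewrite mxtrace_mulC -!mulmxA mxtrace_mulC -!mulmxA mxtrace_mulC !mulmxA.
congr (fint _ _ _); apply/funext => y; rewrite /qpot /aff tupK.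
have -> : S *m colx y + (u - S *m q.1) - u = S *m (colx y - q.1).
 by rewrite mulmxBr addrBK_l.
by rewrite [dotc (S *m w) _]dotc_mulmxl sS -!mulmxA [dotc (S *m _) _]dotc_mulmxl sS.
Qed.

(** On the graph the cost is the sum of the two potentials, so the integral reduces to second
    moments of the two marginals. *)
Lemma graph_cost q S u : Gd q -> sympd S ->
 (\int[graph_coupling q S u]_z (sqdist z.1 z.2)%:E =
 (dotc (u - q.1) (u - q.1) + \tr (S *m q.2 *m S *m (1%:M - invmx S)) +
 \tr (q.2 *m (1%:M - S)))%:E)%E.
Proof.
move=> hq pS; have sS := sympd_sym pS; have sI := sympd_sym (sympd_inv pS).
have s1 : (1%:M - S)^T = 1%:M - S by rewrite linearB/= trmx1 sS.
have s2 : (1%:M - invmx S)^T = 1%:M - invmx S by rewrite linearB/= trmx1 sI.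
have f1 := fint_graph1 u (dotc (u - q.1) (u - q.1)) (u - q.1) hq pS s2.
have f2 := fint_qpot 0 (- (u - q.1)) hq s1.
have [_ e] := fintD f1 f2; rewrite add0r in e; rewrite -e.
transitivity (\int[gauss q]_x ((fun z => (sqdist z.1 z.2)%:E) \o graph_map S (u - S *m q.1)) x)%E.
 rewrite [LHS]ge0_integral_pushforward//.
 - exact: measurable_sqdist.
 - by move=> z _; rewrite lee_fin sqdist_ge0.
by apply: eq_integral => y _ /=; rewrite qpot_graph.
Qed.

End graph_coupling.

Lemma fint_mscale {R : realType} {dT} {T : measurableType dT} (k : {nonneg R})
 (rho : {measure set T -> \bar R}) (f : T -> R) (v : R) :
 fint rho f v -> fint (mscale k rho) f (k%:num * v).
Proof.
move=> fv; have [f1 f2] := fv; have mf := measurable_int _ f1.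
have [a [b [ea eb ve]]] := fint_posneg fv.
split.
 apply/integrableP; split => //.
 rewrite ge0_integral_mscale//; last exact: measurableT_comp.
 by rewrite lte_mul_pinfty//; case/integrableP: f1.
have [mp mn] := (measurable_funepos mf, measurable_funeneg mf).
have pE x : ((EFin \o f)^\+ x = (Num.max (f x) 0)%:E)%E by rewrite funeposE/= EFin_max.
have nE x : ((EFin \o f)^\- x = (Num.max (- f x) 0)%:E)%E by rewrite funenegE/= EFin_max.
rewrite integralE !ge0_integral_mscale//.
under eq_integral do rewrite pE.
under [X in (_ - _ * X)%E]eq_integral do rewrite nE.
by rewrite ea eb -!EFinM -EFinB ve mulrBr.
Qed.

(** * Tilted Gaussians normalised to a prescribed mass *)

Section gaussian_tilt.
Context {R : realType} {d : nat}.
Implicit Types p q : gparam R d.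

Lemma mscaleT t (m : {posnum R}) (P : probability (Rn R d) R) :
 (t%:E * scaled m P setT = (t * m%:num)%:E)%E.
Proof.
rewrite EFinM; congr (_ * _)%E; rewrite -[RHS]mule1; congr (_ * _)%E.
exact: probability_setT.
Qed.

Lemma qpotDc al c (w v' : 'cV[R]_d) (B : 'M[R]_d) x :
 qpot (al + c) w v' B x = qpot al w v' B x + c.
Proof. by rewrite /qpot -!addrA; congr (_ + _); rewrite addrC -!addrA. Qed.

(** The additive constant [c] of the potential is the one that gives the tilted measure mass [M].
    Normalising both sides to a common [M] makes them possible marginals of one plan. *)
Lemma gauss_tilt_density (p0 : gparam R d) (t : R) al w (B : 'M[R]_d) (m : {posnum R}) (M : R) x :
 Gd p0 -> 0 < t -> sympd (invmx p0.2 + (2 / t) *: B) -> 0 < M ->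
 let c := t * (ln (m%:num * gmass (2 / t) al w p0.2 B) - ln M) in
 let v0 := p0.1 - (2 / t) *: (p0.2 *m w) in
 m%:num * expR (- (qpot (al + c) w v0 B x / t)) =
 M * gauss_ratio (v0, invmx (invmx p0.2 + (2 / t) *: B)) p0 x.
Proof.
move=> hp0 tgt0 pB M0 c v0.
have g0 := gmass_gt0 al w hp0 pB.
have -> : qpot (al + c) w v0 B x / t = 2^-1 * (2 / t) * qpot al w v0 B x + (c / t).
 by rewrite qpotDc mulrDl; congr (_ + _); field; rewrite gt_eqF.
rewrite opprD expRD exp_qpot// -/v0.
have -> : expR (- (c / t)) = M / (m%:num * gmass (2 / t) al w p0.2 B).
 have -> : - (c / t) = ln M - ln (m%:num * gmass (2 / t) al w p0.2 B).
 by rewrite /c; field; rewrite gt_eqF.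
 by rewrite expRB !lnK// posrE mulr_gt0.
by field; rewrite !gt_eqF.
Qed.

Lemma integral_gauss_tilt (p0 : gparam R d) (t : R) al w (B : 'M[R]_d) (m : {posnum R}) (M : R) A :
 Gd p0 -> 0 < t -> sympd (invmx p0.2 + (2 / t) *: B) -> 0 < M -> measurable A ->
 let c := t * (ln (m%:num * gmass (2 / t) al w p0.2 B) - ln M) in
 let v0 := p0.1 - (2 / t) *: (p0.2 *m w) in
 (\int[scaled m (gauss p0)]_(x in A) (expR (- (qpot (al + c) w v0 B x / t)))%:E =
 M%:E * gauss (v0, invmx (invmx p0.2 + (2 / t) *: B)) A)%E.
Proof.
move=> hp0 tgt0 pB M0 mA c v0.
have hq0 : Gd (v0, invmx (invmx p0.2 + (2 / t) *: B)) by exact: sympd_inv.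
have me : measurable_fun A (fun x => (expR (- (qpot (al + c) w v0 B x / t)))%:E).
 apply/measurable_EFinP; apply: measurable_funTS.
 apply: measurableT_comp; first exact: measurable_expR.
 apply: measurableT_comp => //; apply: measurable_funM => //.
 exact: measurable_qpot.
have mg : measurable_fun A (fun x => (gauss_ratio (v0, invmx (invmx p0.2 + (2 / t) *: B)) p0 x)%:E).
 by apply/measurable_EFinP; apply: measurable_funTS; exact: measurable_gauss_ratio.
rewrite ge0_integral_mscale// -ge0_integralZl_EFin//.
transitivity (\int[gauss p0]_(x in A) (M%:E *
 (gauss_ratio (v0, invmx (invmx p0.2 + (2 / t) *: B)) p0 x)%:E))%E.
 by apply: eq_integral => x _; rewrite -!EFinM (gauss_tilt_density _ _ _ _ hp0).
rewrite ge0_integralZl_EFin ?(ltW M0)//; last first.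
 by move=> x _; rewrite lee_fin ltW// gauss_ratio_gt0.
by rewrite (gauss_ratio_density hq0 hp0).
Qed.

Lemma KL_gauss_tilt (p0 : gparam R d) (t : R) al w (B : 'M[R]_d) (m M : {posnum R}) :
 Gd p0 -> 0 < t -> sympd (invmx p0.2 + (2 / t) *: B) -> B^T = B ->
 let c := t * (ln (m%:num * gmass (2 / t) al w p0.2 B) - ln M%:num) in
 let q0 : gparam R d := (p0.1 - (2 / t) *: (p0.2 *m w), invmx (invmx p0.2 + (2 / t) *: B)) in
 (t%:E * KL (scaled M (gauss q0)) (scaled m (gauss p0)) =
 (t * m%:num - t * M%:num - M%:num * (al + c + \tr (q0.2 *m B)))%:E)%E.
Proof.
move=> hp0 tgt0 pB sB c q0.
have hq0 : Gd q0 by exact: sympd_inv.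
have f1 : fint (scaled M (gauss q0)) (qpot (al + c) w q0.1 B)
 (M%:num * (al + c + \tr (q0.2 *m B))) by apply: fint_mscale; exact: fint_qpot.
apply: (KL_exact_mass tgt0 (measurable_qpot _ _ _ _) _ f1).
- by move=> A mA; rewrite (integral_gauss_tilt _ _ _ hp0).
- by have := mscaleT 1 m (gauss p0); rewrite mul1e mul1r.
- by have := mscaleT 1 M (gauss q0); rewrite mul1e mul1r.
Qed.

End gaussian_tilt.

Lemma primal_algebra {R : comPzRingType} (M dd T0 T1 t0 t1 a b G0 G1 l : R) :
 M * (dd + T0 + T1) + (t0 * a - t0 * M - M * (dd + t0 * (G0 - l) + T0)) +
 (t1 * b - t1 * M - M * (0 + t1 * (G1 - l) + T1)) =
 t0 * a + t1 * b - (t0 + t1) * M - (t0 * (G0 - l) + t1 * (G1 - l)) * M.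
Proof. ring. Qed.

Lemma shift_algebra {R : comPzRingType} (t0 t1 A B G0 G1 l L : R) :
 t0 * G0 + t1 * G1 = (t0 + t1) * L ->
 t0 * (A + G0 - l) + t1 * (B + G1 - l) = t0 * A + t1 * B + (t0 + t1) * (L - l).
Proof. by move=> e; rewrite [(t0 + t1) * _]mulrBr -e; ring. Qed.

(** * Dual and primal values for two scaled Gaussians *)

Section gaussian_duality.
Context {R : realType} {d : nat}.
Variables (p q : gparam R d) (t0 t1 : R) (S : 'M[R]_d) (r : 'cV[R]_d) (a b : {posnum R}).
Hypotheses (hp : Gd p) (hq : Gd q) (t00 : 0 < t0) (t10 : 0 < t1).
Hypothesis pS : sympd S.
Let K0 := 1%:M - invmx S.
Let K := 1%:M - S.
Hypothesis pK0 : sympd (invmx p.2 + (2 / t0) *: K0).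
Hypothesis pK : sympd (invmx q.2 + (2 / t1) *: K).
Hypothesis hr : r + (2 / t0) *: (p.2 *m r) + (2 / t1) *: (q.2 *m r) = p.1 - q.1.

Let I0 := gmass (2 / t0) (dotc r r) r p.2 K0.
Let I1 := gmass (2 / t1) 0 (- r) q.2 K.
Let u := p.1 - (2 / t0) *: (p.2 *m r).
Let v := q.1 - (2 / t1) *: (q.2 *m - r).
Let p' : gparam R d := (u, invmx (invmx p.2 + (2 / t0) *: K0)).
Let q' : gparam R d := (v, invmx (invmx q.2 + (2 / t1) *: K)).

Let hp' : Gd p'. Proof. exact: sympd_inv. Qed.

Let hq' : Gd q'. Proof. exact: sympd_inv. Qed.

(** This is the meaning of [hr]: the vector [r] in the linear parts of the potentials is the
    difference of the tilted means, as [qpot_le] requires. *)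
Let uv : u - v = r.
Proof.
rewrite /u /v mulmxN scalerN opprK opprD addrACA -hr addrAC.
by rewrite addrA addrK subrK.
Qed.

Let alpha := scaled a (gauss p).
Let beta := scaled b (gauss q).
Let phi c := qpot (dotc r r + c) r u K0.
Let psi c := qpot (0 + c) (- r) v K.

Let I00 : 0 < I0. Proof. exact: gmass_gt0. Qed.
Let I10 : 0 < I1. Proof. exact: gmass_gt0. Qed.

Let kM (M : R) := t0 * (ln (a%:num * I0) - ln M) + t1 * (ln (b%:num * I1) - ln M).

Lemma gaussian_dual (g : fmeas R (Rn R d * Rn R d))
 (rho0 rho1 : fmeas R (Rn R d)) (M : R) :
 (forall A, measurable A -> marginal1 g A = rho0 A) ->
 (forall A, measurable A -> marginal2 g A = rho1 A) -> 0 < M ->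
 ((t0 * a%:num + t1 * b%:num)%:E <=
 transport_cost g + t0%:E * KL rho0 alpha + t1%:E * KL rho1 beta +
 ((t0 + t1) * M)%:E + (kM M)%:E * g setT)%E.
Proof.
move=> g1 g2 M0.
pose c0 := t0 * (ln (a%:num * I0) - ln M); pose c1 := t1 * (ln (b%:num * I1) - ln M).
have J0 : (\int[alpha]_x (expR (- (phi c0 x / t0)))%:E = M%:E)%E.
 by have := integral_gauss_tilt (dotc r r) r a hp t00 pK0 M0 measurableT; rewrite /= probability_setT mule1.
have J1 : (\int[beta]_x (expR (- (psi c1 x / t1)))%:E = M%:E)%E.
 by have := integral_gauss_tilt 0 (- r) b hq t10 pK M0 measurableT; rewrite /= probability_setT mule1.
have hc x y : phi c0 x + psi c1 y <= sqdist x y + kM M.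
 have -> : phi c0 x = qpot (dotc r r) r u K0 x + c0 by exact: qpotDc.
 have -> : psi c1 y = qpot 0 (- r) v K y + c1 by exact: qpotDc.
 rewrite addrACA.
 by have := qpot_le u v x y pS; rewrite uv -(lerD2r (kM M)).
have := duality_bound g1 g2 t00 t10 (measurable_qpot _ _ _ _) (measurable_qpot _ _ _ _) hc.
move=> /(_ alpha beta); rewrite J0 J1 => /(_ (ltry _) (ltry _)).
have -> : ((t0 * a%:num + t1 * b%:num)%:E =
 t0%:E * alpha setT + t1%:E * beta setT)%E.
 by rewrite EFinD; congr (_ + _)%E; rewrite mscaleT.
by have -> : (((t0 + t1) * M)%:E = t0%:E * M%:E + t1%:E * M%:E)%E by rewrite mulrDl EFinD.
Qed.

Hypothesis pkk : invmx q.2 + (2 / t1) *: K = S *m (invmx p.2 + (2 / t0) *: K0) *m S.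

(** Under [pkk] the map [S] carries the tilted covariance of [q] to that of [p], so the graph
    coupling has the two tilted Gaussians as marginals. Both entropies are then in the equality case
    of Young's inequality. *)
Lemma gaussian_primal (M : {posnum R}) :
 let g := scaled M (graph_coupling q' S u) in
 (transport_cost g + t0%:E * KL (scaled M (gauss p')) alpha +
 t1%:E * KL (scaled M (gauss q')) beta =
 (t0 * a%:num + t1 * b%:num - (t0 + t1) * M%:num - kM M%:num * M%:num)%:E)%E.
Proof.
move=> g.
have sS := sympd_sym pS; have sI := sympd_sym (sympd_inv pS).
have s1 : K^T = K by rewrite /K linearB/= trmx1 sS.
have s2 : K0^T = K0 by rewrite /K0 linearB/= trmx1 sI.
rewrite (KL_gauss_tilt (dotc r r) r a M hp)// (KL_gauss_tilt 0 (- r) b M hq)//.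
have -> : (transport_cost g = M%:num%:E * \int[graph_coupling q' S u]_z (sqdist z.1 z.2)%:E)%E.
 rewrite /transport_cost ge0_integral_mscale//.
 exact: measurable_sqdist.
 by move=> z _; rewrite lee_fin sqdist_ge0.
rewrite graph_cost// -!EFinM -!EFinD; congr EFin.
have -> : u - q'.1 = r by exact: uv.
have -> : S *m q'.2 *m S = p'.2.
 rewrite /q' /p' /= pkk; have uS := sympd_unit pS; have uP := sympd_unit pK0.
 rewrite !invmx_mulmx ?unitmx_mul ?uS ?uP//.
 by rewrite !mulmxA mulmxV// mul1mx -mulmxA mulVmx// mulmx1.
rewrite -/K -/K0 /kM -/I0 -/I1.
exact: primal_algebra.
Qed.

End gaussian_duality.

(** * Exact values of unbalanced transport, of its probability version and of the squared
    Wasserstein distance *)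

Section gaussian_uot.
Context {R : realType} {d : nat}.
Implicit Types (p q : gparam R d) (t : R) (S : 'M[R]_d) (r : 'cV[R]_d).

Lemma UOT_le (t0 t1 : R) (alpha beta rho0 rho1 : fmeas R (Rn R d))
 (g : fmeas R (Rn R d * Rn R d)) :
 (forall A, measurable A -> marginal1 g A = rho0 A) ->
 (forall A, measurable A -> marginal2 g A = rho1 A) ->
 (UOT t0 t1 alpha beta <= transport_cost g + t0%:E * KL rho0 alpha + t1%:E * KL rho1 beta)%E.
Proof.
move=> g1 g2; apply: ereal_inf_lbound; exists g => //.
by rewrite (KL_ext (rho' := rho0) (eta' := alpha) g1)// (KL_ext (rho' := rho1) (eta' := beta) g2).
Qed.

Lemma mscale_graph_marginal1 q (M : {posnum R}) S u A : Gd q -> sympd S -> measurable A ->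
 marginal1 (scaled M (graph_coupling q S u)) A =
 scaled M (gauss (u, S *m q.2 *m S)) A.
Proof.
move=> hq pS mA; rewrite /marginal1 /pushforward /mscale; congr (_ * _)%E.
exact: (graph_marginal1 u hq pS mA).
Qed.

Lemma mscale_graph_marginal2 q (M : {posnum R}) S u A :
 marginal2 (scaled M (graph_coupling q S u)) A =
 scaled M (gauss q) A.
Proof. by rewrite /marginal2 /pushforward /mscale; congr (_ * _)%E. Qed.

(** [S] parametrises the quadratic parts of the potentials; the positivity of the two tilted
    precision matrices makes the exponentials integrable; the last equation says that [r] is the
    difference of the tilted means. *)
Definition admissible p q t0 t1 S r : Prop :=
 [/\ sympd S, sympd (invmx p.2 + (2 / t0) *: (1%:M - invmx S)),
 sympd (invmx q.2 + (2 / t1) *: (1%:M - S)) &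
 r + (2 / t0) *: (p.2 *m r) + (2 / t1) *: (q.2 *m r) = p.1 - q.1].

(** The tilted covariances correspond under [S]. Through [1 / t0] and [1 / t1] the equation tends to
    [invmx q.2 = S *m invmx p.2 *m S], the equation of the optimal transport map. *)
Definition matched p q t0 t1 S : Prop :=
 invmx q.2 + (2 / t1) *: (1%:M - S) =
 S *m (invmx p.2 + (2 / t0) *: (1%:M - invmx S)) *m S.

Lemma matched_inv p q t0 t1 S r : admissible p q t0 t1 S r -> matched p q t0 t1 S ->
 S *m invmx (invmx q.2 + (2 / t1) *: (1%:M - S)) *m S =
 invmx (invmx p.2 + (2 / t0) *: (1%:M - invmx S)).
Proof.
move=> [pS pK0 pK hr] ->; have uS := sympd_unit pS; have uP := sympd_unit pK0.
rewrite !invmx_mulmx ?unitmx_mul ?uS ?uP//.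
by rewrite !mulmxA mulmxV// mul1mx -mulmxA mulVmx// mulmx1.
Qed.

(** [- (t0 + t1) * lnE] is the dual value of the probability problem [Acost]; at a matched pair
    [expR lnE] is therefore the factor [e^(- A / (kappa s))] of the partition function. *)
Definition lnE p q t0 t1 S r : R :=
 (- dotc r (p.1 - q.1) - t0 / 2 * ln (\det (1%:M + (2 / t0) *: (p.2 *m (1%:M - invmx S))))
 - t1 / 2 * ln (\det (1%:M + (2 / t1) *: (q.2 *m (1%:M - S))))) / (t0 + t1).

Lemma ln_gmass p (eta a : R) (w : 'cV[R]_d) (K : 'M[R]_d) : Gd p ->
 sympd (invmx p.2 + eta *: K) ->
 ln (gmass eta a w p.2 K) = - (2^-1 * eta * a) - 2^-1 * eta ^+ 2 * dotc w (p.2 *m w)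
 - 2^-1 * ln (\det (1%:M + eta *: (p.2 *m K))).
Proof.
move=> hp pM; have h : 0 < \det (1%:M + eta *: (p.2 *m K)).
 by rewrite scalemxAr; exact: det1_gt0.
by rewrite /gmass sqrtr_expR_ln// -expRN -expRD expRK.
Qed.

Lemma ln_gmassM p (m : {posnum R}) (eta a : R) (w : 'cV[R]_d) (K : 'M[R]_d) : Gd p ->
 sympd (invmx p.2 + eta *: K) ->
 ln (m%:num * gmass eta a w p.2 K) = ln m%:num + ln (gmass eta a w p.2 K).
Proof. by move=> hp pM; rewrite [LHS]lnM ?posrE//; exact: gmass_gt0. Qed.

Lemma gmass_sum p q t0 t1 S r : Gd p -> Gd q -> 0 < t0 -> 0 < t1 ->
 admissible p q t0 t1 S r ->
 t0 * ln (gmass (2 / t0) (dotc r r) r p.2 (1%:M - invmx S)) +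
 t1 * ln (gmass (2 / t1) 0 (- r) q.2 (1%:M - S)) = (t0 + t1) * lnE p q t0 t1 S r.
Proof.
move=> hp hq t00 t10 [pS pK0 pK hr]; have t01 : t0 + t1 != 0 by rewrite gt_eqF// addr_gt0.
rewrite !ln_gmass// /lnE [RHS]mulrC (divfK t01).
rewrite mulmxN dotcNl dotcNr opprK -hr !(dotcDr, dotcZr).
move: (dotc _ _) (dotc _ _) (dotc _ _) (ln _) (ln _) => A B C D E; clear -t00 t10.
by field; rewrite !gt_eqF.
Qed.

Lemma gaussian_dual_lnE p q t0 t1 S r (a b : {posnum R}) (M : R)
 (g : fmeas R (Rn R d * Rn R d))
 (rho0 rho1 : fmeas R (Rn R d)) :
 Gd p -> Gd q -> 0 < t0 -> 0 < t1 -> admissible p q t0 t1 S r ->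
 (forall A, measurable A -> marginal1 g A = rho0 A) ->
 (forall A, measurable A -> marginal2 g A = rho1 A) -> 0 < M ->
 ((t0 * a%:num + t1 * b%:num)%:E <=
 transport_cost g + t0%:E * KL rho0 (scaled a (gauss p)) +
 t1%:E * KL rho1 (scaled b (gauss q)) +
 ((t0 + t1) * M)%:E +
 (t0 * ln a%:num + t1 * ln b%:num + (t0 + t1) * (lnE p q t0 t1 S r - ln M))%:E * g setT)%E.
Proof.
move=> hp hq t00 t10 hS g1 g2 M0; have [pS pK0 pK hr] := hS.
have := gaussian_dual a b hp hq t00 t10 pS pK0 pK hr g1 g2 M0.
rewrite (ln_gmassM _ _ _ hp pK0) (ln_gmassM _ _ _ hq pK)/=.
have -> // : t0 * (ln a%:num + ln (gmass (2 / t0) (dotc r r) r p.2 (1%:M - invmx S)) - ln M) +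
 t1 * (ln b%:num + ln (gmass (2 / t1) 0 (- r) q.2 (1%:M - S)) - ln M) =
 t0 * ln a%:num + t1 * ln b%:num + (t0 + t1) * (lnE p q t0 t1 S r - ln M).
exact: (shift_algebra _ _ _ (gmass_sum hp hq t00 t10 hS)).
Qed.

Lemma leeBl_fin (c k : R) (X : \bar R) : (c%:E <= X + k%:E)%E -> ((c - k)%:E <= X)%E.
Proof. by rewrite EFinB leeBlDr. Qed.

Lemma UOT_ge p q t0 t1 S r (a b : {posnum R}) :
 Gd p -> Gd q -> 0 < t0 -> 0 < t1 -> admissible p q t0 t1 S r ->
 ((t0 * a%:num + t1 * b%:num - (t0 + t1) *
 expR ((t0 * ln a%:num + t1 * ln b%:num) / (t0 + t1) + lnE p q t0 t1 S r))%:E <=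
 UOT t0 t1 (scaled a (gauss p)) (scaled b (gauss q)))%E.
Proof.
move=> hp hq t00 t10 hS; have t01 : t0 + t1 != 0 by rewrite gt_eqF// addr_gt0.
apply: le_ereal_inf_tmp => _ [g _ <-]; apply: leeBl_fin.
have := gaussian_dual_lnE a b hp hq t00 t10 hS (fun _ _ => erefl) (fun _ _ => erefl) (expR_gt0 _).
(* The common mass [M] is chosen as the weighted geometric mean of [a] and [b] times [expR lnE]: it
   makes the coefficient of the mass of [g] vanish, so the bound is free of [g]. *)
move=> /(_ ((t0 * ln a%:num + t1 * ln b%:num) / (t0 + t1) + lnE p q t0 t1 S r) g).
rewrite expRK; have -> : t0 * ln a%:num + t1 * ln b%:num + (t0 + t1) *
 (lnE p q t0 t1 S r - ((t0 * ln a%:num + t1 * ln b%:num) / (t0 + t1) + lnE p q t0 t1 S r)) = 0.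
 by field.
by rewrite mul0e adde0.
Qed.

Lemma UOT_eq p q t0 t1 S r (a b : {posnum R}) :
 Gd p -> Gd q -> 0 < t0 -> 0 < t1 -> admissible p q t0 t1 S r ->
 matched p q t0 t1 S ->
 UOT t0 t1 (scaled a (gauss p)) (scaled b (gauss q)) =
 (t0 * a%:num + t1 * b%:num - (t0 + t1) *
 expR ((t0 * ln a%:num + t1 * ln b%:num) / (t0 + t1) + lnE p q t0 t1 S r))%:E.
Proof.
move=> hp hq t00 t10 hS mS; apply/eqP; rewrite eq_le; apply/andP; split; last exact: UOT_ge.
have t01 : t0 + t1 != 0 by rewrite gt_eqF// addr_gt0.
have [pS pK0 pK hr] := hS.
pose m := expR ((t0 * ln a%:num + t1 * ln b%:num) / (t0 + t1) + lnE p q t0 t1 S r).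
have m0 : 0 < m by exact: expR_gt0.
pose M := PosNum m0.
have := gaussian_primal a b hp hq t00 t10 pS pK0 pK hr mS M.
rewrite (ln_gmassM _ _ _ hp pK0) (ln_gmassM _ _ _ hq pK)/=.
have -> : t0 * (ln a%:num + ln (gmass (2 / t0) (dotc r r) r p.2 (1%:M - invmx S)) - ln m) +
 t1 * (ln b%:num + ln (gmass (2 / t1) 0 (- r) q.2 (1%:M - S)) - ln m) = 0.
 transitivity (t0 * ln a%:num + t1 * ln b%:num + (t0 + t1) * (lnE p q t0 t1 S r - ln m)).
 exact: (shift_algebra _ _ _ (gmass_sum hp hq t00 t10 hS)).
 by rewrite /m expRK; field.
rewrite mul0r subr0 => <-.
apply: UOT_le => A mA; last exact: mscale_graph_marginal2.
rewrite (mscale_graph_marginal1 _ _ _ pS mA) ?(matched_inv hS mS)//.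
exact: sympd_inv.
Qed.

Lemma leeBl_fin2 (A B L : R) (X G : \bar R) : A = B -> G = 1%E ->
 (A%:E <= X + B%:E + L%:E * G)%E -> ((- L)%:E <= X)%E.
Proof.
move=> -> -> h; have -> : - L = B - (B + L) by ring.
by apply: leeBl_fin; rewrite EFinD addeA; rewrite mule1 in h.
Qed.

Lemma KL_mscale1 (P : fmeas R (Rn R d)) (Q : probability (Rn R d) R) :
 KL P (mscale ((PosNum (@ltr01 R))%:num%:nng)%R Q) = KL P Q.
Proof. by apply: KL_ext => // A mA; exact: mul1e. Qed.

Lemma W2sq_le (P Q : probability (Rn R d) R) (G : probability (Rn R d * Rn R d)%type R)
 (g : fmeas R (Rn R d * Rn R d)) : coupling P Q G ->
 (forall A, measurable A -> g A = G A) -> (W2sq P Q <= transport_cost g)%E.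
Proof.
move=> cG gG; apply: ge_ereal_inf; exists (transport_cost G); first by exists G.
by apply/eq_ler/eq_measure_integral => A mA _; exact/esym/gG.
Qed.

Lemma Acost_ge p q t0 t1 S r :
 Gd p -> Gd q -> 0 < t0 -> 0 < t1 -> admissible p q t0 t1 S r ->
 ((- ((t0 + t1) * lnE p q t0 t1 S r))%:E <=
 ereal_inf [set (W2sq pq.1 pq.2 + t0%:E * KL pq.1 (gauss p) + t1%:E * KL pq.2 (gauss q))%E
 | pq in [set: probability (Rn R d) R * probability (Rn R d) R]])%E.
Proof.
move=> hp hq t00 t10 hS; apply: le_ereal_inf_tmp => _ [[P Q] _ <-]/=.
have W0 : (0 <= W2sq P Q)%E.
 by apply: le_ereal_inf_tmp => _ [g _ <-]; apply: integral_ge0 => z _; rewrite lee_fin sqdist_ge0.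
have K0 : (0 <= t0%:E * KL P (gauss p))%E by rewrite mule_ge0 ?KL_ge0// lee_fin ltW.
have K1 : (0 <= t1%:E * KL Q (gauss q))%E by rewrite mule_ge0 ?KL_ge0// lee_fin ltW.
case e0 : (t0%:E * KL P (gauss p))%E K0 => [k0| |]// K0; last first.
 by rewrite addey ?addye ?leey// gt_eqF// (lt_le_trans ltNy0).
case e1 : (t1%:E * KL Q (gauss q))%E K1 => [k1| |]// K1; last first.
 by rewrite addey ?leey// gt_eqF// (lt_le_trans ltNy0)// adde_ge0.
(* With both entropies finite they can be moved to the other side, and the infimum in [W2sq] is
   bounded coupling by coupling. The dual bound is used with masses 1, where the coupling has total
   mass 1. *)
rewrite -addeA -EFinD -leeBlDr// -EFinB; apply: le_ereal_inf_tmp => _ [g cg <-].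
rewrite EFinB leeBlDr// EFinD addeA -e0 -e1.
have := gaussian_dual_lnE (PosNum ltr01) (PosNum ltr01) hp hq t00 t10 hS
 (fun A mA => (cg A mA).1) (fun A mA => (cg A mA).2) ltr01.
rewrite !KL_mscale1 !ln1 !mulr0 !add0r subr0/= !mulr1.
by apply: leeBl_fin2 => //; exact: probability_setT.
Qed.

Lemma Acost_eq p q t0 t1 S r :
 Gd p -> Gd q -> 0 < t0 -> 0 < t1 -> admissible p q t0 t1 S r ->
 matched p q t0 t1 S ->
 ereal_inf [set (W2sq pq.1 pq.2 + t0%:E * KL pq.1 (gauss p) + t1%:E * KL pq.2 (gauss q))%E
 | pq in [set: probability (Rn R d) R * probability (Rn R d) R]] =
 (- ((t0 + t1) * lnE p q t0 t1 S r))%:E.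
Proof.
move=> hp hq t00 t10 hS mS; apply/eqP; rewrite eq_le; apply/andP; split; last exact: Acost_ge.
have [pS pK0 pK hr] := hS.
have := gaussian_primal (PosNum ltr01) (PosNum ltr01) hp hq t00 t10 pS pK0 pK hr mS (PosNum ltr01).
set q' := (_, invmx (invmx q.2 + _)); set p' := (_, invmx (invmx p.2 + _)).
have hq' : Gd q' by exact: sympd_inv.
rewrite /= !mul1r ln1 !subr0 !mulr1 (gmass_sum hp hq t00 t10 hS) subrr add0r => e.
apply: ge_ereal_inf; exists (W2sq (gauss p') (gauss q') + t0%:E * KL (gauss p') (gauss p) +
 t1%:E * KL (gauss q') (gauss q))%E.
 by exists (gauss p', gauss q').
rewrite -e; apply: leeD; last first.
 by apply: eq_ler; congr (_ * _)%E;
 apply: KL_ext => A mA; apply/esym; exact: mul1e.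
apply: leeD; last first.
 by apply: eq_ler; congr (_ * _)%E;
 apply: KL_ext => A mA; apply/esym; exact: mul1e.
apply: W2sq_le => [A mA|A mA]; last exact: mul1e.
split; last exact: graph_marginal2.
rewrite [LHS](graph_marginal1 _ hq' pS mA)/=.
by rewrite (matched_inv hS mS).
Qed.

(** The balanced dual functional at the quadratic potentials given by [S]: a lower bound of the
    squared distance for every positive [S], exact when [S *m q.2 *m S = p.2]. *)
Definition wcost p q S : R :=
 dotc (p.1 - q.1) (p.1 - q.1) + \tr (p.2 *m (1%:M - invmx S)) + \tr (q.2 *m (1%:M - S)).

Lemma addr_split_le {T : realDomainType} (c a b a1 a2 b1 b2 : T) :
 a = a1 - a2 -> b = b1 - b2 -> a + b <= c -> a1 + b1 <= c + (a2 + b2).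
Proof. by move=> -> ->; lra. Qed.

(** No entropy controls the potentials here; their integrability comes from the second moments of
    the fixed Gaussian marginals. *)
Lemma W2sq_ge p q S : Gd p -> Gd q -> sympd S ->
 ((wcost p q S)%:E <= W2sq (gauss p) (gauss q))%E.
Proof.
move=> hp hq pS; have sS := sympd_sym pS; have sI := sympd_sym (sympd_inv pS).
have s1 : (1%:M - S)^T = 1%:M - S by rewrite linearB/= trmx1 sS.
have s2 : (1%:M - invmx S)^T = 1%:M - invmx S by rewrite linearB/= trmx1 sI.
pose dl := p.1 - q.1.
pose phi := qpot (dotc dl dl) dl p.1 (1%:M - invmx S).
pose psi := qpot 0 (- dl) q.1 (1%:M - S).
have [a0 [b0 [ea0 eb0 v0]]] := fint_posneg (fint_qpot (dotc dl dl) dl hp s2).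
have [a1 [b1 [ea1 eb1 v1]]] := fint_posneg (fint_qpot 0 (- dl) hq s1).
have mpos (f : Rn R d -> R) : mfunT f -> mfunT (fun x => (Num.max (f x) 0)%:E).
 by move=> mf; apply/measurable_EFinP; apply: measurable_maxr.
have mneg (f : Rn R d -> R) : mfunT f -> mfunT (fun x => (Num.max (- f x) 0)%:E).
 by move=> mf; apply/measurable_EFinP; apply: measurable_maxr => //; exact: measurableT_comp.
have ge0 (x : R) : (0 <= (Num.max x 0)%:E)%E by rewrite lee_fin le_max lexx orbT.
have mphi : mfunT phi by exact: measurable_qpot.
have mpsi : mfunT psi by exact: measurable_qpot.
apply: le_ereal_inf_tmp => _ [g cg <-].
have g1 A mA := (cg A mA).1; have g2 A mA := (cg A mA).2.
have i1 := ge0_integral_fst g1 (mpos _ mphi) (fun _ => ge0 _).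
have i2 := ge0_integral_fst g1 (mneg _ mphi) (fun _ => ge0 _).
have j1 := ge0_integral_snd g2 (mpos _ mpsi) (fun _ => ge0 _).
have j2 := ge0_integral_snd g2 (mneg _ mpsi) (fun _ => ge0 _).
rewrite ea0 in i1; rewrite eb0 in i2; rewrite ea1 in j1; rewrite eb1 in j2.
have mf (f : Rn R d -> \bar R) : mfunT f ->
 mfunT (fun z : Rn R d * Rn R d => f z.1).
 by move=> m; apply: measurableT_comp => //; exact: measurable_fst.
have ms (f : Rn R d -> \bar R) : mfunT f ->
 mfunT (fun z : Rn R d * Rn R d => f z.2).
 by move=> m; apply: measurableT_comp => //; exact: measurable_snd.
have h : (a0%:E + a1%:E <= transport_cost g + (b0%:E + b1%:E))%E.
 have M1 := mf _ (mpos _ mphi); have M2 := mf _ (mneg _ mphi).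
 have M3 := ms _ (mpos _ mpsi); have M4 := ms _ (mneg _ mpsi).
 have M13 := emeasurable_funD M1 M3; have M24 := emeasurable_funD M2 M4.
 have M0 := @measurable_sqdist R d; have M024 := emeasurable_funD M0 M24.
 have c0 (z : Rn R d * Rn R d) : setT z -> (0 <= (sqdist z.1 z.2)%:E)%E.
 by rewrite lee_fin sqdist_ge0.
 have n24 (z : Rn R d * Rn R d) : setT z ->
 (0 <= (Num.max (- phi z.1) 0)%:E + (Num.max (- psi z.2) 0)%:E)%E.
 by rewrite adde_ge0.
 have n13 (z : Rn R d * Rn R d) : setT z ->
 (0 <= (Num.max (phi z.1) 0)%:E + (Num.max (psi z.2) 0)%:E)%E.
 by rewrite adde_ge0.
 rewrite -i1 -i2 -j1 -j2 /transport_cost -(ge0_integralD g measurableT _ M1 _ M3)//.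
 rewrite -(ge0_integralD g measurableT _ M2 _ M4)// -(ge0_integralD g measurableT c0 M0 n24 M24).
 apply: ge0_le_integral => //.
 move=> x _; rewrite -!EFinD lee_fin.
 have pn (y : R) : y = Num.max y 0 - Num.max (- y) 0.
 case: (leP 0 y) => h0; first by rewrite max_r ?subr0// oppr_le0.
 by rewrite max_l ?oppr_ge0 ?(ltW h0)// sub0r opprK.
 exact: (addr_split_le (pn _) (pn _) (qpot_le _ _ _ _ pS)).
move: h; rewrite -!EFinD => h.
have -> : wcost p q S = a0 + a1 - (b0 + b1).
 rewrite opprD addrACA -v0 -v1 /wcost -/dl add0r; ring.
exact: leeBl_fin.
Qed.

Lemma W2sq_eq p q S : Gd p -> Gd q -> sympd S ->
 S *m q.2 *m S = p.2 -> W2sq (gauss p) (gauss q) = (wcost p q S)%:E.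
Proof.
move=> hp hq pS e; apply/eqP; rewrite eq_le; apply/andP; split; last exact: W2sq_ge.
have := graph_cost p.1 hq pS; rewrite e -/(wcost p q S) => <-.
apply: ereal_inf_lbound; exists (graph_coupling q S p.1) => // A mA.
split; last exact: graph_marginal2.
rewrite [LHS](graph_marginal1 _ hq pS mA) e.
by case: (p).
Qed.

Lemma Wass_eq p q S : Gd p -> Gd q -> sympd S ->
 S *m q.2 *m S = p.2 -> Wass p q = wcost p q S.
Proof. by move=> hp hq pS e; rewrite /Wass (W2sq_eq hp hq pS e). Qed.

Lemma Wass_ge p q S : Gd p -> Gd q -> sympd S ->
 wcost p q S <= Wass p q.
Proof.
move=> hp hq pS; have [T pT e] := sympd_geomean hp hq.
by rewrite (Wass_eq hp hq pT e) -lee_fin -(W2sq_eq hp hq pT e) W2sq_ge.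
Qed.

End gaussian_uot.

(** * From dual values to minimizers in the mass and in the Gaussian *)

Section objective.
Context {R : realType}.

Lemma theta_compl (tau0 tau1 : R) : 0 < tau0 + tau1 -> 1 - tau0 / (tau0 + tau1) = tau1 / (tau0 + tau1).
Proof. by move=> h; field; rewrite gt_eqF. Qed.

Lemma expR_mul_ln (x y : R) : 0 < y -> expR (x * ln y) = y `^ x.
Proof. by move=> y0; rewrite /powR gt_eqF. Qed.

(* With [b = Z ^ theta^-1 * e^y], the inequality is [e^((1-theta) y) <= theta + (1-theta) e^y]. *)
Lemma mass_ge (tau0 tau1 b Z : R) : 0 < tau0 -> 0 < tau1 -> 0 < b -> 0 < Z ->
 let s := tau0 + tau1 in let th := tau0 / s in
 - (tau0 * Z `^ th^-1) <= tau1 * b - s * (b `^ (1 - th) * Z) ?= iff (b == Z `^ th^-1).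
Proof.
move=> t00 t10 b0 Z0 s th.
have s0 : 0 < s by rewrite addr_gt0.
have th0 : 0 < th by rewrite divr_gt0.
have th1 : 0 < 1 - th.
 by rewrite /th theta_compl// divr_gt0.
pose B := Z `^ th^-1; have B0 : 0 < B by exact: powR_gt0.
pose y := ln b - ln B.
have eb : b = B * expR y by rewrite /y expRB !lnK ?posrE// mulrC divfK ?gt_eqF.
have eZ : Z = B `^ th.
 by rewrite /B -powRrM mulVf ?gt_eqF// powRr1// ltW.
have e1 : b `^ (1 - th) * Z = B * expR ((1 - th) * y).
 rewrite eZ eb powRM ?expR_ge0 ?(ltW B0)// mulrAC -powRD; last first.
 by rewrite (gt_eqF B0) implybT.
 rewrite subrK powRr1 ?(ltW B0)//; congr (_ * _).
 by rewrite -expR_mul_ln ?expR_gt0// expRK.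
have -> : tau1 * b - s * (b `^ (1 - th) * Z) =
 - (tau0 * B) + s * B * (th + (1 - th) * expR y - expR ((1 - th) * y)).
 rewrite e1 eb; have -> : tau1 = s * (1 - th) by rewrite /th theta_compl// mulrC divfK// gt_eqF.
 have -> : tau0 = s * th by rewrite /th mulrC divfK// gt_eqF.
 ring.
have conv (u : R) : u != 0 -> 1 + u < expR u.
 by move=> u0; exact: expR_gt1Dx.
have key : 0 <= th + (1 - th) * expR y - expR ((1 - th) * y).
 have [->|y0] := eqVneq y 0; first by rewrite mulr0 expR0; lra.
 rewrite -(pmulr_rge0 _ (expR_gt0 (- ((1 - th) * y)))) mulrBr expRN mulVf ?gt_eqF ?expR_gt0//.
 rewrite -expRN mulrDr [expR _ * ((1 - th) * _)]mulrCA -expRD.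
 have h1 := expR_ge1Dx (- ((1 - th) * y)); have h2 := expR_ge1Dx (- ((1 - th) * y) + y).
 nra.
split.
 by rewrite lerDl; apply: mulr_ge0 => //; apply: mulr_ge0; exact: ltW.
apply/eqP/eqP => [e|e]; last first.
 by rewrite /y e subrr mulr0 expR0 -/B; lra.
have {e} e : th + (1 - th) * expR y - expR ((1 - th) * y) = 0.
 have sB : s * B != 0 by rewrite mulf_neq0// gt_eqF.
 by apply: (mulfI sB); rewrite mulr0; apply: (addrI (- (tau0 * B))); rewrite addr0 -e.
have [y0|y0] := eqVneq y 0; first by rewrite eb y0 expR0 mulr1.
have h1 := conv (- ((1 - th) * y)); have h2 := expR_ge1Dx (- ((1 - th) * y) + y).
have h3 : - ((1 - th) * y) != 0 by rewrite oppr_eq0 mulf_neq0// gt_eqF.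
have {}h1 := h1 h3.
have : 0 < expR (- ((1 - th) * y)) * (th + (1 - th) * expR y - expR ((1 - th) * y)).
 rewrite mulrBr expRN mulVf ?gt_eqF ?expR_gt0//.
 rewrite -expRN mulrDr [expR _ * ((1 - th) * _)]mulrCA -expRD; nra.
by rewrite e mulr0 ltxx.
Qed.

Lemma cw_gt0 {n} {tau0 tau1} {lam : 'I_n -> R} a i : 0 < lam i -> 0 < cw tau0 tau1 lam a i.
Proof. by move=> h; rewrite mulr_gt0// powR_gt0. Qed.

Context {d n : nat}.
Variables (tau0 tau1 : R) (lam : 'I_n -> R) (a : 'I_n -> {posnum R}) (mu : 'I_n -> gparam R d).
Hypotheses (hn : (0 < n)%N) (t00 : 0 < tau0) (t10 : 0 < tau1) (lam0 : forall i, 0 < lam i).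
Hypothesis hmu : forall i, Gd (mu i).

Let s := sbar tau0 tau1.
Let th := theta tau0 tau1.
Let c := cw tau0 tau1 lam a.

Definition Zval k nu (S : 'I_n -> 'M[R]_d) (r : 'I_n -> 'cV[R]_d) : R :=
 \sum_i cw tau0 tau1 lam a i * expR (lnE (mu i) nu (k * tau0) (k * tau1) (S i) (r i)).

(** The objective depends on the dual pairs only through [Z], and decreases in it: lower bounds for
    the transport costs are upper bounds for [Z]. *)
Definition Fval k b Z : R :=
 k * (tau0 * (\sum_i lam i * (a i)%:num) + (tau1 * (\sum_i lam i) * b - s * (b `^ (1 - th) * Z))).

Lemma Zval_gt0 k nu S r : 0 < Zval k nu S r.
Proof. by apply: sum_gt0 => // i; rewrite mulr_gt0 ?cw_gt0 ?expR_gt0. Qed.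

Let one_term (k : R) nu i S r (b : {posnum R}) : 0 < k ->
 k * tau0 * (a i)%:num + k * tau1 * b%:num - (k * tau0 + k * tau1) *
 expR ((k * tau0 * ln (a i)%:num + k * tau1 * ln b%:num) / (k * tau0 + k * tau1) +
 lnE (mu i) nu (k * tau0) (k * tau1) S r) =
 k * (tau0 * (a i)%:num + tau1 * b%:num - s * (b%:num `^ (1 - th) *
 ((a i)%:num `^ th * expR (lnE (mu i) nu (k * tau0) (k * tau1) S r)))).
Proof.
move=> k0; have s0 : 0 < s by rewrite addr_gt0.
have -> : (k * tau0 * ln (a i)%:num + k * tau1 * ln b%:num) / (k * tau0 + k * tau1) =
 (1 - th) * ln b%:num + th * ln (a i)%:num.
 rewrite /th /theta; have := s0; rewrite /s /sbar => s0'.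
 by field; rewrite -mulrDr mulf_neq0// gt_eqF.
have e x (y : {posnum R}) : expR (x * ln y%:num) = y%:num `^ x.
 exact: expR_mul_ln.
by rewrite !expRD !e /s /sbar; ring.
Qed.

Lemma sum_terms k nu S r b :
 \sum_i lam i * (k * (tau0 * (a i)%:num + tau1 * b - s * (b `^ (1 - th) *
 ((a i)%:num `^ th * expR (lnE (mu i) nu (k * tau0) (k * tau1) (S i) (r i))))))
 = Fval k b (Zval k nu S r).
Proof.
rewrite (eq_bigr (fun i => k * tau0 * (lam i * (a i)%:num) + k * tau1 * b * lam i -
 k * s * b `^ (1 - th) * (c i * expR (lnE (mu i) nu (k * tau0) (k * tau1) (S i) (r i))))).
 by rewrite sumrB big_split/= -!mulr_sumr /Fval /Zval; ring.
by move=> i _; rewrite /c /cw -/th; ring.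
Qed.

Lemma Fobj_ge k (b : {posnum R}) nu S r : 0 < k -> Gd nu ->
 (forall i, admissible (mu i) nu (k * tau0) (k * tau1) (S i) (r i)) ->
 ((Fval k b%:num (Zval k nu S r))%:E <= Fobj tau0 tau1 lam a mu k (b, nu))%E.
Proof.
move=> k0 hnu hS; rewrite -sum_terms /Fobj -sumEFin; apply: lee_sum => i _.
rewrite EFinM lee_pmul2l//; last by rewrite lte_fin.
by rewrite -one_term//; apply: UOT_ge => //; rewrite mulr_gt0.
Qed.

Lemma Fobj_eq k (b : {posnum R}) nu S r : 0 < k -> Gd nu ->
 (forall i, admissible (mu i) nu (k * tau0) (k * tau1) (S i) (r i)) ->
 (forall i, matched (mu i) nu (k * tau0) (k * tau1) (S i)) ->
 Fobj tau0 tau1 lam a mu k (b, nu) = (Fval k b%:num (Zval k nu S r))%:E.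
Proof.
move=> k0 hnu hS mS; rewrite -sum_terms /Fobj -sumEFin; apply: eq_bigr => i _.
rewrite EFinM -one_term//; congr (_ * _)%E.
by apply: UOT_eq => //; rewrite mulr_gt0.
Qed.

Lemma Zpart_eq k nu S r : 0 < k -> Gd nu ->
 (forall i, admissible (mu i) nu (k * tau0) (k * tau1) (S i) (r i)) ->
 (forall i, matched (mu i) nu (k * tau0) (k * tau1) (S i)) ->
 Zpart tau0 tau1 lam a mu k nu = Zval k nu S r.
Proof.
move=> k0 hnu hS mS; apply: eq_bigr => i _; congr (_ * _).
rewrite /Acost (Acost_eq (hmu i) hnu _ _ (hS i) (mS i)) ?mulr_gt0//.
rewrite -EFinM -EFinN /= -mulrDr -/(sbar tau0 tau1); congr expR.
by rewrite mulNr opprK mulrC mulKf// mulf_neq0// gt_eqF// addr_gt0.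
Qed.

Hypothesis lam1 : \sum_i lam i = 1.

Lemma Fval_ge k b Z : 0 < k -> 0 < b -> 0 < Z ->
 Fval k (Z `^ th^-1) Z <= Fval k b Z ?= iff (b == Z `^ th^-1).
Proof.
move=> k0 b0 Z0; rewrite /Fval lam1 mulr1.
have [_ e0] := mass_ge t00 t10 (powR_gt0 th^-1 Z0) Z0.
have [h1 h2] := mass_ge t00 t10 b0 Z0.
rewrite eqxx in e0; move/eqP: e0 => e0.
split; first by rewrite ler_pM2l// lerD2l -e0.
by rewrite (inj_eq (mulfI (lt0r_neq0 k0))) (inj_eq (addrI _)) -e0 h2.
Qed.

Lemma Fval_lt k b Z Z' : 0 < k -> 0 < b -> Z < Z' -> Fval k b Z' < Fval k b Z.
Proof.
move=> k0 b0 ZZ; rewrite ltr_pM2l// ltrD2l ltrD2l ltrN2 ltr_pM2l ?addr_gt0//.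
by rewrite ltr_pM2l// powR_gt0.
Qed.

(** At the candidate the dual pairs are matched, so its value is exact. At a competitor an
    admissible family with a smaller [Zval] already gives a strictly larger lower bound. *)
Lemma argmin_criterion k nu S r : 0 < k -> Gd nu ->
 (forall i, admissible (mu i) nu (k * tau0) (k * tau1) (S i) (r i)) ->
 (forall i, matched (mu i) nu (k * tau0) (k * tau1) (S i)) ->
 (forall nu', Gd nu' -> nu' <> nu -> exists S' r',
 (forall i, admissible (mu i) nu' (k * tau0) (k * tau1) (S' i) (r' i)) /\
 Zval k nu' S' r' < Zval k nu S r) ->
 [/\ argmin Gd (Phi tau0 tau1 lam a mu k) = [set nu],
 exists2 b : {posnum R}, b%:num = bmass tau0 tau1 lam a mu k nu &
 argmin (setT `*` Gd) (Fobj tau0 tau1 lam a mu k) = [set (b, nu)] &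
 bmass tau0 tau1 lam a mu k nu = Zval k nu S r `^ th^-1].
Proof.
move=> k0 hnu hS mS better; set Z := Zval k nu S r.
have Z0 : 0 < Z by exact: Zval_gt0.
have eb : bmass tau0 tau1 lam a mu k nu = Z `^ th^-1.
 by rewrite /bmass (Zpart_eq k0 hnu hS mS).
pose b := PosNum (powR_gt0 th^-1 Z0).
have Fb : Fobj tau0 tau1 lam a mu k (b, nu) = (Fval k b%:num Z)%:E by exact: Fobj_eq.
have Fnu b' : (Fobj tau0 tau1 lam a mu k (b, nu) <= Fobj tau0 tau1 lam a mu k (b', nu))%E.
 by rewrite Fb (Fobj_eq b' k0 hnu hS mS) lee_fin; case: (Fval_ge k0 (gt0 b') Z0).
(* The separating value [x] does not depend on the mass, so strictness survives the infimum over
   masses in [Phi]. *)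
have Fother nu' : Gd nu' -> nu' <> nu -> exists2 x,
 x > Fval k b%:num Z & ((forall b', x%:E <= Fobj tau0 tau1 lam a mu k (b', nu')))%E.
 move=> hnu' ne; have [S' [r' [hS' ZZ]]] := better _ hnu' ne.
 pose Z' := Zval k nu' S' r'; have Z'0 : 0 < Z' by exact: Zval_gt0.
 exists (Fval k (Z' `^ th^-1) Z').
 apply: (@le_lt_trans _ _ (Fval k (Z' `^ th^-1) Z)).
 by case: (Fval_ge k0 (powR_gt0 th^-1 Z'0) Z0).
 exact: (Fval_lt k0 (powR_gt0 _ Z'0) ZZ).
 move=> b''; apply: (@le_trans _ _ (Fval k b''%:num Z')%:E); last exact: Fobj_ge.
 by rewrite lee_fin; case: (Fval_ge k0 (gt0 b'') Z'0).
have Pnu : Phi tau0 tau1 lam a mu k nu = (Fval k b%:num Z)%:E.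
 rewrite -Fb; apply/eqP; rewrite eq_le; apply/andP; split.
 by apply: ereal_inf_lbound; exists b.
 by apply: le_ereal_inf_tmp => _ [b' _ <-].
have Pother nu' : Gd nu' -> nu' <> nu ->
 (Phi tau0 tau1 lam a mu k nu < Phi tau0 tau1 lam a mu k nu')%E.
 move=> hnu' ne; have [x xg hx] := Fother nu' hnu' ne.
 apply: (@lt_le_trans _ _ x%:E); first by rewrite Pnu lte_fin.
 by apply: le_ereal_inf_tmp => _ [b' _ <-].
split => //.
- apply/seteqP; split => nu' /=.
 move=> [hnu' hmin]; apply: contrapT => ne; have := hmin nu hnu.
 by rewrite leNgt Pother.
 move=> ->; split; first exact: hnu.
 move=> nu'' hnu''; have [->|/eqP ne] := eqVneq nu'' nu; first exact: lexx.
 exact/ltW/Pother.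
- exists b; first by rewrite eb.
 apply/seteqP; split => -[b' nu'] /=.
 move=> [[_ /= hnu'] hmin].
 have e : nu' = nu.
 apply: contrapT => ne; have [x xg hx] := Fother nu' hnu' ne.
 have := hmin (b, nu) (conj I hnu); rewrite Fb => /(le_trans (hx b')).
 by rewrite lee_fin leNgt xg.
 rewrite e in hmin *; congr (_, _); apply: val_inj => /=.
 have := hmin (b, nu) (conj I hnu); rewrite Fb (Fobj_eq b' k0 hnu hS mS) lee_fin => h.
 have [h1 h2] := Fval_ge k0 (gt0 b') Z0; apply/eqP; rewrite -h2.
 by rewrite eq_le h1.
 move=> [-> ->]; split; first by split.
 move=> -[b'' nu''] [_ /= hnu''].
 have [->|/eqP ne] := eqVneq nu'' nu; first exact: Fnu.
 have [x xg hx] := Fother nu'' hnu'' ne; rewrite Fb.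
 by apply: le_trans (hx b''); rewrite lee_fin ltW.
Qed.

End objective.

(** * Real power series in the weighted l1 norm *)

Section power_series.
Context {R : realType}.
Implicit Types (f g : R -> R) (c : nat -> R).

Lemma cvgn_le (u : nat -> R) l b : u @ \oo --> l -> (forall n, u n <= b) -> l <= b.
Proof.
move=> ul ub; rewrite -(cvg_lim _ ul)//; apply: limr_le; first by apply/cvg_ex; exists l.
exact: nearW.
Qed.

Lemma cvgn_sum (I : Type) (r : seq I) (u : I -> nat -> R) (l : I -> R) :
 (forall i, u i @ \oo --> l i) -> (fun n => \sum_(i <- r) u i n) @ \oo --> \sum_(i <- r) l i.
Proof.
move=> ul; elim: r => [|i r IH].
 by rewrite big_nil; under eq_fun do rewrite big_nil; exact: cvg_cst.
by rewrite big_cons; under eq_fun do rewrite big_cons; exact: cvgD.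
Qed.

Lemma cvgn_sub0 (u v : nat -> R) (l : R) : u @ \oo --> l -> (fun n => u n - v n) @ \oo --> (0 : R) ->
 v @ \oo --> l.
Proof.
move=> ul uv; have -> : v = (fun n => u n - (u n - v n)).
 by apply/funext => n; rewrite opprB addrC subrK.
by rewrite -[l]subr0; exact: cvgB.
Qed.

Lemma cvgn_geometric_le (u : nat -> R) l B t : 0 <= t < 1 ->
 (forall n, `|l - u n| <= B * t ^+ n) -> u @ \oo --> l.
Proof.
move=> /andP[t0 t1] h.
have h0 : (fun n => B * t ^+ n) @ \oo --> 0.
 by apply: cvg_geometric; rewrite ger0_norm.
apply/cvgrPdist_le => e e0; near=> n.
apply: le_trans (h n) _; apply: le_trans (ler_norm _) _; near: n.
by have /cvgr0Pnorm_le := h0; apply.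
Unshelve. all: by end_near. Qed.

(* [f] is on the disc of radius [rho] the sum of a power series of weighted l1 norm at most [B]. *)
Definition pw (rho B : R) f : Prop := exists c,
 (forall N, \sum_(0 <= k < N) `|c k| * rho ^+ k <= B) /\
 (forall e, `|e| < rho -> (fun N => \sum_(0 <= k < N) c k * e ^+ k) @ \oo --> f e).

Lemma pw_B0 rho B f : pw rho B f -> 0 <= B.
Proof. by move=> [c [h _]]; have := h 0%N; rewrite big_nil. Qed.

Lemma tail_le c rho B e K L : (K <= L)%N -> `|e| < rho ->
 (forall N, \sum_(0 <= k < N) `|c k| * rho ^+ k <= B) ->
 `|\sum_(K <= k < L) c k * e ^+ k| <= B * (`|e| / rho) ^+ K.
Proof.
move=> KL er h; have r0 : 0 < rho by apply: le_lt_trans er.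
have t01 : 0 <= `|e| / rho <= 1 by rewrite divr_ge0 ?(ltW r0)//= ler_pdivrMr// mul1r ltW.
rewrite (le_trans (ler_norm_sum _ _ _))//.
apply: (@le_trans _ _ (\sum_(K <= k < L) (`|c k| * rho ^+ k) * (`|e| / rho) ^+ K)).
 rewrite !big_nat; apply: ler_sum => k /andP[Kk _].
 rewrite normrM normrX -mulrA ler_wpM2l// -(subnK Kk) exprD.
 have -> : `|e| ^+ (k - K) * `|e| ^+ K =
 rho ^+ (k - K) * rho ^+ K * (`|e| / rho) ^+ (k - K) * (`|e| / rho) ^+ K.
 rewrite !expr_div_n; field; rewrite !expf_neq0// gt_eqF//.
 rewrite exprD ler_wpM2r ?exprn_ge0//; first by case/andP: t01.
 apply: ler_piMr; first by rewrite mulr_ge0 ?exprn_ge0 ?(ltW r0).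
 by apply: exprn_ile1; case/andP: t01.
rewrite -mulr_suml ler_wpM2r ?exprn_ge0//; first by case/andP: t01.
apply: le_trans (h L); rewrite [leRHS](big_cat_nat _ KL)//= lerDr.
by apply: sumr_ge0 => k _; rewrite mulr_ge0// exprn_ge0// ltW.
Qed.

Lemma series_tail c rho B e l K : `|e| < rho ->
 (forall N, \sum_(0 <= k < N) `|c k| * rho ^+ k <= B) ->
 (fun N => \sum_(0 <= k < N) c k * e ^+ k) @ \oo --> l ->
 `|l - \sum_(0 <= k < K) c k * e ^+ k| <= B * (`|e| / rho) ^+ K.
Proof.
move=> er h cl.
have h1 : (fun N => `|\sum_(0 <= k < N) c k * e ^+ k - \sum_(0 <= k < K) c k * e ^+ k|) @ \oo -->
 `|l - \sum_(0 <= k < K) c k * e ^+ k|.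
 by apply: cvg_norm; apply: cvgB => //; exact: cvg_cst.
rewrite -(cvg_lim _ h1)//; apply: limr_le; first by apply/cvg_ex; eexists; exact: h1.
near=> N; have KN : (K <= N)%N by near: N; exact: nbhs_infty_ge.
have -> : \sum_(0 <= k < N) c k * e ^+ k - \sum_(0 <= k < K) c k * e ^+ k =
 \sum_(K <= k < N) c k * e ^+ k by rewrite (big_cat_nat _ KN)//= addrAC subrr add0r.
exact: tail_le h.
Unshelve. all: by end_near. Qed.

Lemma pw_norm rho B f e : pw rho B f -> `|e| < rho -> `|f e| <= B.
Proof.
move=> [c [h1 h2]] er; have := series_tail 0 er h1 (h2 _ er).
by rewrite big_nil subr0 expr0 mulr1.
Qed.

Lemma pw_ext rho B f g : (forall e, `|e| < rho -> f e = g e) -> pw rho B f -> pw rho B g.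
Proof. by move=> fg [c [h1 h2]]; exists c; split => // e er; rewrite -fg//; exact: h2. Qed.

Lemma pw_le rho B B' f : B <= B' -> pw rho B f -> pw rho B' f.
Proof. by move=> BB [c [h1 h2]]; exists c; split => // N; exact: le_trans (h1 N) BB. Qed.

Lemma pw_cst rho a : pw rho `|a| (fun=> a).
Proof.
have e (c : R) N (x : R) : \sum_(0 <= k < N.+1) (if k == 0%N then c else 0) * x ^+ k = c.
 rewrite big_nat_recl//= expr0 mulr1 big1 ?addr0// => k _; by rewrite mul0r.
exists (fun k => if k == 0%N then a else 0); split => [[|N]|x _]; first by rewrite big_nil.
 rewrite -[leRHS](e `|a| N rho); apply: eq_ler.
 by apply: eq_bigr => k _; case: ifP => //; rewrite normr0.
rewrite -cvg_shiftS; under eq_fun do rewrite e; exact: cvg_cst.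
Qed.

Lemma pw_0 rho : pw rho 0 (fun=> 0).
Proof. by have := pw_cst rho 0; rewrite normr0. Qed.

Lemma pw_id rho : 0 < rho -> pw rho rho id.
Proof.
move=> r0; have e N (x : R) : \sum_(0 <= k < N.+2) (if k == 1%N then 1 else 0) * x ^+ k = x.
 rewrite big_nat_recl//= mul0r add0r big_nat_recl//= expr1 mul1r big1 ?addr0// => k _.
 by rewrite mul0r.
exists (fun k => if k == 1%N then 1 else 0); split => [[|[|N]]|x _].
- by rewrite big_nil ltW.
- by rewrite big_nat1/= normr0 mul0r ltW.
- rewrite -[leRHS](e N rho); apply: eq_ler.
 by apply: eq_bigr => k _; case: ifP => _; rewrite ?normr1 ?normr0.
rewrite -(cvg_shiftn 2); under eq_fun do rewrite addn2 e; exact: cvg_cst.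
Qed.

Lemma pwD rho A B f g : 0 <= rho -> pw rho A f -> pw rho B g ->
 pw rho (A + B) (fun e => f e + g e).
Proof.
move=> r0 [a [a1 a2]] [b [b1 b2]]; exists (fun k => a k + b k); split => [N|e er].
 apply: le_trans (lerD (a1 N) (b1 N)); rewrite -big_split/=; apply: ler_sum => k _.
 by rewrite -mulrDl ler_wpM2r ?exprn_ge0// ler_normD.
under eq_fun do under eq_bigr do rewrite mulrDl.
under eq_fun do rewrite big_split/=.
exact: cvgD (a2 _ er) (b2 _ er).
Qed.

Lemma conv_sum (F : nat -> nat -> R) N :
 \sum_(0 <= k < N) \sum_(0 <= i < k.+1) F i (k - i)%N =
 \sum_(0 <= i < N) \sum_(0 <= j < N - i) F i j.
Proof.
elim: N => [|N IH]; first by rewrite !big_nil.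
rewrite big_nat_recr//= IH [RHS]big_nat_recr//= subSnn big_nat1.
rewrite [X in _ + X]big_nat_recr//= subnn addrA; congr (_ + _).
rewrite -big_split/= !big_nat; apply: eq_bigr => i /andP[_ iN].
by rewrite subSn ?(ltnW iN)// big_nat_recr.
Qed.

(** Cauchy product: the weighted l1 norm is submultiplicative. The product of partial sums differs
    from the partial Cauchy sum by terms of total degree at least [N], which are geometrically small
    inside the disc. *)
Lemma pwM rho A B f g : 0 < rho -> pw rho A f -> pw rho B g ->
 pw rho (A * B) (fun e => f e * g e).
Proof.
move=> r0 [a [a1 a2]] [b [b1 b2]].
have A0 : 0 <= A by have := a1 0%N; rewrite big_nil.
have B0 : 0 <= B by have := b1 0%N; rewrite big_nil.
exists (fun k => \sum_(0 <= i < k.+1) a i * b (k - i)%N).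
have split_pow (x : R) i k : (i <= k)%N -> x ^+ k = x ^+ i * x ^+ (k - i).
 by move=> ik; rewrite -exprD subnKC.
split => [N|e er].
 apply: (@le_trans _ _ (\sum_(0 <= k < N) \sum_(0 <= i < k.+1)
 (`|a i| * rho ^+ i) * (`|b (k - i)%N| * rho ^+ (k - i)))).
 apply: ler_sum => k _; rewrite -ler_pdivlMr ?exprn_gt0//.
 rewrite (le_trans (ler_norm_sum _ _ _))// mulr_suml !big_nat; apply: ler_sum => i /andP[_ ik].
 rewrite ler_pdivlMr ?exprn_gt0// normrM (split_pow rho i k ik).
 by rewrite mulrACA.
 rewrite (conv_sum (fun i j => (`|a i| * rho ^+ i) * (`|b j| * rho ^+ j))).
 apply: (@le_trans _ _ (\sum_(0 <= i < N) (`|a i| * rho ^+ i) * B)).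
 apply: ler_sum => i _; rewrite -mulr_sumr; apply: ler_wpM2l; last exact: b1.
 by rewrite mulr_ge0// exprn_ge0// ltW.
 by rewrite -mulr_suml ler_wpM2r.
have t01 : 0 <= `|e| / rho < 1 by rewrite divr_ge0 ?(ltW r0)//= ltr_pdivrMr// mul1r.
have [t0 t1] := andP t01.
have key N : `|(\sum_(0 <= i < N) a i * e ^+ i) * (\sum_(0 <= i < N) b i * e ^+ i) -
 \sum_(0 <= k < N) (\sum_(0 <= i < k.+1) a i * b (k - i)%N) * e ^+ k| <=
 A * B * (`|e| / rho) ^+ N.
 have -> : \sum_(0 <= k < N) (\sum_(0 <= i < k.+1) a i * b (k - i)%N) * e ^+ k =
 \sum_(0 <= i < N) \sum_(0 <= j < N - i) (a i * e ^+ i) * (b j * e ^+ j).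
 rewrite -(conv_sum (fun i j => (a i * e ^+ i) * (b j * e ^+ j))).
 apply: eq_bigr => k _; rewrite mulr_suml !big_nat; apply: eq_bigr => i /andP[_ ik].
 by rewrite (split_pow e i k ik) mulrACA.
 rewrite mulr_suml -sumrB.
 apply: (@le_trans _ _ (\sum_(0 <= i < N) (`|a i| * rho ^+ i) * (B * (`|e| / rho) ^+ N))); last first.
 by rewrite -mulr_suml -mulrA ler_wpM2r// mulr_ge0// exprn_ge0.
 rewrite (le_trans (ler_norm_sum _ _ _))// [leLHS]big_nat [leRHS]big_nat; apply: ler_sum => i /andP[_ iN].
 rewrite -mulr_sumr -mulrBr normrM.
 have -> : \sum_(0 <= j < N) b j * e ^+ j - \sum_(0 <= j < N - i) b j * e ^+ j =
 \sum_(N - i <= j < N) b j * e ^+ j.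
 by rewrite (big_cat_nat _ (leq_subr i N))//= addrAC subrr add0r.
 apply: (@le_trans _ _ (`|a i * e ^+ i| * (B * (`|e| / rho) ^+ (N - i)))).
 by rewrite ler_wpM2l//; apply: tail_le b1 => //; rewrite leq_subr.
 apply: eq_ler.
 rewrite normrM normrX (split_pow (`|e| / rho) i N (ltnW iN)) [(_ / _) ^+ i]expr_div_n.
 by field; rewrite expf_neq0// gt_eqF.
apply: (cvgn_sub0 (cvgM (a2 _ er) (b2 _ er))).
by apply: (cvgn_geometric_le t01 (B := A * B)) => N; rewrite sub0r normrN; exact: key.
Qed.

Lemma pwZ rho A a f : 0 < rho -> pw rho A f -> pw rho (`|a| * A) (fun e => a * f e).
Proof. by move=> r0 h; exact: pwM (pw_cst rho a) h. Qed.

Lemma pwN rho A f : 0 < rho -> pw rho A f -> pw rho A (fun e => - f e).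
Proof.
move=> r0 /(pwZ (-1) r0); rewrite normrN1 mul1r; apply: pw_ext => e _; by rewrite mulN1r.
Qed.

Lemma pwB rho A B f g : 0 < rho -> pw rho A f -> pw rho B g ->
 pw rho (A + B) (fun e => f e - g e).
Proof. by move=> r0 hf /(pwN r0); apply: pwD => //; exact: ltW. Qed.

Lemma pw_sum rho (I : Type) (r : seq I) (A : I -> R) (f : I -> R -> R) : 0 < rho ->
 (forall i, pw rho (A i) (f i)) ->
 pw rho (\sum_(i <- r) A i) (fun e => \sum_(i <- r) f i e).
Proof.
move=> r0 h; elim: r => [|i r IH].
 by rewrite big_nil; apply: pw_ext (pw_0 _) => e _; rewrite big_nil.
rewrite big_cons; apply: pw_ext (pwD (ltW r0) (h i) IH) => e _; by rewrite big_cons.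
Qed.

Lemma pwX rho A f k : 0 < rho -> pw rho A f -> pw rho (A ^+ k) (fun e => f e ^+ k).
Proof.
move=> r0 h; elim: k => [|k IH].
 by rewrite expr0 -[X in pw _ X _]normr1; exact: pw_cst.
by rewrite exprS; apply: pw_ext (pwM r0 h IH) => e _; rewrite exprS.
Qed.

(** Completeness of the weighted l1 norm: the coefficients of an absolutely summable series are
    summed degree by degree. The exponential, recentring, limits of Newton iterates and compositions
    are all obtained from it. *)
Lemma pw_series rho B (Bn : nat -> R) (g : nat -> R -> R) f : 0 < rho ->
 (forall n, pw rho (Bn n) (g n)) -> (forall N, \sum_(0 <= n < N) Bn n <= B) ->
 (forall e, `|e| < rho -> (fun N => \sum_(0 <= n < N) g n e) @ \oo --> f e) ->
 pw rho B f.
Proof.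
move=> r0 hg hB hf; have [c hc] := choice hg.
have Bn0 n : 0 <= Bn n by exact: pw_B0 (hg n).
have B0 : 0 <= B by have := hB 0%N; rewrite big_nil.
have cB n k : `|c n k| * rho ^+ k <= Bn n.
 have [h _] := hc n; apply: le_trans (h k.+1); rewrite big_nat_recr//= lerDr.
 by apply: sumr_ge0 => j _; rewrite mulr_ge0// exprn_ge0// ltW.
have cvgc k : cvgn (fun N => \sum_(0 <= n < N) c n k).
 apply: (@normed_cvg R R^o (fun n => c n k)).
 apply: nondecreasing_is_cvgn.
 by apply/nondecreasing_seqP => N; rewrite [leRHS]big_nat_recr//= lerDl.
 exists (B / rho ^+ k) => _ [N _ <-] /=; rewrite ler_pdivlMr ?exprn_gt0// mulr_suml.
 by apply: le_trans (hB N); apply: ler_sum => n _; exact: cB.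
pose C k := limn (fun N => \sum_(0 <= n < N) c n k).
have hC k : (fun N => \sum_(0 <= n < N) c n k) @ \oo --> C k by exact: cvgc.
exists C; split => [K|e er].
 have h : (fun N => \sum_(0 <= k < K) `|\sum_(0 <= n < N) c n k| * rho ^+ k) @ \oo -->
 \sum_(0 <= k < K) `|C k| * rho ^+ k.
 by apply: cvgn_sum => k; apply: cvgMl; exact: cvg_norm.
 apply: (cvgn_le h) => N; apply: le_trans (hB N).
 apply: (@le_trans _ _ (\sum_(0 <= k < K) \sum_(0 <= n < N) `|c n k| * rho ^+ k)).
 apply: ler_sum => k _; rewrite -mulr_suml ler_wpM2r ?exprn_ge0 ?(ltW r0)//.
 exact: ler_norm_sum.
 by rewrite exchange_big/=; apply: ler_sum => n _; have [h1 _] := hc n; exact: h1.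
have t01 : 0 <= `|e| / rho < 1 by rewrite divr_ge0 ?(ltW r0)//= ltr_pdivrMr// mul1r.
have [t0 t1] := andP t01.
apply: (cvgn_geometric_le t01 (B := B)) => K.
have h : (fun N => `|\sum_(0 <= n < N) g n e - \sum_(0 <= k < K) (\sum_(0 <= n < N) c n k) * e ^+ k|)
 @ \oo --> `|f e - \sum_(0 <= k < K) C k * e ^+ k|.
 apply: cvg_norm; apply: cvgB; first exact: hf.
 by apply: cvgn_sum => k; exact: cvgMl.
apply: (cvgn_le h) => N.
have -> : \sum_(0 <= k < K) (\sum_(0 <= n < N) c n k) * e ^+ k =
 \sum_(0 <= n < N) \sum_(0 <= k < K) c n k * e ^+ k.
 by rewrite exchange_big/=; apply: eq_bigr => k _; rewrite mulr_suml.
rewrite -sumrB (le_trans (ler_norm_sum _ _ _))//.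
apply: (@le_trans _ _ (\sum_(0 <= n < N) Bn n * (`|e| / rho) ^+ K)).
 apply: ler_sum => n _; have [h1 h2] := hc n; exact: series_tail (h2 _ er).
by rewrite -mulr_suml ler_wpM2r// exprn_ge0.
Qed.

Implicit Types h : R -> R.

Lemma cvgn_shift2 (u : nat -> R) (l : R) : u @ \oo --> l -> (fun n => u n.+2) @ \oo --> l.
Proof.
move=> ul; have -> : (fun n => u n.+2) = (fun n => u (n + 2)%N) by apply/funext => n; rewrite addn2.
by move: ul; rewrite -(cvg_shiftn 2).
Qed.

Lemma cvg_expR (x : R) : series (exp_coeff x) @ \oo --> expR x.
Proof. exact: is_cvg_series_exp_coeff. Qed.

Lemma series_expR_le (x : R) N : 0 <= x -> \sum_(0 <= k < N) x ^+ k / k`!%:R <= expR x.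
Proof.
move=> x0; apply: (nondecreasing_cvgn_le (u_ := series (exp_coeff x))).
 by apply/nondecreasing_seqP => n; rewrite seriesSr lerDl exp_coeff_ge0.
exact: is_cvg_series_exp_coeff.
Qed.

Lemma pw_expR rho B h : 0 < rho -> pw rho B h -> pw rho (expR B) (fun e => expR (h e)).
Proof.
move=> r0 ph; have B0 := pw_B0 ph.
apply: (pw_series (Bn := fun k => B ^+ k / k`!%:R) (g := fun k e => h e ^+ k / k`!%:R)) => //.
- move=> k; rewrite -[X in pw _ (_ / X)]ger0_norm// -normfV.
 exact: pwM (pwX k r0 ph) (pw_cst _ _).
- by move=> N; exact: series_expR_le.
- by move=> e _; exact: cvg_expR.
Qed.

(** The second-order remainder of the exponential factors through [h ^+ 2] with a bounded cofactor,
    which is what strict differentiability of the exponential needs. *)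
Lemma pw_expR2 rho B h : 0 < rho -> pw rho B h -> exists2 chi, pw rho (expR B) chi &
 forall e, expR (h e) = 1 + h e + h e * (h e * chi e).
Proof.
move=> r0 ph; have B0 := pw_B0 ph.
(* The value at a zero of [h] is the constant term of [(expR x - 1 - x) / x ^+ 2 = \sum x ^+ k / (k
   + 2)!]. *)
pose chi e := if h e == 0 then 2^-1 else (expR (h e) - 1 - h e) / h e ^+ 2.
exists chi; last first.
 move=> e; rewrite /chi; case: eqVneq => [->|h0]; first by rewrite expR0 !mul0r !addr0.
 by field.
apply: (pw_series (Bn := fun k => B ^+ k / (k.+2)`!%:R) (g := fun k e => h e ^+ k / (k.+2)`!%:R)) => //.
- move=> k; rewrite -[X in pw _ (_ / X)]ger0_norm// -normfV.
 exact: pwM (pwX k r0 ph) (pw_cst _ _).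
- move=> N; apply: le_trans (series_expR_le N B0); apply: ler_sum => k _.
 rewrite ler_wpM2l ?exprn_ge0// lef_pV2 ?posrE ?ltr0n ?fact_gt0// ler_nat.
 by rewrite !factS mulnA leq_pmull.
- move=> e _; rewrite /chi; case: eqVneq => [h0|h0].
 rewrite -cvg_shiftS; apply: cvg_near_cst; apply: nearW => N.
 rewrite /= big_nat_recl//= expr0 mul1r big1 ?addr0// => k _.
 by rewrite h0 expr0n mul0r.
 have -> : (fun N => \sum_(0 <= n < N) h e ^+ n / (n.+2)`!%:R) =
 (fun N => (series (exp_coeff (h e)) N.+2 - 1 - h e) / h e ^+ 2).
 apply/funext => N; rewrite /series/= big_nat_recl//= big_nat_recl//= /exp_coeff/= expr0 expr1.
 rewrite fact0 factS fact0 !divr1.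
 set X := (X in _ + (_ + X)); have -> : 1 + (h e + X) - 1 - h e = X by ring.
 rewrite /X mulr_suml.
 by apply: eq_bigr => k _; rewrite !exprS; field; rewrite h0 pnatr_eq0 -lt0n fact_gt0.
 apply: cvgMr_tmp; apply: cvgB; last exact: cvg_cst.
 apply: cvgB; last exact: cvg_cst.
 exact: (cvgn_shift2 (@cvg_expR (h e))).
Qed.

Lemma pw_shift (rho B : R) f (e0 : R) : `|e0| < rho -> pw rho B f ->
 pw (rho - `|e0|) B (fun t => f (e0 + t)).
Proof.
move=> er [c [c1 c2]]; have r1 : 0 < rho - `|e0| by rewrite subr_gt0.
apply: (pw_series (Bn := fun k => `|c k| * rho ^+ k) (g := fun k t => c k * (e0 + t) ^+ k)) => //.
- move=> k; apply: pwZ => //; apply: pwX => //.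
 by have := pwD (ltW r1) (pw_cst _ e0) (pw_id r1); rewrite subrKC.
- move=> e he; apply: c2; apply: le_lt_trans (ler_normD _ _) _; lra.
Qed.

End power_series.

(** * Strict differentiability along curves of power series *)

Section analytic_implicit.
Context {R : realType} {V : vectType R}.
Implicit Types (x y z : R -> V) (l : V -> R).

Let b := vbasis {:V}.

Definition pwV (rho B : R) x := forall j, pw rho B (fun e => coord b j (x e)).

Definition lin l := forall (a : R) (u v : V), l (a *: u + v) = a * l u + l v.

Lemma lin0 l : lin l -> l 0 = 0.
Proof. by move=> h; have := h 1 0 0; rewrite scale1r addr0 mul1r; lra. Qed.

Lemma linD l u v : lin l -> l (u + v) = l u + l v.
Proof. by move=> h; have := h 1 u v; rewrite scale1r mul1r. Qed.

Lemma linZ l a u : lin l -> l (a *: u) = a * l u.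
Proof. by move=> h; have := h a u 0; rewrite addr0 (lin0 h) addr0. Qed.

Lemma linB l u v : lin l -> l (u - v) = l u - l v.
Proof. by move=> h; rewrite linD// -scaleN1r linZ// mulN1r. Qed.

Lemma lin_sum l (I : Type) (r : seq I) (F : I -> V) : lin l ->
 l (\sum_(i <- r) F i) = \sum_(i <- r) l (F i).
Proof.
move=> h; elim: r => [|i r IH]; first by rewrite !big_nil lin0.
by rewrite !big_cons linD// IH.
Qed.

Lemma lin_coord l v : lin l -> l v = \sum_j coord b j v * l b`_j.
Proof.
move=> h; rewrite {1}(coord_vbasis (memvf v)) lin_sum//.
by apply: eq_bigr => j _; rewrite linZ.
Qed.

Definition lnorm l : R := \sum_(j < \dim {:V}) `|l b`_j|.

Lemma lnorm_ge0 l : 0 <= lnorm l.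
Proof. exact: sumr_ge0. Qed.

Lemma pw_lin rho D x l : 0 < rho -> lin l -> pwV rho D x -> pw rho (lnorm l * D) (fun e => l (x e)).
Proof.
move=> r0 h px; have -> : (fun e => l (x e)) = (fun e => \sum_(j < \dim {:V}) l b`_j * coord b j (x e)).
 by apply/funext => e; rewrite lin_coord//; apply: eq_bigr => j _; rewrite mulrC.
by rewrite /lnorm mulr_suml; apply: pw_sum => // j; exact: pwZ.
Qed.

Lemma lin_coordj j : lin (coord b j).
Proof. by move=> a u v; rewrite linearP. Qed.

Lemma pwV_le rho A B x : A <= B -> pwV rho A x -> pwV rho B x.
Proof. by move=> AB px j; exact: pw_le (px j). Qed.

Variable z0 : V.

(* Analytic with value [f0] and partial differential [l] in [V] at [(0, z0)], read on curves
 of convergent power series. *)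
Definition Anl (F : R -> V -> R) (f0 : R) l : Prop := lin l /\
 forall eps, 0 < eps -> exists2 dl, 0 < dl & forall rho x y D, 0 < rho <= dl -> 0 <= D ->
 pwV rho dl (fun e => x e - z0) -> pwV rho dl (fun e => y e - z0) ->
 pwV rho D (fun e => x e - y e) ->
 pw rho (eps * D) (fun e => F e (x e) - F e (y e) - l (x e - y e)) /\
 pw rho eps (fun e => F e (x e) - f0).

Lemma Anl_ext F G f g l k : Anl F f l -> (forall e v, F e v = G e v) -> f = g ->
 (forall v, l v = k v) -> Anl G g k.
Proof.
move=> h FG <- lk; have -> : k = l by apply/funext => v.
by have -> : G = F by apply/funext => e; apply/funext => v; rewrite FG.
Qed.

Lemma lin_cst0 : lin (fun=> 0).
Proof. by move=> *; rewrite mulr0 addr0. Qed.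

Lemma Anl_cst a : Anl (fun _ _ => a) a (fun=> 0).
Proof.
split; first exact: lin_cst0.
move=> eps e0; exists 1 => // rho x y D _ D0 _ _ _; rewrite subrr subrr; split.
 by apply: pw_le (pw_0 _); rewrite mulr_ge0// ltW.
by apply: pw_le (pw_0 _); rewrite ltW.
Qed.

Lemma Anl_e : Anl (fun e _ => e) 0 (fun=> 0).
Proof.
split; first exact: lin_cst0.
move=> eps e0; exists eps => // rho x y D /andP[r0 re] D0 _ _ _; split.
 apply: (@pw_ext _ _ _ (fun=> 0)) => [e _|]; first by rewrite subrr subrr.
 by apply: pw_le (pw_0 _); rewrite mulr_ge0// ltW.
by apply: pw_le re _; apply: pw_ext (pw_id r0) => e _; rewrite subr0.
Qed.

Lemma Anl_lin l : lin l -> Anl (fun _ v => l v) (l z0) l.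
Proof.
move=> h; split => // eps e0; have L0 := lnorm_ge0 l.
exists (eps / (lnorm l + 1)); first by rewrite divr_gt0// ltr_wpDl.
move=> rho x y D /andP[r0 re] D0 px py _; split.
 apply: (@pw_ext _ _ _ (fun=> 0)) => [e _|]; first by rewrite [X in _ - X]linB// subrr.
 by apply: pw_le (pw_0 _); rewrite mulr_ge0// ltW.
apply: pw_ext (pw_le _ (pw_lin r0 h px)) => [e _|]; first by rewrite linB.
by rewrite mulrA ler_pdivrMr ?ltr_wpDl//; nra.
Qed.

Lemma pwV_min rho d1 d2 x : pwV rho (Num.min d1 d2) x -> pwV rho d1 x /\ pwV rho d2 x.
Proof.
by move=> px; split; apply: pwV_le px; rewrite ge_min lexx ?orbT.
Qed.

Lemma AnlD F G f g l k : Anl F f l -> Anl G g k ->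
 Anl (fun e v => F e v + G e v) (f + g) (fun v => l v + k v).
Proof.
move=> [hl hF] [hk hG]; split; first by move=> a u v; rewrite hl hk; ring.
move=> eps e0; have e20 : 0 < eps / 2 by rewrite divr_gt0.
have [d1 d10 h1] := hF _ e20; have [d2 d20 h2] := hG _ e20.
exists (Num.min d1 d2); first by rewrite lt_min d10.
move=> rho x y D; rewrite le_min => /and3P[r0 r1 r2] D0 /pwV_min[x1 x2] /pwV_min[y1 y2] xy.
have [|a1 a2] := h1 rho x y D _ D0 x1 y1 xy; first by rewrite r0.
have [|b1 b2] := h2 rho x y D _ D0 x2 y2 xy; first by rewrite r0.
split.
 apply: pw_ext (pw_le _ (pwD (ltW r0) a1 b1)) => [e _|]; first by ring.
 by rewrite -mulrDl; apply: ler_wpM2r => //; lra.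
apply: pw_ext (pw_le _ (pwD (ltW r0) a2 b2)) => [e _|]; first by ring.
lra.
Qed.

Lemma AnlM F G f g l k : Anl F f l -> Anl G g k ->
 Anl (fun e v => F e v * G e v) (f * g) (fun v => f * k v + g * l v).
Proof.
move=> [hl hF] [hk hG]; split; first by move=> a u v; rewrite hl hk; ring.
move=> eps e0; have L0 := lnorm_ge0 l; have K0 := lnorm_ge0 k.
(* The error of the product is split into four terms, each a remainder or a deviation of norm at
   most [ep] times a bounded factor; [C] adds up those factors. *)
pose C := `|f| + `|g| + 2 + lnorm l + lnorm k.
have C0 : 0 < C by rewrite /C; have := normr_ge0 f; have := normr_ge0 g; lra.
pose ep := Num.min 1 (eps / C).
have ep0 : 0 < ep by rewrite lt_min ltr01 divr_gt0.
have ep1 : ep <= 1 by rewrite ge_min lexx.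
have epC : ep * C <= eps by rewrite -ler_pdivlMr// ge_min lexx orbT.
have [d1 d10 h1] := hF _ ep0; have [d2 d20 h2] := hG _ ep0.
exists (Num.min d1 d2); first by rewrite lt_min d10.
move=> rho x y D; rewrite le_min => /and3P[r0 r1 r2] D0 /pwV_min[x1 x2] /pwV_min[y1 y2] xy.
have [|a1 a2] := h1 rho x y D _ D0 x1 y1 xy; first by rewrite r0.
have [|b1 b2] := h2 rho x y D _ D0 x2 y2 xy; first by rewrite r0.
have yy : pwV rho 0 (fun e => y e - y e).
 by move=> j; apply: pw_ext (pw_0 _) => e _; rewrite subrr linear0.
have [|_ c2] := h1 rho y y 0 _ (lexx 0) y1 y1 yy; first by rewrite r0.
have lxy := pw_lin r0 hl xy; have kxy := pw_lin r0 hk xy.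
have bdd (H : R -> V -> R) (w : R -> V) (h : R) : pw rho ep (fun e => H e (w e) - h) ->
 pw rho (`|h| + 1) (fun e => H e (w e)).
 move=> p; apply: pw_ext (pw_le _ (pwD (ltW r0) (pw_cst _ h) p)) => [e _|]; last by lra.
 by rewrite subrKC.
have Gx := bdd _ _ _ b2; have Fy := bdd _ _ _ c2.
have f0 := normr_ge0 f; have g0 := normr_ge0 g.
split.
 apply: pw_ext (pw_le _ (pwD (ltW r0) (pwD (ltW r0) (pwM r0 a1 Gx) (pwM r0 lxy b2))
 (pwD (ltW r0) (pwM r0 Fy b1) (pwM r0 c2 kxy)))) => [e _|]; first by ring.
 apply: (@le_trans _ _ (ep * C * D)); last by rewrite ler_wpM2r.
 by apply: eq_ler; rewrite /C; ring.
apply: pw_ext (pw_le _ (pwD (ltW r0) (pwM r0 a2 Gx) (pwM r0 (pw_cst _ f) b2))) => [e _|]; first by ring.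
by apply: le_trans epC; rewrite /C; nra.
Qed.

Lemma Anl_exp F f l : Anl F f l -> Anl (fun e v => expR (F e v)) (expR f) (fun v => expR f * l v).
Proof.
move=> [hl hF]; split; first by move=> a u v; rewrite hl; ring.
move=> eps e0; have L0 := lnorm_ge0 l.
pose q : R := expR f; pose q1 : R := expR 1; pose q2 : R := expR 2.
have q0 : 0 < q by exact: expR_gt0. have q10 : 0 < q1 by exact: expR_gt0.
have q20 : 0 < q2 by exact: expR_gt0.
(* With [D] the increment of [F], the error is [E (e^D - 1 - D) + E (D - l) + (E - q) l], where [E]
   is the exponential at [y]. The constant [C] collects the three norms and the bound on the
   value. *)
pose C := q * (q1 * ((1 + lnorm l) * (2 * q2)) + q1 + (1 + q1) * lnorm l + (1 + q1)).
have s1 : 0 <= q1 * ((1 + lnorm l) * (2 * q2)).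
 by apply: mulr_ge0; [exact: ltW|apply: mulr_ge0; [lra|apply: mulr_ge0 => //; exact: ltW]].
have s2 : 0 <= (1 + q1) * lnorm l by apply: mulr_ge0 => //; lra.
have C0 : 0 < C by apply: mulr_gt0 => //; lra.
pose ep := Num.min 1 (eps / C).
have ep0 : 0 < ep by rewrite lt_min ltr01 divr_gt0.
have ep1 : ep <= 1 by rewrite ge_min lexx.
have epC : ep * C <= eps by rewrite -ler_pdivlMr// ge_min lexx orbT.
have [dl dl0 h] := hF _ ep0; exists dl => // rho x y D rr D0 px py xy.
have /andP[r0 _] := rr; have r0' := ltW r0.
have [a1 a2] := h rho x y D rr D0 px py xy.
have yy : pwV rho 0 (fun e => y e - y e).
 by move=> j; apply: pw_ext (pw_0 _) => e _; rewrite subrr linear0.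
have [_ b2] := h rho y y 0 rr (lexx 0) py py yy.
have lxy := pw_lin r0 hl xy.
have expo u : pw rho ep u -> pw rho ((1 + q1) * ep) (fun e => expR (u e) - 1).
 move=> pu; have [chi pc ec] := pw_expR2 r0 pu.
 apply: pw_ext (pw_le _ (pwD r0' pu (pwM r0 pu (pwM r0 pu pc)))) => [e _|].
 by rewrite ec; ring.
 have : expR ep <= q1 by rewrite ler_expR.
 rewrite mulrA -expr2; have : ep ^+ 2 <= ep by rewrite expr2 ler_piMr// ltW.
 by have := expR_gt0 ep; nra.
have close w : pw rho ep (fun e => F e (w e) - f) ->
 pw rho (q * ((1 + q1) * ep)) (fun e => expR (F e (w e)) - q).
 move=> p; apply: pw_ext (pw_le _ (pwM r0 (pw_cst _ q) (expo _ p))) => [e _|]; last first.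
 by rewrite ger0_norm// ltW.
 by rewrite mulrBr mulr1 -expRD subrKC.
have Ey : pw rho (q * q1) (fun e => expR (F e (y e))).
 have p := pwM r0 (pw_cst _ q) (pw_expR r0 b2).
 apply: pw_ext (pw_le _ p) => [e _|]; first by rewrite -expRD subrKC.
 by rewrite ger0_norm ?(ltW q0)// ler_pM2l// ler_expR.
have D1 : pw rho ((ep + lnorm l) * D) (fun e => F e (x e) - F e (y e)).
 by apply: pw_ext (pw_le _ (pwD r0' a1 lxy)) => [e _|]; [rewrite subrK|rewrite mulrDl].
have D2 : pw rho (2 * ep) (fun e => F e (x e) - F e (y e)).
 by apply: pw_ext (pw_le _ (pwB r0 a2 b2)) => [e _|]; [ring|lra].
have [chi pc ec] := pw_expR2 r0 D2.
split; last first.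
 apply: pw_le (close _ a2); apply: le_trans epC.
 rewrite /C [leLHS](_ : _ = ep * (q * (1 + q1))); last by ring.
 rewrite ler_pM2l// ler_pM2l//; lra.
apply: pw_ext (pw_le _ (pwD r0' (pwD r0' (pwM r0 Ey (pwM r0 D1 (pwM r0 D2 pc)))
 (pwM r0 Ey a1)) (pwM r0 (close _ b2) lxy))) => [e _|].
 have -> : expR (F e (x e)) = expR (F e (y e)) * expR (F e (x e) - F e (y e)).
 by rewrite -expRD subrKC.
 by rewrite ec -/q; ring.
have e2 : expR (2 * ep) <= q2 by rewrite ler_expR; lra.
have e20 := expR_gt0 (2 * ep).
apply: (@le_trans _ _ (ep * C * D)); last by rewrite ler_wpM2r.
apply: (@le_trans _ _ (ep * D * (q * (q1 * ((1 + lnorm l) * (2 * q2)) + q1 + (1 + q1) * lnorm l)))); last first.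
 rewrite [leRHS]mulrAC ler_wpM2l ?mulr_ge0 ?(ltW ep0)// /C ler_pM2l//; lra.
have -> : q * q1 * ((ep + lnorm l) * D * (2 * ep * expR (2 * ep))) + q * q1 * (ep * D) +
 q * ((1 + q1) * ep) * (lnorm l * D) = ep * D * (q * (q1 * ((ep + lnorm l) * (2 * expR (2 * ep))) + q1 + (1 + q1) * lnorm l)).
 by ring.
rewrite ler_wpM2l ?mulr_ge0 ?(ltW ep0)// ler_pM2l// lerD2r lerD2r ler_pM2l//.
by apply: ler_pM; rewrite ?addr_ge0 ?mulr_ge0 ?(ltW ep0) ?(ltW e20)//; lra.
Qed.

Lemma Anl_sum (I : Type) (r : seq I) (F : I -> R -> V -> R) (f : I -> R) (l : I -> V -> R) :
 (forall i, Anl (F i) (f i) (l i)) ->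
 Anl (fun e v => \sum_(i <- r) F i e v) (\sum_(i <- r) f i) (fun v => \sum_(i <- r) l i v).
Proof.
move=> h; elim: r => [|i r IH].
 by apply: Anl_ext (Anl_cst 0) _ _ _ => *; rewrite big_nil.
by apply: Anl_ext (AnlD (h i) IH) _ _ _ => *; rewrite big_cons.
Qed.

Lemma AnlZ F f l a : Anl F f l -> Anl (fun e v => a * F e v) (a * f) (fun v => a * l v).
Proof.
by move=> h; apply: Anl_ext (AnlM (Anl_cst a) h) _ _ _ => // v; rewrite mulr0 addr0.
Qed.

Lemma AnlB F G f g l k : Anl F f l -> Anl G g k ->
 Anl (fun e v => F e v - G e v) (f - g) (fun v => l v - k v).
Proof.
by move=> hF /(AnlZ (-1)) hG; apply: Anl_ext (AnlD hF hG) _ _ _ => *; rewrite mulN1r.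
Qed.

End analytic_implicit.

(** * The analytic implicit function theorem; rules for maps with values in vectors and matrices *)

Section implicit_function.
Context {R : realType} {V : vectType R}.

Lemma linear_inverse (L : V -> V) : (forall a u v, L (a *: u + v) = a *: L u + L v) ->
 (forall v, L v = 0 -> v = 0) ->
 exists P : V -> V, [/\ forall a u v, P (a *: u + v) = a *: P u + P v,
 forall v, P (L v) = v & forall v, P v = 0 -> v = 0].
Proof.
move=> hL injL; pose L' : {linear V -> V} := HB.pack L (GRing.isLinear.Build R V V _ L hL).
pose f := linfun L'; have fE v : f v = L v by rewrite lfunE.
have kf : lker f == 0%VS.
 apply/lker0P => u v; rewrite !fE => e; apply/eqP; rewrite -subr_eq0; apply/eqP/injL.
 by have := hL (-1) v u; rewrite !scaleN1r addrC => ->; rewrite e addNr.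
exists (f^-1)%VF; split.
- by move=> a u v; rewrite linearP.
- by move=> v; rewrite -fE; exact: lker0_lfunK.
- by move=> v e; rewrite -(lker0_lfunVK kf v) e linear0.
Qed.

Lemma geometric_half_sum (a : R) N : 0 <= a -> \sum_(0 <= n < N) a * 2^-1 ^+ n.+1 <= a.
Proof.
move=> a0; have -> : \sum_(0 <= n < N) a * 2^-1 ^+ n.+1 = a * (1 - 2^-1 ^+ N).
 elim: N => [|N IH]; first by rewrite big_nil expr0 subrr mulr0.
 by rewrite big_nat_recr//= IH exprS; field.
by rewrite ler_piMr// gerBl exprn_ge0.
Qed.

Lemma half_pow_small (a : R) (x : R) : (forall n, `|x| <= a * 2^-1 ^+ n) -> x = 0.
Proof.
move=> h; have t : (0 <= 2^-1 :> R) && (2^-1 < 1 :> R) by apply/andP; split; lra.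
have : (fun=> 0 : R) @ \oo --> x.
 by apply: (cvgn_geometric_le t (B := a)) => n; rewrite subr0.
by move=> /(cvg_unique _ (cvg_cst _)) ->.
Qed.

Let b := vbasis {:V}.

Lemma coord_eq0 (v : V) : (forall j, coord b j v = 0) -> v = 0.
Proof. by move=> h; rewrite (coord_vbasis (memvf v)) big1// => j _; rewrite h scale0r. Qed.

(* Newton iteration with a frozen differential, in the weighted l1 norm. *)
Theorem analytic_implicit (z0 : V) (G : R -> V -> V) (L : V -> V) :
 (forall j, Anl z0 (fun e v => coord b j (G e v)) 0 (fun v => coord b j (L v))) ->
 (forall a u v, L (a *: u + v) = a *: L u + L v) -> (forall v, L v = 0 -> v = 0) ->
 forall eps, 0 < eps -> exists rho z, [/\ 0 < rho, rho <= eps,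
 pwV rho eps (fun e => z e - z0) & forall e, `|e| < rho -> G e (z e) = 0].
Proof.
move=> hG hL injL eps e0; have [P [linP PL Pinj]] := linear_inverse hL injL.
have lP j : lin (fun v => coord b j (P v)) by move=> a u v; rewrite linP linearP.
pose C := \sum_(j < \dim {:V}) lnorm (fun v => coord b j (P v)).
have Cj j : lnorm (fun v => coord b j (P v)) <= C.
 by rewrite /C (bigD1 j)//= lerDl; apply: sumr_ge0 => i _; exact: lnorm_ge0.
have C0 : 0 <= C by apply: sumr_ge0 => i _; exact: lnorm_ge0.
have cP rho B (x : R -> V) : 0 < rho -> 0 <= B -> pwV rho B x -> pwV rho (C * B) (fun e => P (x e)).
 move=> r0 B0 px j; apply: pw_le (pw_lin r0 (lP j) px); exact: ler_wpM2r.
have unif ep : 0 < ep -> exists2 dl, 0 < dl & forall rho x y D, 0 < rho <= dl -> 0 <= D ->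
 pwV rho dl (fun e => x e - z0) -> pwV rho dl (fun e => y e - z0) ->
 pwV rho D (fun e => x e - y e) ->
 pwV rho (ep * D) (fun e => G e (x e) - G e (y e) - L (x e - y e)) /\
 pwV rho ep (fun e => G e (x e)).
 move=> ep0; have hd j := cid2 ((hG j).2 _ ep0).
 pose d j := s2val (hd j).
 pose dl := \big[Num.min/1]_(j < \dim {:V}) d j.
 have dlj j : dl <= d j by exact: bigmin_le_cond.
 exists dl; first by apply: lt_bigmin => // j _; exact: s2valP (hd j).
 move=> rho x y D /andP[r0 rd] D0 px py xy.
 have h j := s2valP' (hd j) rho x y D.
 have rj j : 0 < rho <= d j by rewrite r0 (le_trans rd).
 have hj j := h j (rj j) D0 (pwV_le (dlj j) px) (pwV_le (dlj j) py) xy.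
 split => j; have [h1 h2] := hj j.
 by apply: pw_ext h1 => e _; rewrite linearB/= linearB.
 by apply: pw_ext h2 => e _; rewrite subr0.
(* [C] bounds the inverse differential [P], so on the chosen ball the map [x - P (G x)] contracts by
   one half. *)
pose ep := (2 * (C + 1))^-1.
have C10 : 0 < C + 1 by rewrite ltr_wpDl.
have ep0 : 0 < ep by rewrite invr_gt0 mulr_gt0.
have Cep : C * ep <= 2^-1 by rewrite /ep invfM mulrCA ler_piMr// ler_pdivrMr//; lra.
have [dl' dl'0 h'] := unif ep ep0.
pose dl := Num.min dl' eps.
have dl0 : 0 < dl by rewrite lt_min dl'0.
have ddl : dl <= dl' by rewrite ge_min lexx.
(* A second, smaller radius in [e] makes the residual at [z0] at most [ep * dl]. The first Newton
   step is then at most [dl / 2], and no iterate leaves the ball of radius [dl]. *)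
have [dl2 dl20 h2] := unif (ep * dl) (mulr_gt0 ep0 dl0).
pose rho := Num.min dl dl2.
have r0 : 0 < rho by rewrite lt_min dl0.
have rdl : rho <= dl by rewrite ge_min lexx.
have h x y D : 0 <= D -> pwV rho dl (fun e => x e - z0) -> pwV rho dl (fun e => y e - z0) ->
 pwV rho D (fun e => x e - y e) ->
 pwV rho (ep * D) (fun e => G e (x e) - G e (y e) - L (x e - y e)).
 move=> D0 px py xy; have [|//] := h' rho x y D _ D0 (pwV_le ddl px) (pwV_le ddl py) xy.
 by rewrite r0 (le_trans rdl).
pose T (x : R -> V) e := x e - P (G e (x e)).
pose X n := iter n T (fun=> z0).
pose dd n : R := dl * 2^-1 ^+ n.+1.
have dd0 n : 0 <= dd n by rewrite mulr_ge0 ?exprn_ge0// ltW.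
have PB u v : P (u - v) = P u - P v.
 by have := linP (-1) v u; rewrite !scaleN1r addrC [in RHS]addrC.
have zz : pwV rho 0 (fun e => z0 - z0).
 by move=> j; apply: pw_ext (pw_0 _) => e _; rewrite subrr linear0.
have zd : pwV rho dl2 (fun e => z0 - z0) by apply: pwV_le zz; exact: ltW.
have pG0 : pwV rho (ep * dl) (fun e => G e z0).
 have [|_ //] := h2 rho (fun=> z0) (fun=> z0) 0 _ (lexx 0) zd zd zz.
 by rewrite r0 ge_min lexx orbT.
have telesc n j e : coord b j (X n e - z0) = \sum_(0 <= i < n) coord b j (X i.+1 e - X i e).
 elim: n => [|n IH]; first by rewrite big_nil subrr linear0.
 by rewrite big_nat_recr//= -IH -linearD/=; congr coord; rewrite [RHS]addrC addrA subrK.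
have sum_le n : \sum_(0 <= i < n) dd i <= dl by apply: geometric_half_sum; exact: ltW.
have near n : (forall i, (i < n)%N -> pwV rho (dd i) (fun e => X i.+1 e - X i e)) ->
 pwV rho dl (fun e => X n e - z0).
 move=> hi j; apply: pw_le (sum_le n) _.
 apply: (@pw_ext _ _ _ (fun e => \sum_(0 <= i < n) coord b j (X i.+1 e - X i e))).
 by move=> e _; rewrite telesc.
 elim: n hi => [|n IH] hi.
 by rewrite big_nil; apply: pw_ext (pw_0 _) => e _; rewrite big_nil.
 rewrite big_nat_recr//=.
 have h1 := IH (fun i ii => hi i (ltnW ii)).
 by apply: pw_ext (pwD (ltW r0) h1 (hi n (ltnSn n) j)) => e _; rewrite big_nat_recr.
have newt m e : P (G e (X m e)) = X m e - X m.+1 e by rewrite /X/= /T subKr.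
have step n : pwV rho (dd n) (fun e => X n.+1 e - X n e).
 elim/ltn_ind: n => -[|n] IH.
 have := cP _ _ _ r0 (mulr_ge0 (ltW ep0) (ltW dl0)) pG0.
 move=> p j; apply: pw_ext (pw_le _ (pwN r0 (p j))) => [e _|].
 by rewrite /X/= /T addrAC subrr add0r linearN.
 by rewrite mulrA /dd expr1 [leRHS]mulrC ler_wpM2r// ltW.
 have p1 : pwV rho dl (fun e => X n.+1 e - z0) by exact: near.
 have p0 : pwV rho dl (fun e => X n e - z0).
 by apply: near => i ii; apply: IH; exact: ltnW.
 have p := cP _ _ _ r0 (mulr_ge0 (ltW ep0) (dd0 n)) (h _ _ _ (dd0 n) p1 p0 (IH n (ltnSn n))).
 move=> j; apply: pw_ext (pw_le _ (pwN r0 (p j))) => [e _|].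
 by rewrite !PB PL !newt -[X n.+1 e - X n e]opprB opprK subrK -linearN opprB.
 have -> : dd n.+1 = 2^-1 * dd n by rewrite /dd [2^-1 ^+ n.+2]exprS mulrCA.
 by rewrite mulrA ler_wpM2r.
have nearn n : pwV rho dl (fun e => X n e - z0) by apply: near => i _; exact: step.
have cvgX e j : `|e| < rho -> cvgn (fun n => coord b j (X n e)).
 move=> er; have : cvgn (fun n => \sum_(0 <= i < n) coord b j (X i.+1 e - X i e)).
 apply: (@normed_cvg R R^o (fun i => coord b j (X i.+1 e - X i e))).
 apply: nondecreasing_is_cvgn.
 by apply/nondecreasing_seqP => N; rewrite [leRHS]big_nat_recr//= lerDl.
 exists dl => _ [N _ <-] /=; apply: le_trans (sum_le N); apply: ler_sum => i _.
 exact: (pw_norm (step i j) er).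
 move=> hc; have -> : (fun n => coord b j (X n e)) =
 (fun n => \sum_(0 <= i < n) coord b j (X i.+1 e - X i e) + coord b j z0).
 by apply/funext => n; rewrite -telesc -linearD/= subrK.
 by apply: is_cvgD => //; exact: is_cvg_cst.
pose z e := \sum_(j < \dim {:V}) limn (fun n => coord b j (X n e)) *: b`_j.
have fb : free b by exact: basis_free (vbasisP _).
have zE e j : coord b j (z e) = limn (fun n => coord b j (X n e)) by rewrite coord_sum_free.
have tail n : pwV rho (dl * 2^-1 ^+ n) (fun e => z e - X n e).
 move=> j; apply: (pw_series (Bn := fun k => dd (n + k)%N)
 (g := fun k e => coord b j (X (n + k).+1 e - X (n + k)%N e))) => //.
 - by move=> k; exact: step.
 - move=> N; have a0 : 0 <= dl * 2^-1 ^+ n by rewrite mulr_ge0 ?exprn_ge0// ltW.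
 apply: le_trans (geometric_half_sum N a0); apply: eq_ler.
 by apply: eq_bigr => k _; rewrite /dd -addnS exprD mulrA.
 - move=> e er.
 have -> : (fun N => \sum_(0 <= k < N) coord b j (X (n + k).+1 e - X (n + k)%N e)) =
 (fun N => coord b j (X (N + n)%N e) - coord b j (X n e)).
 apply/funext; elim => [|N IH]; first by rewrite big_nil subrr.
 rewrite big_nat_recr// IH (addnC N.+1 n) addnS (addnC N n).
 have -> : coord b j (X (n + N).+1 e - X (n + N)%N e) =
 coord b j (X (n + N).+1 e) - coord b j (X (n + N)%N e) by exact: linearB.
 by rewrite [LHS]addrC addrA subrK.
 have -> : coord b j (z e - X n e) = coord b j (z e) - coord b j (X n e) by exact: linearB.
 apply: cvgB; last exact: cvg_cst.
 by rewrite (cvg_shiftn n (fun N => coord b j (X N e))) zE; exact: cvgX.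
exists rho, z; split => //.
- by rewrite (le_trans rdl)// ge_min lexx orbT.
- apply: pwV_le (tail 0%N); by rewrite expr0 mulr1 ge_min lexx orbT.
move=> e er; apply: Pinj; apply: coord_eq0 => j.
apply: (half_pow_small (a := 3 * dl)) => n.
have tn := tail n; have zn : pwV rho dl (fun e => z e - z0).
 by apply: pwV_le (tail 0%N); rewrite expr0 mulr1.
have dn0 : 0 <= dl * 2^-1 ^+ n by rewrite mulr_ge0 ?exprn_ge0// ltW.
have p := cP _ _ _ r0 (mulr_ge0 (ltW ep0) dn0) (h _ _ _ dn0 zn (nearn n) tn).
(* The residual at the limit is rewritten with the [n]-th iterate: a linearisation error, the
   distance to the limit and one Newton step. Each is at most [dl * 2^-1 ^+ n], so the residual is
   0. *)
have -> : coord b j (P (G e (z e))) =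
 coord b j (P (G e (z e) - G e (X n e) - L (z e - X n e))) + coord b j (z e - X n e)
 - coord b j (X n.+1 e - X n e).
 by rewrite -linearD -linearB !PB PL newt subrK -[X n.+1 e - X n e]opprB opprK subrK.
have n1 := pw_norm (p j) er; have n2 := pw_norm (tn j) er; have n3 := pw_norm (step n j) er.
apply: le_trans (ler_normB _ _) _; apply: le_trans (lerD (ler_normD _ _) (lexx _)) _.
have d3 : dd n <= dl * 2^-1 ^+ n by rewrite /dd exprS mulrCA ler_piMl//; lra.
have d1 : C * (ep * (dl * 2^-1 ^+ n)) <= dl * 2^-1 ^+ n.
 by rewrite mulrA ler_piMl//; lra.
rewrite -mulrA; lra.
Qed.

Variable z0 : V.

Lemma lin_comp (W : vectType R) (l : W -> R) (f : V -> W) : lin l -> linW f -> lin (fun v => l (f v)).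
Proof. by move=> hl hf a u v; rewrite hf hl. Qed.

(* [W]-valued version, tested against the linear functionals of [W]. *)
Definition AnlW (W : vectType R) (G : R -> V -> W) (g0 : W) (L : V -> W) :=
 linW L /\ forall l : W -> R, lin l -> Anl z0 (fun e v => l (G e v)) (l g0) (fun v => l (L v)).

Lemma AnlW_ext (W : vectType R) (G : R -> V -> W) g0 L G' g0' L' : AnlW G g0 L ->
 (forall e v, G e v = G' e v) -> g0 = g0' -> (forall v, L v = L' v) -> AnlW G' g0' L'.
Proof.
move=> h gg <- ll; have <- : L = L' by exact/funext.
by have <- : G = G' by apply/funext => e; exact/funext.
Qed.

Lemma AnlW_lin (W : vectType R) (f : V -> W) : linW f -> AnlW (fun _ v => f v) (f z0) f.
Proof. by move=> hf; split => // l hl; apply: Anl_lin; exact: lin_comp. Qed.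

Lemma linW_cst0 (W W' : lmodType R) : linW (fun _ : W => 0 : W').
Proof. by move=> a u v; rewrite scaler0 addr0. Qed.

Lemma AnlW_cst (W : vectType R) (w : W) : AnlW (fun _ _ => w) w (fun=> 0).
Proof.
split; first exact: linW_cst0.
by move=> l hl; apply: Anl_ext (Anl_cst z0 (l w)) _ _ _ => // v; rewrite lin0.
Qed.

Lemma AnlW_map (W W' : vectType R) (f : W -> W') (G : R -> V -> W) g0 L : linW f -> AnlW G g0 L ->
 AnlW (fun e v => f (G e v)) (f g0) (fun v => f (L v)).
Proof.
move=> hf [hL h]; split; first by move=> a u v; rewrite hL hf.
by move=> l hl; apply: (h (fun w => l (f w))) => a u v; rewrite hf hl.
Qed.

Lemma AnlW_D (W : vectType R) (G H : R -> V -> W) g h L M : AnlW G g L -> AnlW H h M ->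
 AnlW (fun e v => G e v + H e v) (g + h) (fun v => L v + M v).
Proof.
move=> [hL hG] [hM hH]; split.
 by move=> a u v; rewrite hL hM scalerDr addrACA.
by move=> l hl; apply: Anl_ext (AnlD (hG l hl) (hH l hl)) _ _ _ => *; rewrite linD.
Qed.

Lemma AnlW_B (W : vectType R) (G H : R -> V -> W) g h L M : AnlW G g L -> AnlW H h M ->
 AnlW (fun e v => G e v - H e v) (g - h) (fun v => L v - M v).
Proof.
move=> hG hH; apply: AnlW_D hG _; apply: (AnlW_map (f := -%R)) hH => a u v.
by rewrite opprD scalerN.
Qed.

Lemma AnlW_sum (W : vectType R) (I : Type) (r : seq I) (G : I -> R -> V -> W) g L :
 (forall i, AnlW (G i) (g i) (L i)) ->
 AnlW (fun e v => \sum_(i <- r) G i e v) (\sum_(i <- r) g i) (fun v => \sum_(i <- r) L i v).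
Proof.
move=> h; elim: r => [|i r IH].
 by apply: AnlW_ext (AnlW_cst 0) _ _ _ => *; rewrite big_nil.
by apply: AnlW_ext (AnlW_D (h i) IH) _ _ _ => *; rewrite big_cons.
Qed.

Lemma AnlW_scale (W : vectType R) (F : R -> V -> R) f l (G : R -> V -> W) g L :
 Anl z0 F f l -> AnlW G g L ->
 AnlW (fun e v => F e v *: G e v) (f *: g) (fun v => f *: L v + l v *: g).
Proof.
move=> hF [hL hG]; split.
 move=> a u v; rewrite hL (hF.1) !scalerDr scalerDl !scalerA [f * a]mulrC addrACA.
 by congr (_ + _).
move=> k hk; apply: Anl_ext (AnlM hF (hG k hk)) _ _ _ => [e v||v].
- by rewrite linZ.
- by rewrite linZ.
- by rewrite (linD _ _ hk) !(linZ _ _ hk) [k g * _]mulrC.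
Qed.

Lemma AnlW_R (F : R -> V -> R) f l : Anl z0 F f l -> @AnlW (R^o : vectType R) F f l.
Proof.
move=> h; split; first by case: h.
move=> k hk; have kE (x : R^o) : k x = k 1 * x.
 by have := linZ x (1 : R^o) hk; rewrite /GRing.scale/= mulr1 mulrC.
by apply: Anl_ext (AnlZ (k 1) h) _ _ _ => *; rewrite -kE.
Qed.

Lemma AnlW_pair (W W' : vectType R) (G : R -> V -> W) g L (H : R -> V -> W') h M :
 AnlW G g L -> AnlW H h M ->
 @AnlW (W * W')%type (fun e v => (G e v, H e v)) (g, h) (fun v => (L v, M v)).
Proof.
move=> [hL hG] [hM hH]; split; first by move=> a u v; rewrite hL hM.
move=> k hk.
have kE (x : W * W') : k x = k (x.1, 0) + k (0, x.2).
 rewrite -linD//; congr k; rewrite [RHS]surjective_pairing/= addr0 add0r.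
 exact: surjective_pairing.
have h1 : lin (fun w => k (w, 0)).
 by move=> a u v; rewrite -hk; congr k; apply: injective_projections => //=; rewrite scaler0 addr0.
have h2 : lin (fun w => k (0, w)).
 by move=> a u v; rewrite -hk; congr k; apply: injective_projections => //=; rewrite scaler0 addr0.
by apply: Anl_ext (AnlD (hG _ h1) (hH _ h2)) _ _ _ => *; exact/esym/kE.
Qed.

Lemma AnlW_ffun (W : vectType R) (n : nat) (G : 'I_n -> R -> V -> W) g L :
 (forall i, AnlW (G i) (g i) (L i)) ->
 @AnlW ({ffun 'I_n -> W}) (fun e v => [ffun i => G i e v]) [ffun i => g i]
 (fun v => [ffun i => L i v]).
Proof.
move=> h; split.
 by move=> a u v; apply/ffunP => i; rewrite !ffunE (h i).1.
move=> k hk; pose dlt (i : 'I_n) (w : W) : {ffun 'I_n -> W} := [ffun j => if j == i then w else 0].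
have kE (f : 'I_n -> W) : k [ffun i => f i] = \sum_i k (dlt i (f i)).
 rewrite -lin_sum//; congr k; apply/ffunP => j; rewrite ffunE sum_ffunE (bigD1 j)//= ffunE eqxx.
 by rewrite big1 ?addr0// => i ij; rewrite ffunE eq_sym (negbTE ij).
have hi i : lin (fun w => k (dlt i w)).
 move=> a u v; rewrite -hk; congr k; apply/ffunP => j; rewrite !ffunE.
 by case: ifP => // _; rewrite scaler0 addr0.
by apply: Anl_ext (Anl_sum _ (fun i => (h i).2 _ (hi i))) _ _ _ => *; rewrite kE.
Qed.

Lemma AnlW_mx m n (G : R -> V -> 'M[R]_(m, n)) (g : 'M[R]_(m, n)) (L : V -> 'M[R]_(m, n)) :
 (forall i j, Anl z0 (fun e v => G e v i j) (g i j) (fun v => L v i j)) -> AnlW G g L.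
Proof.
move=> h; split.
 by move=> a u v; apply/matrixP => i j; rewrite !mxE (h i j).1.
move=> k hk.
have kE (M : 'M[R]_(m, n)) : k M = \sum_i \sum_j k (delta_mx i j) * M i j.
 rewrite {1}(matrix_sum_delta M) lin_sum//; apply: eq_bigr => i _; rewrite lin_sum//.
 by apply: eq_bigr => j _; rewrite linZ// mulrC.
apply: Anl_ext (Anl_sum _ (fun i => Anl_sum _ (fun j => AnlZ (k (delta_mx i j)) (h i j)))) _ _ _ => *;
by rewrite kE.
Qed.

Lemma AnlW_entry m n (G : R -> V -> 'M[R]_(m, n)) g (L : V -> 'M[R]_(m, n)) i j :
 AnlW G g L -> Anl z0 (fun e v => G e v i j) (g i j) (fun v => L v i j).
Proof. by move=> [_ h]; apply: (h (fun M => M i j)) => a u v; rewrite !mxE. Qed.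

Lemma AnlW_mul m n p (G : R -> V -> 'M[R]_(m, n)) g (L : V -> 'M[R]_(m, n))
 (H : R -> V -> 'M[R]_(n, p)) h (M : V -> 'M[R]_(n, p)) : AnlW G g L -> AnlW H h M ->
 AnlW (fun e v => G e v *m H e v) (g *m h) (fun v => g *m M v + L v *m h).
Proof.
move=> hG hH; apply: AnlW_mx => i j.
apply: Anl_ext (Anl_sum _ (fun k => AnlM (AnlW_entry i k hG) (AnlW_entry k j hH))) _ _ _ => [e v||v].
- by rewrite mxE.
- by rewrite mxE.
- by rewrite !mxE -big_split/=; apply: eq_bigr => k _; rewrite [L v i k * _]mulrC.
Qed.

Lemma Anl_prod0 (I : Type) (r : seq I) (F : I -> R -> V -> R) (f : I -> R) :
 (forall i, Anl z0 (F i) (f i) (fun=> 0)) ->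
 Anl z0 (fun e v => \prod_(i <- r) F i e v) (\prod_(i <- r) f i) (fun=> 0).
Proof.
move=> h; elim: r => [|i r IH].
 by apply: Anl_ext (Anl_cst z0 1) _ _ _ => *; rewrite ?big_nil.
apply: Anl_ext (AnlM (h i) IH) _ _ _ => *; rewrite ?big_cons//.
by rewrite !mulr0 addr0.
Qed.

(** Determinants enter the system only for matrices [1 + e (...)], whose partial differential in the
    unknowns vanishes at [e = 0]; products of such entries keep this property, so the Leibniz
    formula suffices. *)
Lemma Anl_det0 n (G : R -> V -> 'M[R]_n) g : AnlW G g (fun=> 0) ->
 Anl z0 (fun e v => \det (G e v)) (\det g) (fun=> 0).
Proof.
move=> hG; have h (s : 'S_n) i : Anl z0 (fun e v => G e v i (s i)) (g i (s i)) (fun=> 0).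
 by apply: Anl_ext (AnlW_entry i (s i) hG) _ _ _ => // v; rewrite mxE.
apply: Anl_ext (Anl_sum _ (fun s : 'S_n => AnlZ ((-1) ^+ s) (Anl_prod0 (index_enum _) (h s)))) _ _ _ => // v.
by rewrite big1// => s _; rewrite mulr0.
Qed.

(** A factor [e] removes both the value and the partial differential at [e = 0]: the entropic
    corrections disappear from the linearised system. *)
Lemma AnlW_e0 (W : vectType R) (a : R) (G : R -> V -> W) g L : AnlW G g L ->
 AnlW (fun e v => (a * e) *: G e v) 0 (fun=> 0).
Proof.
move=> hG; apply: AnlW_ext (AnlW_scale (AnlZ a (Anl_e z0)) hG) _ _ _ => // *.
 by rewrite mulr0 scale0r.
by rewrite !mulr0 !scale0r addr0.
Qed.

Lemma Anl_e0 (a : R) F f l : Anl z0 F f l -> Anl z0 (fun e v => a * e * F e v) 0 (fun=> 0).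
Proof.
move=> h; apply: Anl_ext (AnlM (AnlZ a (Anl_e z0)) h) _ _ _ => // *.
 by rewrite !mulr0 mul0r.
by rewrite !(mulr0, mul0r) addr0.
Qed.

End implicit_function.

(** * The optimality system and its linearisation at the barycenter *)

Section stationarity_system.
Context {R : realType} {d n : nat}.
Variables (tau0 tau1 : R) (c : 'I_n -> R) (mi : 'I_n -> 'cV[R]_d) (A : 'I_n -> 'M[R]_d).
Variables (S0 : 'I_n -> 'M[R]_d) (Sg0 : 'M[R]_d) (m0 : 'cV[R]_d).
Hypotheses (t00 : 0 < tau0) (t10 : 0 < tau1) (c0 : forall i, 0 < c i).
Hypotheses (pA : forall i, sympd (A i)) (pS0 : forall i, sympd (S0 i)) (pSg0 : sympd Sg0).
Hypothesis SgS0 : forall i, S0 i *m Sg0 *m S0 i = A i.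
Hypothesis sumS0 : \sum_i c i *: S0 i = (\sum_i c i)%:M.
Hypothesis sumr0 : \sum_i c i *: (mi i - m0) = 0.
Hypothesis hn : (0 < n)%N.

(* The blocks carry named structures, so that no large canonical structure is ever inferred. *)
Definition prodv (V W : vectType R) : vectType R := (V * W)%type.
Definition ffunv (W : vectType R) : vectType R := {ffun 'I_n -> W}.
Definition sblock1 := prodv R^o R^o.
Definition sblock2 := prodv 'cV[R]_d sblock1.
Definition sblock3 := prodv 'M[R]_d sblock2.
Definition sblock4 := prodv 'M[R]_d sblock3.
Definition sblock := prodv 'M[R]_d sblock4.
Definition sblocks := ffunv sblock.
Definition shead := prodv 'M[R]_d 'cV[R]_d.
Definition sspace := prodv shead sblocks.

(** The unknown matrices [uSg] and [uS] range over all matrices. The equations use their symmetric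
    parts, and adding [antis] of the unknown to a symmetric equation forces the unknown to be
    symmetric, which makes an injective linearisation on the whole space possible. *)
Definition symm (M : 'M[R]_d) : 'M[R]_d := 2^-1 *: (M + M^T).
Definition antis (M : 'M[R]_d) : 'M[R]_d := M - M^T.

Definition uSg (v : sspace) : 'M[R]_d := v.1.1.
Definition um (v : sspace) : 'cV[R]_d := v.1.2.
Definition uS i (v : sspace) : 'M[R]_d := (v.2 i).1.
Definition uT i (v : sspace) : 'M[R]_d := (v.2 i).2.1.
Definition uN i (v : sspace) : 'M[R]_d := (v.2 i).2.2.1.
Definition ur i (v : sspace) : 'cV[R]_d := (v.2 i).2.2.2.1.
Definition u0 i (v : sspace) : R := (v.2 i).2.2.2.2.1.
Definition u1 i (v : sspace) : R := (v.2 i).2.2.2.2.2.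

Definition vSg v := symm (uSg v).
Definition vS i v := symm (uS i v).

(** The matching condition multiplied by [Sg] on both sides. This clears [invmx Sg], and
    [S (1 - S^-1) S = S S - S] clears [invmx S], so the equation is polynomial. *)
Definition eqS i e v : 'M[R]_d :=
 vSg v *m vS i v *m invmx (A i) *m vS i v *m vSg v
 + (2 / tau0 * e) *: (vSg v *m (vS i v *m vS i v - vS i v) *m vSg v)
 - (2 / tau1 * e) *: (vSg v *m (1%:M - vS i v) *m vSg v) - vSg v + antis (uS i v).
Definition eqT i (e : R) v : 'M[R]_d := uT i v *m vS i v - 1%:M.
(** Makes [uN] the matrix [(1 - S) (1 + eta Sg (1 - S))^-1] with [eta = 2 e / tau1], the derivative
    in [Sg] of the term [t1 / 2 * ln \det] of [lnE]. *)
Definition eqN i e v : 'M[R]_d :=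
 uN i v + (2 / tau1 * e) *: (uN i v *m vSg v *m (1%:M - vS i v)) - (1%:M - vS i v).
Definition eqr i e v : 'cV[R]_d :=
 ur i v + (2 / tau0 * e) *: (A i *m ur i v) + (2 / tau1 * e) *: (vSg v *m ur i v) - (mi i - um v).
(** [u0] and [u1] stand for the logarithms of the two determinants in [lnE], so that only
    exponentials occur. *)
Definition eq0 i e v : R :=
 expR (u0 i v) - \det (1%:M + (2 / tau0 * e) *: (A i *m (1%:M - uT i v))).
Definition eq1 i e v : R :=
 expR (u1 i v) - \det (1%:M + (2 / tau1 * e) *: (vSg v *m (1%:M - vS i v))).
Definition lnw i e v : R :=
 - (tau0 / (tau0 + tau1) / 2) * u0 i v + - (tau1 / (tau0 + tau1) / 2) * u1 i v
 - (tau0 + tau1)^-1 * e * dotc (ur i v) (mi i - um v).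
Definition wgt i e v : R := c i * expR (lnw i e v).
Definition eqm e v : 'cV[R]_d := \sum_i wgt i e v *: ur i v.
(** Stationarity of [\sum_i c i * expR (lnE_i)] in the covariance: the derivative of
    [(t0 + t1) * lnE] is [- N] from the determinant plus [eta r r^T] from the mean term. In [eqm]
    the same is done for the mean. *)
Definition eqSg e v : 'M[R]_d :=
 symm (\sum_i wgt i e v *: (uN i v - (2 / tau1 * e) *: (ur i v *m (ur i v)^T))) + antis (uSg v).

Definition Gsys e v : sspace :=
 ((eqSg e v, eqm e v),
 [ffun i => (eqS i e v, (eqT i e v, (eqN i e v, (eqr i e v, (eq0 i e v, eq1 i e v))))) : sblock]).

Definition base : sspace :=
 ((Sg0, m0), [ffun i => (S0 i, (invmx (S0 i), (1%:M - S0 i, (mi i - m0, (0, 0))))) : sblock]).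

Definition LlS i v : 'M[R]_d := vSg v + Sg0 *m vS i v *m invmx (S0 i)
 + invmx (S0 i) *m vS i v *m Sg0 + antis (uS i v).
Definition LlT i v : 'M[R]_d := uT i v *m S0 i + invmx (S0 i) *m vS i v.
Definition LlN i v : 'M[R]_d := uN i v + vS i v.
Definition Llr i v : 'cV[R]_d := ur i v + um v.
Definition Llw i v : R := c i * (- (tau0 / (tau0 + tau1) / 2) * u0 i v + - (tau1 / (tau0 + tau1) / 2) * u1 i v).
Definition Llm v : 'cV[R]_d := \sum_i (c i *: ur i v + Llw i v *: (mi i - m0)).
Definition LlSg v : 'M[R]_d := symm (\sum_i (c i *: uN i v + Llw i v *: (1%:M - S0 i))) + antis (uSg v).
Definition Lsys v : sspace :=
 ((LlSg v, Llm v), [ffun i => (LlS i v, (LlT i v, (LlN i v, (Llr i v, (u0 i v, u1 i v))))) : sblock]).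

Lemma symmE M : M^T = M -> symm M = M.
Proof.
by move=> sM; rewrite /symm sM -mulr2n -[M *+ 2]scaler_nat scalerA mulVf ?scale1r.
Qed.

Lemma tr_symm M : (symm M)^T = symm M.
Proof. by rewrite /symm linearZ/= linearD/= trmxK addrC. Qed.

Lemma tr_antis M : (antis M)^T = - antis M.
Proof. by rewrite /antis linearB/= trmxK opprB. Qed.

Lemma symm_antis0 (X M : 'M[R]_d) : X^T = X -> X + antis M = 0 -> X = 0 /\ M^T = M.
Proof.
move=> sX e; have e2 : X - antis M = 0.
 by rewrite -[LHS]trmxK linearB/= tr_antis sX opprK e trmx0.
have X0 : X = 0.
 have : X + X = 0.
 transitivity ((X + antis M) + (X - antis M)); first by rewrite addrACA subrr addr0.
 by rewrite e e2 addr0.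
 by rewrite -mulr2n => /eqP; rewrite -scaler_nat scaler_eq0 pnatr_eq0 => /eqP.
split => //; move: e; rewrite X0 add0r /antis => /eqP; rewrite subr_eq0 => /eqP.
exact: esym.
Qed.

Lemma linW_symm : linW symm.
Proof.
by move=> a u v; apply/matrixP => i j; rewrite !mxE; ring.
Qed.

Lemma linW_antis : linW antis.
Proof. by move=> a u v; rewrite /antis linearP/= opprD addrACA -scalerBr. Qed.

Lemma linW_comp (U W W' : lmodType R) (f : W -> W') (g : U -> W) : linW f -> linW g -> linW (f \o g).
Proof. by move=> hf hg a u v; rewrite /= hg hf. Qed.

Lemma linW_fst (V W : vectType R) : @linW R (prodv V W) V fst. Proof. by []. Qed.
Lemma linW_snd (V W : vectType R) : @linW R (prodv V W) W snd. Proof. by []. Qed.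
Lemma linW_app (W : vectType R) i : @linW R (ffunv W) W (fun f => f i).
Proof. by move=> a u v; rewrite !ffunE. Qed.

Lemma linW_uSg : linW uSg. Proof. exact: (linW_comp (@linW_fst _ _) (@linW_fst shead sblocks)). Qed.
Lemma linW_um : linW um. Proof. exact: (linW_comp (@linW_snd _ _) (@linW_fst shead sblocks)). Qed.

Lemma linW_blk i : @linW R sspace sblock (fun v => v.2 i).
Proof. exact: (linW_comp (@linW_app sblock i) (@linW_snd shead sblocks)). Qed.
Lemma linW_blk4 i : @linW R sspace sblock4 (fun v => (v.2 i).2).
Proof. exact: (linW_comp (@linW_snd _ sblock4) (linW_blk i)). Qed.
Lemma linW_blk3 i : @linW R sspace sblock3 (fun v => (v.2 i).2.2).
Proof. exact: (linW_comp (@linW_snd _ sblock3) (linW_blk4 i)). Qed.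
Lemma linW_blk2 i : @linW R sspace sblock2 (fun v => (v.2 i).2.2.2).
Proof. exact: (linW_comp (@linW_snd _ sblock2) (linW_blk3 i)). Qed.
Lemma linW_blk1 i : @linW R sspace sblock1 (fun v => (v.2 i).2.2.2.2).
Proof. exact: (linW_comp (@linW_snd _ sblock1) (linW_blk2 i)). Qed.

Lemma linW_uS i : linW (uS i). Proof. exact: (linW_comp (@linW_fst _ sblock4) (linW_blk i)). Qed.
Lemma linW_uT i : linW (uT i). Proof. exact: (linW_comp (@linW_fst _ sblock3) (linW_blk4 i)). Qed.
Lemma linW_uN i : linW (uN i). Proof. exact: (linW_comp (@linW_fst _ sblock2) (linW_blk3 i)). Qed.
Lemma linW_ur i : linW (ur i). Proof. exact: (linW_comp (@linW_fst _ sblock1) (linW_blk2 i)). Qed.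
Lemma lin_u0 i : lin (u0 i). Proof. exact: (linW_comp (@linW_fst R^o R^o) (linW_blk1 i)). Qed.
Lemma lin_u1 i : lin (u1 i). Proof. exact: (linW_comp (@linW_snd R^o R^o) (linW_blk1 i)). Qed.

Let J i := invmx (A i).

Lemma SgJ i : J i *m S0 i *m Sg0 = invmx (S0 i).
Proof.
have uS := sympd_unit (pS0 i); have uSg := sympd_unit pSg0.
rewrite /J -SgS0 !invmx_mulmx ?unitmx_mul ?uS//.
by rewrite -!mulmxA (mulmxA (invmx (S0 i)) (S0 i)) mulVmx// mul1mx mulVmx// mulmx1.
Qed.

Lemma SgJ' i : Sg0 *m S0 i *m J i = invmx (S0 i).
Proof.
have := congr1 trmx (SgJ i); rewrite !trmx_mul !(sympd_sym pSg0) (sympd_sym (pS0 i)).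
by rewrite (sympd_sym (sympd_inv (pA i))) (sympd_sym (sympd_inv (pS0 i))) mulmxA.
Qed.

Let hSg : AnlW base (fun _ v => vSg v) Sg0 vSg.
Proof.
apply: AnlW_ext (AnlW_lin base (linW_comp linW_symm linW_uSg)) _ _ _ => //.
by rewrite /= symmE//; exact: sympd_sym.
Qed.

Let hS i : AnlW base (fun _ v => vS i v) (S0 i) (vS i).
Proof.
apply: AnlW_ext (AnlW_lin base (linW_comp linW_symm (linW_uS i))) _ _ _ => //.
by rewrite /= /uS/= ffunE symmE ?(sympd_sym (pS0 i)).
Qed.

Let hT i : AnlW base (fun _ v => uT i v) (invmx (S0 i)) (uT i).
Proof. by apply: AnlW_ext (AnlW_lin base (linW_uT i)) _ _ _ => //; rewrite /uT/= ffunE. Qed.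

Let hN i : AnlW base (fun _ v => uN i v) (1%:M - S0 i) (uN i).
Proof. by apply: AnlW_ext (AnlW_lin base (linW_uN i)) _ _ _ => //; rewrite /uN/= ffunE. Qed.

Let hr i : AnlW base (fun _ v => ur i v) (mi i - m0) (ur i).
Proof. by apply: AnlW_ext (AnlW_lin base (linW_ur i)) _ _ _ => //; rewrite /ur/= ffunE. Qed.

Let hm : AnlW base (fun _ v => um v) m0 um.
Proof. exact: (AnlW_lin base linW_um). Qed.

Let h0 i : Anl base (fun _ v => u0 i v) 0 (u0 i).
Proof. by apply: Anl_ext (Anl_lin base (lin_u0 i)) _ _ _ => //; rewrite /u0/= ffunE. Qed.

Let h1 i : Anl base (fun _ v => u1 i v) 0 (u1 i).
Proof. by apply: Anl_ext (Anl_lin base (lin_u1 i)) _ _ _ => //; rewrite /u1/= ffunE. Qed.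

Let h1S i : AnlW base (fun _ v => 1%:M - vS i v) (1%:M - S0 i) (fun v => - vS i v).
Proof.
by apply: AnlW_ext (AnlW_B (AnlW_cst base 1%:M) (hS i)) _ _ _ => // v; rewrite sub0r.
Qed.

Lemma Anl_eqS i : AnlW base (fun e v => eqS i e v) 0 (LlS i).
Proof.
have hJ := AnlW_cst base (J i).
have p1 := AnlW_mul (AnlW_mul (AnlW_mul (AnlW_mul hSg (hS i)) hJ) (hS i)) hSg.
have p2 := AnlW_e0 (2 / tau0) (AnlW_mul (AnlW_mul hSg (AnlW_B (AnlW_mul (hS i) (hS i)) (hS i))) hSg).
have p3 := AnlW_e0 (2 / tau1) (AnlW_mul (AnlW_mul hSg (h1S i)) hSg).
have p4 := AnlW_lin base (linW_comp linW_antis (linW_uS i)).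
apply: AnlW_ext (AnlW_D (AnlW_B (AnlW_B (AnlW_D p1 p2) p3) hSg) p4) _ _ _ => //.
 rewrite SgJ' mulVmx ?sympd_unit// mul1mx addr0 subr0 subrr add0r /= /uS/= ffunE.
 by rewrite /antis (sympd_sym (pS0 i)) subrr.
move=> v; rewrite /= SgJ' mulVmx ?sympd_unit// mul1mx addr0 subr0 mulmx0 add0r.
rewrite /LlS -/(J i) !mulmxDl -!mulmxA (mulmxA (J i)) SgJ.
rewrite [vSg v *m (S0 i *m _)](_ : _ = vSg v); last first.
 by rewrite mulmxV ?sympd_unit// mulmx1.
congr (_ + _); move: (Sg0 *m _) (invmx (S0 i) *m _) (vSg v) => X Y Z.
by rewrite !addrA addrK addrAC.
Qed.

Lemma Anl_eqT i : AnlW base (fun e v => eqT i e v) 0 (LlT i).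
Proof.
apply: AnlW_ext (AnlW_B (AnlW_mul (hT i) (hS i)) (AnlW_cst base 1%:M)) _ _ _ => //.
 by rewrite mulVmx ?sympd_unit// subrr.
by move=> v; rewrite subr0 addrC.
Qed.

Lemma Anl_eqN i : AnlW base (fun e v => eqN i e v) 0 (LlN i).
Proof.
have p := AnlW_e0 (2 / tau1) (AnlW_mul (AnlW_mul (hN i) hSg) (h1S i)).
apply: AnlW_ext (AnlW_B (AnlW_D (hN i) p) (h1S i)) _ _ _ => //; first by rewrite addr0 subrr.
by move=> v; rewrite addr0 opprK.
Qed.

Lemma Anl_eqr i : AnlW base (fun e v => eqr i e v) 0 (Llr i).
Proof.
have p1 := AnlW_e0 (2 / tau0) (AnlW_mul (AnlW_cst base (A i)) (hr i)).
have p2 := AnlW_e0 (2 / tau1) (AnlW_mul hSg (hr i)).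
apply: AnlW_ext (AnlW_B (AnlW_D (AnlW_D (hr i) p1) p2)
 (AnlW_B (AnlW_cst base (mi i)) hm)) _ _ _ => //; first by rewrite !addr0 subrr.
by move=> v; rewrite !addr0 sub0r opprK.
Qed.

Lemma Anl_eq0 i : Anl base (fun e v => eq0 i e v) 0 (u0 i).
Proof.
have p := AnlW_D (AnlW_cst base 1%:M)
 (AnlW_e0 (2 / tau0) (AnlW_mul (AnlW_cst base (A i)) (AnlW_B (AnlW_cst base 1%:M) (hT i)))).
have p' : AnlW base (fun e v => 1%:M + (2 / tau0 * e) *: (A i *m (1%:M - uT i v))) 1%:M (fun=> 0).
 by apply: AnlW_ext p _ _ _ => //; [rewrite addr0|move=> v; rewrite addr0].
apply: Anl_ext (AnlB (Anl_exp (h0 i)) (Anl_det0 p')) _ _ _ => //.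
 by rewrite expR0 det1 subrr.
by move=> v; rewrite expR0 mul1r subr0.
Qed.

Lemma Anl_eq1 i : Anl base (fun e v => eq1 i e v) 0 (u1 i).
Proof.
have p := AnlW_D (AnlW_cst base 1%:M) (AnlW_e0 (2 / tau1) (AnlW_mul hSg (h1S i))).
have p' : AnlW base (fun e v => 1%:M + (2 / tau1 * e) *: (vSg v *m (1%:M - vS i v))) 1%:M (fun=> 0).
 by apply: AnlW_ext p _ _ _ => //; [rewrite addr0|move=> v; rewrite addr0].
apply: Anl_ext (AnlB (Anl_exp (h1 i)) (Anl_det0 p')) _ _ _ => //.
 by rewrite expR0 det1 subrr.
by move=> v; rewrite expR0 mul1r subr0.
Qed.

Lemma Anl_wgt i : Anl base (fun e v => wgt i e v) (c i) (Llw i).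
Proof.
have pd : Anl base (fun e v => dotc (ur i v) (mi i - um v)) (dotc (mi i - m0) (mi i - m0))
 (fun v => ((mi i - m0)^T *m (0 - um v) + (ur i v)^T *m (mi i - m0)) 0 0).
 have ht : linW (fun M : 'cV[R]_d => M^T) by move=> a u v; rewrite linearP.
 exact: (AnlW_entry 0 0 (AnlW_mul (AnlW_map ht (hr i)) (AnlW_B (AnlW_cst base (mi i)) hm))).
have p1 := AnlZ (- (tau0 / (tau0 + tau1) / 2)) (h0 i).
have p2 := AnlZ (- (tau1 / (tau0 + tau1) / 2)) (h1 i).
apply: Anl_ext (AnlZ (c i) (Anl_exp (AnlB (AnlD p1 p2) (Anl_e0 (tau0 + tau1)^-1 pd)))) _ _ _ => //.
 by rewrite !mulr0 addr0 subr0 expR0 mulr1.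
by move=> v; rewrite !mulr0 addr0 !subr0 expR0 mul1r.
Qed.

Lemma Anl_eqm : AnlW base (fun e v => eqm e v) 0 Llm.
Proof.
by apply: AnlW_ext (AnlW_sum _ (fun i => AnlW_scale (Anl_wgt i) (hr i))) _ _ _.
Qed.

Lemma Anl_eqSg : AnlW base (fun e v => eqSg e v) 0 LlSg.
Proof.
have ht : linW (fun M : 'cV[R]_d => M^T) by move=> a u v; rewrite linearP.
have p i := AnlW_B (hN i) (AnlW_e0 (2 / tau1) (AnlW_mul (hr i) (AnlW_map ht (hr i)))).
have q := AnlW_map linW_symm (AnlW_sum (index_enum 'I_n) (fun i => AnlW_scale (Anl_wgt i) (p i))).
apply: AnlW_ext (AnlW_D q (AnlW_lin base (linW_comp linW_antis linW_uSg))) _ _ _ => //.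
 rewrite (_ : \sum_i _ = 0).
 by rewrite /symm trmx0 addr0 scaler0 add0r /= /uSg/= /antis (sympd_sym pSg0) subrr.
 under eq_bigr do rewrite subr0 scalerBr.
 by rewrite sumrB sumS0 -scaler_suml scalemx1 subrr.
by move=> v; congr (symm _ + _); apply: eq_bigr => i _; rewrite !subr0.
Qed.

Lemma Anl_Gsys : AnlW base Gsys 0 Lsys.
Proof.
have b1 i : @AnlW R sspace base sblock1 (fun e v => (eq0 i e v, eq1 i e v)) (0, 0)
 (fun v => (u0 i v, u1 i v)) := AnlW_pair (AnlW_R (Anl_eq0 i)) (AnlW_R (Anl_eq1 i)).
have b2 i : @AnlW R sspace base sblock2 (fun e v => (eqr i e v, (eq0 i e v, eq1 i e v)))
 (0, (0, 0)) (fun v => (Llr i v, (u0 i v, u1 i v))) := AnlW_pair (Anl_eqr i) (b1 i).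
have b3 i : @AnlW R sspace base sblock3 (fun e v => (eqN i e v, (eqr i e v, (eq0 i e v, eq1 i e v))))
 (0, (0, (0, 0))) (fun v => (LlN i v, (Llr i v, (u0 i v, u1 i v)))) := AnlW_pair (Anl_eqN i) (b2 i).
have b4 i : @AnlW R sspace base sblock4 (fun e v => (eqT i e v, (eqN i e v, (eqr i e v, (eq0 i e v, eq1 i e v)))))
 (0, (0, (0, (0, 0)))) (fun v => (LlT i v, (LlN i v, (Llr i v, (u0 i v, u1 i v))))) :=
 AnlW_pair (Anl_eqT i) (b3 i).
have b5 i : @AnlW R sspace base sblock
 (fun e v => (eqS i e v, (eqT i e v, (eqN i e v, (eqr i e v, (eq0 i e v, eq1 i e v))))))
 (0, (0, (0, (0, (0, 0))))) (fun v => (LlS i v, (LlT i v, (LlN i v, (Llr i v, (u0 i v, u1 i v)))))) :=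
 AnlW_pair (Anl_eqS i) (b4 i).
have b6 := AnlW_ffun b5.
have b7 : @AnlW R sspace base shead (fun e v => (eqSg e v, eqm e v)) (0, 0)
 (fun v => (LlSg v, Llm v)) := AnlW_pair Anl_eqSg Anl_eqm.
have b8 := AnlW_pair b7 b6.
apply: AnlW_ext b8 _ _ _ => [e v||v].
- by rewrite /Gsys.
- by congr pair; apply/ffunP => i; rewrite !ffunE.
- by rewrite /Lsys.
Qed.

(** At [e = 0] the logarithms [u0], [u1] are not moved, hence neither are the weights, and the mean
    equations decouple. What is left is the pair of variations [vSg], [vS i], on which the
    linearised barycenter equations are definite by [tr_PXQ_ge]. *)
Lemma Lsys_inj v : Lsys v = 0 -> v = 0.
Proof.
move=> e; have eSg : LlSg v = 0 by have := congr1 uSg e; rewrite (linW0 linW_uSg).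
have em : Llm v = 0 by have := congr1 um e; rewrite (linW0 linW_um).
have eS i : LlS i v = 0 by have := congr1 (uS i) e; rewrite (linW0 (linW_uS i)) /uS/= ffunE.
have eT i : LlT i v = 0 by have := congr1 (uT i) e; rewrite (linW0 (linW_uT i)) /uT/= ffunE.
have eN i : LlN i v = 0 by have := congr1 (uN i) e; rewrite (linW0 (linW_uN i)) /uN/= ffunE.
have er i : Llr i v = 0 by have := congr1 (ur i) e; rewrite (linW0 (linW_ur i)) /ur/= ffunE.
have e0 i : u0 i v = 0.
 by have := congr1 (u0 i) e; rewrite (linW0 (W' := R^o) (lin_u0 i)) {1}/u0/= ffunE.
have e1 i : u1 i v = 0.
 by have := congr1 (u1 i) e; rewrite (linW0 (W' := R^o) (lin_u1 i)) {1}/u1/= ffunE.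
have w0 i : Llw i v = 0 by rewrite /Llw e0 e1 !mulr0 addr0 mulr0.
have er' i : ur i v = - um v by apply/eqP; rewrite -addr_eq0; apply/eqP/er.
have Z0 := sum_gt0 hn c0.
have m'0 : um v = 0.
 move: em; rewrite /Llm; under eq_bigr do rewrite w0 scale0r addr0 er'.
 rewrite -scaler_suml scalerN => /eqP; rewrite oppr_eq0 scaler_eq0 gt_eqF//= => /eqP//.
have r0 i : ur i v = 0 by rewrite er' m'0 oppr0.
have eN' i : uN i v = - vS i v by apply/eqP; rewrite -addr_eq0; apply/eqP/eN.
have [sN sSg] : symm (\sum_i (c i *: uN i v + Llw i v *: (1%:M - S0 i))) = 0 /\ (uSg v)^T = uSg v.
 by apply: symm_antis0 => //; exact: tr_symm.
have cS : \sum_i c i *: vS i v = 0.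
 move: sN; under eq_bigr do rewrite w0 scale0r addr0 eN' scalerN.
 rewrite sumrN symmE; first by move/eqP; rewrite oppr_eq0 => /eqP.
 rewrite linearN/= linear_sum/=; congr (- _); apply: eq_bigr => i _.
 by rewrite linearZ/= tr_symm.
have sS i : vSg v + Sg0 *m vS i v *m invmx (S0 i) + invmx (S0 i) *m vS i v *m Sg0 = 0 /\
 (uS i v)^T = uS i v.
 apply: symm_antis0; last exact: eS.
 rewrite !linearD/= !trmx_mul !tr_symm (sympd_sym pSg0) (sympd_sym (sympd_inv (pS0 i))).
 by rewrite -!addrA; congr (_ + _); rewrite addrC !mulmxA.
pose q i X := \tr (X^T *m Sg0 *m X *m invmx (S0 i)).
have hq i : exists2 k, 0 < k & forall X, k * fro X <= q i X.
 exact: tr_PXQ_ge pSg0 (sympd_inv (pS0 i)).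
have q0 i X : 0 <= q i X.
 by have [k k0 h] := hq i; apply: le_trans (h X); rewrite mulr_ge0 ?fro_ge0// ltW.
(* Each linearised matching equation is paired with [vS i] and summed with weights [c i]; the
   contribution of [vSg] drops out because the weighted sum of the [vS i] is 0. *)
have tot : \sum_i c i * (2 * q i (vS i v)) = 0.
 transitivity (- \tr (vSg v *m \sum_i c i *: vS i v)); last by rewrite cS mulmx0 mxtrace0 oppr0.
 have trs (F : 'I_n -> 'M[R]_d) : \tr (\sum_i F i) = \sum_i \tr (F i) by exact: raddf_sum.
 rewrite mulmx_sumr trs -sumrN; apply: eq_bigr => i _.
 rewrite -scalemxAr linearZ/= -mulrN; congr (_ * _).
 have := (sS i).1 => /eqP; rewrite -addrA addr_eq0 => /eqP ->.
 rewrite mulNmx linearN/= opprK mulmxDl linearD/= /q tr_symm.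
 have -> : \tr (Sg0 *m vS i v *m invmx (S0 i) *m vS i v) = \tr (vS i v *m Sg0 *m vS i v *m invmx (S0 i)).
 by rewrite mxtrace_mulC !mulmxA.
 have -> : \tr (invmx (S0 i) *m vS i v *m Sg0 *m vS i v) = \tr (vS i v *m Sg0 *m vS i v *m invmx (S0 i)).
 by rewrite -!mulmxA mxtrace_mulC !mulmxA.
 by ring.
have S'0 i : vS i v = 0.
 have : c i * (2 * q i (vS i v)) = 0.
 have := tot; move/eqP; rewrite psumr_eq0; last first.
 by move=> j _; rewrite mulr_ge0 ?mulr_ge0// ltW.
 by move/allP/(_ i); rewrite mem_index_enum => /(_ isT) /eqP.
 move/eqP; rewrite mulf_eq0 gt_eqF//= mulf_eq0 pnatr_eq0/= => /eqP qi.
 have [k k0 h] := hq i; apply: fro_eq0; have := h (vS i v); rewrite qi pmulr_rle0//.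
have Sg'0 : vSg v = 0.
 by have := (sS (Ordinal hn)).1; rewrite S'0 !(mulmx0, mul0mx) !addr0.
have uS0 i : uS i v = 0 by rewrite -(S'0 i) /vS symmE//; exact: (sS i).2.
have uSg0 : uSg v = 0 by rewrite -Sg'0 /vSg symmE.
have uT0 i : uT i v = 0.
 have := eT i; rewrite /LlT S'0 mulmx0 addr0 => h.
 by rewrite -[LHS](mulmxK (sympd_unit (pS0 i))) h mul0mx.
have uN0 i : uN i v = 0 by rewrite eN' S'0 oppr0.
rewrite [v]surjective_pairing [v.1]surjective_pairing -/(uSg v) -/(um v) uSg0 m'0.
congr pair; apply/ffunP => i; rewrite ffunE.
rewrite [v.2 i]surjective_pairing [(v.2 i).2]surjective_pairing [(v.2 i).2.2]surjective_pairing.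
rewrite [(v.2 i).2.2.2]surjective_pairing [(v.2 i).2.2.2.2]surjective_pairing.
by rewrite -/(uS i v) -/(uT i v) -/(uN i v) -/(ur i v) -/(u0 i v) -/(u1 i v) uS0 uT0 uN0 r0 e0 e1.
Qed.

Lemma uS_Gsys i e v : uS i (Gsys e v) = eqS i e v. Proof. by rewrite /uS/= ffunE. Qed.
Lemma uT_Gsys i e v : uT i (Gsys e v) = eqT i e v. Proof. by rewrite /uT/= ffunE. Qed.
Lemma uN_Gsys i e v : uN i (Gsys e v) = eqN i e v. Proof. by rewrite /uN/= ffunE. Qed.
Lemma ur_Gsys i e v : ur i (Gsys e v) = eqr i e v. Proof. by rewrite /ur/= ffunE. Qed.
Lemma u0_Gsys i e v : u0 i (Gsys e v) = eq0 i e v. Proof. by rewrite /u0/= ffunE. Qed.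
Lemma u1_Gsys i e v : u1 i (Gsys e v) = eq1 i e v. Proof. by rewrite /u1/= ffunE. Qed.

End stationarity_system.

(** * The analytic curve of solutions through the barycenter *)

Section star_curve.
Context {R : realType} {d n : nat}.

Definition pwx rho (f : R -> R) := exists B, pw rho B f.
Definition pwm {p q} rho (F : R -> 'M[R]_(p, q)) := forall i j, pwx rho (fun e => F e i j).

Lemma pwx_le rho rho' f : 0 < rho' -> rho' <= rho -> pwx rho f -> pwx rho' f.
Proof.
move=> r0 rr [B [c [h1 h2]]]; exists B, c; split => [N|e er].
 apply: le_trans (h1 N); apply: ler_sum => k _; rewrite ler_wpM2l// lerXn2r// nnegrE ltW//.
 exact: lt_le_trans rr.
by apply: h2; exact: lt_le_trans rr.
Qed.

Variables (tau0 tau1 : R) (c : 'I_n -> R) (mi : 'I_n -> 'cV[R]_d) (A : 'I_n -> 'M[R]_d).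
Hypotheses (t00 : 0 < tau0) (t10 : 0 < tau1) (c0 : forall i, 0 < c i).
Hypotheses (pA : forall i, sympd (A i)) (hn : (0 < n)%N).

Let s := tau0 + tau1.

(* The stationarity system at [e = kappa^-1]: [S i] is the linear part of the optimal map from
 [N(m, Sg)] to the i-th Gaussian after tilting, [w i = c_i exp (lnE i)]. *)
Record star (e : R) (Sg : 'M[R]_d) (m : 'cV[R]_d) (S N : 'I_n -> 'M[R]_d)
 (r : 'I_n -> 'cV[R]_d) (w : 'I_n -> R) : Prop := Star {
 star_Sg : sympd Sg;
 star_S : forall i, sympd (S i);
 star_match : forall i, invmx Sg + (2 / tau1 * e) *: (1%:M - S i) =
 S i *m (invmx (A i) + (2 / tau0 * e) *: (1%:M - invmx (S i))) *m S i;
 star_N : forall i, N i + (2 / tau1 * e) *: (N i *m Sg *m (1%:M - S i)) = 1%:M - S i;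
 star_r : forall i, r i + (2 / tau0 * e) *: (A i *m r i) + (2 / tau1 * e) *: (Sg *m r i) = mi i - m;
 star_d0 : forall i, 0 < \det (1%:M + (2 / tau0 * e) *: (A i *m (1%:M - invmx (S i))));
 star_d1 : forall i, 0 < \det (1%:M + (2 / tau1 * e) *: (Sg *m (1%:M - S i)));
 star_w : forall i, w i = c i * expR (- (tau0 / s / 2) *
 ln (\det (1%:M + (2 / tau0 * e) *: (A i *m (1%:M - invmx (S i))))) +
 - (tau1 / s / 2) * ln (\det (1%:M + (2 / tau1 * e) *: (Sg *m (1%:M - S i))))
 - s^-1 * e * dotc (r i) (mi i - m));
 star_sum_m : \sum_i w i *: r i = 0;
 star_sum_Sg : symm (\sum_i w i *: (N i - (2 / tau1 * e) *: (r i *m (r i)^T))) = 0 }.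

(** The barycenter itself: the mean is the weighted average, and the covariance is the common value
    produced by [barycenter_factors_exist]. *)
Lemma base_exists : exists (S0 : 'I_n -> 'M[R]_d) Sg0 m0,
 [/\ forall i, sympd (S0 i), sympd Sg0, forall i, S0 i *m Sg0 *m S0 i = A i,
 \sum_i c i *: S0 i = (\sum_i c i)%:M & \sum_i c i *: (mi i - m0) = 0].
Proof.
have [S [pS sumS eqS]] := barycenter_factors_exist c0 pA hn.
pose i0 := Ordinal hn; pose Sg := invmx (S i0) *m A i0 *m invmx (S i0).
have Z0 := sum_gt0 hn c0.
exists S, Sg, ((\sum_i c i)^-1 *: \sum_i c i *: mi i); split => //.
- exact: sympd_congr' (pA i0) (sympd_inv (pS i0)).
- move=> i; rewrite /Sg (eqS i0 i) !mulmxA mulmxV ?sympd_unit// mul1mx.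
 by rewrite -mulmxA mulVmx ?sympd_unit// mulmx1.
- under eq_bigr do rewrite scalerBr.
 by rewrite sumrB -scaler_suml scalerA mulfV ?gt_eqF// scale1r subrr.
Qed.

Definition mlnorm {V : vectType R} {p q} (f : V -> 'M[R]_(p, q)) : R :=
 \sum_i \sum_j lnorm (fun v => f v i j).

Lemma mlnorm_ge0 (V : vectType R) p q (f : V -> 'M[R]_(p, q)) : 0 <= mlnorm f.
Proof. by apply: sumr_ge0 => i _; apply: sumr_ge0 => j _; exact: lnorm_ge0. Qed.

Lemma lin_entry (V : vectType R) p q (f : V -> 'M[R]_(p, q)) i j : linW f -> lin (fun v => f v i j).
Proof. by move=> h a u v; rewrite h !mxE. Qed.

Lemma pwV_mx_norm (V : vectType R) p q (f : V -> 'M[R]_(p, q)) rho eps z z0 e : linW f ->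
 0 < rho -> 0 <= eps -> pwV rho eps (fun e => z e - z0) -> `|e| < rho ->
 `|f (z e) - f z0| <= mlnorm f * eps.
Proof.
move=> hf r0 e0 pz er; apply: mx_norm_le => [|i j]; first by rewrite mulr_ge0// mlnorm_ge0.
have hl := lin_entry i j hf; have := pw_norm (pw_lin r0 hl pz) er.
have -> : (f (z e) - f z0) i j = f (z e - z0) i j by rewrite [RHS](linB _ _ hl) !mxE.
move=> /le_trans; apply; apply: ler_wpM2r => //.
rewrite /mlnorm (bigD1 i)//= (bigD1 j)//= -addrA lerDl addr_ge0//.
 by apply: sumr_ge0 => k _; exact: lnorm_ge0.
by apply: sumr_ge0 => k _; apply: sumr_ge0 => l _; exact: lnorm_ge0.
Qed.

Lemma pwV_lin_pwx (V : vectType R) (l : V -> R) rho eps (z : R -> V) z0 : lin l -> 0 < rho ->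
 pwV rho eps (fun e => z e - z0) -> pwx rho (fun e => l (z e)).
Proof.
move=> hl r0 pz; exists (lnorm l * eps + `|l z0|).
apply: pw_ext (pwD (ltW r0) (pw_lin r0 hl pz) (pw_cst _ (l z0))) => e _.
by rewrite linB// subrK.
Qed.

Lemma pwxD rho f g : 0 < rho -> pwx rho f -> pwx rho g -> pwx rho (fun e => f e + g e).
Proof. by move=> r0 [a pa] [b pb]; exists (a + b); exact: pwD (ltW r0) pa pb. Qed.
Lemma pwxB rho f g : 0 < rho -> pwx rho f -> pwx rho g -> pwx rho (fun e => f e - g e).
Proof. by move=> r0 [a pa] [b pb]; exists (a + b); exact: pwB r0 pa pb. Qed.
Lemma pwxM rho f g : 0 < rho -> pwx rho f -> pwx rho g -> pwx rho (fun e => f e * g e).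
Proof. by move=> r0 [a pa] [b pb]; exists (a * b); exact: pwM r0 pa pb. Qed.
Lemma pwx_cst rho a : pwx rho (fun=> a).
Proof. by exists `|a|; exact: pw_cst. Qed.
Lemma pwx_id rho : 0 < rho -> pwx rho id.
Proof. by move=> r0; exists rho; exact: pw_id. Qed.
Lemma pwx_exp rho f : 0 < rho -> pwx rho f -> pwx rho (fun e => expR (f e)).
Proof. by move=> r0 [a pa]; exists (expR a); exact: pw_expR. Qed.
Lemma pwx_sum rho (I : Type) (l : seq I) (f : I -> R -> R) : 0 < rho ->
 (forall i, pwx rho (f i)) -> pwx rho (fun e => \sum_(i <- l) f i e).
Proof.
move=> r0 h; have [B hB] := choice h; exists (\sum_(i <- l) B i); exact: pw_sum.
Qed.
Lemma pwx_ext rho f g : (forall e, `|e| < rho -> f e = g e) -> pwx rho f -> pwx rho g.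
Proof. by move=> h [B p]; exists B; exact: pw_ext p. Qed.

Lemma match_of_eq (Sg S Ai : 'M[R]_d) (a b : R) : sympd Sg -> sympd S ->
 Sg *m S *m Ai *m S *m Sg + a *: (Sg *m (S *m S - S) *m Sg) - b *: (Sg *m (1%:M - S) *m Sg) - Sg = 0 ->
 invmx Sg + b *: (1%:M - S) = S *m (Ai + a *: (1%:M - invmx S)) *m S.
Proof.
move=> pSg pS e; have uG := sympd_unit pSg; have uS := sympd_unit pS.
have e2 : S *m (Ai + a *: (1%:M - invmx S)) *m S = S *m Ai *m S + a *: (S *m S - S).
 rewrite mulmxDr mulmxDl -scalemxAr -scalemxAl mulmxBr mulmx1 mulmxV// mulmxBl mul1mx//.
rewrite e2; apply/eqP; rewrite -subr_eq0 -oppr_eq0; apply/eqP.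
have gen (P Q W : 'M[R]_d) : Sg *m (W + a *: P - (invmx Sg + b *: Q)) *m Sg =
 Sg *m W *m Sg + a *: (Sg *m P *m Sg) - b *: (Sg *m Q *m Sg) - Sg.
 rewrite mulmxBr mulmxBl !mulmxDr !mulmxDl -!scalemxAr -!scalemxAl mulmxV// mul1mx.
 by rewrite opprD [- Sg - _]addrC addrA.
have e3 : Sg *m (S *m Ai *m S + a *: (S *m S - S) - (invmx Sg + b *: (1%:M - S))) *m Sg = 0.
 by rewrite gen -[RHS]e; congr (_ + _ - _ - _); rewrite !mulmxA.
rewrite opprB; apply: (can_inj (mulKmx uG)); rewrite mulmx0.
by apply: (can_inj (mulmxK uG)); rewrite e3 mul0mx.
Qed.

Lemma tr_eqS (Sg S Ai : 'M[R]_d) (a b : R) : Sg^T = Sg -> S^T = S -> Ai^T = Ai ->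
 let X := Sg *m S *m Ai *m S *m Sg + a *: (Sg *m (S *m S - S) *m Sg)
 - b *: (Sg *m (1%:M - S) *m Sg) - Sg in X^T = X.
Proof.
move=> sG sS sA; have tB (X Y : 'M[R]_d) : (X - Y)^T = X^T - Y^T by exact: linearB.
have tD (X Y : 'M[R]_d) : (X + Y)^T = X^T + Y^T by exact: linearD.
have tZ k (X : 'M[R]_d) : (k *: X)^T = k *: X^T by exact: linearZ.
by rewrite /= !(tB, tD, tZ) !trmx_mul !tB trmx1 trmx_mul sG sS sA !mulmxA.
Qed.

Theorem star_curve : exists rho (Sg : R -> 'M[R]_d) (m : R -> 'cV[R]_d)
 (S N : 'I_n -> R -> 'M[R]_d) (r : 'I_n -> R -> 'cV[R]_d) (w : 'I_n -> R -> R), [/\ 0 < rho,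
 forall e, `|e| < rho -> star e (Sg e) (m e) (fun i => S i e) (fun i => N i e)
 (fun i => r i e) (fun i => w i e),
 pwm rho Sg /\ pwm rho m & forall i, [/\ pwm rho (S i), pwm rho (fun e => invmx (S i e)),
 pwm rho (N i), pwm rho (r i) & pwx rho (w i)]].
Proof.
have [S0 [Sg0 [m0 [pS0 pSg0 SgS0 sumS0 sumr0]]]] := base_exists.
have hA := Anl_Gsys tau0 tau1 pA pS0 pSg0 SgS0 sumS0 sumr0.
have hinj := Lsys_inj (tau0 := tau0) (tau1 := tau1) c0 pS0 pSg0 hn.
have [dg dg0 hdg] := sympd_near pSg0.
have hds i : {dl : R | 0 < dl & forall M : 'M[R]_d, M^T = M -> `|M - S0 i| <= dl -> sympd M}.
 by apply: cid2; exact: sympd_near.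
pose ds i := s2val (hds i).
(* Within distance [dm] of the base point all symmetric matrices concerned stay positive definite;
   dividing by the norms collected in [K] turns this into the tolerance [eps] for the curve. *)
pose dm := Num.min dg (\big[Num.min/1]_i ds i).
have dm0 : 0 < dm.
 by rewrite lt_min dg0/=; apply: lt_bigmin => // i _; exact: s2valP (hds i).
have dmg : dm <= dg by rewrite ge_min lexx.
have dms i : dm <= ds i.
 apply: (@le_trans _ _ (\big[Num.min/1]_i ds i)); first by rewrite ge_min lexx orbT.
 exact: bigmin_le_cond.
have lSg : linW (@vSg R d n) by exact: linW_comp (@linW_symm R d) (@linW_uSg R d n).
have lS i : linW (@vS R d n i) by exact: linW_comp (@linW_symm R d) (@linW_uS R d n i).
pose K := mlnorm (@vSg R d n) + \sum_i mlnorm (@vS R d n i) + 1.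
have K0 : 0 < K by rewrite ltr_wpDl// addr_ge0 ?mlnorm_ge0// sumr_ge0// => i _; exact: mlnorm_ge0.
pose eps := dm / K; have e0 : 0 < eps by rewrite divr_gt0.
have Ke : K * eps = dm by rewrite /eps mulrC divfK// gt_eqF.
have hc j : Anl (base mi S0 Sg0 m0) (fun e v => coord (vbasis fullv) j (Gsys tau0 tau1 c mi A e v)) 0
 (fun v => coord (vbasis fullv) j (Lsys tau0 tau1 c mi S0 Sg0 m0 v)).
 by have := hA.2 _ (@lin_coordj R _ j); rewrite linear0.
have [rho [z [r0 rle pz Gz]]] := analytic_implicit hc hA.1 (hinj mi m0) e0.
pose z0 := base mi S0 Sg0 m0.
have b1 : vSg z0 = Sg0 by rewrite /vSg symmE//; exact: sympd_sym.
have b2 i : vS i z0 = S0 i by rewrite /vS /uS /= ffunE /= symmE// (sympd_sym (pS0 i)).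
have Ks i : mlnorm (@vS R d n i) <= K.
 rewrite /K (bigD1 i)//= addrCA -!addrA lerDl !addr_ge0 ?mlnorm_ge0// sumr_ge0// => j _.
 exact: mlnorm_ge0.
have pSg e : `|e| < rho -> sympd (vSg (z e)).
 move=> er; apply: hdg; first exact: tr_symm.
 rewrite -b1; apply: le_trans (pwV_mx_norm lSg r0 (ltW e0) pz er) _.
 apply: le_trans dmg; rewrite -Ke; apply: ler_wpM2r; first exact: ltW.
 rewrite /K -addrA lerDl addr_ge0// sumr_ge0// => i _; exact: mlnorm_ge0.
have pS e i : `|e| < rho -> sympd (vS i (z e)).
 move=> er; apply: (s2valP' (hds i)); first exact: tr_symm.
 have h := pwV_mx_norm (lS i) r0 (ltW e0) pz er; rewrite b2 in h; apply: le_trans h _.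
 apply: le_trans (dms i); rewrite -Ke; apply: ler_wpM2r => //; exact: ltW.
have Tinv e i : `|e| < rho -> uT i (z e) = invmx (vS i (z e)).
 move=> er; have := uT_Gsys tau0 tau1 c mi A i e (z e).
 rewrite Gz// (linW0 (@linW_uT R d n i)) => /esym/eqP; rewrite subr_eq0 => /eqP h.
 by rewrite -[LHS](mulmxK (sympd_unit (pS e i er))) h mul1mx.
have pe p q (f : @sspace R d n -> 'M[R]_(p, q)) : linW f -> pwm rho (fun e => f (z e)).
 by move=> hf i j; exact: pwV_lin_pwx (lin_entry i j hf) r0 pz.
have pl f : lin f -> pwx rho (fun e => f (z e)) by move=> hf; exact: pwV_lin_pwx hf r0 pz.
exists rho, (fun e => vSg (z e)), (fun e => um (z e)), (fun i e => vS i (z e)),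
 (fun i e => uN i (z e)), (fun i e => ur i (z e)), (fun i e => wgt tau0 tau1 c mi i e (z e)).
split => //; last first.
- move=> i; split.
 + exact: pe.
 + move=> a b; apply: pwx_ext (pe _ _ _ (@linW_uT R d n i) a b) => e er.
 by rewrite Tinv.
 + exact: pe (@linW_uN R d n i).
 + exact: pe (@linW_ur R d n i).
 apply: pwxM => //; first exact: pwx_cst.
 apply: pwx_exp => //; apply: pwxB => //.
 apply: pwxD => //; apply: pwxM => //; try exact: pwx_cst.
 - exact: pl (@lin_u0 R d n i).
 - exact: pl (@lin_u1 R d n i).
 apply: pwxM => //; first by apply: pwxM => //; [exact: pwx_cst|exact: pwx_id].
 apply: (@pwx_ext _ (fun e => \sum_k ur i (z e) k 0 * (mi i k 0 - um (z e) k 0))).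
 by move=> e _; rewrite dotcE; apply: eq_bigr => k _; rewrite !mxE.
 apply: pwx_sum => // k; apply: pwxM => //; first exact: pe (@linW_ur R d n i) k 0.
 by apply: pwxB => //; [exact: pwx_cst|exact: pe (@linW_um R d n) k 0].
- by split; [exact: pe|exact: pe (@linW_um R d n)].
move=> e er; have G0 := Gz e er; set v := z e in G0 *.
have sSg := sympd_sym (pSg e er); have sS i := sympd_sym (pS e i er).
have gS i : eqS tau0 tau1 A i e v = 0.
 by rewrite -(uS_Gsys tau0 tau1 c mi A) G0 (linW0 (@linW_uS R d n i)).
have gN i : eqN tau1 i e v = 0.
 by rewrite -(uN_Gsys tau0 tau1 c mi A) G0 (linW0 (@linW_uN R d n i)).
have gr i : eqr tau0 tau1 mi A i e v = 0.
 by rewrite -(ur_Gsys tau0 tau1 c mi A) G0 (linW0 (@linW_ur R d n i)).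
have g0 i : eq0 tau0 A i e v = 0.
 by rewrite -(u0_Gsys tau0 tau1 c mi A) G0 (lin0 (@lin_u0 R d n i)).
have g1 i : eq1 tau1 i e v = 0.
 by rewrite -(u1_Gsys tau0 tau1 c mi A) G0 (lin0 (@lin_u1 R d n i)).
have gm : eqm tau0 tau1 c mi e v = 0 by exact: (congr1 (@um R d n) G0).
have gSg : eqSg tau0 tau1 c mi e v = 0 by exact: (congr1 (@uSg R d n) G0).
have d0 i : expR (u0 i v) = \det (1%:M + (2 / tau0 * e) *: (A i *m (1%:M - invmx (vS i v)))).
 by rewrite -Tinv//; apply/eqP; rewrite -subr_eq0; apply/eqP; exact: g0.
have d1 i : expR (u1 i v) = \det (1%:M + (2 / tau1 * e) *: (vSg v *m (1%:M - vS i v))).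
 by apply/eqP; rewrite -subr_eq0; apply/eqP; exact: g1.
split.
- exact: pSg.
- by move=> i; exact: pS.
- move=> i; apply: match_of_eq; [exact: pSg|exact: pS|].
 have sX := tr_eqS (2 / tau0 * e) (2 / tau1 * e) sSg (sS i) (sympd_sym (sympd_inv (pA i))).
 by have [] := symm_antis0 sX (gS i).
- by move=> i; apply/eqP; rewrite -subr_eq0; apply/eqP; exact: gN.
- by move=> i; apply/eqP; rewrite -subr_eq0; apply/eqP; exact: gr.
- by move=> i; rewrite -d0 expR_gt0.
- by move=> i; rewrite -d1 expR_gt0.
- by move=> i; rewrite -d0 -d1 !expRK.
- exact: gm.
- by have [] := symm_antis0 (tr_symm _) gSg.
Qed.

End star_curve.

(** * Effect on the determinants and on the mean term of perturbing the dual pair *)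

Section matrix_bounds.
Context {R : realType} {d : nat}.

Lemma mxM_le m n p (X : 'M[R]_(m, n)) (Y : 'M[R]_(n, p)) x y : `|X| <= x -> `|Y| <= y ->
 `|X *m Y| <= n%:R * x * y.
Proof.
move=> hx hy; apply: le_trans (mx_normM _ _) _.
by apply: ler_pM => //; rewrite ler_wpM2l.
Qed.

Lemma tr_cyc (S Q Y : 'M[R]_d) : S \in unitmx ->
 \tr (S *m Q *m S *m (invmx S *m Y *m invmx S)) = \tr (Q *m Y).
Proof.
move=> uS; rewrite -[in LHS]mulmxA (mulmxA S (invmx S *m Y)) (mulmxA S (invmx S)) mulmxV// mul1mx.
by rewrite mxtrace_mulC mulmxA mulmxKV// mxtrace_mulC.
Qed.

Lemma norm1_le : `|1%:M : 'M[R]_d| <= 1.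
Proof. by apply: mx_norm_le => // i j; rewrite !mxE; case: (i == j); rewrite ?normr1 ?normr0. Qed.

Lemma sympd_ge_inv_tr (M : 'M[R]_d) v : sympd M -> dotc v v <= \tr (invmx M) * dotc v (M *m v).
Proof.
move=> pM; have [->|v0] := eqVneq v 0; first by rewrite !dotc0l mulr0.
have vv := dotc_gt0 v0; have h1 := sympd_CS v v pM; have h2 := sympd_tr_ge v (sympd_inv pM).
have h3 := sympd_ge0 pM v; rewrite -(ler_pM2l vv) -expr2; apply: le_trans h1 _.
by rewrite mulrC mulrA ler_wpM2r// mulrC.
Qed.

Lemma sympd_perturb (M E : 'M[R]_d) c : sympd M -> E^T = E -> 0 < c ->
 (forall v, c * dotc v v <= dotc v (M *m v)) -> d%:R ^+ 2 * `|E| <= c / 2 ->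
 sympd (M + E) /\ forall v, c / 2 * dotc v v <= dotc v ((M + E) *m v).
Proof.
move=> pM sE c0 hc hE.
have key v : c / 2 * dotc v v <= dotc v ((M + E) *m v).
 rewrite mulmxDl dotcDr; have h1 := hc v; have h2 := dotc_mulmx_norm E v.
 have h3 := ler_wpM2r (dotc_ge0 v) hE.
 move: h2; rewrite ler_norml => /andP[h2 _].
 move: (dotc v v) (dotc v (M *m v)) (dotc v (E *m v)) (d%:R ^+ 2 * `|E|) h1 h2 h3 => a b e k; lra.
split => //; apply: sympdP; first by rewrite linearD/= (sympd_sym pM) sE.
move=> v v0; apply: lt_le_trans (key v); rewrite mulr_gt0 ?divr_gt0//; exact: dotc_gt0.
Qed.

(** The right side is the maximum of the left one over [y], so an approximate solution bounds the
    exact mean term without inverting the perturbed matrix. *)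
Lemma variational_mean (M : 'M[R]_d) (b r y : 'cV[R]_d) : sympd M -> M *m r = b ->
 2 * dotc y b - dotc y (M *m y) <= dotc r b.
Proof.
move=> pM <-; have := sympd_ge0 pM (r - y).
rewrite mulmxBr !(dotcBl, dotcBr).
have -> : dotc r (M *m y) = dotc y (M *m r) by rewrite dotc_mulmx (sympd_sym pM) dotcC.
lra.
Qed.

Variables (dl Cl : R).
Hypothesis hln : forall X : 'M[R]_d, `|X| <= dl -> 0 < \det (1%:M + X) /\
 `|ln (\det (1%:M + X)) - \tr X| <= Cl * `|X| ^+ 2.

Variables (eta0 eta : R) (Sg S N A : 'M[R]_d).
Hypotheses (pSg : sympd Sg) (pS : sympd S) (pA : sympd A).
Let T : 'M[R]_d := invmx S.
Hypothesis hm : invmx Sg + eta *: (1%:M - S) = S *m (invmx A + eta0 *: (1%:M - T)) *m S.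
Hypothesis hN : N + eta *: (N *m Sg *m (1%:M - S)) = 1%:M - S.
Let P : 'M[R]_d := 1%:M - eta *: (Sg *m N).
Let Q : 'M[R]_d := P *m Sg.
Let scr k (X Y : 'M[R]_d) : X *m (k *: Y) = k *: (X *m Y).
Proof. by rewrite scalemxAr. Qed.
Let scl k (X Y : 'M[R]_d) : (k *: X) *m Y = k *: (X *m Y).
Proof. by rewrite scalemxAl. Qed.

Lemma PM1 : P *m (1%:M + eta *: (Sg *m (1%:M - S))) = 1%:M.
Proof.
have hN' := hN; move: hN'; set K : 'M[R]_d := 1%:M - S => hN'; rewrite /P mulmxBl mul1mx scl mulmxDr mulmx1 scr.
rewrite -[X in _ - X](_ : eta *: (Sg *m K) = _); last first.
 by rewrite -{1}hN' mulmxDr scr !mulmxA.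
by rewrite addrK.
Qed.

Lemma MP1 : (1%:M + eta *: (Sg *m (1%:M - S))) *m P = 1%:M.
Proof. exact: mulmx1C PM1. Qed.

Lemma KP : (1%:M - S) *m P = N.
Proof.
have h : N *m (1%:M + eta *: (Sg *m (1%:M - S))) = 1%:M - S.
 by rewrite mulmxDr mulmx1 scr mulmxA.
by rewrite -h -mulmxA MP1 mulmx1.
Qed.

Lemma Q_inv : Q *m (invmx Sg + eta *: (1%:M - S)) = 1%:M.
Proof.
rewrite /Q -mulmxA mulmxDr mulmxV ?sympd_unit// scr; exact: PM1.
Qed.

(** The perturbed matrix factors exactly as the old one times [1 + eta P Z], so the expansion at the
    identity applies. Its trace consists of a term in [H], a term in [X] and the mixed term that
    carries the gain. *)
Lemma det1_gain (H X : 'M[R]_d) : 0 < \det (1%:M + eta *: (Sg *m (1%:M - S))) ->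
 let Z := H *m (1%:M - S) + Sg *m X + H *m X in `|eta *: (P *m Z)| <= dl ->
 0 < \det (1%:M + eta *: ((Sg + H) *m (1%:M - (S - X)))) /\
 ln (\det (1%:M + eta *: (Sg *m (1%:M - S)))) + eta * (\tr (N *m H) + \tr (Q *m X) + \tr (P *m H *m X))
 - Cl * `|eta *: (P *m Z)| ^+ 2 <= ln (\det (1%:M + eta *: ((Sg + H) *m (1%:M - (S - X))))).
Proof.
move=> d0 Z hZ; set M := 1%:M + eta *: (Sg *m (1%:M - S)) in d0 *.
have e : 1%:M + eta *: ((Sg + H) *m (1%:M - (S - X))) = M *m (1%:M + eta *: (P *m Z)).
 rewrite [RHS]mulmxDr mulmx1 scr mulmxA MP1 mul1mx /M -addrA -scalerDr; congr (_ + _ *: _).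
 have -> : 1%:M - (S - X) = (1%:M - S) + X by rewrite opprB addrA addrAC.
 by rewrite /Z; move: (1%:M - S) => K; rewrite mulmxDr !mulmxDl !addrA.
have [h1 h2] := hln hZ; rewrite e det_mulmx; split; first by rewrite mulr_gt0.
rewrite lnM ?posrE// -addrA lerD2l.
have -> : eta * (\tr (N *m H) + \tr (Q *m X) + \tr (P *m H *m X)) = \tr (eta *: (P *m Z)).
 rewrite linearZ/= /Z -KP /Q; move: (1%:M - S) (P) => K P'; rewrite !mulmxDr !linearD/= !mulmxA.
 by rewrite [\tr (P' *m H *m K)]mxtrace_mulC mulmxA.
by move: h2; rewrite ler_norml => /andP[h2 _]; move: h2; move: (Cl * _) (ln _) (\tr _) => a b k; lra.
Qed.

(** The matching condition [hm] identifies the resolvent of this determinant with [S Q S]. The term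
    linear in [X] is then [- \tr (Q X)], the opposite of the one in [det1_gain]: a matched [S] is
    stationary for [lnE]. *)
Lemma det0_gain (X T' : 'M[R]_d) : 0 < \det (1%:M + eta0 *: (A *m (1%:M - T))) ->
 (S - X) *m T' = 1%:M -> let Y := eta0 *: (S *m Q *m S *m (T *m X *m T')) in `|Y| <= dl ->
 0 < \det (1%:M + eta0 *: (A *m (1%:M - T'))) /\
 ln (\det (1%:M + eta0 *: (A *m (1%:M - T)))) - eta0 * (\tr (Q *m X) + \tr (Q *m X *m T' *m X))
 - Cl * `|Y| ^+ 2 <= ln (\det (1%:M + eta0 *: (A *m (1%:M - T')))).
Proof.
move=> d0 eT' Y hY; set M := 1%:M + eta0 *: (A *m (1%:M - T)) in d0 *.
have uS := sympd_unit pS; have uA := sympd_unit pA.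
have eT1 : T' = T + T *m X *m T'.
 have : T *m ((S - X) *m T') = T by rewrite eT' mulmx1.
 rewrite mulmxBl mulmxBr mulmxA mulVmx// mul1mx mulmxA => /eqP.
 by rewrite subr_eq => /eqP.
have eT2 : T' = T + T' *m X *m T.
 have : T' *m (S - X) *m T = T by rewrite (mulmx1C eT') mul1mx.
 rewrite mulmxBr mulmxBl -[T' *m S *m T]mulmxA mulmxV// mulmx1 => /eqP.
 by rewrite subr_eq => /eqP.
have QM : S *m Q *m S *m invmx A *m M = 1%:M.
 have -> : S *m Q *m S *m invmx A *m M = S *m Q *m (S *m (invmx A + eta0 *: (1%:M - T))).
 rewrite /M -!mulmxA mulmxDr mulmx1 scr (mulmxA (invmx A)) mulVmx// mul1mx.
 by rewrite !mulmxA.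
 have -> : S *m (invmx A + eta0 *: (1%:M - T)) = (invmx Sg + eta *: (1%:M - S)) *m T.
 by rewrite hm mulmxK.
 by rewrite -mulmxA (mulmxA Q) Q_inv mul1mx mulmxV.
have MQ := mulmx1C QM.
have e : 1%:M + eta0 *: (A *m (1%:M - T')) = M *m (1%:M + - Y).
 rewrite [RHS]mulmxDr mulmx1 mulmxN /Y scr.
 have -> : S *m Q *m S *m (T *m X *m T') = S *m Q *m S *m invmx A *m (A *m (T *m X *m T')).
 by rewrite !mulmxA -[in RHS](mulmxA _ (invmx A) A) mulVmx// mulmx1.
 rewrite [M *m (_ *m _)]mulmxA MQ mul1mx /M -addrA -scalerBr; congr (_ + _ *: _).
 by rewrite -mulmxBr {1}eT1 opprD addrA.
have hY' : `|- Y| <= dl by rewrite normrN.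
have [h1 h2] := hln hY'; rewrite e det_mulmx; split; first by rewrite mulr_gt0.
rewrite lnM ?posrE// -!addrA lerD2l.
have tY : \tr Y = eta0 * (\tr (Q *m X) + \tr (Q *m X *m T' *m X)).
 rewrite /Y linearZ/=; congr (_ * _).
 have -> : T *m X *m T' = T *m X *m T + T *m X *m T' *m X *m T.
 by rewrite {1}eT2 mulmxDr !mulmxA.
 have -> : T *m X *m T' *m X *m T = T *m (X *m T' *m X) *m T by rewrite !mulmxA.
 by rewrite mulmxDr linearD/= !(tr_cyc _ _ uS) -(mulmxA _ X T') -(mulmxA Q).
move: h2; rewrite linearN/= tY normrN ler_norml => /andP[h2 _].
move: h2; move: (eta0 * _) (ln _) (Cl * _) => a b k; lra.
Qed.

End matrix_bounds.

(** * A gain for every moderately distant competitor, uniform in [kappa] *)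

Section gain_step.
Context {R : realType} {d : nat}.

(** Quadratic near 0 and linear at infinity: what remains of a quadratic gain when the perturbation
    of [S] stays bounded while the displacement does not. *)
Definition qg (t : R) : R := t ^+ 2 / (1 + t).

Lemma qg_facts (x : R) : 0 <= x -> let u := x / (1 + x) in
 [/\ 0 <= u, u <= 1, u <= x, x * u = qg x & u ^+ 2 <= qg x].
Proof.
move=> x0 u; have x1 : 0 < 1 + x by rewrite ltr_pwDl.
have ux : x = u * (1 + x) by rewrite /u divfK// gt_eqF.
have u0 : 0 <= u by rewrite divr_ge0// ltW.
have u1 : u <= 1 by rewrite ler_pdivrMr// mul1r lerDr.
have ule : u <= x by rewrite [leRHS]ux ler_peMr// lerDl.
have e : x * u = qg x by rewrite /qg /u expr2 mulrA.
by split => //; rewrite -e expr2 ler_wpM2r.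
Qed.

Lemma qg_cross (x y : R) : 0 <= x -> 0 <= y -> x * (y / (1 + y)) <= qg x + qg y.
Proof.
move=> x0 y0; have [a0 a1 ax ea _] := qg_facts x0; have [b0 b1 bx eb _] := qg_facts y0.
have [xy|yx] := leP x y.
 by apply: ler_wpDl; [rewrite -ea mulr_ge0|rewrite -eb ler_wpM2r].
apply: ler_wpDr; first by rewrite -eb mulr_ge0.
rewrite -ea ler_wpM2l// ler_pdivrMr ?ltr_pwDl// mulrAC ler_pdivlMr ?ltr_pwDl//.
by rewrite !mulrDr !mulr1 [y * x]mulrC lerD2r ltW.
Qed.

Lemma qg_ge0 (x : R) : 0 <= x -> 0 <= qg x.
Proof. by move=> x0; rewrite divr_ge0 ?sqr_ge0// addr_ge0. Qed.

(** [variational_mean] with test vector [r - z]; choosing [z] along [h] later yields the gain in the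
    mean. *)
Lemma mixed_mean_bound (A Sg H : 'M[R]_d) (mi m r h z : 'cV[R]_d) (a b : R) :
 sympd (1%:M + a *: A + b *: (Sg + H)) -> H^T = H -> sympd A -> sympd Sg ->
 r + a *: (A *m r) + b *: (Sg *m r) = mi - m ->
 exists r', r' + a *: (A *m r') + b *: ((Sg + H) *m r') = mi - (m + h) /\
 dotc r (mi - m) - 2 * dotc r h - b * dotc r (H *m r) + (2 * dotc z h
 - (dotc z z + a * dotc z (A *m z) + b * dotc z (Sg *m z)) + 2 * b * dotc r (H *m z) - b * dotc z (H *m z))
 <= dotc r' (mi - (m + h)).
Proof.
move=> pM sH pA pSg hr; set M := 1%:M + a *: A + b *: (Sg + H) in pM.
have Mv v : M *m v = v + a *: (A *m v) + b *: ((Sg + H) *m v).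
 by rewrite /M 2!mulmxDl mul1mx -!scalemxAl.
pose r' := invmx M *m (mi - (m + h)).
have hr' : M *m r' = mi - (m + h) by rewrite /r' mulKVmx// sympd_unit.
exists r'; split; first by rewrite -Mv.
have := variational_mean (r - z) pM hr'.
have -> : mi - (m + h) = mi - m - h by rewrite opprD addrA.
apply: le_trans; rewrite -hr Mv.
have sw (C : 'M[R]_d) : C^T = C -> dotc z (C *m r) = dotc r (C *m z).
 by move=> sC; rewrite dotc_mulmx sC dotcC.
apply: eq_ler.
rewrite mulmxDl !(mulmxBr, dotcDl, dotcDr, dotcBl, dotcBr, dotcZr, scalerDr, scalerBr, dotcNr, dotcNl).
rewrite !(sw _ sH) !(sw _ (sympd_sym pA)) !(sw _ (sympd_sym pSg)) (dotcC z r).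
ring.
Qed.

Lemma sympd_lower_norm (M : 'M[R]_d) b v : sympd M -> `|invmx M| <= b ->
 (d%:R * b + 1)^-1 * dotc v v <= dotc v (M *m v).
Proof.
move=> pM hb; have b0 : 0 <= b by exact: le_trans hb.
have k0 : 0 < d%:R * b + 1 by rewrite ltr_wpDl// mulr_ge0.
rewrite ler_pdivrMl//; apply: le_trans (sympd_ge_inv_tr v pM) _.
apply: ler_wpM2r; first exact: sympd_ge0.
by have := tr_le hb; have := ler_norm (\tr (invmx M)); lra.
Qed.

Lemma lnE_mul (p q : gparam R d) t0 t1 S r : t0 + t1 != 0 -> (t0 + t1) * lnE p q t0 t1 S r =
 - dotc r (p.1 - q.1) - t0 / 2 * ln (\det (1%:M + (2 / t0) *: (p.2 *m (1%:M - invmx S))))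
 - t1 / 2 * ln (\det (1%:M + (2 / t1) *: (q.2 *m (1%:M - S)))).
Proof. by move=> h; rewrite mulrC divfK. Qed.

(** [S] is moved to [S - X] with [X] a damped multiple of [H]. The terms linear in [X] cancel, the
    mixed term [\tr (P H X)] is close to [\tr (H X)] and gives the gain, and terms quadratic in [X]
    cost one more factor [sg]. The vector [z] plays the same role for the mean. All constants depend
    on [B] and the dimension only. *)
Lemma gain_step (B : R) : 1 <= B -> exists cc g e1 : R, [/\ 0 < cc, 0 < g, 0 < e1 &
 forall (p q q' : gparam R d) (t0 t1 : R) (S N : 'M[R]_d) (r : 'cV[R]_d),
 let eta0 := 2 / t0 in let eta := 2 / t1 in let H := q'.2 - q.2 in let h := q'.1 - q.1 in
 0 < t0 -> 0 < t1 -> eta0 <= e1 -> eta <= e1 ->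
 sympd p.2 -> sympd q.2 -> sympd q'.2 ->
 admissible p q t0 t1 S r -> matched p q t0 t1 S ->
 N + eta *: (N *m q.2 *m (1%:M - S)) = 1%:M - S ->
 0 < \det (1%:M + eta0 *: (p.2 *m (1%:M - invmx S))) ->
 0 < \det (1%:M + eta *: (q.2 *m (1%:M - S))) ->
 `|p.2| <= B -> `|invmx p.2| <= B -> `|q.2| <= B -> `|S| <= B -> `|invmx S| <= B -> `|N| <= B -> `|r| <= B ->
 eta * `|H| <= cc ->
 exists S' r', admissible p q' t0 t1 S' r' /\
 (t0 + t1) * lnE p q' t0 t1 S' r' <= (t0 + t1) * lnE p q t0 t1 S r -
 (- 2 * dotc r h + \tr (N *m H) - eta * dotc r (H *m r) + g * (qg `|H| + qg `|h|))].
Proof.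
move=> B1; have [[dl Cl] /= [dl0 dl1 Cl0 hln]] := @lndet1D_expand R d.
have B0 : 0 <= B by lra.
pose D : R := d%:R; have D0 : 0 <= D by exact: ler0n.
pose L := D * B + 1; have L1 : 1 <= L by rewrite /L lerDr mulr_ge0.
have L_0 : 0 < L by lra.
have Li0 : 0 < L^-1 by rewrite invr_gt0.
have L0 : 0 <= L by lra.
pose kP := 1 + D * B * B; have kP0 : 0 <= kP by rewrite /kP addr_ge0// !mulr_ge0.
pose kQ := D * kP * B; have kQ0 : 0 <= kQ by rewrite /kQ !mulr_ge0.
pose kT := D / (L^-1 / 2); have kT0 : 0 <= kT by rewrite /kT !divr_ge0// invr_ge0.
pose k3 := D * (D * (D * (D * kQ * 1) * kT) * 1).
pose k4 := D * (D * (D * (D * B * B) * 1) * 1).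
pose k5 := D * kP * (D * 1 * (1 + B) + D * B * 1 + D * 1 * 1).
pose k6 := D * (D * (D * B * kQ) * B) * (D * (D * B * 1) * kT).
pose k7 := D * (D * 1) + D * (D * B) + D * (D * B).
pose k8 := D * B * D; pose k9 := D * D.
have [[k30 k40 k50 k60] [k70 k80 k90]] : [/\ 0 <= k3, 0 <= k4, 0 <= k5 & 0 <= k6] /\
 [/\ 0 <= k7, 0 <= k8 & 0 <= k9] by rewrite /k3 /k4 /k5 /k6 /k7 /k8 /k9; split; split; nonneg.
pose D2 := D ^+ 2.
have DD0 : 0 <= D2 by rewrite exprn_ge0.
have [DT0 DB0] : 0 <= D2 * (1 + kT) /\ 0 <= D2 * (2 + B) by split; nonneg.
(* One number above all the dimensional constants that occur as products of norms in the error
   estimates. *)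
pose K := 1 + L + kT + k3 + k4 + k5 + k6 + k7 + k8 + k9 + D2 + D2 * (1 + kT) + D2 * (2 + B).
have K1 : 1 <= K by rewrite /K; lra.
have [K3 K4 K5 K6] : [/\ k3 <= K, k4 <= K, k5 <= K & k6 <= K] by rewrite /K; split; lra.
have [K7 K8 K9 KL] : [/\ k7 <= K, k8 <= K, k9 <= K & L <= K] by rewrite /K; split; lra.
have [KD KT KB] : [/\ D2 <= K, D2 * (1 + kT) <= K & D2 * (2 + B) <= K] by rewrite /K; split; lra.
have K0 : 0 < K by lra.
have D_L : D <= L by rewrite /L; have := ler_wpM2l D0 B1; lra.
(* The size of the perturbation: errors of order [K * sg ^+ 2] become at most [1 / 32] of the gain,
   of order [sg]. *)
pose sg := (32 * K ^+ 2)^-1.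
have sg0 : 0 < sg by rewrite invr_gt0 mulr_gt0// exprn_gt0.
have KKs : K ^+ 2 * sg = 32^-1 by rewrite /sg; field; rewrite gt_eqF.
have K2 : K <= K ^+ 2 by rewrite expr2 ler_peMr// ltW.
have Ks : K * sg <= 32^-1 by rewrite -KKs ler_wpM2r// ltW.
have s1 : sg <= 32^-1 by apply: le_trans Ks; rewrite ler_peMl// ltW.
(* Bound for [eta0], [eta] and [eta * |H|] alike: it keeps the determinants in the range of the
   logarithmic expansion and makes their remainders a small part of the gain. *)
pose cc := Num.min (dl / K) (sg / (16 * (1 + Cl) * K ^+ 2)).
have C1 : 0 < 1 + Cl by rewrite ltr_pwDl.
have cc0 : 0 < cc by rewrite lt_min !divr_gt0// !mulr_gt0// exprn_gt0.
have ccdl : K * cc <= dl by rewrite mulrC -ler_pdivlMr// ge_min lexx.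
have ccs : (1 + Cl) * (K ^+ 2 * cc) <= sg / 16.
 have : cc <= sg / (16 * (1 + Cl) * K ^+ 2) by rewrite ge_min lexx orbT.
 by rewrite ler_pdivlMr ?mulr_gt0 ?exprn_gt0//; lra.
have KKcc : K ^+ 2 * cc <= sg / 16.
 by apply: le_trans ccs; rewrite ler_peMl// ?lerDl// mulr_ge0 ?exprn_ge0// ltW.
have Kcc : K * cc <= sg / 16 by apply: le_trans KKcc; rewrite ler_wpM2r// ltW.
have cc1 : cc <= sg / 16 by apply: le_trans Kcc; rewrite ler_peMl// ltW.
exists cc, (sg / 4), cc; split => //; first by rewrite divr_gt0.
move=> p q q' t0 t1 S N r; set eta0 := 2 / t0; set eta := 2 / t1; set H := q'.2 - q.2; set h := q'.1 - q.1.
move=> t00 t10 he0 he pA pG pG' hadm hmat hN d0 d1 bA bAi bG bS bT bN br hH.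
have [pS pK0 pK hr] := hadm.
have eta00 : 0 < eta0 by rewrite divr_gt0.
have eta_0 : 0 < eta by rewrite divr_gt0.
have t0e : t0 / 2 * eta0 = 1 by rewrite /eta0; field; rewrite gt_eqF.
have t1e : t1 / 2 * eta = 1 by rewrite /eta; field; rewrite gt_eqF.
have sH : H^T = H by rewrite /H linearB/= (sympd_sym pG) (sympd_sym pG').
have [u0 u1 ux eu uu] := qg_facts (normr_ge0 H).
set u := `|H| / (1 + `|H|) in u0 u1 ux eu uu.
have [v0 v1 vx ev vv] := qg_facts (normr_ge0 h).
set v := `|h| / (1 + `|h|) in v0 v1 vx ev vv.
have H1 : 0 < 1 + `|H| by rewrite ltr_pwDl.
have h1 : 0 < 1 + `|h| by rewrite ltr_pwDl.
(* The denominator keeps [X] below [sg], so [S - X] stays positive definite however large [H] is. *)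
pose X : 'M[R]_d := (sg / (1 + `|H|)) *: H.
have sX : X^T = X by rewrite /X linearZ/= sH.
have nX : `|X| = sg * u by rewrite normrZ ger0_norm ?divr_ge0// ?ltW// /u mulrAC mulrA.
have nXs : `|X| <= sg by rewrite nX ler_piMr// ltW.
have [pS' lS'] : sympd (S - X) /\ forall v, L^-1 / 2 * dotc v v <= dotc v ((S - X) *m v).
 apply: sympd_perturb => //; first by rewrite linearN/= sX.
 by move=> w; exact: sympd_lower_norm.
 rewrite normrN -/D2 ler_pdivlMl//.
 have : L * (D2 * `|X|) <= K * (K * sg).
 by apply: ler_pM => //; [nonneg|apply: ler_pM].
 by move=> /le_trans; apply; rewrite mulrA -expr2 KKs; clear -K0; lra.
pose T : 'M[R]_d := invmx S; pose T' : 'M[R]_d := invmx (S - X).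
have bT' : `|T'| <= kT by apply: sympd_lower_inv_norm pS' _ lS'; rewrite divr_gt0.
have eT' : (S - X) *m T' = 1%:M by rewrite mulmxV// sympd_unit.
have sT' : T'^T = T' by exact: sympd_sym (sympd_inv pS').
have pK0' : sympd (invmx p.2 + eta0 *: (1%:M - T')).
 apply: (@sympd_perturb _ _ _ _ L^-1 _ _ _ _ _).1 => //; first exact: sympd_inv.
 - by rewrite linearZ/= linearB/= trmx1 sT'.
 - by move=> w; apply: sympd_lower_norm; [exact: sympd_inv|rewrite invmxK].
 rewrite -/D2 ler_pdivlMl//.
 have n1 : `|1%:M - T'| <= 1 + kT by apply: le_trans (ler_normB _ _) _; rewrite lerD ?norm1_le.
 have : L * (D2 * `|eta0 *: (1%:M - T')|) <= K * (K * cc).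
 apply: ler_pM => //; first by nonneg.
 rewrite normrZ (gtr0_norm eta00) mulrCA.
 rewrite [K * _]mulrC; apply: ler_pM => //; [exact: ltW|nonneg|].
 by apply: le_trans KT; rewrite ler_wpM2l.
 by move=> /le_trans; apply; rewrite mulrA -expr2; apply: le_trans KKcc _; clear -s1; lra.
have pK' : sympd (invmx q'.2 + eta *: (1%:M - (S - X))).
 have L'0 : 0 < D * (B + `|H|) + 1 by rewrite ltr_wpDl//; nonneg.
 apply: (@sympd_perturb _ _ _ _ (D * (B + `|H|) + 1)^-1 _ _ _ _ _).1 => //; first exact: sympd_inv.
 - by rewrite linearZ/= !linearB/= trmx1 sX (sympd_sym pS).
 - by rewrite invr_gt0.
 - move=> w; apply: sympd_lower_norm; [exact: sympd_inv|rewrite invmxK].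
 by rewrite -[q'.2](subrK q.2) -/H addrC; apply: le_trans (ler_normD _ _) _; rewrite lerD2r.
 rewrite -/D2 ler_pdivlMl//.
 have n1 : `|1%:M - (S - X)| <= 2 + B.
 apply: le_trans (ler_normB _ _) _; have := ler_normB S X; have := norm1_le (d := d) (R := R).
 by move: (`|_|) (`|_|) (`|S|) (`|X|) nXs bS s1 => ? ? ? ?; clear; lra.
 have eL : (D * (B + `|H|) + 1) * eta <= 2 * (K * cc).
 have : D * (eta * `|H|) <= K * cc by apply: ler_pM => //; [rewrite mulr_ge0// ltW|clear -D_L KL; lra].
 have : L * eta <= K * cc by apply: ler_pM => //; exact: ltW.
 by rewrite /L; clear; lra.
 have : ((D * (B + `|H|) + 1) * eta) * (D2 * `|1%:M - (S - X)|) <= 2 * (K * cc) * K.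
 apply: ler_pM => //; [by rewrite mulr_ge0// ltW|by nonneg|].
 by apply: le_trans KB; rewrite ler_wpM2l.
 rewrite normrZ (gtr0_norm eta_0) => hh; apply: (@le_trans _ _ (2 * (K * cc) * K)).
 by apply: le_trans hh; apply: eq_ler; ring.
 by rewrite -mulrA [K * cc * K]mulrAC -expr2; clear -KKcc s1; lra.
pose P : 'M[R]_d := 1%:M - eta *: (q.2 *m N); pose Q : 'M[R]_d := P *m q.2.
have a1 : eta0 <= 1 by clear -he0 cc1 s1; lra.
have b1 : eta <= 1 by clear -he cc1 s1; lra.
have bP : `|P| <= kP.
 apply: le_trans (ler_normB _ _) _; rewrite /kP; apply: lerD; first exact: norm1_le.
 rewrite normrZ (gtr0_norm eta_0) -[leRHS]mul1r; apply: ler_pM => //; [exact: ltW|exact: mxM_le].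
have bQ : `|Q| <= kQ by exact: mxM_le.
pose Z : 'M[R]_d := H *m (1%:M - S) + q.2 *m X + H *m X.
have nX1 : `|X| <= 1 * u by rewrite nX; apply: ler_pM => //; [exact: ltW|clear -s1; lra].
have nXH : `|X| <= `|H| by apply: le_trans nX1 _; rewrite mul1r.
have bPZ : `|P *m Z| <= K * `|H|.
 have n1 : `|1%:M - S| <= 1 + B by apply: le_trans (ler_normB _ _) _; rewrite lerD ?norm1_le.
 have hHX : `|H *m X| <= D * `|H| * 1 by apply: mxM_le => //; clear -nXs s1; lra.
 have hZ : `|Z| <= (D * 1 * (1 + B) + D * B * 1 + D * 1 * 1) * `|H|.
 have z1 := mxM_le (lexx `|H|) n1; have z2 := mxM_le bG nXH.
 have zz := ler_normD (H *m (1%:M - S) + q.2 *m X) (H *m X).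
 have zy := ler_normD (H *m (1%:M - S)) (q.2 *m X).
 move: z1 z2 hHX zz zy; rewrite -/D; move: (`|_|) (`|_|) (`|_|) (`|_|) (`|_|) => ? ? ? ? ?; clear; lra.
 by apply: le_trans (mxM_le bP hZ) _; rewrite mulrA -/D ler_wpM2r.
have etaPZ : `|eta *: (P *m Z)| <= dl.
 rewrite normrZ (gtr0_norm eta_0); apply: le_trans ccdl; rewrite [leRHS]mulrC.
 apply: le_trans (ler_wpM2l (ltW eta_0) bPZ) _; rewrite mulrCA [leLHS]mulrC.
 by rewrite ler_wpM2r// ltW.
have [d1' g1] := det1_gain hln hN d1 etaPZ.
pose Y : 'M[R]_d := S *m Q *m S *m (T *m X *m T').
have bY : `|Y| <= K * (sg * u).
 have y1 : `|T *m X *m T'| <= D * (D * B * (1 * (sg * u))) * kT.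
 by apply: mxM_le bT'; apply: mxM_le bT _; rewrite mul1r nX.
 have y2 : `|S *m Q *m S| <= D * (D * B * kQ) * B by exact: mxM_le (mxM_le bS bQ) bS.
 apply: le_trans (mxM_le y2 y1) _.
 have -> : d%:R * (D * (D * B * kQ) * B) * (D * (D * B * (1 * (sg * u))) * kT) = k6 * (sg * u).
 by rewrite /k6 -/D; ring.
 by rewrite ler_wpM2r// mulr_ge0// ltW.
have sgu : sg * u <= sg by rewrite ler_piMr// ltW.
have etaY : `|eta0 *: Y| <= dl.
 rewrite normrZ (gtr0_norm eta00); apply: le_trans ccdl.
 have : eta0 * `|Y| <= cc * (K * 1).
 by apply: ler_pM => //; [exact: ltW|apply: le_trans bY _; rewrite ler_wpM2l//; [exact: ltW|clear -sgu s1; lra]].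
 by rewrite mulr1 [leRHS]mulrC.
have [d0' g0] := det0_gain hln pG pS pA hmat hN d0 eT' etaY.
have pM : sympd (1%:M + eta0 *: p.2 + eta *: (q.2 + H)).
 rewrite /H [q.2 + _]addrC subrK; apply: sympdD; last exact: sympdZ.
 by apply: sympdD; [exact: sympd1|exact: sympdZ].
pose z := (sg / (1 + `|h|)) *: h.
have nz : `|z| = sg * v by rewrite normrZ ger0_norm ?divr_ge0// ?ltW// /v mulrAC mulrA.
have [r' [hr' mr']] := mixed_mean_bound h z pM sH pA pG hr.
have eG : q.2 + H = q'.2 by rewrite /H addrC subrK.
have em : q.1 + h = q'.1 by rewrite /h addrC subrK.
rewrite eG in g1 d1' hr'; rewrite em in hr' mr'.
exists (S - X), r'; split; first by split.
have t01 : t0 + t1 != 0 by rewrite gt_eqF// addr_gt0.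
rewrite !lnE_mul//.
have e0 : \tr (P *m H *m X) = (sg / (1 + `|H|)) * fro H - eta * \tr (q.2 *m N *m H *m X).
 rewrite /P !mulmxBl mul1mx linearB/= -!scalemxAl [X in _ - X]linearZ/=; congr (_ - _).
 by rewrite /X -scalemxAr linearZ/= /fro sH.
have f3 : sg * qg `|H| <= (sg / (1 + `|H|)) * fro H.
 rewrite mulrAC -mulrA ler_wpM2l ?(ltW sg0)// /qg ler_wpM2r ?invr_ge0 ?(ltW H1)//; exact: sqr_norm_le_fro.
have f4 : `|\tr (q.2 *m N *m H *m X)| <= K * sg * qg `|H|.
 apply: le_trans (tr_le (mxM_le (mxM_le (mxM_le bG bN) (lexx `|H|)) (lexx `|X|))) _.
 have -> : d%:R * (d%:R * (d%:R * (d%:R * B * B) * `|H|) * `|X|) = k4 * (sg * (`|H| * u)).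
 by rewrite nX /k4 -/D; ring.
 by rewrite eu -mulrA ler_wpM2r// mulr_ge0 ?qg_ge0// ltW.
have f5 : `|\tr (Q *m X *m T' *m X)| <= K * sg ^+ 2 * qg `|H|.
 apply: le_trans (tr_le (mxM_le (mxM_le (mxM_le bQ (lexx `|X|)) bT') (lexx `|X|))) _.
 have -> : d%:R * (d%:R * (d%:R * (d%:R * kQ * `|X|) * kT) * `|X|) = k3 * (sg ^+ 2 * u ^+ 2).
 by rewrite nX /k3 -/D; ring.
 rewrite -[leRHS]mulrA; apply: ler_pM => //; first by rewrite mulr_ge0 ?sqr_ge0.
 by rewrite ler_wpM2l ?sqr_ge0.
(* [t1 / 2] cancels one factor [eta], and [eta * |H| ^+ 2 = (eta + eta * |H|) * qg |H|]: the
   remainder is absorbed by the gain although [H] itself may be large. *)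
have f6 : t1 / 2 * (Cl * `|eta *: (P *m Z)| ^+ 2) <= (Cl * K ^+ 2) * (2 * cc) * qg `|H|.
 rewrite normrZ (gtr0_norm eta_0) exprMn.
 have -> : t1 / 2 * (Cl * (eta ^+ 2 * `|P *m Z| ^+ 2)) = (t1 / 2 * eta) * (Cl * (eta * `|P *m Z| ^+ 2)) by ring.
 rewrite t1e mul1r -[Cl * K ^+ 2 * _]mulrA -[leRHS]mulrA ler_wpM2l//.
 have PZ2 : `|P *m Z| ^+ 2 <= K ^+ 2 * (`|H| ^+ 2) by rewrite -exprMn lerXn2r ?nnegrE// mulr_ge0// ltW.
 apply: le_trans (ler_wpM2l (ltW eta_0) PZ2) _; rewrite mulrCA -[leRHS]mulrA ler_wpM2l ?sqr_ge0//.
 have -> : eta * `|H| ^+ 2 = (eta + eta * `|H|) * qg `|H| by rewrite /qg; field; rewrite gt_eqF.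
 by rewrite ler_wpM2r ?qg_ge0//; clear -he hH; lra.
have f7 : t0 / 2 * (Cl * `|eta0 *: Y| ^+ 2) <= Cl * cc * (K ^+ 2 * sg ^+ 2) * qg `|H|.
 rewrite normrZ (gtr0_norm eta00) exprMn.
 have -> : t0 / 2 * (Cl * (eta0 ^+ 2 * `|Y| ^+ 2)) = (t0 / 2 * eta0) * (Cl * (eta0 * `|Y| ^+ 2)) by ring.
 rewrite t0e mul1r -[Cl * cc * _]mulrA -[leRHS]mulrA ler_wpM2l// -[leRHS]mulrA; apply: ler_pM; [exact: ltW|exact: sqr_ge0|exact: he0|].
 have Y2 : `|Y| ^+ 2 <= (K * (sg * u)) ^+ 2 by rewrite lerXn2r ?nnegrE// !mulr_ge0// ltW.
 by apply: le_trans Y2 _; rewrite exprMn [(sg * u) ^+ 2]exprMn -[leRHS]mulrA; apply: ler_wpM2l; [exact: sqr_ge0|apply: ler_wpM2l; [exact: sqr_ge0|exact: uu]].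
have f8 : sg * qg `|h| <= dotc z h.
 rewrite dotcZl mulrAC -mulrA ler_wpM2l ?(ltW sg0)// /qg ler_wpM2r ?invr_ge0 ?(ltW h1)//; exact: sqr_norm_le_dotc.
have bMz (M : 'M[R]_d) b : `|M| <= b -> `|dotc z (M *m z)| <= D * (D * b) * (sg ^+ 2 * qg `|h|).
 move=> hb; apply: le_trans (dotc_norm _ _) _.
 apply: le_trans (ler_wpM2l _ (mxM_le hb (lexx `|z|))) _; first by nonneg.
 have -> : d%:R * `|z| * (d%:R * b * `|z|) = D * (D * b) * (sg ^+ 2 * v ^+ 2) by rewrite nz /D; ring.
 have b0 : 0 <= b by exact: le_trans hb.
 by rewrite ler_wpM2l ?ler_wpM2l ?sqr_ge0//; nonneg.
have sq0 : 0 <= sg ^+ 2 * qg `|h| by rewrite mulr_ge0 ?sqr_ge0 ?qg_ge0.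
have f9 : dotc z z + eta0 * dotc z (p.2 *m z) + eta * dotc z (q.2 *m z) <= K * (sg ^+ 2 * qg `|h|).
 have h1' := bMz 1%:M 1 norm1_le; rewrite mul1mx in h1'.
 have h2' : eta0 * dotc z (p.2 *m z) <= 1 * (D * (D * B) * (sg ^+ 2 * qg `|h|)).
 by apply: ler_pM => //; [exact: ltW|exact: sympd_ge0|exact: le_trans (ler_norm _) (bMz _ _ bA)].
 have h3' : eta * dotc z (q.2 *m z) <= 1 * (D * (D * B) * (sg ^+ 2 * qg `|h|)).
 by apply: ler_pM => //; [exact: ltW|exact: sympd_ge0|exact: le_trans (ler_norm _) (bMz _ _ bG)].
 have h4' := le_trans (ler_norm _) h1'.
 have h5' : k7 * (sg ^+ 2 * qg `|h|) <= K * (sg ^+ 2 * qg `|h|) by rewrite ler_wpM2r.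
 by apply: le_trans h5'; move: h4' h2' h3'; rewrite /k7; clear; move: (sg ^+ 2 * _) => w; lra.
have f10 : eta * dotc z (H *m z) <= K * cc * (sg ^+ 2 * qg `|h|).
 apply: le_trans (ler_wpM2l (ltW eta_0) (le_trans (ler_norm _) (bMz H _ (lexx _)))) _.
 have -> : eta * (D * (D * `|H|) * (sg ^+ 2 * qg `|h|)) = k9 * (eta * `|H|) * (sg ^+ 2 * qg `|h|).
 by rewrite /k9; ring.
 by rewrite ler_wpM2r//; apply: ler_pM => //; rewrite mulr_ge0// ltW.
have f11 : `|2 * eta * dotc r (H *m z)| <= 2 * cc * (K * sg * (qg `|H| + qg `|h|)).
 have hz : `|dotc r (H *m z)| <= K * sg * (qg `|H| + qg `|h|).
 apply: le_trans (dotc_norm _ _) _.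
 apply: le_trans (ler_pM _ _ (ler_wpM2l _ br) (mxM_le (lexx `|H|) (lexx `|z|))) _ => //; try by nonneg.
 have -> : d%:R * B * (d%:R * `|H| * `|z|) = k8 * sg * (`|H| * v) by rewrite nz /k8 /D; ring.
 apply: ler_pM; [by rewrite mulr_ge0// ltW|by rewrite mulr_ge0| |exact: qg_cross].
 by rewrite ler_wpM2r// ltW.
 have e2 : 0 < 2 * eta by rewrite mulr_gt0.
 rewrite normrM (gtr0_norm e2); apply: le_trans (ler_wpM2l (ltW e2) hz) _.
 by rewrite ler_wpM2r ?ler_wpM2l//; exact: le_trans hz.
have g1' : t1 / 2 * ln (\det (1%:M + eta *: (q.2 *m (1%:M - S)))) + (\tr (N *m H) + \tr (Q *m X) + \tr (P *m H *m X))
 - t1 / 2 * (Cl * `|eta *: (P *m Z)| ^+ 2) <= t1 / 2 * ln (\det (1%:M + eta *: (q'.2 *m (1%:M - (S - X))))).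
 have t10' : 0 <= t1 / 2 by rewrite divr_ge0// ltW.
 apply: le_trans (ler_wpM2l t10' g1); apply: eq_ler.
 by rewrite mulrBr mulrDr [in RHS]mulrA t1e mul1r.
have g0' : t0 / 2 * ln (\det (1%:M + eta0 *: (p.2 *m (1%:M - T)))) - (\tr (Q *m X) + \tr (Q *m X *m T' *m X))
 - t0 / 2 * (Cl * `|eta0 *: Y| ^+ 2) <= t0 / 2 * ln (\det (1%:M + eta0 *: (p.2 *m (1%:M - T')))).
 have t00' : 0 <= t0 / 2 by rewrite divr_ge0// ltW.
 apply: le_trans (ler_wpM2l t00' g0); apply: eq_ler.
 by rewrite !mulrBr [in RHS]mulrA t0e mul1r.
have qH0 := qg_ge0 (normr_ge0 H); have qh0 := qg_ge0 (normr_ge0 h).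
have s0q : 0 <= sg * qg `|H| by rewrite mulr_ge0// ltW.
have s0p : 0 <= sg * qg `|h| by rewrite mulr_ge0// ltW.
have m1 : K * sg ^+ 2 * qg `|H| <= 32^-1 * (sg * qg `|H|).
 have -> : K * sg ^+ 2 * qg `|H| = K * sg * (sg * qg `|H|) by ring.
 by rewrite ler_wpM2r.
have m2 : K * (sg ^+ 2 * qg `|h|) <= 32^-1 * (sg * qg `|h|).
 have -> : K * (sg ^+ 2 * qg `|h|) = K * sg * (sg * qg `|h|) by ring.
 by rewrite ler_wpM2r.
rewrite -/P -/Q -/Z in g1'; rewrite -/T -/T'.
have m3 : Cl * cc * (K ^+ 2 * sg ^+ 2) * qg `|H| <= 32^-1 * (sg * qg `|H|).
 have -> : Cl * cc * (K ^+ 2 * sg ^+ 2) * qg `|H| = (Cl * (K ^+ 2 * cc)) * sg * (sg * qg `|H|) by ring.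
 rewrite ler_wpM2r//.
 have c1 : 0 <= K ^+ 2 * cc by rewrite mulr_ge0 ?sqr_ge0// ltW.
 have : Cl * (K ^+ 2 * cc) <= 1 by clear -ccs s1 c1; lra.
 by move=> /(ler_wpM2r (ltW sg0)); rewrite mul1r => /le_trans; apply.
have m4 : Cl * K ^+ 2 * (2 * cc) * qg `|H| <= 8^-1 * (sg * qg `|H|).
 rewrite mulrA ler_wpM2r//; have c1 : 0 <= K ^+ 2 * cc by rewrite mulr_ge0 ?sqr_ge0// ltW.
 by clear -ccs c1; lra.
have m5 : eta * `|\tr (q.2 *m N *m H *m X)| <= 32^-1 * (sg * qg `|H|).
 apply: (@le_trans _ _ (cc * (K * sg * qg `|H|))); first by apply: ler_pM => //; exact: ltW.
 have -> : cc * (K * sg * qg `|H|) = K * cc * (sg * qg `|H|) by ring.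
 rewrite ler_wpM2r//.
 by clear -Kcc s1; lra.
have m6 : K * cc * (sg ^+ 2 * qg `|h|) <= 32^-1 * (sg * qg `|h|).
 have -> : K * cc * (sg ^+ 2 * qg `|h|) = (K * cc) * sg * (sg * qg `|h|) by ring.
 rewrite ler_wpM2r//.
 have : K * cc <= 1 by clear -Kcc s1; lra.
 by move=> /(ler_wpM2r (ltW sg0)); rewrite mul1r => /le_trans; apply.
have m7 : 2 * cc * (K * sg * (qg `|H| + qg `|h|)) <= 32^-1 * (sg * (qg `|H| + qg `|h|)).
 have -> : 2 * cc * (K * sg * (qg `|H| + qg `|h|)) = 2 * (K * cc) * (sg * (qg `|H| + qg `|h|)) by ring.
 by rewrite ler_wpM2r//; [rewrite mulr_ge0 ?addr_ge0// ltW|clear -Kcc s1; lra].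
have m8 := le_trans f11 m7; rewrite ler_norml in m8; move/andP: m8 => [m8 _].
have m9 : eta * \tr (q.2 *m N *m H *m X) <= 32^-1 * (sg * qg `|H|).
 by apply: le_trans m5; rewrite ler_wpM2l// ?ler_norm// ltW.
have m10 := le_trans (ler_norm _) (le_trans f5 m1).
have m11 := le_trans f6 m4; have m12 := le_trans f7 m3.
have m13 := le_trans f9 m2; have m14 := le_trans f10 m6.
rewrite e0 in g1'.
have -> : sg / 4 * (qg `|H| + qg `|h|) = 4^-1 * (sg * qg `|H|) + 4^-1 * (sg * qg `|h|) by field.
rewrite mulrDr mulrDr in m8.
clear -mr' g1' g0' f3 f8 m8 m9 m10 m11 m12 m13 m14 s0q s0p.
move: mr' g1' g0' f3 f8 m8 m9 m10 m11 m12 m13 m14 s0q s0p.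
set a := sg * qg `|H|; set b := sg * qg `|h|.
move: (t1 / 2 * _) (t1 / 2 * _) (t1 / 2 * _) (t0 / 2 * _) (t0 / 2 * _) (t0 / 2 * _) => x1 x2 x3 y1 y2 y3.
move: (\tr _) (\tr _) (\tr _) (\tr _) (_ * fro H) => w1 w2 w3 w4 w5.
lra.
Qed.

End gain_step.

(** * Comparison of weighted exponentials; very distant competitors *)

Section optimality.
Context {R : realType}.

Lemma pwx_taylor1 (rho : R) f : 0 < rho -> pwx rho f ->
 exists C, forall e, `|e| < rho -> `|f e - f 0| <= C * `|e|.
Proof.
move=> r0 [B [c [h1 h2]]]; exists (B / rho) => e er.
have z0 : `|0 : R| < rho by rewrite normr0.
have t0 := series_tail 1 z0 h1 (h2 _ z0); have t1 := series_tail 1 er h1 (h2 _ er).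
rewrite big_nat1 expr0 mulr1 normr0 mul0r expr1 mulr0 in t0.
move/eqP: (le_anti (introT andP (conj t0 (normr_ge0 _)))); rewrite normr_eq0 subr_eq0 => /eqP ->.
by move: t1; rewrite big_nat1 expr0 mulr1 expr1 mulrA mulrAC.
Qed.

Lemma pwx_taylor2 (rho : R) f : 0 < rho -> pwx rho f ->
 exists a C, forall e, `|e| < rho -> `|f e - f 0 - a * e| <= C * e ^+ 2.
Proof.
move=> r0 [B [c [h1 h2]]]; exists (c 1%N), (B / rho ^+ 2) => e er.
have z0 : `|0 : R| < rho by rewrite normr0.
have t0 := series_tail 1 z0 h1 (h2 _ z0); have t1 := series_tail 2 er h1 (h2 _ er).
rewrite big_nat1 expr0 mulr1 normr0 mul0r expr1 mulr0 in t0.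
move/eqP: (le_anti (introT andP (conj t0 (normr_ge0 _)))); rewrite normr_eq0 subr_eq0 => /eqP ->.
move: t1; rewrite big_nat_recr//= big_nat1 expr0 mulr1 expr1 opprD addrA.
by rewrite expr_div_n real_normK ?num_real// mulrA mulrAC.
Qed.

Lemma pwm_bound (rho : R) p q (F : R -> 'M[R]_(p, q)) : pwm rho F ->
 exists2 B, 0 <= B & forall e, `|e| < rho -> `|F e| <= B.
Proof.
move=> h; have hh (ij : 'I_p * 'I_q) : exists B, pw rho B (fun e => F e ij.1 ij.2) by exact: h.
have [B hB] := choice hh; have B0 ij : 0 <= B ij by exact: pw_B0 (hB ij).
exists (\sum_ij B ij); first exact: sumr_ge0.
move=> e er; apply: mx_norm_le => [|i j]; first exact: sumr_ge0.
by apply: le_trans (pw_norm (hB (i, j)) er) _; rewrite (bigD1 (i, j))//= lerDl sumr_ge0.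
Qed.

(** The first-order part [G] averages to 0 under the weights, so only the gain [Q] remains; the
    quadratic error of the exponential is allowed to consume half of it. *)
Lemma weighted_exp_lt n (w G y : 'I_n -> R) (k Q : R) : (0 < n)%N -> (forall i, 0 < w i) ->
 0 < k -> 0 < Q -> \sum_i w i * G i = 0 -> (forall i, y i <= - (k * (G i + Q))) ->
 (forall i, `|k * (G i + Q)| <= 2^-1) -> (forall i, 2 * (k * (G i + Q)) ^+ 2 <= k * Q / 2) ->
 \sum_i w i * expR (y i) < \sum_i w i.
Proof.
move=> hn w0 k0 Q0 wG hy h1 h2.
have W0 := sum_gt0 hn w0.
apply: (@le_lt_trans _ _ (\sum_i w i * (1 - k * (G i + Q) + k * Q / 2))).
 apply: ler_sum => i _; rewrite ler_wpM2l ?(ltW (w0 i))//.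
 apply: (@le_trans _ _ (expR (- (k * (G i + Q))))); first by rewrite ler_expR.
 apply: le_trans (expR_le_quadratic _) _; first by rewrite normrN.
 by rewrite sqrrN lerD2l.
rewrite (eq_bigr (fun i => w i * (1 - k * Q / 2) - k * (w i * G i))); last by move=> i _; field.
rewrite sumrB -mulr_sumr wG mulr0 subr0 -mulr_suml gtr_pMr// ltrBlDr ltrDl divr_gt0//.
exact: mulr_gt0.
Qed.

Context {d : nat}.

Lemma tr_symm_mul (M H : 'M[R]_d) : H^T = H -> \tr (symm M *m H) = \tr (M *m H).
Proof.
move=> sH; rewrite /symm -scalemxAl linearZ/= mulmxDl linearD/=.
have -> : \tr (M^T *m H) = \tr (M *m H) by rewrite -mxtrace_tr trmx_mul trmxK sH mxtrace_mulC.
by field.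
Qed.

Lemma mean_solution (a b L : R) (A Sg : 'M[R]_d) (v : 'cV[R]_d) : 0 < a -> 0 < b ->
 sympd A -> sympd Sg -> 0 < L -> exists r,
 [/\ r + a *: (A *m r) + b *: (Sg *m r) = v, 0 <= dotc r v &
 (forall u, dotc u ((1%:M + a *: A + b *: Sg) *m u) <= L * dotc u u) -> dotc v v <= L * dotc r v].
Proof.
move=> a0 b0 pA pSg L0; pose M := 1%:M + a *: A + b *: Sg.
have pM : sympd M by apply: sympdD; [apply: sympdD; [exact: sympd1|exact: sympdZ]|exact: sympdZ].
have Mv u : M *m u = u + a *: (A *m u) + b *: (Sg *m u) by rewrite /M 2!mulmxDl mul1mx -!scalemxAl.
have hr : M *m (invmx M *m v) = v by rewrite mulKVmx// sympd_unit.
have pos : 0 <= dotc (invmx M *m v) v by rewrite dotcC; apply: sympd_ge0; exact: sympd_inv.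
exists (invmx M *m v); split => //; first by rewrite -Mv.
move=> hL; have [->|v0] := eqVneq v 0; first by rewrite mulmx0 !dotc0r mulr0.
have vv := dotc_gt0 v0; rewrite -(ler_pM2l vv) -expr2.
apply: le_trans (sympd_CS v v pM) _; rewrite [dotc (_ *m v) v]dotcC mulrA [dotc v v * L]mulrC.
by rewrite ler_wpM2r// dotcC.
Qed.

(** Beyond [c2 / e] crude pairs are enough. If the covariance is large, [S = 1 / 2] makes the second
    determinant at least [1 + c2 / tau1], by [det1D_sympd_ge]; otherwise [S = 1] makes both
    determinants trivial and the distant mean gives the bound. *)
Lemma far_step (B c2 tau0 tau1 : R) : 1 <= B -> 0 < c2 -> 0 < tau0 -> 0 < tau1 ->
 exists dl e1, [/\ 0 < dl, 0 < e1 & forall (p q : gparam R d) e, 0 < e -> e <= e1 ->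
 sympd p.2 -> sympd q.2 -> `|p.2| <= B -> `|invmx p.2| <= B -> `|p.1| <= B ->
 c2 / e < `|q.2| \/ c2 / e < `|q.1| -> exists S r,
 admissible p q (e^-1 * tau0) (e^-1 * tau1) S r /\
 lnE p q (e^-1 * tau0) (e^-1 * tau1) S r <= - dl].
Proof.
move=> B1 c20 t00 t10; pose s := tau0 + tau1; have s0 : 0 < s by rewrite addr_gt0.
have [[dl Cl] [/= dl0 dl1 Cl0 hln]] := @lndet1D_expand R d.
pose D : R := d%:R; have D0 : 0 <= D by exact: ler0n.
have B0 : 0 < B by lra.
pose lam := ln (1 + c2 / tau1).
have lam0 : 0 < lam by rewrite ln_gt0// ltrDl divr_gt0.
pose L := 1 + D ^+ 2 * B + 2 * D ^+ 2 * c2 / tau1.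
have L0 : 0 < L.
 have t : 0 <= D ^+ 2 * B by rewrite mulr_ge0 ?sqr_ge0// ltW.
 have : 0 <= 2 * D ^+ 2 * c2 / tau1 by nonneg.
 by rewrite /L; lra.
pose K := D * B + Cl * B ^+ 2 * 1.
have K0 : 0 <= K by rewrite /K addr_ge0// !mulr_ge0 ?sqr_ge0// ltW.
(* [da] is half of the gain [tau1 * lam / (2 * s)], the other half paying for the first determinant.
   [db] comes from a mean difference of at least [c2 / (2 * e)] and from the bound [L] on the mean
   matrix, with [e <= 1]. *)
pose da := tau1 * lam / (4 * s); pose db := c2 ^+ 2 / (4 * s * L).
have da0 : 0 < da by rewrite divr_gt0 ?mulr_gt0.
have db0 : 0 < db by rewrite divr_gt0 ?exprn_gt0 ?mulr_gt0.
pose m1 := c2 / (2 * B); pose m2 := tau1 * lam / (4 * (K + 1)).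
pose m3 := tau0 * dl / (2 * B); pose m4 := tau0 / (4 * B).
have m10 : 0 < m1 by rewrite divr_gt0 ?mulr_gt0.
have K10 : 0 < K + 1 by rewrite ltr_wpDl.
have m20 : 0 < m2 by rewrite divr_gt0 ?mulr_gt0.
have m30 : 0 < m3 by rewrite divr_gt0 ?mulr_gt0.
have m40 : 0 < m4 by rewrite divr_gt0 ?mulr_gt0.
pose Lb := D * B + 1; have Lb0 : 0 < Lb by rewrite ltr_wpDl// mulr_ge0// ltW.
pose m5 := tau0 / (4 * (Lb * (D ^+ 2 + 1))).
have D20 : 0 < D ^+ 2 + 1 by rewrite ltr_wpDl// sqr_ge0.
have m50 : 0 < m5 by rewrite divr_gt0 ?mulr_gt0.
exists (Num.min da db), (Num.min 1 (Num.min m1 (Num.min m2 (Num.min m3 (Num.min m4 m5))))).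
rewrite !lt_min da0 db0 m10 m20 m30 m40 m50 ltr01; split => //.
move=> p q e e0; rewrite !le_min => /andP[el1 /andP[em1 /andP[em2 /andP[em3 /andP[em4 em5]]]]].
move=> pA pG bA bAi bm far.
set t0 := e^-1 * tau0; set t1 := e^-1 * tau1.
have h0 : 2 / t0 = 2 / tau0 * e by rewrite /t0; field; rewrite !gt_eqF.
have h1 : 2 / t1 = 2 / tau1 * e by rewrite /t1; field; rewrite !gt_eqF.
have hs : t0 + t1 = s / e by rewrite /t0 /t1 -mulrDr mulrC.
have h00 : 0 < 2 / t0 by rewrite h0 mulr_gt0 ?divr_gt0.
have h10 : 0 < 2 / t1 by rewrite h1 mulr_gt0 ?divr_gt0.
have h0B : 2 / t0 * B <= 2^-1.
 rewrite h0; move: em4; rewrite /m4 ler_pdivlMr ?mulr_gt0// => h.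
 have -> : 2 / tau0 * e * B = (e * (4 * B)) / tau0 / 2 by field; rewrite gt_eqF.
 by rewrite ler_pdivrMr// ler_pdivrMr// mulrC; move: h; lra.
have h0dl : 2 / t0 * B <= dl.
 rewrite h0; move: em3; rewrite /m3 ler_pdivlMr ?mulr_gt0// => h.
 have -> : 2 / tau0 * e * B = (e * (2 * B)) / tau0 by field; rewrite gt_eqF.
 by rewrite ler_pdivrMr// mulrC; move: h; lra.
have t00' : 0 < t0 by rewrite mulr_gt0 ?invr_gt0.
have t10' : 0 < t1 by rewrite mulr_gt0 ?invr_gt0.
have t01' : t0 + t1 != 0 by rewrite gt_eqF ?addr_gt0.
have [r [hr r0 rL]] := mean_solution (p.1 - q.1) h00 h10 pA pG L0.
have [q2big|q2small] := ltP (c2 / e) `|q.2|; last first.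
- have q1big : c2 / e < `|q.1| by case: far => //; rewrite ltNge q2small.
 exists 1%:M, r; split.
 rewrite /admissible invmx1 !subrr !scaler0 !addr0; split => //; [exact: sympd1|exact: sympd_inv|exact: sympd_inv].
 rewrite /lnE invmx1 !subrr !mulmx0 !scaler0 !addr0 det1 ln1 !mulr0 !subr0.
 have vv : dotc (p.1 - q.1) (p.1 - q.1) <= L * dotc r (p.1 - q.1).
 apply: rL => u; rewrite 2!mulmxDl mul1mx -!scalemxAl !dotcDr !dotcZr.
 have k1 := le_trans (ler_norm _) (dotc_mulmx_norm p.2 u).
 have k2 := le_trans (ler_norm _) (dotc_mulmx_norm q.2 u).
 have uu := dotc_ge0 u.
 have k3 : 2 / t0 * dotc u (p.2 *m u) <= D ^+ 2 * B * dotc u u.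
 apply: (@le_trans _ _ (1 * (D ^+ 2 * B * dotc u u))); last by rewrite mul1r.
 apply: ler_pM; [exact: ltW|exact: sympd_ge0| |].
 by apply: le_trans (_ : 2 / t0 * B <= 1); [rewrite ler_peMr// ltW|lra].
 by apply: le_trans k1 _; rewrite ler_wpM2r// ler_wpM2l ?sqr_ge0.
 have k4 : 2 / t1 * dotc u (q.2 *m u) <= 2 * D ^+ 2 * c2 / tau1 * dotc u u.
 apply: le_trans (ler_wpM2l (ltW h10) k2) _; rewrite h1.
 have -> : 2 / tau1 * e * (d%:R ^+ 2 * `|q.2| * dotc u u) =
 2 * D ^+ 2 / tau1 * (e * `|q.2|) * dotc u u by rewrite /D; field; rewrite gt_eqF.
 rewrite ler_wpM2r// [leRHS]mulrAC ler_wpM2l//.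
 by nonneg.
 by rewrite mulrC -ler_pdivlMr.
 by rewrite /L; lra.
 have nb : c2 / (2 * e) <= `|p.1 - q.1|.
 have k1 : B <= c2 / (2 * e).
 by move: em1; rewrite /m1 !ler_pdivlMr ?mulr_gt0//; lra.
 have k2 : c2 / e = 2 * (c2 / (2 * e)) by field; rewrite gt_eqF.
 have k3 := lerB_dist q.1 p.1; rewrite distrC in k3; move: bm q1big k3; rewrite k2; lra.
 have k4 : c2 ^+ 2 / (4 * e ^+ 2) <= L * dotc r (p.1 - q.1).
 apply: le_trans vv; apply: le_trans (sqr_norm_le_dotc _).
 have -> : c2 ^+ 2 / (4 * e ^+ 2) = (c2 / (2 * e)) ^+ 2 by field; rewrite gt_eqF.
 by rewrite lerXn2r// nnegrE ?divr_ge0// ?mulr_ge0// ltW.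
 apply: (@le_trans _ _ (- db)); last by rewrite lerN2 ge_min lexx orbT.
 rewrite mulNr lerN2 hs ler_pdivlMr ?divr_gt0//.
 rewrite -(ler_pM2l L0); apply: le_trans k4.
 have -> : L * (db * (s / e)) = c2 ^+ 2 / (4 * e ^+ 2) * e by rewrite /db; field; rewrite !gt_eqF.
 by rewrite ler_piMr// divr_ge0 ?sqr_ge0// mulr_ge0// sqr_ge0.
pose S : 'M[R]_d := (2^-1)%:M.
have iS : invmx S = 2%:M by rewrite /S invmx_scalar invrK.
have e1 : 1%:M - invmx S = - 1%:M :> 'M[R]_d.
 by rewrite iS -(@raddfB _ _ (@scalar_mx R d)) -raddfN; congr (_%:M); lra.
have e2 : 1%:M - S = (2^-1)%:M by rewrite /S -(@raddfB _ _ (@scalar_mx R d)); congr (_%:M); field.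
exists S, r; split.
 rewrite /admissible; split => //; first exact: sympd_scalar.
 apply: (@sympd_perturb _ _ _ _ Lb^-1 _ _ _ _ _).1.
 - exact: sympd_inv.
 - by rewrite e1 linearZ/= linearN/= trmx1.
 - by rewrite invr_gt0.
 - by move=> v; apply: sympd_lower_norm; [exact: sympd_inv|rewrite invmxK].
 rewrite e1 normrZ normrN (gtr0_norm h00) ler_pdivlMl//.
 have k1 : D ^+ 2 * (2 / t0 * `|1%:M : 'M[R]_d|) <= (D ^+ 2 + 1) * (2 / t0).
 apply: ler_pM; [by nonneg|by nonneg|by rewrite lerDl|].
 by rewrite ler_piMr ?norm1_le// ltW.
 apply: le_trans (ler_wpM2l (ltW Lb0) k1) _.
 move: em5; rewrite /m5 ler_pdivlMr ?mulr_gt0// => h; rewrite h0.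
 have -> : Lb * ((D ^+ 2 + 1) * (2 / tau0 * e)) = (e * (4 * (Lb * (D ^+ 2 + 1)))) / tau0 / 2.
 by field; rewrite gt_eqF.
 by rewrite ler_pdivrMr// ler_pdivrMr// mulrC; move: h; lra.
 rewrite e2; apply: sympdD; first exact: sympd_inv.
 by apply: sympdZ => //; exact: sympd_scalar.
apply: (@le_trans _ _ (- da)); last by rewrite lerN2 ge_min lexx.
rewrite /lnE e1 e2 mulmxN mulmx1 mul_mx_scalar scalerA hs ler_pdivrMr ?divr_gt0//.
have bX : `|(2 / t0) *: - p.2| <= 2 / t0 * B.
 by rewrite normrZ (gtr0_norm h00) normrN ler_wpM2l// ltW.
have [_ ] := hln _ (le_trans bX h0dl); rewrite ler_norml => /andP[d0 _].
have trb : - (2 / t0 * (D * B)) <= \tr ((2 / t0) *: - p.2).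
 rewrite scalerN [leRHS]linearN [X in _ <= - X]linearZ/= lerN2 ler_wpM2l// ?(ltW h00)//.
 exact: le_trans (ler_norm _) (tr_le bA).
have q0 : Cl * `|(2 / t0) *: - p.2| ^+ 2 <= 2 / t0 * (Cl * B ^+ 2 * 1).
 apply: (@le_trans _ _ (Cl * (2 / t0 * B) ^+ 2)).
 by rewrite ler_wpM2l// lerXn2r// nnegrE; nonneg.
 have -> : Cl * (2 / t0 * B) ^+ 2 = 2 / t0 * (Cl * B ^+ 2 * (2 / t0)) by ring.
 apply: ler_wpM2l; [exact: ltW|apply: ler_wpM2l; first by nonneg].
 by apply: le_trans (_ : 2 / t0 * B <= 1); [rewrite ler_peMr// ltW|clear -h0B; lra].
have b0 : - K <= t0 / 2 * ln (\det (1%:M + (2 / t0) *: - p.2)).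
 have k1 : - (2 / t0 * K) <= ln (\det (1%:M + (2 / t0) *: - p.2)) by rewrite /K; clear -d0 trb q0; lra.
 have k2 : 0 <= t0 / 2 by rewrite divr_ge0// ltW.
 apply: le_trans (ler_wpM2l k2 k1); rewrite mulrN mulrA.
 have -> : t0 / 2 * (2 / t0) = 1 by field; rewrite gt_eqF.
 by rewrite mul1r.
have b1 : lam <= ln (\det (1%:M + (2 / t1 * 2^-1) *: q.2)).
 have k1 : 0 < 2 / t1 * 2^-1 by rewrite mulr_gt0.
 have k2 := det1D_sympd_ge (sympdZ k1 pG).
 have k3 : 1 + c2 / tau1 <= 1 + \tr ((2 / t1 * 2^-1) *: q.2).
 rewrite lerD2l linearZ/= h1.
 have -> : c2 / tau1 = 2 / tau1 * e / 2 * (c2 / e) by field; rewrite !gt_eqF.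
 rewrite ler_wpM2l//; first by rewrite ltW// divr_gt0// mulr_gt0// divr_gt0.
 exact: le_trans (ltW q2big) (sympd_norm_le_tr pG).
 have k4 := le_trans k3 k2; have k5 : 0 < 1 + c2 / tau1 by rewrite addr_gt0// divr_gt0.
 by rewrite /lam ler_ln ?posrE//; exact: lt_le_trans k5 k4.
have b2 : t1 / 2 * lam <= t1 / 2 * ln (\det (1%:M + (2 / t1 * 2^-1) *: q.2)).
 by rewrite ler_wpM2l// divr_ge0// ltW.
have b3 : K <= tau1 * lam / (4 * e).
 rewrite ler_pdivlMr ?mulr_gt0//; move: em2; rewrite /m2 ler_pdivlMr ?mulr_gt0// => h.
 by have := mulr_ge0 K0 (ltW e0); clear -h e0; lra.
have -> : - da * (s / e) = tau1 * lam / (4 * e) - t1 / 2 * lam.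
 by rewrite /da /t1; field; rewrite !gt_eqF.
by clear -b0 b2 b3 r0; lra.
Qed.

End optimality.

(** * The curve consists of the unique minimizers for small [e] *)

Section star_optimal.
Context {R : realType} {d n : nat}.
Variables (tau0 tau1 : R) (lam : 'I_n -> R) (a : 'I_n -> {posnum R}) (mu : 'I_n -> gparam R d).
Hypotheses (hn : (0 < n)%N) (t00 : 0 < tau0) (t10 : 0 < tau1) (lam0 : forall i, 0 < lam i).
Hypotheses (lam1 : \sum_(i < n) lam i = 1) (hmu : forall i, Gd (mu i)).

Let s := tau0 + tau1.
Let c := cw tau0 tau1 lam a.
Let mi i := (mu i).1.
Let A i := (mu i).2.

Lemma star_lnE e Sg m S N r w i : 0 < e -> star tau0 tau1 c mi A e Sg m S N r w ->
 w i = c i * expR (lnE (mu i) (m, Sg) (e^-1 * tau0) (e^-1 * tau1) (S i) (r i)).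
Proof.
move=> e0 h; rewrite (star_w h) /lnE /A /mi /=; congr (_ * expR _).
have -> : 2 / (e^-1 * tau0) = 2 / tau0 * e by field; rewrite !gt_eqF.
have -> : 2 / (e^-1 * tau1) = 2 / tau1 * e by field; rewrite !gt_eqF.
move: (ln _) (ln _) (dotc _ _) => x y z; field.
by rewrite !gt_eqF ?addr_gt0// -mulrDr mulr_gt0 ?invr_gt0 ?addr_gt0.
Qed.

Lemma star_admissible e Sg m S N r w i B : 0 < e -> star tau0 tau1 c mi A e Sg m S N r w ->
 `|A i| <= B -> `|invmx (S i)| <= B ->
 2 / tau0 * e * ((d%:R * B + 1) * (d%:R ^+ 2 * (1 + B))) <= 2^-1 ->
 admissible (mu i) (m, Sg) (e^-1 * tau0) (e^-1 * tau1) (S i) (r i) /\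
 matched (mu i) (m, Sg) (e^-1 * tau0) (e^-1 * tau1) (S i).
Proof.
move=> e0 h bA bT small; have pS := star_S h i; have B0 : 0 <= B by exact: le_trans bA.
have h0 : 2 / (e^-1 * tau0) = 2 / tau0 * e by field; rewrite !gt_eqF.
have h1 : 2 / (e^-1 * tau1) = 2 / tau1 * e by field; rewrite !gt_eqF.
have h00 : 0 < 2 / tau0 * e by rewrite mulr_gt0 ?divr_gt0.
rewrite /admissible /matched h0 h1 /=.
have k0 : 0 < d%:R * B + 1 by rewrite ltr_wpDl// mulr_ge0.
have pK0 : sympd (invmx (A i) + (2 / tau0 * e) *: (1%:M - invmx (S i))).
 apply: (@sympd_perturb _ _ _ _ (d%:R * B + 1)^-1 _ _ _ _ _).1.
 - exact: sympd_inv (hmu i).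
 - by rewrite linearZ/= linearB/= trmx1 (sympd_sym (sympd_inv pS)).
 - by rewrite invr_gt0.
 - by move=> v; apply: sympd_lower_norm; [exact: sympd_inv (hmu i)|rewrite invmxK].
 rewrite ler_pdivlMl// normrZ (gtr0_norm h00); apply: le_trans small.
 have n1 : `|1%:M - invmx (S i)| <= 1 + B by apply: le_trans (ler_normB _ _) _; rewrite lerD ?norm1_le.
 rewrite [leRHS]mulrCA ler_wpM2l ?(ltW k0)// [leRHS]mulrCA ler_wpM2l ?sqr_ge0//.
 by rewrite ler_wpM2l// ltW.
split; last exact: star_match h i.
split => //; last exact: star_r h i.
by rewrite (star_match h i); exact: sympd_congr'.
Qed.

(** The stationarity equations tested on [(h, H)]: the first-order changes found in [gain_step]
    cancel in the weighted sum. *)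
Lemma star_gain_sum e Sg m S N r w (H : 'M[R]_d) (h : 'cV[R]_d) :
 star tau0 tau1 c mi A e Sg m S N r w -> H^T = H ->
 \sum_i w i * (- 2 * dotc (r i) h + \tr (N i *m H) - 2 / tau1 * e * dotc (r i) (H *m r i)) = 0.
Proof.
move=> st sH; set eta := 2 / tau1 * e.
have e1 : \sum_i w i * dotc (r i) h = 0.
 transitivity (dotc (\sum_i w i *: r i) h); last by rewrite (star_sum_m st) dotc0l.
 rewrite dotcE; under eq_bigr do rewrite dotcE mulr_sumr.
 rewrite exchange_big/=; apply: eq_bigr => k _; rewrite summxE mulr_suml; apply: eq_bigr => i _.
 by rewrite mxE mulrA.
have e2 : \sum_i w i * (\tr (N i *m H) - eta * dotc (r i) (H *m r i)) = 0.
 transitivity (\tr ((\sum_i w i *: (N i - eta *: (r i *m (r i)^T))) *m H)).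
 rewrite mulmx_suml [RHS]linear_sum/=; apply: eq_bigr => i _.
 rewrite -scalemxAl mxtraceZ; congr (_ * _); rewrite mulmxBl linearB/=; congr (_ - _).
 rewrite -scalemxAl mxtraceZ; congr (_ * _).
 by rewrite dotc_tr -mulmxA mxtrace_mulC.
 by rewrite -tr_symm_mul// (star_sum_Sg st) mul0mx linear0.
rewrite (eq_bigr (fun i => - 2 * (w i * dotc (r i) h) +
 w i * (\tr (N i *m H) - eta * dotc (r i) (H *m r i)))); last by move=> i _; ring.
by rewrite big_split/= -mulr_sumr e1 e2 mulr0 addr0.
Qed.

(** The displacements may be as large as [2 * c2 / e], but they enter the exponents multiplied by
    [e / s]. The exponents stay bounded, and [e * (x + y) ^+ 2 <= 6 * c2 * (qg x + qg y)] lets the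
    linear growth of [qg] absorb the quadratic error. *)
Lemma near_bounds (x y e g C0 c2 G : R) : 0 <= x -> 0 <= y -> 0 < e -> 0 < g -> 0 < C0 -> 0 < c2 -> e <= c2 ->
 x <= 2 * (c2 / e) -> y <= 2 * (c2 / e) -> 8 * C0 * c2 <= s -> 24 * C0 ^+ 2 * c2 <= g * s ->
 let Q := g * (qg x + qg y) in `|G + Q| <= C0 * (x + y) ->
 `|e / s * (G + Q)| <= 2^-1 /\ 2 * (e / s * (G + Q)) ^+ 2 <= e / s * Q / 2.
Proof.
move=> x0 y0 e0 g0 C00 c20 ec hx hy h1 h2 Q hG.
have s0 : 0 < s by rewrite addr_gt0.
have k0 : 0 < e / s by rewrite divr_gt0.
have ex : e * x <= 2 * c2 by rewrite mulrC -ler_pdivlMr// -mulrA.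
have ey : e * y <= 2 * c2 by rewrite mulrC -ler_pdivlMr// -mulrA.
split.
 rewrite normrM (gtr0_norm k0); apply: le_trans (ler_wpM2l (ltW k0) hG) _.
 rewrite mulrAC ler_pdivrMr//; have -> : e * (C0 * (x + y)) = C0 * (e * x + e * y) by ring.
 have : C0 * (e * x + e * y) <= C0 * (4 * c2) by rewrite ler_wpM2l ?(ltW C00)//; lra.
 lra.
have [_ _ _ ux _] := qg_facts x0; have [_ _ _ uy _] := qg_facts y0.
have qx0 := qg_ge0 x0; have qy0 := qg_ge0 y0.
have e1 : x ^+ 2 = qg x * (1 + x) by rewrite /qg divfK// gt_eqF// ltr_pwDl.
have e2 : y ^+ 2 = qg y * (1 + y) by rewrite /qg divfK// gt_eqF// ltr_pwDl.
have sq : (e / s * (G + Q)) ^+ 2 <= (e / s) ^+ 2 * (C0 ^+ 2 * (x + y) ^+ 2).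
 rewrite exprMn ler_wpM2l ?sqr_ge0// -exprMn -[leLHS]real_normK ?num_real//.
 by rewrite lerXn2r// nnegrE mulr_ge0 ?addr_ge0// ltW.
have xy : e * (x + y) ^+ 2 <= 6 * c2 * (qg x + qg y).
 have : (x + y) ^+ 2 <= 2 * (x ^+ 2 + y ^+ 2) by have := sqr_ge0 (x - y); rewrite !expr2; lra.
 move=> /(ler_wpM2l (ltW e0)) /le_trans; apply; rewrite e1 e2.
 have -> : e * (2 * (qg x * (1 + x) + qg y * (1 + y))) = 2 * (qg x * (e + e * x) + qg y * (e + e * y)) by ring.
 have : qg x * (e + e * x) <= qg x * (3 * c2) by rewrite ler_wpM2l//; lra.
 have : qg y * (e + e * y) <= qg y * (3 * c2) by rewrite ler_wpM2l//; lra.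
 lra.
apply: (@le_trans _ _ (e / s * (2 * (C0 ^+ 2 * (e * (x + y) ^+ 2)) / s))).
 rewrite -ler_pdivlMl//; apply: le_trans sq _; apply: eq_ler.
 by field; rewrite gt_eqF.
rewrite -[leRHS]mulrA ler_wpM2l ?(ltW k0)// ler_pdivrMr//.
have := ler_wpM2l (sqr_ge0 C0) xy.
have : 24 * C0 ^+ 2 * c2 * (qg x + qg y) <= g * s * (qg x + qg y) by rewrite ler_wpM2r// addr_ge0.
rewrite /Q; move: (C0 ^+ 2) (e * _) (qg x + qg y) => C2 E q; lra.
Qed.

Theorem star_optimal : exists rho (Sg : R -> 'M[R]_d) (m : R -> 'cV[R]_d)
 (S N : 'I_n -> R -> 'M[R]_d) (r : 'I_n -> R -> 'cV[R]_d) (w : 'I_n -> R -> R) (e0 : R),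
 [/\ 0 < e0 <= rho,
 forall e, `|e| < rho -> star tau0 tau1 c mi A e (Sg e) (m e) (fun i => S i e) (fun i => N i e)
 (fun i => r i e) (fun i => w i e),
 pwm rho Sg /\ pwm rho m, forall i, [/\ pwm rho (S i), pwm rho (fun e => invmx (S i e)),
 pwm rho (N i), pwm rho (r i) & pwx rho (w i)] &
 forall e, 0 < e -> e < e0 ->
 [/\ argmin Gd (Phi tau0 tau1 lam a mu e^-1) = [set (m e, Sg e)],
 exists2 b : {posnum R}, b%:num = bmass tau0 tau1 lam a mu e^-1 (m e, Sg e) &
 argmin (setT `*` Gd) (Fobj tau0 tau1 lam a mu e^-1) = [set (b, (m e, Sg e))] &
 bmass tau0 tau1 lam a mu e^-1 (m e, Sg e) = (\sum_i w i e) `^ (theta tau0 tau1)^-1]].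
Proof.
have c0 i : 0 < c i by exact: cw_gt0.
have [rho [Sg [m [S [N [r [w [r0 st [pSg pm] pp]]]]]]]] := @star_curve R d n tau0 tau1 c mi A c0 hmu hn.
exists rho, Sg, m, S, N, r, w.
have s0 : 0 < s by rewrite addr_gt0.
have [Bg Bg0 hBg] := pwm_bound pSg; have [Bm Bm0 hBm] := pwm_bound pm.
have bd i : exists Bi, 0 <= Bi /\ forall e, `|e| < rho ->
 [/\ `|S i e| <= Bi, `|invmx (S i e)| <= Bi, `|N i e| <= Bi & `|r i e| <= Bi].
 have [p1 p2 p3 p4 _] := pp i; have [b1 z1 h1] := pwm_bound p1; have [b2 z2 h2] := pwm_bound p2.
 have [b3 z3 h3] := pwm_bound p3; have [b4 z4 h4] := pwm_bound p4.
 exists (b1 + b2 + b3 + b4); split=> [|e he]; first by nonneg.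
 by move: (h1 e he) (h2 e he) (h3 e he) (h4 e he); clear -z1 z2 z3 z4; split; lra.
have [Bs hBs] := choice bd.
have [Cw hCw] := choice (fun i => let: And5 _ _ _ _ h := pp i in pwx_taylor1 r0 h).
pose Bi i := Bs i + `|A i| + `|invmx (A i)| + `|mi i|.
have Bi0 i : 0 <= Bi i by have [? _] := hBs i; rewrite /Bi; nonneg.
pose B := 1 + Bg + Bm + \sum_i Bi i.
have sB0 : 0 <= \sum_i Bi i by exact: sumr_ge0.
have BB i : Bi i <= B.
 rewrite /B (bigD1 i)//= addrCA lerDl; have : 0 <= \sum_(j | j != i) Bi j by exact: sumr_ge0.
 by lra.
have [B1 BgB BmB] : [/\ 1 <= B, Bg <= B & Bm <= B] by rewrite /B; split; lra.
have [bs bA bAi bmi] : [/\ forall i, Bs i <= B, forall i, `|A i| <= B, forall i, `|invmx (A i)| <= B &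
 forall i, `|mi i| <= B].
 split=> i; have [? _] := hBs i; apply: le_trans (BB i); rewrite /Bi.
 - by rewrite -!addrA lerDl; nonneg.
 - by rewrite -!addrA addrCA lerDl; nonneg.
 - by rewrite addrAC lerDr; nonneg.
 - by rewrite lerDr; nonneg.
have bds e i : `|e| < rho -> [/\ `|S i e| <= B, `|invmx (S i e)| <= B, `|N i e| <= B & `|r i e| <= B].
 by move=> he; have [_ /(_ e he)[? ? ? ?]] := hBs i; split; apply: le_trans (bs i).
have [cc [g [e1 [cc0 g0 e10 gain]]]] := @gain_step R d B B1.
pose D : R := d%:R; have D0 : 0 <= D by exact: ler0n.
have B0 : 0 < B by lra.
pose C0 := 2 * D * B + D ^+ 2 * B + D ^+ 2 * B ^+ 2 + g.
have C00 : 0 < C0 by rewrite /C0 ltr_wpDl//; nonneg.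
(* The first bound keeps [eta * |H|] below [cc], the other two are the smallness conditions of
   [near_bounds]. It is fixed before [far_step] is called, whose gain depends on it. *)
pose c2 := Num.min (cc * tau1 / 4) (Num.min (s / (8 * C0)) (g * s / (24 * C0 ^+ 2))).
have c20 : 0 < c2 by rewrite !lt_min !divr_gt0 ?mulr_gt0 ?exprn_gt0.
have c2a : c2 <= cc * tau1 / 4 by rewrite !ge_min lexx.
have c2b : 8 * C0 * c2 <= s by rewrite mulrC -ler_pdivlMr ?mulr_gt0// !ge_min lexx ?orbT.
have c2c : 24 * C0 ^+ 2 * c2 <= g * s by rewrite mulrC -ler_pdivlMr ?mulr_gt0 ?exprn_gt0// !ge_min lexx ?orbT.
clearbody c2.
have [dl [e2 [dl0 e20 far]]] := @far_step R d B c2 tau0 tau1 B1 c20 t00 t10.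
pose Z := \sum_i c i; have Z0 : 0 < Z := sum_gt0 hn c0.
pose CC := \sum_i `|Cw i|; have CC0 : 0 <= CC by exact: sumr_ge0.
pose E1 := 2 * ((D * B + 1) * (D ^+ 2 * (1 + B))) + 1.
have E10 : 0 < E1 by rewrite /E1 ltr_wpDl//; nonneg.
have ed : 0 < 1 - expR (- dl) by rewrite subr_gt0 expR_lt1 oppr_lt0.
(* In order: the ranges of the curve and of [far_step]; [e <= c2] and [B <= c2 / e]; the range of
   [gain_step]; admissibility of the curve; [eta <= 1]; and the comparison with distant
   competitors. *)
pose e3 := Num.min (Num.min rho e2) (Num.min (Num.min c2 (c2 / B)) (Num.min (Num.min (e1 * tau0 / 2) (e1 * tau1 / 2))
 (Num.min (Num.min (tau0 / 2 / E1) (tau1 / 2)) (Z * (1 - expR (- dl)) / (CC + 1))))).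
have e30 : 0 < e3.
 by rewrite !lt_min r0 e20 c20 !divr_gt0 ?mulr_gt0// ltr_wpDl.
exists e3; split => //; first by rewrite e30 !ge_min lexx.
move=> e e_0; rewrite !lt_min => /andP[/andP[er ee2] /andP[/andP[ec ecB] /andP[/andP[ea eb] /andP[/andP[ef eh] ek]]]].
have er' : `|e| < rho by rewrite gtr0_norm.
have ste := st e er'.
have h0 : 2 / (e^-1 * tau0) = 2 / tau0 * e by field; rewrite !gt_eqF.
have h1 : 2 / (e^-1 * tau1) = 2 / tau1 * e by field; rewrite !gt_eqF.
have hs : e^-1 * tau0 + e^-1 * tau1 = s / e by rewrite -mulrDr mulrC.
have small : 2 / tau0 * e * ((D * B + 1) * (D ^+ 2 * (1 + B))) <= 2^-1.
 have k1 : e * E1 <= tau0 / 2 by move: (ltW ef); rewrite ler_pdivlMr.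
 have -> : 2 / tau0 * e * ((D * B + 1) * (D ^+ 2 * (1 + B))) = e * (E1 - 1) / tau0.
 by rewrite /E1 addrK; field; rewrite gt_eqF.
 by rewrite ler_pdivrMr//; clear -k1 e_0; lra.
have adm i : admissible (mu i) (m e, Sg e) (e^-1 * tau0) (e^-1 * tau1) (S i e) (r i e) /\
 matched (mu i) (m e, Sg e) (e^-1 * tau0) (e^-1 * tau1) (S i e).
 apply: (star_admissible e_0 ste (bA i) _ small).
 by have [] := bds e i er'.
have wE i := star_lnE i e_0 ste.
have Zw : Zval tau0 tau1 lam a mu e^-1 (m e, Sg e) (fun i => S i e) (fun i => r i e) = \sum_i w i e.
 by apply: eq_bigr => i _; rewrite wE.
have w0 i : 0 < w i e by rewrite wE mulr_gt0 ?expR_gt0.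
rewrite -Zw; apply: argmin_criterion => //.
- by rewrite invr_gt0.
- exact: star_Sg ste.
- by move=> i; have [] := adm i.
- by move=> i; have [] := adm i.
move=> q pq qne; rewrite Zw.
have [isfar|] := pselect (c2 / e < `|q.2| \/ c2 / e < `|q.1|).
 have [S' hS'] := choice (fun i => far (mu i) q e e_0 (ltW ee2) (hmu i) pq (bA i) (bAi i) (bmi i) isfar).
 have [r' hr'] := choice hS'.
 exists S', r'; split => [i|]; first by have [] := hr' i.
 apply: (@le_lt_trans _ _ (Z * expR (- dl))).
 rewrite /Zval /Z mulr_suml; apply: ler_sum => i _; apply: ler_wpM2l; first exact/ltW/c0.
 by rewrite ler_expR; have [] := hr' i.
 (* The weights of the curve lose only [O(e)] from their value at 0, whereas a distant competitor
    loses the fixed factor [expR (- dl)]. *)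
 have k1 : Z - \sum_i w i e <= CC * e.
 rewrite /Z -sumrB /CC mulr_suml; apply: ler_sum => i _.
 have wz : w i 0 = c i.
 have z0 : `|0 : R| < rho by rewrite normr0.
 by rewrite (star_w (st 0 z0)) !mulr0 !scale0r !addr0 det1 ln1 !mulr0 mul0r subr0 addr0 expR0 mulr1.
 have := hCw i e er'; rewrite wz (gtr0_norm e_0) distrC => k2; apply: le_trans (ler_norm _) _.
 by apply: le_trans k2 _; rewrite ler_wpM2r ?(ltW e_0)// ler_norm.
 have k2 : e * (CC + 1) < Z * (1 - expR (- dl)) by rewrite -ltr_pdivlMr// ltr_wpDl.
 move: k1 k2; clear -e_0 CC0; move: (\sum_i w i e) (expR _) => x y; lra.
move=> /not_orP[/negP n1 /negP n2]; rewrite -!leNgt in n1 n2.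
pose H := q.2 - Sg e; pose h := q.1 - m e.
have BcE : B <= c2 / e by rewrite ler_pdivlMr// mulrC -ler_pdivlMr// ltW.
have hx : `|H| <= 2 * (c2 / e).
 apply: le_trans (ler_normB _ _) _; rewrite mulr_natl mulr2n lerD//.
 exact: le_trans (le_trans (hBg e er') BgB) BcE.
have hy : `|h| <= 2 * (c2 / e).
 apply: le_trans (ler_normB _ _) _; rewrite mulr_natl mulr2n lerD//.
 exact: le_trans (le_trans (hBm e er') BmB) BcE.
have etaH : 2 / tau1 * e * `|H| <= cc.
 have k1 : e * `|H| <= 2 * c2 by rewrite mulrC -ler_pdivlMr// -mulrA.
 have -> : 2 / tau1 * e * `|H| = 2 * (e * `|H|) / tau1 by field; rewrite gt_eqF.
 by rewrite ler_pdivrMr//; move: (e * _) k1 => u k1; move: c2a; rewrite ler_pdivlMr//; lra.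
have gi i : exists S' r', admissible (mu i) q (e^-1 * tau0) (e^-1 * tau1) S' r' /\
 (e^-1 * tau0 + e^-1 * tau1) * lnE (mu i) q (e^-1 * tau0) (e^-1 * tau1) S' r' <=
 (e^-1 * tau0 + e^-1 * tau1) * lnE (mu i) (m e, Sg e) (e^-1 * tau0) (e^-1 * tau1) (S i e) (r i e) -
 (- 2 * dotc (r i e) h + \tr (N i e *m H) - 2 / (e^-1 * tau1) * dotc (r i e) (H *m r i e) +
 g * (qg `|H| + qg `|h|)).
 have [a1 a2] := adm i.
 have k0 : 2 / tau0 * e <= e1 by move: (ltW ea); rewrite ler_pdivlMr// => k; rewrite mulrAC ler_pdivrMr// [2 * e]mulrC.
 have k1 : 2 / tau1 * e <= e1 by move: (ltW eb); rewrite ler_pdivlMr// => k; rewrite mulrAC ler_pdivrMr// [2 * e]mulrC.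
 have [b1' b2' b3' b4'] := bds e i er'.
 have f0 := star_d0 ste i; have f1 := star_d1 ste i; have f2 := star_N ste i.
 have pmu : sympd (mu i).2 := hmu i; have pSe : sympd (Sg e) := star_Sg ste.
 have bSe := le_trans (hBg e er') BgB; have i0 : 0 < e^-1 by rewrite invr_gt0.
 apply: (gain (mu i) (m e, Sg e) q _ _ (S i e) (N i e) (r i e)) => /=; rewrite ?h0 ?h1 ?mulr_gt0//.
 exact: bA.
 exact: bAi.
have [S' hS'] := choice gi; have [r' hr'] := choice hS'.
exists S', r'; split => [i|]; first by have [] := hr' i.
pose G i := - 2 * dotc (r i e) h + \tr (N i e *m H) - 2 / tau1 * e * dotc (r i e) (H *m r i e).
pose Q := g * (qg `|H| + qg `|h|).
(* The competitor's sum is written with the weights of the curve and the increments of [lnE], the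
   form to which the averaging argument applies. *)
pose y i := lnE (mu i) q (e^-1 * tau0) (e^-1 * tau1) (S' i) (r' i) -
 lnE (mu i) (m e, Sg e) (e^-1 * tau0) (e^-1 * tau1) (S i e) (r i e).
have -> : Zval tau0 tau1 lam a mu e^-1 q S' r' = \sum_i w i e * expR (y i).
 by apply: eq_bigr => i _; rewrite wE -mulrA -expRD /y addrC subrK.
have Q0 : 0 < Q.
 have qpos (x : R) : 0 <= x -> x != 0 -> 0 < qg x.
 by move=> x0 xn; rewrite /qg divr_gt0 ?ltr_pwDl// exprn_gt0// lt_neqAle eq_sym xn.
 rewrite mulr_gt0//; have [h_0|hn0] := eqVneq `|h| 0; last by rewrite ltr_wpDl ?qg_ge0// qpos.
 have [H_0|Hn0] := eqVneq `|H| 0; last by rewrite ltr_pwDl ?qg_ge0// qpos.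
 exfalso; apply: qne; move/eqP: h_0; move/eqP: H_0; rewrite !normr_eq0 !subr_eq0 => /eqP e4 /eqP e5.
 by rewrite [q]surjective_pairing e4 e5.
have sH : H^T = H by rewrite linearB/= (sympd_sym pq) (sympd_sym (star_Sg ste)).
have bnd i : `|G i + Q| <= C0 * (`|H| + `|h|).
 have [_ _ b3' b4'] := bds e i er'.
 have u1 : `|- 2 * dotc (r i e) h| <= 2 * D * B * `|h|.
 have -> : `|- 2 * dotc (r i e) h| = 2 * `|dotc (r i e) h| by rewrite normrM normrN (@ger0_norm _ (2 : R)).
 rewrite -!mulrA ler_wpM2l//; apply: le_trans (dotc_norm _ _) _.
 by rewrite -mulrA ler_wpM2l// ler_wpM2r.
 have u2 : `|\tr (N i e *m H)| <= D ^+ 2 * B * `|H|.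
 by apply: le_trans (tr_mxM_norm _ _) _; rewrite ler_wpM2r// ler_wpM2l ?sqr_ge0.
 have u3 : `|2 / tau1 * e * dotc (r i e) (H *m r i e)| <= D ^+ 2 * B ^+ 2 * `|H|.
 have et0 : 0 <= 2 / tau1 * e by nonneg.
 rewrite normrM (ger0_norm et0).
 have et1 : 2 / tau1 * e <= 1 by move: (ltW eh); rewrite ler_pdivlMr// => k; rewrite mulrAC ler_pdivrMr// mul1r [2 * e]mulrC.
 have k1 : `|dotc (r i e) (H *m r i e)| <= D ^+ 2 * B ^+ 2 * `|H|.
 apply: le_trans (dotc_norm _ _) _.
 have k2 := mxM_le (lexx `|H|) b4'.
 apply: (@le_trans _ _ (D * B * (D * `|H| * B))); last by apply: eq_ler; ring.
 by apply: ler_pM => //; rewrite ler_wpM2l.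
 by apply: le_trans (ler_wpM2l et0 k1) _; rewrite ler_piMl//; nonneg.
 have qx := qg_ge0 (normr_ge0 H); have qy := qg_ge0 (normr_ge0 h).
 have [_ _ _ vx _] := qg_facts (normr_ge0 H); have [_ _ _ vy _] := qg_facts (normr_ge0 h).
 have u4 : `|Q| <= g * (`|H| + `|h|).
 rewrite gtr0_norm// /Q ler_wpM2l ?(ltW g0)//; apply: lerD.
 by rewrite -vx ler_piMr//; have [] := qg_facts (normr_ge0 H).
 by rewrite -vy ler_piMr//; have [] := qg_facts (normr_ge0 h).
 rewrite /G; apply: le_trans (ler_normD _ _) _; apply: le_trans (lerD (ler_normB _ _) (lexx _)) _.
 apply: le_trans (lerD (lerD (ler_normD _ _) (lexx _)) (lexx _)) _.
 have v1 : 0 <= D * B * `|H| by nonneg.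
 have v2 : 0 <= D ^+ 2 * B * `|h| by nonneg.
 have v3 : 0 <= D ^+ 2 * B ^+ 2 * `|h| by nonneg.
 apply: le_trans (lerD (lerD (lerD u1 u2) u3) u4) _; rewrite /C0; clear -v1 v2 v3.
 by move: (D ^+ 2) (B ^+ 2) v1 v2 v3 => D2 B2; lra.
have nb i := near_bounds (normr_ge0 H) (normr_ge0 h) e_0 g0 C00 c20 (ltW ec) hx hy c2b c2c (bnd i).
apply: (@weighted_exp_lt _ _ _ G y (e / s) Q) => //; first by rewrite divr_gt0.
- exact: (star_gain_sum h ste sH).
- move=> i; have [_ k] := hr' i; rewrite hs h1 -/(G i) -/Q in k.
 rewrite /y lerBlDl -(ler_pM2l (divr_gt0 s0 e_0)); apply: le_trans k _.
 apply: eq_ler; field.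
 by rewrite !gt_eqF.
- by move=> i; have [] := nb i.
- by move=> i; have [] := nb i.
Qed.

End star_optimal.

(** * Differential of the squared Wasserstein distance and its Fisher-Rao dual norm *)

Section wasserstein_derivative.
Context {R : realType}.

Lemma quad_derive (V W : nmodT R) (f : V -> W) (x v : V) (L : W) (C r : R) : 0 < r ->
 (forall t : R, `|t| < r -> `|f (t *: v + x) - f x - t *: L| <= C * t ^+ 2) -> 'D_v f x = L.
Proof.
move=> r0 h; pose g (t : R^o) := f (t *: v + x).
have [_ D] : differentiable g 0 /\ forall s, 'D_s g 0 = s *: L.
 apply: (quad_differentiable (K := `|L|) (C := C) _ _ r0) => [k s t|s|t tr].
 - by rewrite scalerDl scalerA.
 - by rewrite normrZ mulrC.
 - by rewrite add0r /g scale0r add0r (real_normK (num_real t)); exact: h.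
rewrite -[L]scale1r -D /derive.
suff -> : (fun t : R => t^-1 *: ((f \o shift x) (t *: v) - f x)) =
 (fun t => t^-1 *: ((g \o shift 0) (t *: (1 : R^o)) - g 0)) by [].
by apply/funext => t; rewrite /g /= (_ : t *: (1 : R^o) = t) ?addr0 ?scale0r ?add0r// [LHS]mulr1.
Qed.

Lemma sqr_le_lin (x y c : R) : 0 <= x -> 0 <= y -> 0 < c -> c * x ^+ 2 <= x * y -> x <= y / c.
Proof.
move=> x0 y0 c0 h; rewrite ler_pdivlMr// mulrC; have [->|xn] := eqVneq x 0; first by rewrite mulr0.
have xp : 0 < x by rewrite lt_neqAle eq_sym xn.
by rewrite -(ler_pM2l xp) mulrCA -expr2.
Qed.

Context {d : nat}.
Implicit Types (A Sg S T X H : 'M[R]_d).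

(** The linear part of the optimal map from covariance [Sg] to covariance [A], with default value 0
    when there is no positive solution. *)
Definition gm A Sg : 'M[R]_d := xget 0 [set S | sympd S /\ S *m Sg *m S = A].

Lemma gmP A Sg : sympd A -> sympd Sg -> sympd (gm A Sg) /\ gm A Sg *m Sg *m gm A Sg = A.
Proof.
move=> pA pSg; have [S pS e] := sympd_geomean pA pSg.
by have := @xgetPex _ 0 [set S | sympd S /\ S *m Sg *m S = A] (ex_intro _ S (conj pS e)).
Qed.

(** Linearising [S Sg S = A] in a direction [H] gives [X Sg S + S Sg X = - S H S]; conjugation by
    [T = S^-1] turns it into [lyap Sg T X = - H], with an operator that is symmetric and coercive
    for the trace. *)
Definition lyap Sg T X : 'M[R]_d := T *m X *m Sg + Sg *m X *m T.

Lemma lyap_coercive Sg T : sympd Sg -> sympd T ->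
 exists2 c : R, 0 < c & forall X, c * `|X| ^+ 2 <= \tr (X^T *m lyap Sg T X).
Proof.
move=> pSg pT; have [c c0 hc] := tr_PXQ_ge pT pSg; have [c' c'0 hc'] := tr_PXQ_ge pSg pT.
exists c => // X; rewrite /lyap mulmxDr linearD/= !mulmxA.
have h1 := le_trans (ler_wpM2l (ltW c0) (sqr_norm_le_fro X)) (hc X).
have h2 : 0 <= \tr (X^T *m Sg *m X *m T) by apply: le_trans (hc' X); rewrite mulr_ge0 ?fro_ge0// ltW.
by move: h1 h2; move: (\tr _) (\tr _) => a b; lra.
Qed.

Lemma lyap_bound Sg T : sympd Sg -> sympd T ->
 exists2 C : R, 0 <= C & forall X H, lyap Sg T X = H -> `|X| <= C * `|H|.
Proof.
move=> pSg pT; have [c c0 hc] := lyap_coercive pSg pT.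
exists (d%:R ^+ 2 / c) => [|X H e]; first by rewrite divr_ge0 ?sqr_ge0// ltW.
rewrite mulrAC; apply: (sqr_le_lin (normr_ge0 _) _ c0); first by rewrite mulr_ge0 ?sqr_ge0.
apply: le_trans (hc X) _; rewrite e.
apply: le_trans (ler_norm _) _; apply: le_trans (tr_mxM_norm _ _) _; rewrite mx_normT.
by rewrite -mulrA mulrCA.
Qed.

Lemma tr_lyap Sg T X Y : \tr (lyap Sg T X *m Y) = \tr (X *m lyap Sg T Y).
Proof.
rewrite /lyap mulmxDl mulmxDr !linearD/= addrC; congr (_ + _).
 by rewrite -!mulmxA [LHS]mxtrace_mulC !mulmxA.
by rewrite -!mulmxA [LHS]mxtrace_mulC !mulmxA.
Qed.

Lemma lyap_inverse Sg T : sympd Sg -> sympd T -> exists LL : 'M[R]_d -> 'M[R]_d,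
 [/\ linW LL, forall H, lyap Sg T (LL H) = - H, (forall X H, lyap Sg T X = - H -> X = LL H) &
 forall X Y, \tr (LL X *m Y) = \tr (X *m LL Y)].
Proof.
move=> pSg pT; have [C C0 hC] := lyap_bound pSg pT.
have lin_l a X Y : lyap Sg T (a *: X + Y) = a *: lyap Sg T X + lyap Sg T Y.
 rewrite /lyap !mulmxDr !mulmxDl -!scalemxAr -!scalemxAl scalerDr !addrA; congr (_ + _).
 by rewrite -!addrA; congr (_ + _); rewrite addrC.
have inj X : lyap Sg T X = 0 -> X = 0.
 by move=> /hC; rewrite normr0 mulr0 normr_le0 => /eqP.
have [P [linP PL Pinj]] := linear_inverse (V := 'M[R]_d) lin_l inj.
have linB' X Y : lyap Sg T (X - Y) = lyap Sg T X - lyap Sg T Y.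
 by rewrite addrC -scaleN1r lin_l scaleN1r addrC.
have LP X : lyap Sg T (P X) = X.
 apply/eqP; rewrite -subr_eq0; apply/eqP/Pinj.
 by rewrite -[_ - _]addrC -scaleN1r linP PL scaleN1r addNr.
have uniq X H : lyap Sg T X = - H -> X = P (- H) by move=> e; rewrite -e PL.
exists (fun H => P (- H)); split => //.
- by move=> a X Y; rewrite opprD -scalerN linP.
- move=> X Y; rewrite -{2}[X]opprK -{1}[Y]opprK -{2}(LP (- X)) -{1}(LP (- Y)).
 by rewrite mulmxN mulNmx !linearN/= tr_lyap.
Qed.

Lemma gm_difference Sg Sg' S S' : S' *m Sg' *m S' = S *m Sg *m S ->
 let D := S' - S in let H := Sg' - Sg in
 D *m Sg' *m S' + S *m Sg' *m D = - (S *m H *m S).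
Proof.
move=> e /=; rewrite !mulmxBr !mulmxBl opprB e.
by rewrite addrA subrK.
Qed.

(** An exact expression for the loss in the dual functional when the map [S] is used at [Sg']
    instead of the optimal [S']; its left side is positive for symmetric [S], [S'] unless they
    agree. *)
Lemma gm_gap Sg S Sg' S' : S \in unitmx -> S' *m Sg' *m S' = S *m Sg *m S ->
 \tr ((S' - S) *m invmx S *m (S' - S) *m Sg') = \tr (S *m Sg) - 2 * \tr (S' *m Sg') + \tr (S *m Sg').
Proof.
move=> uS e; have e1 : \tr (S' *m invmx S *m S' *m Sg') = \tr (S *m Sg).
 rewrite -!mulmxA mxtrace_mulC -!mulmxA (mulmxA S' Sg' S') e !mulmxA mulVmx// mul1mx.
 exact: mxtrace_mulC.
rewrite (mulmxBl S' S) mulmxV// (mulmxBl (S' *m _)) mul1mx (mulmxBr (S' *m _)) mulmxKV//.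
by rewrite !mulmxBl !linearB/= e1; ring.
Qed.

(** Adding the gap identity to the one with the roles exchanged leaves [- \tr ((S' - S) (Sg' - Sg))]
    on the right, while the left is coercive in [S' - S]. No prior continuity of the map is assumed;
    uniqueness is the case of equal covariances. *)
Lemma gm_lip A Sg S : sympd A -> sympd Sg -> sympd S -> S *m Sg *m S = A ->
 exists C r : R, [/\ 0 <= C, 0 < r & forall Sg' S', sympd Sg' -> sympd S' -> S' *m Sg' *m S' = A ->
 `|Sg' - Sg| <= r -> `|S' - S| <= C * `|Sg' - Sg|].
Proof.
move=> pA pSg pS eS; pose T : 'M[R]_d := invmx S; have pT : sympd T by exact: sympd_inv.
have [c c0 hc] := tr_PXQ_ge pT pSg.
pose D : R := d%:R; have D0 : 0 <= D by exact: ler0n.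
pose k := D * (D * (D * (D * `|T|))).
have k0 : 0 <= k by rewrite /k; nonneg.
have k10 : 0 < k + 1 by lra.
have c20 : 0 < c / 2 by rewrite divr_gt0.
exists (D ^+ 2 / (c / 2)), (c / 2 / (k + 1)); split; [by nonneg|by rewrite divr_gt0|].
move=> Sg' S' pSg' pS' eS' hr; set X := S' - S; set H := Sg' - Sg in hr *.
have rk : `|H| * (k + 1) <= c / 2 by rewrite -ler_pdivlMr.
have sX : X^T = X by rewrite linearB/= (sympd_sym pS) (sympd_sym pS').
have g1 := gm_gap (sympd_unit pS) (etrans eS' (esym eS)).
have g2 := gm_gap (sympd_unit pS') (etrans eS (esym eS')).
have eXH : \tr (X *m H) = \tr (S' *m Sg') - \tr (S' *m Sg) - \tr (S *m Sg') + \tr (S *m Sg).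
 by rewrite !mulmxBl !mulmxBr !linearB/=; ring.
have p3 : 0 <= \tr ((S - S') *m invmx S' *m (S - S') *m Sg).
 have [c3 c30 hc3] := tr_PXQ_ge (sympd_inv pS') pSg; have := hc3 (S - S').
 have -> : (S - S')^T = S - S' by rewrite linearB/= (sympd_sym pS) (sympd_sym pS').
 apply: le_trans.
 by rewrite mulr_ge0 ?fro_ge0// ltW.
have p1 := le_trans (ler_wpM2l (ltW c0) (sqr_norm_le_fro X)) (hc X); rewrite sX in p1.
have e2 : \tr (X *m T *m X *m Sg') = \tr (X *m T *m X *m Sg) + \tr (X *m T *m X *m H).
 by rewrite -mxtraceD -mulmxDr /H [Sg + _]addrC subrK.
have p2 : `|\tr (X *m T *m X *m H)| <= c / 2 * `|X| ^+ 2.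
 apply: le_trans (tr_le (mxM_le (mxM_le (mxM_le (lexx `|X|) (lexx `|T|)) (lexx `|X|)) (lexx `|H|))) _.
 have -> : d%:R * (d%:R * (d%:R * (d%:R * `|X| * `|T|) * `|X|) * `|H|) = (`|H| * k) * `|X| ^+ 2.
 by rewrite /k /D; ring.
 by rewrite ler_wpM2r ?sqr_ge0//; move: rk; have := normr_ge0 H; lra.
have p4 := tr_mxM_norm X H; rewrite -/X mulrAC; apply: sqr_le_lin => //; first by nonneg.
move: p2 p4; rewrite !ler_norml mulrAC [_ * `|X|]mulrC => /andP[p2 _] /andP[p4 _].
rewrite -/X -/T e2 in g1; move: g1 g2 eXH p1 p2 p3 p4; do ?[move: (\tr _) => ?].
by move: (`|X| ^+ 2) => *; rewrite /D; lra.
Qed.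

Lemma gm_unique A Sg S : sympd A -> sympd Sg -> sympd S -> S *m Sg *m S = A -> S = gm A Sg.
Proof.
move=> pA pSg pS e; have [pG eG] := gmP pA pSg.
have [C [r [C0 r0 h]]] := gm_lip pA pSg pG eG.
have := h Sg S pSg pS e; rewrite subrr normr0 mulr0 normr_le0 subr_eq0 => hh.
by apply/eqP/hh; exact: ltW.
Qed.

Lemma lyap_conj Sg S X : S \in unitmx ->
 invmx S *m (X *m Sg *m S + S *m Sg *m X) *m invmx S = lyap Sg (invmx S) X.
Proof.
move=> uS; rewrite /lyap mulmxDr mulmxDl; congr (_ + _); rewrite -!mulmxA.
 by rewrite mulmxV// mulmx1.
by rewrite mulKmx.
Qed.

Lemma conj_id S H : S \in unitmx -> invmx S *m (S *m H *m S) *m invmx S = H.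
Proof. by move=> uS; rewrite !mulmxA mulVmx// mul1mx mulmxK. Qed.

Lemma gm_expand A Sg S LL : sympd A -> sympd Sg -> sympd S -> S *m Sg *m S = A ->
 (forall H, lyap Sg (invmx S) (LL H) = - H) -> linW LL ->
 exists C r : R, [/\ 0 <= C, 0 < r & forall Sg' S', sympd Sg' -> sympd S' -> S' *m Sg' *m S' = A ->
 `|Sg' - Sg| <= r -> `|S' - S - LL (Sg' - Sg)| <= C * `|Sg' - Sg| ^+ 2].
Proof.
move=> pA pSg pS eS hLL linLL; pose T : 'M[R]_d := invmx S; have pT : sympd T by exact: sympd_inv.
have [C1 [r [C10 r0 lip]]] := gm_lip pA pSg pS eS.
have [C2 C20 hC2] := lyap_bound pSg pT.
pose D : R := d%:R; have D0 : 0 <= D by exact: ler0n.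
pose K := D * (D * C1 * `|Sg|) * C1 + D * (D * C1) * (`|S| + C1 * r) + D * (D * `|S|) * C1.
pose K2 := D * (D * `|T| * K) * `|T|.
exists (C2 * K2), r; split => //; first by rewrite /K2 /K; nonneg.
move=> Sg' S' pSg' pS' eS' hr; have := lip _ _ pSg' pS' eS' hr.
set X := S' - S; set H := Sg' - Sg in hr * => hX.
have dS' : S' = S + X by rewrite /X addrC subrK.
have dG' : Sg' = Sg + H by rewrite /H addrC subrK.
pose rho : 'M[R]_d := X *m Sg *m X + X *m H *m S' + S *m H *m X.
have e1 : X *m Sg *m S + S *m Sg *m X + rho = - (S *m H *m S).
 rewrite -(gm_difference (etrans eS' (esym eS))) -/X.
 have -> : X *m Sg' *m S' = X *m Sg *m S + X *m Sg *m X + X *m H *m S'.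
 by rewrite -mulmxDr -dS' -mulmxDl -mulmxDr -dG'.
 have -> : S *m Sg' *m X = S *m Sg *m X + S *m H *m X by rewrite -mulmxDl -mulmxDr -dG'.
 by rewrite /rho addrACA [X in X + _ = _]addrA.
have uS := sympd_unit pS.
have e2 : lyap Sg T (X - LL H) = - (T *m rho *m T).
 have lB (X1 X2 : 'M[R]_d) : lyap Sg T (X1 - X2) = lyap Sg T X1 - lyap Sg T X2.
 by rewrite /lyap !mulmxBr !mulmxBl opprD addrACA.
 have cD P Q : T *m P *m T + T *m Q *m T = T *m (P + Q) *m T by rewrite mulmxDr mulmxDl.
 rewrite lB hLL opprK -(lyap_conj Sg X uS) -[X in _ + X](conj_id H uS) -/T cD.
 by rewrite -mulNmx -mulmxN; congr (_ *m _ *m _); apply/eqP; rewrite -addr_eq0 addrAC e1 addNr.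
have bX : `|X| <= C1 * r by apply: le_trans hX _; rewrite ler_wpM2l.
have bS' : `|S'| <= `|S| + C1 * r by rewrite dS'; apply: le_trans (ler_normD _ _) _; rewrite lerD2l.
have brho : `|rho| <= K * `|H| ^+ 2.
 have r1 := mxM_le (mxM_le hX (lexx `|Sg|)) hX.
 have r2 := mxM_le (mxM_le hX (lexx `|H|)) bS'.
 have r3 := mxM_le (mxM_le (lexx `|S|) (lexx `|H|)) hX.
 apply: le_trans (ler_normD _ _) _; apply: le_trans (lerD (ler_normD _ _) (lexx _)) _.
 apply: le_trans (lerD (lerD r1 r2) r3) _.
 by apply: eq_ler; rewrite /K /D; ring.
apply: le_trans (hC2 _ _ e2) _; rewrite normrN -mulrA ler_wpM2l//.
apply: le_trans (mxM_le (mxM_le (lexx `|T|) brho) (lexx `|T|)) _.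
by apply: eq_ler; rewrite /K2 /D; ring.
Qed.

Implicit Types p q xi : gparam R d.

Definition dWass p q S xi : R := - 2 * dotc (p.1 - q.1) xi.1 + \tr ((1%:M - S) *m xi.2).

Lemma wcost_swap p q S : S \in unitmx -> wcost q p (invmx S) = wcost p q S.
Proof. by move=> uS; rewrite /wcost invmxK -addrA [X in _ + X]addrC addrA -opprB dotcNl dotcNr opprK. Qed.

Lemma Wass_swap p q : Gd p -> Gd q -> Wass p q = Wass q p.
Proof.
move=> hp hq; have [pS eS] := gmP hp hq; set S := gm p.2 q.2 in pS eS; have uS := sympd_unit pS.
rewrite (Wass_eq hp hq pS eS) -wcost_swap//; symmetry; apply: Wass_eq => //; first exact: sympd_inv.
by rewrite -eS !mulmxA mulVmx// mul1mx -mulmxA mulmxV// mulmx1.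
Qed.

Lemma wcost_shift p q q' S : wcost p q' S - wcost p q S =
 dWass p q S (q' - q) + dotc (q'.1 - q.1) (q'.1 - q.1).
Proof.
have e : p.1 - q'.1 = p.1 - q.1 - (q'.1 - q.1) by rewrite opprB addrA subrK.
have eH : q'.2 = q.2 + (q'.2 - q.2) by rewrite addrC subrK.
rewrite /wcost /dWass e /= {1}eH; move: (p.1 - q.1) (q'.1 - q.1) (q'.2 - q.2) => x h H.
rewrite (mulmxDl q.2 H) mxtraceD [\tr (H *m _)]mxtrace_mulC !(dotcBl, dotcBr) (dotcC h x); ring.
Qed.

(** Envelope argument: [S] is optimal at [q] and feasible at [q'], and [S'] conversely, so the
    increment of the distance lies between the increments of [wcost] at [S] and at [S']. By [gm_lip]
    these differ by a quadratic term. *)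
Lemma Wass_expand p q S : Gd p -> Gd q -> sympd S -> S *m q.2 *m S = p.2 ->
 exists C r : R, [/\ 0 <= C, 0 < r & forall q', Gd q' -> `|q' - q| <= r ->
 `|Wass p q' - Wass p q - dWass p q S (q' - q)| <= C * `|q' - q| ^+ 2].
Proof.
move=> hp hq pS eS; have [C [r [C0 r0 lip]]] := gm_lip hp hq pS eS.
pose D : R := d%:R; have D0 : 0 <= D by exact: ler0n.
exists (D + D ^+ 2 * C), r; split => //; first by nonneg.
move=> q' hq' hr; have [pS' eS'] := gmP hp hq'; set S' := gm p.2 q'.2 in pS' eS'.
have [n1 n2] := pair_norm_le (q' - q); rewrite /= in n1 n2.
have hS := lip _ _ hq' pS' eS' (le_trans n2 hr).
have l1 := Wass_ge hp hq' pS; have l2 := Wass_ge hp hq pS'.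
have e1 := Wass_eq hp hq pS eS; have e2 := Wass_eq hp hq' pS' eS'.
have s1 := wcost_shift p q q' S; have s2 := wcost_shift p q q' S'.
have b1 : dotc (q'.1 - q.1) (q'.1 - q.1) <= D * `|q' - q| ^+ 2.
 apply: le_trans (ler_norm _) _; apply: le_trans (dotc_norm _ _) _.
 by rewrite -mulrA ler_wpM2l// expr2 ler_pM.
have b0 := dotc_ge0 (q'.1 - q.1).
have b2 : `|dWass p q S' (q' - q) - dWass p q S (q' - q)| <= D ^+ 2 * C * `|q' - q| ^+ 2.
 have -> : dWass p q S' (q' - q) - dWass p q S (q' - q) = - \tr ((S' - S) *m (q'.2 - q.2)).
 by rewrite /dWass /= !mulmxBl !linearB/=; ring.
 rewrite normrN; apply: le_trans (tr_mxM_norm _ _) _.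
 rewrite -[leLHS]mulrA -[leRHS]mulrA; apply: ler_wpM2l; first exact: sqr_ge0.
 rewrite expr2 mulrA; apply: ler_pM => //; apply: le_trans hS _; exact: ler_wpM2l.
move: b2; rewrite !ler_norml => /andP[b2 b3].
move: l1 l2 s1 s2 b0 b1 b2 b3; rewrite e1 e2 mulrDl.
move: (wcost p q S) (wcost p q S') (wcost p q' S) (wcost p q' S') (dotc _ _) => x1 x2 x3 x4 x5.
move: (dWass p q S' (q' - q)) (dWass p q S (q' - q)) (D * _) (D ^+ 2 * _ * _) => y1 y2 z1 z2.
by clear => *; apply/andP; split; lra.
Qed.

Lemma gaussians_line q xi : Gd q -> tangent xi ->
 exists2 r : R, 0 < r & forall t : R, `|t| < r -> Gd (t *: xi + q).
Proof.
move=> hq hxi; have [e e0 he] := sympd_near hq.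
exists (e / (`|xi.2| + 1)) => [|t ht]; first by rewrite divr_gt0// ltr_wpDl.
apply: he => /=; first by rewrite linearD/= linearZ/= (hxi : xi.2^T = xi.2) (sympd_sym hq).
rewrite addrK normrZ; rewrite ltr_pdivlMr ?ltr_wpDl// in ht; apply: le_trans (ltW ht).
by rewrite ler_wpM2l// lerDl.
Qed.

(** Stated for any [F] that agrees with the distance on Gaussian parameters: symmetry of the
    distance is available only there, and the derivative in the first argument is reduced to the
    second through it. *)
Lemma derive_Wass p q S xi (F : gparam R d -> R) : Gd p -> Gd q -> sympd S ->
 S *m q.2 *m S = p.2 -> tangent xi -> (forall q', Gd q' -> F q' = Wass p q') ->
 'D_xi F q = dWass p q S xi.
Proof.
move=> hp hq pS eS hxi hF; have [C [r [C0 r0 hC]]] := Wass_expand hp hq pS eS.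
have [r' r'0 hl] := gaussians_line hq hxi.
pose rr := Num.min r' (r / (`|xi| + 1)).
have rr0 : 0 < rr by rewrite lt_min r'0 divr_gt0// ltr_wpDl.
apply: (@quad_derive _ _ _ _ _ _ (C * `|xi| ^+ 2) rr) => // t.
rewrite lt_min => /andP[t1 t2]; have := hC _ (hl t t1); rewrite !hF//; last exact: hl.
rewrite addrK normrZ ltr_pdivlMr ?ltr_wpDl// in t2 *.
have k1 : `|t| * `|xi| <= r by apply: le_trans (ltW t2); rewrite ler_wpM2l// lerDl.
have k2 : dWass p q S (t *: xi) = t * dWass p q S xi.
 by rewrite /dWass /= dotcZr -scalemxAr mxtraceZ; ring.
by move=> /(_ k1); rewrite k2 exprMn (real_normK (num_real t)) [t ^+ 2 * _]mulrC mulrA.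
Qed.

Lemma D2WassE p q S xi : Gd p -> Gd q -> sympd S -> S *m q.2 *m S = p.2 ->
 tangent xi -> D2Wass p q xi = dWass p q S xi.
Proof. by move=> hp hq pS eS hxi; exact: derive_Wass. Qed.

Lemma D1WassE p q S xi : Gd p -> Gd q -> sympd S -> S *m q.2 *m S = p.2 ->
 tangent xi -> D1Wass p q xi = dWass q p (invmx S) xi.
Proof.
move=> hp hq pS eS hxi; have uS := sympd_unit pS.
apply: (derive_Wass hq hp (sympd_inv pS) _ hxi) => [|q' hq']; last exact: Wass_swap.
by rewrite -eS !mulmxA mulVmx// mul1mx -mulmxA mulmxV// mulmx1.
Qed.

(** [z] below is the Riesz representative of the covector for the Fisher-Rao metric, so the squared
    norm is [form z z]; the supremum is attained at the normalised [z], or is 0. *)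
Lemma fr_dual_norm_sqr p (k : 'cV[R]_d) (K : 'M[R]_d) (l : gparam R d -> R) : Gd p ->
 K^T = K -> (forall xi, tangent xi -> l xi = dotc k xi.1 + \tr (K *m xi.2)) ->
 fr_dual_norm p l ^+ 2 = dotc k (p.2 *m k) + 2 * \tr (K *m p.2 *m K *m p.2).
Proof.
move=> hp sK hl; set Nn := dotc k _ + _; pose Sg := p.2; pose J := invmx Sg.
have pJ : sympd J by exact: sympd_inv.
have uG : Sg \in unitmx by exact: sympd_unit.
have sG := sympd_sym hp.
have trsq (P X : 'M[R]_d) : sympd P -> X^T = X -> 0 <= \tr (P *m X *m P *m X).
 move=> pP sX; have [c c0 hc] := tr_PXQ_ge pP pP.
 by rewrite mxtrace_mulC !mulmxA; have := hc X; rewrite sX; apply: le_trans; rewrite mulr_ge0 ?fro_ge0// ltW.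
pose form (x y : gparam R d) := dotc x.1 (J *m y.1) + 2^-1 * \tr (J *m x.2 *m J *m y.2).
have frE x : fisher_rao p x = form x x by rewrite /fisher_rao /form /dotc mulmxA.
have form0 x : tangent x -> 0 <= form x x.
 by move=> hx; rewrite addr_ge0 ?sympd_ge0// mulr_ge0// trsq.
pose z : gparam R d := (Sg *m k, 2 *: (Sg *m K *m Sg)).
have hz : tangent z by rewrite /tangent /= linearZ/= !trmx_mul sG sK mulmxA.
have lE x : tangent x -> l x = form z x.
 move=> hx; rewrite hl// /form /z /=; congr (_ + _).
 by rewrite dotc_mulmxl sG mulKVmx.
 rewrite -scalemxAr -!scalemxAl mxtraceZ mulrA mulVf// mul1r.
 by rewrite !mulmxA mulVmx// mul1mx mulmxK.
have zz : form z z = Nn.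
 rewrite -lE// hl// /Nn /z /=; congr (_ + _).
 by rewrite -scalemxAr mxtraceZ !mulmxA.
have formC x y : form x y = form y x.
 rewrite /form dotc_mulmx (sympd_sym pJ) dotcC; congr (_ + _ * _).
 by rewrite -mulmxA mxtrace_mulC mulmxA.
have formBr x y w b : form x (y - b *: w) = form x y - b * form x w.
 rewrite /form /= !mulmxBr -!scalemxAr dotcBr dotcZr linearB/= mxtraceZ; ring.
have expand x b : tangent x -> form (x - b *: z) (x - b *: z) = form x x - 2 * b * l x + b ^+ 2 * Nn.
 by move=> hx; rewrite formBr ![form (_ - _) _]formC !formBr (formC x z) zz -lE//; ring.
have tanB x b : tangent x -> tangent (x - b *: z).
 by move=> hx; rewrite /tangent /= linearB/= linearZ/= (hx : x.2^T = x.2) (hz : z.2^T = z.2).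
have N0 : 0 <= Nn by rewrite -zz form0.
have CS x : tangent x -> form x x <= 1 -> l x ^+ 2 <= Nn.
 (* Cauchy-Schwarz through the square completed at [l x / N']; the added [eps] keeps the denominator
    positive when the form of [z] vanishes. *)
 move=> hx f1; apply/ler_addgt0Pr => eps e0; pose N' := Nn + eps.
 have N'0 : 0 < N' by rewrite ltr_wpDl.
 have := form0 _ (tanB x (l x / N') hx); rewrite expand// -(pmulr_rge0 _ N'0).
 have -> : N' * (form x x - 2 * (l x / N') * l x + (l x / N') ^+ 2 * Nn) =
 N' * form x x - 2 * l x ^+ 2 + l x ^+ 2 * (Nn / N') by field; rewrite gt_eqF.
 have : l x ^+ 2 * (Nn / N') <= l x ^+ 2 by rewrite ler_piMr ?sqr_ge0// ler_pdivrMr// mul1r lerDl ltW.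
 have : N' * form x x <= N' by rewrite ler_piMr// ltW.
 by rewrite -/N'; move: (l x ^+ 2) (N' * _) (_ * (Nn / N')) => *; lra.
suff -> : fr_dual_norm p l = Num.sqrt Nn by rewrite sqr_sqrtr.
have ub : ubound [set `|l xi| | xi in [set xi | tangent xi /\ fisher_rao p xi <= 1]] (Num.sqrt Nn).
 move=> _ [x [hx fx] <-]; rewrite frE in fx; rewrite -sqrtr_sqr; apply: ler_wsqrtr; exact: CS.
have mem x : tangent x -> form x x <= 1 ->
 [set `|l xi| | xi in [set xi | tangent xi /\ fisher_rao p xi <= 1]] `|l x|.
 by move=> hx fx; exists x => //; split => //; rewrite frE.
apply/eqP; rewrite eq_le; apply/andP; split.
 apply: ge_sup => //; exists `|l 0|; apply: mem; first by rewrite /tangent /= trmx0.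
 by rewrite /form /= !mulmx0 dotc0r linear0 mulr0 addr0.
have [N00|Nn0] := eqVneq Nn 0.
 rewrite N00 sqrtr0; apply: le_trans (normr_ge0 (l 0)) _; apply: ub_le_sup; first by exists (Num.sqrt Nn).
 apply: mem; first by rewrite /tangent /= trmx0.
 by rewrite /form /= !mulmx0 dotc0r linear0 mulr0 addr0.
have Np : 0 < Nn by rewrite lt_neqAle eq_sym Nn0.
have sN : 0 < Num.sqrt Nn by rewrite sqrtr_gt0.
pose x : gparam R d := 0 - (- (Num.sqrt Nn)^-1) *: z.
have t0 : tangent (0 : gparam R d) by rewrite /tangent /= trmx0.
have f0 : form 0 0 = 0 by rewrite /form /= !mulmx0 dotc0r linear0 mulr0 addr0.
have l0 : l 0 = 0 by rewrite hl//= dotc0r mulmx0 linear0 addr0.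
have hx : tangent x by exact: tanB.
have lx : l x = Num.sqrt Nn.
 rewrite lE// /x formBr zz -lE// l0 sub0r mulNr opprK -{2}(sqr_sqrtr N0) expr2 mulKf// gt_eqF//.
have fx : form x x <= 1.
 by rewrite expand// f0 l0 mulr0 subr0 add0r sqrrN -{2}(sqr_sqrtr N0) exprVn mulVf// expf_neq0// gt_eqF//.
apply: (@le_trans _ _ `|l x|); first by rewrite lx ler_norm.
by apply: ub_le_sup; [exists (Num.sqrt Nn)|exact: mem].
Qed.

Lemma tr_congr_dual (Sg S A : 'M[R]_d) : S \in unitmx -> S *m Sg *m S = A ->
 \tr ((1%:M - invmx S) *m A *m (1%:M - invmx S) *m A) = \tr ((1%:M - S) *m Sg *m S *m (1%:M - S) *m Sg *m S).
Proof.
move=> uS <-; have e : (1%:M - invmx S) *m (S *m Sg *m S) = - ((1%:M - S) *m Sg *m S).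
 by rewrite !mulmxBl !mul1mx !mulmxA mulVmx// mul1mx opprB.
by rewrite -mulmxA e mulmxN mulNmx opprK !mulmxA.
Qed.

(** [invmx S] is eliminated, so that the differential of [Ci] follows from that of [gm] by product
    rules. *)
Lemma Ci_formula n (tau0 tau1 : R) (mu : 'I_n -> gparam R d) i q S :
 Gd (mu i) -> Gd q -> sympd S -> S *m q.2 *m S = (mu i).2 ->
 Ci tau0 tau1 mu i q =
 - (2 * tau0)^-1 * (4 * dotc ((mu i).1 - q.1) ((mu i).2 *m ((mu i).1 - q.1)) +
 2 * \tr ((1%:M - S) *m q.2 *m S *m (1%:M - S) *m q.2 *m S)) -
 (2 * tau1)^-1 * (4 * dotc ((mu i).1 - q.1) (q.2 *m ((mu i).1 - q.1)) +
 2 * \tr ((1%:M - S) *m q.2 *m (1%:M - S) *m q.2)).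
Proof.
move=> hp hq pS eS; have uS := sympd_unit pS; have sS := sympd_sym pS; have sT := sympd_sym (sympd_inv pS).
have h1 xi : tangent xi -> D1Wass (mu i) q xi =
 dotc (2 *: ((mu i).1 - q.1)) xi.1 + \tr ((1%:M - invmx S) *m xi.2).
 move=> hxi; rewrite (D1WassE hp hq pS eS hxi) /dWass -(opprB (mu i).1) dotcNl dotcZl; congr (_ + _); ring.
have h2 xi : tangent xi -> D2Wass (mu i) q xi =
 dotc ((- 2) *: ((mu i).1 - q.1)) xi.1 + \tr ((1%:M - S) *m xi.2).
 by move=> hxi; rewrite (D2WassE hp hq pS eS hxi) /dWass dotcZl.
have s1 : (1%:M - invmx S)^T = 1%:M - invmx S by rewrite linearB/= trmx1 sT.
have s2 : (1%:M - S)^T = 1%:M - S by rewrite linearB/= trmx1 sS.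
have f1 := @fr_dual_norm_sqr (mu i) _ _ (D1Wass (mu i) q) hp s1 h1.
have f2 := @fr_dual_norm_sqr q _ _ (D2Wass (mu i) q) hq s2 h2.
have ring4 (k : R) (v : 'cV[R]_d) (M : 'M[R]_d) : dotc (k *: v) (M *m (k *: v)) = k ^+ 2 * dotc v (M *m v).
 by rewrite dotcZl -scalemxAr dotcZr mulrA.
rewrite /Ci; congr (_ * _ - _ * _).
 by apply: (etrans f1); rewrite (tr_congr_dual uS eS) ring4; congr (_ * _ + _); ring.
by apply: (etrans f2); rewrite ring4; congr (_ * _ + _); ring.
Qed.

End wasserstein_derivative.

(** * Analytic maps: strict derivatives, and composition with power series *)

Section analytic_derivative.
Context {R : realType}.

Lemma multilinear_sub (V W : nmodT R) k (M : ('I_k.+1 -> V) -> W) (c m : R) (a b : V) : 0 <= c ->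
 multilinear M -> (forall v, `|M v| <= c * \prod_(i < k.+1) `|v i|) -> `|a| <= m -> `|b| <= m ->
 `|M (fun=> a) - M (fun=> b)| <= c * (k.+1%:R * m ^+ k) * `|a - b|.
Proof.
move=> c0 hM hb am bm; have m0 : 0 <= m by exact: le_trans am.
pose v (j : nat) : 'I_k.+1 -> V := fun i => if (i < j)%N then a else b.
have step (j : 'I_k.+1) : `|M (v j.+1) - M (v j)| <= c * (m ^+ k) * `|a - b|.
 have e1 : v j.+1 = dfwith (v j) j (1 *: (a - b) + b).
 apply/funext => i; rewrite scale1r subrK; case: (eqVneq j i) => [->|ji]; first by rewrite dfwithin /v ltnS leqnn.
 by rewrite dfwithout// /v ltnS leq_eqVlt (_ : (_ == _ :> nat) = false)//; apply/negbTE; rewrite eq_sym.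
 have e2 : v j = dfwith (v j) j b.
 apply/funext => i; case: (eqVneq j i) => [->|ji]; last by rewrite dfwithout.
 by rewrite dfwithin /v ltnn.
 rewrite e1 hM scale1r -e2 addrK; apply: le_trans (hb _) _; rewrite -mulrA ler_wpM2l//.
 rewrite (bigD1 j)//= dfwithin mulrC ler_wpM2r//.
 have -> : m ^+ k = \prod_(i < k.+1 | i != j) m.
 by rewrite prodr_const; congr (_ ^+ _); rewrite cardC1 card_ord.
 apply: ler_prod => i ij; rewrite normr_ge0 dfwithout 1?eq_sym//= /v; by case: ifP.
have -> : (fun=> a) = v k.+1 by apply/funext => i; rewrite /v ltn_ord.
have -> : (fun=> b) = v 0%N by [].
rewrite -(telescope_sumr (fun j => M (v j)))// big_mkord; apply: le_trans (ler_norm_sum _ _ _) _.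
apply: le_trans (ler_sum _ (fun j _ => step j)) _.
rewrite sumr_const card_ord -[leLHS]mulr_natl; apply: eq_ler; ring.
Qed.

Lemma geometric_sum_le2 (x : R) n : 0 <= x <= 2^-1 -> \sum_(0 <= k < n) x ^+ k <= 2.
Proof.
move=> /andP[x0 x1]; elim: n => [|n IH]; first by rewrite big_nil.
rewrite big_nat_recl// expr0; under eq_bigr do rewrite exprS.
rewrite -mulr_sumr; have := ler_pM x0 (sumr_ge0 _ (fun i _ => exprn_ge0 i x0)) x1 IH.
by move: (_ * _) => z; lra.
Qed.

(** A bound on the second derivative in the form of a strict differential, for pairs of points of
    [S]: nothing is asked on the segment between them, which may leave [S]. *)
Lemma analytic_strong (V W : nmodT R) (S : set V) (f : V -> W) p : analytic_within S f p ->
 exists (L : V -> W) (C r : R), [/\ linW L, 0 < r, 0 <= C, forall v, `|L v| <= C * `|v| &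
 forall y z m, S y -> S z -> `|y - p| <= m -> `|z - p| <= m -> m < r ->
 `|f y - f z - L (y - z)| <= C * m * `|y - z|].
Proof.
move=> [M [C [r [r0 hM hb hc]]]].
pose L v := M 1%N (fun=> v); pose D : R := `|C|; have D0 : 0 <= D by exact: normr_ge0.
have hb' k v : `|M k v| <= D * r ^- k * \prod_(i < k) `|v i|.
 apply: le_trans (hb k v) _; rewrite -!mulrA ler_wpM2r ?ler_norm// mulr_ge0//; first by rewrite invr_ge0 exprn_ge0// ltW.
 exact: prodr_ge0.
have linL : linW L.
 move=> a u v; have h := hM 1%N (fun=> 0) ord0 a u v.
 have e w : L w = M 1%N (dfwith (fun=> 0) ord0 w).
 by rewrite /L; congr (M 1%N _); apply/funext => i; rewrite (ord1 i); exact/esym/dfwithin.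
 by rewrite !e.
(* On the radius [r / 4] the ratio [2 * m / r] is at most one half; the factor [k + 2] from
   exchanging the arguments one by one is absorbed by [2 ^ (k + 2)]. *)
exists L, (D / r + 8 * D / r ^+ 2), (r / 4); split => //; first by rewrite divr_gt0.
- by rewrite addr_ge0// divr_ge0// ?mulr_ge0 ?exprn_ge0// ltW.
- move=> v; apply: le_trans (hb' 1%N _) _; rewrite big_ord_recl big_ord0 mulr1 expr1 ler_wpM2r//.
 by rewrite lerDl divr_ge0 ?mulr_ge0 ?exprn_ge0// ltW.
move=> y z m Sy Sz ym zm mr; set a := y - p; set b := z - p.
have m0 : 0 <= m by exact: le_trans ym.
have eab : y - z = a - b by rewrite /a /b opprB addrA subrK.
rewrite eab; pose s x n := \sum_(0 <= k < n) M k (fun=> x : V).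
have cy : s a @ \oo --> f y by apply: hc => //; apply: le_lt_trans ym _; lra.
have cz : s b @ \oo --> f z by apply: hc => //; apply: le_lt_trans zm _; lra.
have cn : (fun n => `|s a (n + 2)%N - s b (n + 2)%N - L (a - b)|) @ \oo --> `|f y - f z - L (a - b)|.
 apply: cvg_norm; apply: cvgB; last exact: cvg_cst.
 by apply: cvgB; [move: cy|move: cz]; rewrite -(cvg_shiftn 2).
apply: (cvgn_le cn) => n; rewrite addn2.
have LB : L (a - b) = L a - L b by rewrite -scaleN1r addrC linL scaleN1r addrC.
have -> : s a n.+2 - s b n.+2 - L (a - b) = \sum_(0 <= k < n) (M k.+2 (fun=> a) - M k.+2 (fun=> b)).
 rewrite /s !big_nat_recl// LB -/(L a) -/(L b) sumrB.
 have -> : M 0%N (fun=> b) = M 0%N (fun=> a) by congr (M 0%N _); apply/funext => -[].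
 have zz (u p1 p2 q1 q2 : W) : u + (p1 + q1) - (u + (p2 + q2)) - (p1 - p2) = q1 - q2.
 have -> : u + (p1 + q1) - (u + (p2 + q2)) = p1 + q1 - (p2 + q2) by rewrite opprD addrACA subrr add0r.
 by rewrite (opprD p2) addrACA [X in X - _]addrC addrK.
 exact: zz.
pose x : R := 2 * m / r.
have x0 : 0 <= x <= 2^-1.
 apply/andP; split; first by rewrite divr_ge0 ?(ltW r0)// mulr_ge0.
 by rewrite ler_pdivrMr//; clear -mr; lra.
have term k : `|M k.+2 (fun=> a) - M k.+2 (fun=> b)| <= (4 * D * m / r ^+ 2 * `|a - b|) * x ^+ k.
 have c0 : 0 <= D * r ^- k.+2 by rewrite mulr_ge0// invr_ge0 exprn_ge0// ltW.
 apply: le_trans (multilinear_sub c0 (hM _) (hb' _) ym zm) _.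
 have k2 : (k.+2%:R : R) <= 2 ^+ k.+2 by rewrite -natrX ler_nat ltnW// ltn_expl.
 apply: (@le_trans _ _ (D * r ^- k.+2 * (2 ^+ k.+2 * m ^+ k.+1) * `|a - b|)).
 by rewrite ler_wpM2r// ler_wpM2l// ler_wpM2r// exprn_ge0.
 apply: eq_ler; rewrite /x !expr_div_n exprMn !exprS; field.
 by rewrite expf_neq0 gt_eqF.
apply: le_trans (ler_norm_sum _ _ _) _; apply: le_trans (ler_sum _ (fun k _ => term k)) _.
rewrite -mulr_sumr; have c0 : 0 <= 4 * D * m / r ^+ 2 * `|a - b| by nonneg.
apply: le_trans (ler_wpM2l c0 (geometric_sum_le2 n x0)) _.
have -> : 4 * D * m / r ^+ 2 * `|a - b| * 2 = 8 * D / r ^+ 2 * m * `|a - b| by ring.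
by rewrite ler_wpM2r// ler_wpM2r// lerDr divr_ge0// ltW.
Qed.

Lemma strong_qexp (V W : nmodT R) (S : set V) (f : V -> W) p L (C r : R) : S p -> 0 < r ->
 (forall v, `|L v| <= C * `|v|) ->
 (forall y z m, S y -> S z -> `|y - p| <= m -> `|z - p| <= m -> m < r ->
 `|f y - f z - L (y - z)| <= C * m * `|y - z|) -> qexp S f p L.
Proof.
move=> Sp r0 hL h; split; first by exists C.
exists C, r; split => // y Sy yr; rewrite expr2 mulrA; apply: h => //; by rewrite subrr normr0.
Qed.

(** The strict differential at [p] controls the derivative at every nearby point; this makes a
    gradient computed point by point differentiable at [p]. *)
Lemma strong_derivative_lip (V W : nmodT R) (f : V -> W) p y (L L' : V -> W) (C r : R) :
 0 <= C -> linW L -> linW L' ->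
 (forall y z m, `|y - p| <= m -> `|z - p| <= m -> m < r ->
 `|f y - f z - L (y - z)| <= C * m * `|y - z|) -> `|y - p| < r -> qexp setT f y L' ->
 forall v, `|L' v - L v| <= C * `|y - p| * `|v|.
Proof.
move=> C0 hL hL' h yr [_ [C' [r' [r'0 h']]]] v.
have [->|v0] := eqVneq v 0; first by rewrite (linW0 hL) (linW0 hL') subrr !normr0 mulr0.
have nv : 0 < `|v| by rewrite normr_gt0.
apply/ler_addgt0Pr => e e0.
pose B : R := C * `|v| ^+ 2 + `|C'| * `|v| ^+ 2 + 1.
have B0 : 0 < B by rewrite /B ltr_wpDl ?addr_ge0 ?mulr_ge0 ?sqr_ge0.
pose t : R := Num.min (Num.min ((r - `|y - p|) / 2 / `|v|) (r' / 2 / `|v|)) (e / B).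
have t0 : 0 < t by rewrite !lt_min !divr_gt0 ?subr_gt0.
have t1 : t * `|v| < r - `|y - p|.
 have : t <= (r - `|y - p|) / 2 / `|v| by rewrite !ge_min lexx.
 by rewrite ler_pdivlMr//; lra.
have t2 : t * `|v| < r'.
 have : t <= r' / 2 / `|v| by rewrite !ge_min lexx orbT.
 by rewrite ler_pdivlMr//; lra.
have t3 : t * B <= e by rewrite -ler_pdivlMr// ge_min lexx orbT.
have ntv : `|t *: v| = t * `|v| by rewrite normrZ gtr0_norm.
have dy : t *: v + y - y = t *: v by rewrite addrK.
have h1 : `|f (t *: v + y) - f y - L (t *: v)| <= C * (`|y - p| + t * `|v|) * (t * `|v|).
 rewrite -{2}dy -ntv -[in leRHS]dy; apply: h.
 - by rewrite dy -addrA addrC (le_trans (ler_normD _ _)).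
 - by rewrite lerDl.
 - by rewrite dy ntv; lra.
have h2 : `|f (t *: v + y) - f y - L' (t *: v)| <= `|C'| * (t * `|v|) ^+ 2.
 rewrite -{2}dy -ntv -[in leRHS]dy; apply: le_trans (h' _ _ _) _ => //; first by rewrite dy ntv.
 by rewrite ler_wpM2r ?sqr_ge0// ler_norm.
have LZ (l : V -> W) : linW l -> l (t *: v) = t *: l v.
 by move=> hl; have := hl t v 0; rewrite !addr0 (linW0 hl) addr0.
have h3 : t * `|L' v - L v| <= C * (`|y - p| + t * `|v|) * (t * `|v|) + `|C'| * (t * `|v|) ^+ 2.
 rewrite -(gtr0_norm t0) -normrZ scalerBr -(LZ _ hL) -(LZ _ hL') (gtr0_norm t0).
 apply: le_trans (lerD h1 h2); apply: le_trans _ (ler_normB _ _).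
 by rewrite opprB [_ - _ + (_ - _)]addrC addrA subrK.
rewrite -(ler_pM2l t0); apply: le_trans h3 _.
have -> : C * (`|y - p| + t * `|v|) * (t * `|v|) + `|C'| * (t * `|v|) ^+ 2 =
 t * (C * `|y - p| * `|v| + (t * B - t)) by rewrite /B; ring.
by rewrite ler_pM2l// lerD2l; lra.
Qed.

Lemma linW_sum_delta (W : lmodType R) N (F : 'cV[R]_N -> W) : linW F ->
 forall v, F v = \sum_j v j 0 *: F (delta_mx j 0).
Proof.
move=> hF v; pose F' : {linear 'cV[R]_N -> W} := HB.pack F (GRing.isLinear.Build R _ W _ F hF).
rewrite {1}(matrix_sum_delta v) -[F]/(F' : _ -> _) linear_sum; apply: eq_bigr => i _.
by rewrite big_ord1 linearZ.
Qed.

Lemma qexp_col (V : nmodT R) N (E : set V) (f L : 'I_N -> V -> R) x :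
 (forall j, qexp E (f j : V -> R^o) x (L j)) ->
 qexp E (fun y => \col_j f j y) x (fun v => \col_j L j v).
Proof.
move=> h; have [K hK] := choice (fun j => (h j).1); have [C hC] := choice (fun j => (h j).2).
have [r hr] := choice hC; split.
 exists (\sum_j `|K j|) => v; apply: mx_norm_le => [|j k]; first by rewrite mulr_ge0// sumr_ge0.
 rewrite mxE; apply: le_trans (hK _ _) _; rewrite ler_wpM2r// (bigD1 j)//=.
 by apply: le_trans (ler_norm _) _; rewrite lerDl sumr_ge0.
exists (\sum_j `|C j|), (\big[Num.min/1]_j r j); split.
 by apply: lt_bigmin => // i _; have [] := hr i.
move=> y Ey yr; apply: mx_norm_le => [|j k]; first by rewrite mulr_ge0 ?sqr_ge0// sumr_ge0.
rewrite !mxE; have [_ hj] := hr j; apply: le_trans (hj _ Ey _) _.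
 by apply: lt_le_trans yr _; exact: bigmin_le_cond.
rewrite ler_wpM2r ?sqr_ge0// (bigD1 j)//=.
by apply: le_trans (ler_norm _) _; rewrite lerDl sumr_ge0.
Qed.

(** Vanishing at 0 gains the factor [t] in norm on a disc shrunk by [t], which brings a curve inside
    the radius of convergence of the map it is composed with. *)
Lemma pw_small (rho B t : R) f : 0 < rho -> 0 < t <= 1 -> pw rho B f -> f 0 = 0 -> pw (t * rho) (t * B) f.
Proof.
move=> r0 /andP[t0 t1] [c [c1 c2]] f0; have z : `|0 : R| < rho by rewrite normr0.
have c00 : c 0%N = 0.
 have := series_tail 1 z c1 (c2 _ z).
 rewrite big_nat1 expr0 mulr1 f0 sub0r normrN normr0 mul0r expr1 mulr0 normr_le0.
 by move=> /eqP.
exists c; split => [N|e er]; last by apply: c2; apply: lt_le_trans er _; rewrite ler_piMl// ltW.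
apply: le_trans (ler_wpM2l (ltW t0) (c1 N)); rewrite mulr_sumr; apply: ler_sum => -[|k] _.
 by rewrite c00 normr0 !mul0r mulr0.
rewrite exprMn mulrCA ler_wpM2r ?mulr_ge0 ?exprn_ge0 ?(ltW r0)//.
by rewrite exprS ler_piMr ?(ltW t0)// exprn_ile1 ?(ltW t0).
Qed.

Lemma multilinear_sum (V W : lmodType R) (T : finType) k (F : ('I_k -> V) -> W) G i (v : T -> V) (c : T -> R) :
 multilinear F -> F (dfwith G i (\sum_l c l *: v l)) = \sum_l c l *: F (dfwith G i (v l)).
Proof.
move=> hF; have h : linW (fun x => F (dfwith G i x)) by move=> a u w; exact: hF.
elim: (index_enum T) => [|l s IH]; first by rewrite !big_nil (linW0 h).
by rewrite !big_cons -IH; exact: hF.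
Qed.

(** The arguments are replaced by the curve one at a time; expanding the newest one in the vectors
    [v l] multiplies the norm by [\sum_l B l * |v l|]. *)
Lemma pw_multilinear (V : nmodT R) (T : finType) k (F : ('I_k -> V) -> R) (K rho : R)
 (v : T -> V) (c : T -> R -> R) (B : T -> R) : 0 < rho -> @multilinear R V R^o k F ->
 (forall w, `|F w| <= K * \prod_(i < k) `|w i|) -> (forall l, pw rho (B l) (c l)) ->
 pw rho (K * (\sum_l B l * `|v l|) ^+ k) (fun e => F (fun=> \sum_l c l e *: v l)).
Proof.
move=> r0 hF hK hc; pose u e : V := \sum_l c l e *: v l; pose D := \sum_l B l * `|v l|.
suff h j : (j <= k)%N -> forall w, pw rho (K * D ^+ j * \prod_(i < k | (j <= i)%N) `|w i|)
 (fun e => F (fun i => if (i < j)%N then u e else w i)).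
 have := h k (leqnn k) (fun=> 0); rewrite big_pred0 ?mulr1; last by move=> i; rewrite leqNgt ltn_ord.
 by apply: pw_ext => e _; congr F; apply/funext => i; rewrite ltn_ord.
elim: j => [_ w|j IH jk w].
 apply: (pw_le _ (pw_ext _ (pw_cst rho (F w)))) => //.
 rewrite expr0 mulr1; apply: le_trans (hK w) _; apply: eq_ler.
 by congr (_ * _); apply: eq_bigl => i; rewrite leq0n.
pose jj := Ordinal jk; pose G (w : 'I_k -> V) e (i : 'I_k) := if (i < j)%N then u e else w i.
have e1 e : (fun i : 'I_k => if (i < j.+1)%N then u e else w i) = dfwith (G w e) jj (u e).
 apply/funext => i; case: (eqVneq jj i) => [<-|ji]; first by rewrite dfwithin leqnn.
 rewrite dfwithout// /G ltnS leq_eqVlt (_ : (_ == _ :> nat) = false)//; apply/negbTE.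
 by apply: contra ji => /eqP ij; apply/eqP/val_inj.
have e2 e l : dfwith (G w e) jj (v l) = G (dfwith w jj (v l)) e.
 apply/funext => i; rewrite /G; case: (eqVneq jj i) => [<-|ji]; first by rewrite !dfwithin ltnn.
 by rewrite !dfwithout.
apply: (pw_ext (f := fun e => \sum_l c l e * F (G (dfwith w jj (v l)) e))) => [e _|].
 by rewrite e1 (multilinear_sum _ _ _ _ hF); apply: eq_bigr => l _; rewrite e2.
have h l := pwM r0 (hc l) (IH (ltnW jk) (dfwith w jj (v l))).
apply: pw_le (pw_sum (index_enum T) r0 h); rewrite exprSr -/D {2}/D !mulr_sumr mulr_suml.
apply: ler_sum => l _; rewrite (bigD1 jj)//= dfwithin.
have -> : \prod_(i < k | (j <= i)%N && (i != jj)) `|dfwith w jj (v l) i| = \prod_(i < k | (j < i)%N) `|w i|.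
 apply: eq_big => [i|i /andP[_ ij]]; last by rewrite dfwithout// eq_sym.
 by rewrite ltn_neqAle andbC; congr (_ && _); rewrite eq_sym -(inj_eq val_inj).
apply: eq_ler; ring.
Qed.

Lemma pw_comp_analytic (V : nmodT R) (D : set V) (f : V -> R) (T : finType) (v : T -> V)
 (c : T -> R -> R) (g : R -> V) (rho : R) : 0 < rho -> @analytic_within R V R^o D f (g 0) ->
 (forall l, pwx rho (c l)) -> (forall l, c l 0 = 0) ->
 (forall e, `|e| < rho -> g e - g 0 = \sum_l c l e *: v l) -> (forall e, `|e| < rho -> D (g e)) ->
 exists2 r, 0 < r & pwx r (fun e => f (g e)).
Proof.
move=> rho0 [M [C [r [r0 hM hb hc]]]] pc c0 hg Dg; have [B hB] := choice pc.
have B0 l : 0 <= B l by exact: pw_B0 (hB l).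
pose K : R := \sum_l B l * `|v l|; have K0 : 0 <= K by apply: sumr_ge0 => l _; rewrite mulr_ge0.
pose t : R := Num.min 1 (r / 4 / (K + 1)).
have K1 : 0 < K + 1 by rewrite ltr_wpDl.
have t0 : 0 < t by rewrite lt_min ltr01 !divr_gt0.
have t1 : t <= 1 by rewrite ge_min lexx.
have tK : t * K <= r / 4.
 have : t <= r / 4 / (K + 1) by rewrite ge_min lexx orbT.
 by rewrite ler_pdivlMr//; apply: le_trans; rewrite ler_pM2l// lerDl.
have hB' l : pw (t * rho) (t * B l) (c l) by apply: pw_small => //; rewrite t0.
have trho : 0 < t * rho by rewrite mulr_gt0.
have er (e : R) : `|e| < t * rho -> `|e| < rho by move=> h; apply: lt_le_trans h _; rewrite ler_piMl// ltW.
have sumK : \sum_l t * B l * `|v l| = t * K by rewrite mulr_sumr; apply: eq_bigr => l _; rewrite mulrA.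
exists (t * rho) => //; exists (`|C| * 2).
have hb' k w : `|(M k w : R)| <= `|C| * r ^- k * \prod_(i < k) `|w i|.
 apply: le_trans (hb k w) _; rewrite -!mulrA ler_wpM2r ?ler_norm// mulr_ge0//; last exact: prodr_ge0.
 by rewrite invr_ge0 exprn_ge0// ltW.
apply: (pw_series trho (fun k => pw_multilinear v trho (hM k) (hb' k) hB')).
 move=> N; have x0 : 0 <= t * K / r <= 2^-1.
 apply/andP; split; first by rewrite divr_ge0 ?(ltW r0)// mulr_ge0// ltW.
 by rewrite ler_pdivrMr//; move: tK r0; lra.
 apply: le_trans (ler_wpM2l (normr_ge0 C) (geometric_sum_le2 N x0)).
 rewrite mulr_sumr; apply: ler_sum => k _; rewrite sumK.
 by rewrite expr_div_n -!mulrA ler_wpM2l// [r ^- k * _]mulrC.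
move=> e he; have := hc (g e) (Dg _ (er _ he)).
have -> : `|g e - g 0| < r.
 rewrite hg ?er//; apply: (@le_lt_trans _ _ (t * K)).
 rewrite -sumK; apply: le_trans (ler_norm_sum _ _ _) _; apply: ler_sum => l _.
 by rewrite normrZ ler_wpM2r//; exact: pw_norm (hB' l) he.
 by apply: le_lt_trans tK _; move: r0; lra.
by move=> /(_ isT); rewrite hg ?er.
Qed.

Lemma pwm_analytic N (F : R -> 'cV[R]_N) (e0 r : R) : 0 < r -> (forall j, pwx r (fun t => F (e0 + t) j 0)) ->
 analytic_within setT F e0.
Proof.
move=> r0 h; have [B hB] := choice h; have [a ha] := choice hB.
have B0 j : 0 <= B j by exact: pw_B0 (hB j).
exists (fun k v => (\prod_i v i) *: (\col_j a j k : 'cV[R]_N)), (\sum_j B j), r; split => //.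
- move=> k v i c u w.
 have e x : \prod_j dfwith v i x j = x * \prod_(j | j != i) v j.
 rewrite (bigD1 i)//= dfwithin; congr (_ * _); apply: eq_bigr => j ij.
 by rewrite dfwithout// eq_sym.
 by rewrite !e scalerA -scalerDl; congr (_ *: _); rewrite /GRing.scale/=; ring.
- move=> k v; rewrite normrZ normr_prod mulrC ler_wpM2r ?prodr_ge0//.
 apply: mx_norm_le => [|j i]; first by rewrite mulr_ge0 ?sumr_ge0// invr_ge0 exprn_ge0// ltW.
 rewrite mxE ler_pdivlMr ?exprn_gt0//; have [h1 _] := ha j.
 apply: le_trans (_ : _ <= B j) _; last by rewrite (bigD1 j)//= lerDl sumr_ge0.
 apply: le_trans (h1 k.+1); rewrite big_nat_recr//= lerDr; apply: sumr_ge0 => l _.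
 by rewrite mulr_ge0// exprn_ge0// ltW.
- move=> y _ yr; set t := y - e0 in yr *; have -> : y = e0 + t by rewrite addrC subrK.
 clearbody t; apply/cvgrPdist_le => eps eps0.
 have q0 : 0 <= `|t| / r by rewrite divr_ge0// ltW.
 have h0 : (fun n => (\sum_j B j) * (`|t| / r) ^+ n) @ \oo --> 0.
 by apply: cvg_geometric; rewrite ger0_norm// ltr_pdivrMr// mul1r.
 near=> n; apply: (@le_trans _ _ ((\sum_j B j) * (`|t| / r) ^+ n)).
 apply: mx_norm_le => [|j i]; first by rewrite mulr_ge0 ?sumr_ge0// exprn_ge0.
 rewrite ord1 !mxE summxE; have [h1 h2] := ha j.
 under eq_bigr do rewrite prodr_const card_ord !mxE mulrC.
 apply: le_trans (series_tail n yr h1 (h2 t yr)) _; rewrite ler_wpM2r ?exprn_ge0//.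
 by rewrite (bigD1 j)//= lerDl sumr_ge0.
 apply: le_trans (ler_norm _) _; near: n.
 by have /cvgr0Pnorm_le := h0; apply.
Unshelve. all: by end_near. Qed.

Lemma chart_curve_analytic d N (x : gparam R d -> 'cV[R]_N) (rho : R) (Sg : R -> 'M[R]_d) (m : R -> 'cV[R]_d) e0 :
 `|e0| < rho -> pwm rho Sg -> pwm rho m -> (forall e, `|e| < rho -> Gd (m e, Sg e)) ->
 analytic_within Gd x (m e0, Sg e0) -> analytic_within setT (fun e => x (m e, Sg e)) e0.
Proof.
move=> er pSg pm hg [M [C [r [r0 hM hb hc]]]].
have hj j : exists2 s, 0 < s & pwx s (fun t => x (m (e0 + t), Sg (e0 + t)) j 0).
 pose T := ('I_d + 'I_d * 'I_d)%type.
 pose v (l : T) : gparam R d := match l with inl i => (delta_mx i 0, 0) | inr ij => (0, delta_mx ij.1 ij.2) end.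
 pose c (l : T) t : R := match l with inl i => m (e0 + t) i 0 - m (e0 + 0) i 0
 | inr ij => Sg (e0 + t) ij.1 ij.2 - Sg (e0 + 0) ij.1 ij.2 end.
 have rr : 0 < rho - `|e0| by rewrite subr_gt0.
 have et t : `|t| < rho - `|e0| -> `|e0 + t| < rho.
 by move=> ht; apply: le_lt_trans (ler_normD _ _) _; lra.
 have sh f : pwx rho f -> pwx (rho - `|e0|) (fun t => f (e0 + t)) by move=> [B hB]; exists B; exact: pw_shift.
 apply: (@pw_comp_analytic _ Gd (fun q => x q j 0) T v c (fun t => (m (e0 + t), Sg (e0 + t))) _ rr).
 - rewrite addr0; exists (fun k w => M k w j 0 : R^o), C, r; split => //.
 + by move=> k w i a u u'; rewrite hM !mxE.
 + by move=> k w; apply: le_trans (hb k w); exact: mx_norm_ge_entry.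
 + move=> y Sy yr; have := hc y Sy yr => /cvgrPdist_le h; apply/cvgrPdist_le => eps eps0.
 have := h eps eps0; apply: filterS => n; apply: le_trans.
 have -> : x y j 0 - \sum_(0 <= k < n) M k (fun=> y - (m e0, Sg e0)) j 0 =
 (x y - \sum_(0 <= k < n) M k (fun=> y - (m e0, Sg e0))) j 0 by rewrite !mxE summxE.
 exact: mx_norm_ge_entry.
 - by case=> [i|ij]; apply: pwxB => //; [exact: (sh _ (pm _ _))|exact: pwx_cst|exact: (sh _ (pSg _ _))|exact: pwx_cst].
 - by case=> [i|ij]; rewrite /c subrr.
 - move=> t _; rewrite big_sumType/=.
 have fsum (I : finType) (F : I -> gparam R d) : \sum_i F i = (\sum_i (F i).1, \sum_i (F i).2).
 rewrite [LHS]surjective_pairing; congr pair.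
 exact: (big_morph (fun q : gparam R d => q.1) (fun _ _ => erefl) erefl).
 exact: (big_morph (fun q : gparam R d => q.2) (fun _ _ => erefl) erefl).
 rewrite !fsum; apply/eqP; rewrite xpair_eqE; apply/andP; split; apply/eqP => /=.
 rewrite [X in _ = _ + X]big1 ?[RHS]addr0; last by move=> i _; rewrite scaler0.
 rewrite {1}[m (e0 + t) - _]matrix_sum_delta; apply: eq_bigr => i _.
 by rewrite big_ord1 !mxE.
 rewrite [X in _ = X + _]big1 ?[RHS]add0r; last by move=> i _; rewrite scaler0.
 rewrite {1}[Sg (e0 + t) - _]matrix_sum_delta pair_bigA; apply: eq_bigr => i _.
 by rewrite !mxE.
 - by move=> t ht; apply/hg/et.
have hj' j : exists s : R, 0 < s /\ pwx s (fun t => x (m (e0 + t), Sg (e0 + t)) j 0).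
 by have [s s0 h] := hj j; exists s.
have [s hs] := choice hj'.
apply: (@pwm_analytic _ _ _ (\big[Num.min/1]_j s j)) => [|j].
 by apply: lt_bigmin => // j _; have [] := hs j.
have [s0 h] := hs j; apply: pwx_le h; first by apply: lt_bigmin => // i _; have [] := hs i.
exact: bigmin_le_cond.
Qed.

Lemma jet_powR (f : R -> R) (z z1 p : R) : 0 < z -> jet (f : R -> R^o) z z1 ->
 jet (fun e => f e `^ p : R^o) (z `^ p) (p * z `^ (p - 1) * z1).
Proof.
move=> z0 hf; have hu := jetZc z^-1 (jetB hf (@jet_cst _ R^o z)).
rewrite subrr subr0 /GRing.scale/= mulr0 in hu; set u := fun e => _ in hu.
have [K [r [K0 r0 hK]]] := jet_bound hu.
have hl : jet (fun e => ln (1 + u e) : R^o) 0 (z^-1 * z1).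
 have [e0 qu] := (jetP _ _ _).1 hu.
 (* The logarithm of [1 + u] is read as the logarithm of the determinant of a 1 by 1 matrix, whose
    expansion is known. *)
 have qX : qexp setT (fun e => (u e)%:M : 'M[R]_1) 0 (fun t => (t *: (z^-1 * z1) : R^o)%:M).
 apply: (@qexp_lin _ _ R^o _ _ (@scalar_mx R 1) 1 _ _ _ _ _ qu) => [x y|x]; first exact: raddfB.
 by rewrite mul1r; apply: mx_norm_le => // i j; rewrite !ord1 mxE eqxx mulr1n.
 have hX := jet_lndet0 (jet_qexp (b := (z^-1 * z1)%:M) qX _ _).
 rewrite mxtrace_scalar mulr1n in hX; apply: (jet_ext ltr01) (hX _ _) => [e _||t].
 - by rewrite -raddfD det_scalar1.
 - by rewrite e0 raddf0.
 - by rewrite scale_scalar_mx.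
have hl' := jetZc p hl; rewrite /GRing.scale/= mulr0 in hl'; have hx := jetZc (z `^ p) (jet_exp hl').
pose r1 := Num.min r (2^-1 / (K + 1)).
have r10 : 0 < r1 by rewrite lt_min r0 divr_gt0 ?invr_gt0// ltr_wpDl.
apply: (jet_conv hx r10) => [e| |]; rewrite /GRing.scale/=.
- rewrite lt_min => /andP[e1 e2]; have := hK e e1; rewrite subr0 => h2'.
 have h2 : `|u e| < 2^-1.
 apply: le_lt_trans h2' _; rewrite ltr_pdivlMr ?ltr_wpDl// in e2; apply: le_lt_trans e2.
 by rewrite mulrC ler_wpM2l// lerDl.
 have fe : f e = z * (1 + u e) by rewrite /u /GRing.scale/= mulrDr mulr1 mulrA divff ?gt_eqF// mul1r addrC subrK.
 have u0 : 0 < 1 + u e by move: h2; rewrite ltr_norml => /andP[h2 _]; lra.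
 by rewrite fe powRM ?(ltW z0) ?(ltW u0)//; congr (_ * _); rewrite /powR gt_eqF.
- by rewrite mulr1.
- have -> : z `^ p = z `^ (p - 1) * z.
 rewrite -{3}(powRr1 (ltW z0)) -powRD ?subrK//.
 by apply/implyP => _; rewrite gt_eqF.
 by field; rewrite gt_eqF.
Qed.

End analytic_derivative.

(** * First-order expansion of the curve at the barycenter *)

Section star_linear.
Context {R : realType} {d n : nat}.

Lemma jet_pwm rho p q (F : R -> 'M[R]_(p, q)) : 0 < rho -> pwm rho F -> exists b, jet F (F 0) b.
Proof.
move=> r0 h; have h' (ij : 'I_p * 'I_q) := pwx_taylor2 r0 (h ij.1 ij.2).
have [b hb] := choice h'; have [C hC] := choice hb.
exists (\matrix_(i, j) b (i, j)), (\sum_ij `|C ij|), rho; split => // e er.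
have S0 : 0 <= \sum_ij `|C ij| by exact: sumr_ge0.
apply: mx_norm_le => [|i j]; first by rewrite mulr_ge0 ?sqr_ge0.
have := hC (i, j) e er; rewrite !mxE [e * _]mulrC => /le_trans; apply.
rewrite ler_wpM2r ?sqr_ge0//; apply: le_trans (ler_norm _) _.
by rewrite (bigD1 (i, j))//= lerDl sumr_ge0.
Qed.

Lemma match_poly (Sg S J : 'M[R]_d) (a b : R) : Sg \in unitmx -> S \in unitmx ->
 invmx Sg + b *: (1%:M - S) = S *m (J + a *: (1%:M - invmx S)) *m S ->
 Sg + b *: (Sg *m (1%:M - S) *m Sg) = Sg *m S *m J *m (S *m Sg) + a *: (Sg *m (S *m S - S) *m Sg).
Proof.
move=> uG uS e.
have gen (M P Q : 'M[R]_d) k : M *m (P + k *: Q) *m M = M *m P *m M + k *: (M *m Q *m M).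
 by rewrite mulmxDr mulmxDl -scalemxAr -scalemxAl.
have := congr1 (fun M => Sg *m M *m Sg) e; rewrite /= (gen Sg (invmx Sg)) mulmxV// mul1mx => ->.
have e1 : S *m (1%:M - invmx S) *m S = S *m S - S by rewrite mulmxBr mulmx1 mulmxV// mulmxBl mul1mx.
by rewrite gen e1 gen !mulmxA.
Qed.

Lemma mxtrace_combination (a b k : R) (P Q M H : 'M[R]_d) :
 \tr ((a *: (P - b *: Q) + k *: M) *m H) = a * (\tr (P *m H) - b * \tr (Q *m H)) + k * \tr (M *m H).
Proof.
by rewrite mulmxDl mxtraceD -scalemxAl mxtraceZ -scalemxAl mxtraceZ -scaleNr mulmxDl mxtraceD -scalemxAl mxtraceZ mulNr.
Qed.

Variables (tau0 tau1 : R) (c : 'I_n -> R) (mi : 'I_n -> 'cV[R]_d) (A : 'I_n -> 'M[R]_d).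
Hypotheses (t00 : 0 < tau0) (t10 : 0 < tau1) (pA : forall i, sympd (A i)).
Variables (rho : R) (Sg : R -> 'M[R]_d) (m : R -> 'cV[R]_d) (S N : 'I_n -> R -> 'M[R]_d)
 (r : 'I_n -> R -> 'cV[R]_d) (w : 'I_n -> R -> R).
Hypotheses (rho0 : 0 < rho)
 (st : forall e, `|e| < rho -> star tau0 tau1 c mi A e (Sg e) (m e) (fun i => S i e) (fun i => N i e)
 (fun i => r i e) (fun i => w i e))
 (pSg : pwm rho Sg) (pm : pwm rho m)
 (pp : forall i, [/\ pwm rho (S i), pwm rho (fun e => invmx (S i e)),
 pwm rho (N i), pwm rho (r i) & pwx rho (w i)]).

Let s := tau0 + tau1.
Let z0 : `|0 : R| < rho. Proof. by rewrite normr0. Qed.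

Lemma star0 : [/\ sympd (Sg 0), forall i, sympd (S i 0), forall i, S i 0 *m Sg 0 *m S i 0 = A i,
 forall i, N i 0 = 1%:M - S i 0 & forall i, r i 0 = mi i - m 0] /\
 [/\ forall i, w i 0 = c i, \sum_i c i *: (mi i - m 0) = 0 & \sum_i c i *: (1%:M - S i 0) = 0].
Proof.
have s0 := st z0; have pG := star_Sg s0; have pS i := star_S s0 i.
have hN i : N i 0 = 1%:M - S i 0 by have := star_N s0 i; rewrite mulr0 scale0r addr0.
have hr i : r i 0 = mi i - m 0 by have := star_r s0 i; rewrite !mulr0 !scale0r !addr0.
have hw i : w i 0 = c i.
 by rewrite (star_w s0) !mulr0 !scale0r !addr0 det1 ln1 !mulr0 mul0r subr0 addr0 expR0 mulr1.
split; split => //.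
- move=> i; have := star_match s0 i; rewrite !mulr0 !scale0r !addr0 => e.
 have uA := sympd_unit (pA i); have uS := sympd_unit (pS i); have uG := sympd_unit pG.
 have e1 : Sg 0 = invmx (S i 0) *m A i *m invmx (S i 0).
 rewrite -[LHS]invmxK e !invmx_mulmx ?unitmx_mul ?uS ?unitmx_inv ?uA//.
 by rewrite invmxK !mulmxA.
 by rewrite e1 !mulmxA mulmxV// mul1mx -mulmxA mulVmx// mulmx1.
- by have := star_sum_m s0; under eq_bigr do rewrite hw hr.
- have := star_sum_Sg s0; under eq_bigr do rewrite hw hN mulr0 scale0r subr0.
 rewrite symmE// linear_sum/=; apply: eq_bigr => i _.
 by rewrite linearZ/= linearB/= trmx1 (sympd_sym (pS i)).
Qed.

Let K i := 1%:M - S i 0.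
(** Source term of the matching equation at first order, from the explicit factors [e] in front of
    the entropic terms. *)
Let Y i := (2 / tau1) *: (Sg 0 *m K i *m Sg 0) - (2 / tau0) *: (Sg 0 *m (S i 0 *m S i 0 - S i 0) *m Sg 0).
Let W i := wcost (mi i, A i) (m 0, Sg 0) (S i 0).
Let dl i := mi i - m 0.

(** The exponent of the weight is [- e A_i / s], and [A_i] at [e = 0] is the squared Wasserstein
    cost; hence the slope [- c i W i / s]. *)
Lemma w_jet i : jet (w i : R -> R^o) (c i) (- (c i * W i / s)).
Proof.
have [[pG pS mS hN hr] [hw _ _]] := star0; have [pSi pTi pNi pri _] := pp i.
have s0 : 0 < s by rewrite addr_gt0.
have [S1 jS] := jet_pwm rho0 pSi; have [T1 jT] := jet_pwm rho0 pTi.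
have [G1 jG] := jet_pwm rho0 pSg; have [r1 jr] := jet_pwm rho0 pri; have [m1 jm] := jet_pwm rho0 pm.
have j0 := jet_lndet (2 / tau0) (jetM (jet_cst (A i)) (jetB (jet_cst 1%:M) jT)).
have j1 := jet_lndet (2 / tau1) (jetM jG (jetB (jet_cst 1%:M) jS)).
have j2 := jet_tr (jetZid s^-1 (jetM jr (jet_trmx (jetB (jet_cst (mi i)) jm)))).
rewrite linear0 mxtraceZ in j2.
have jL := jetB (jetD (jetZc (- (tau0 / s / 2)) j0) (jetZc (- (tau1 / s / 2)) j1)) j2.
rewrite !scaler0 addr0 subrr in jL.
apply: (jet_conv (jetZc (c i) (jet_exp jL)) rho0) => [e er| |]; last 1 first.
- rewrite /GRing.scale/= /W /wcost /= -dotc_tr dotcC hr.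
 by move: (dotc _ _) (\tr _) (\tr _) => x y z; field; rewrite !gt_eqF.
- rewrite (star_w (st er)) /GRing.scale/= mxtraceZ -dotc_tr dotcC; congr (_ * expR (_ - _)).
- by rewrite /GRing.scale/= mulr1.
Qed.

(** Every equation of [star] is an identity between curves, differentiated at 0 by [jet_unique]. The
    last clause is the pair of stationarity equations tested on [(h, H)], after eliminating the
    slopes of [r] and [N]. *)
Lemma star_linearized : exists (Sg1 : 'M[R]_d) (m1 : 'cV[R]_d) (S1 : 'I_n -> 'M[R]_d),
 [/\ jet Sg (Sg 0) Sg1, jet m (m 0) m1, Sg1^T = Sg1,
 forall i, lyap (Sg 0) (invmx (S i 0)) (S1 i) = - (Sg1 - Y i) &
 forall h H, H^T = H -> 2 * (\sum_i c i) * dotc m1 h - \sum_i c i * \tr (S1 i *m H) =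
 s^-1 * (\sum_i c i * W i * (- 2 * dotc (dl i) h + \tr (K i *m H))) -
 \sum_i c i * (4 / tau0 * dotc (A i *m dl i) h + 4 / tau1 * dotc (Sg 0 *m dl i) h
 - 2 / tau1 * \tr (K i *m Sg 0 *m K i *m H) - 2 / tau1 * dotc (dl i) (H *m dl i))].
Proof.
have [[pG pS mS hN hr] [hw _ _]] := star0.
have s0 : 0 < s by rewrite addr_gt0.
have [Sg1 jG] := jet_pwm rho0 pSg; have [m1 jm] := jet_pwm rho0 pm.
have hS1 i : exists b, jet (S i) (S i 0) b.
 by have [h _ _ _ _] := pp i; have := jet_pwm rho0 h.
have [S1 jS] := choice hS1.
have hT1 i : exists b, jet (fun e => invmx (S i e)) (invmx (S i 0)) b.
 by have [_ h _ _ _] := pp i; have := jet_pwm rho0 h.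
have [T1 jT] := choice hT1.
have hN1 i : exists b, jet (N i) (K i) b.
 by have [_ _ h _ _] := pp i; have := jet_pwm rho0 h; rewrite hN.
have [N1 jN] := choice hN1.
have hr1 i : exists b, jet (r i) (dl i) b.
 by have [_ _ _ h _] := pp i; have := jet_pwm rho0 h; rewrite hr.
have [r1 jr] := choice hr1.
exists Sg1, m1, S1; split => //.
- have jGT : jet Sg (Sg 0) Sg1^T.
 apply: (jet_conv (jet_trmx jG) rho0) => [e er| |//]; last exact: sympd_sym.
 exact/sympd_sym/(star_Sg (st er)).
 by have [] := jet_unique jGT jG.
- move=> i; have uG := sympd_unit pG; have uS := sympd_unit (pS i); have uA := sympd_unit (pA i).
 have jK := jetB (jet_cst 1%:M) (jS i).
 have jL := jetD jG (jetZid (2 / tau1) (jetM (jetM jG jK) jG)).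
 have jP := jetM (jetM (jetM jG (jS i)) (jet_cst (invmx (A i)))) (jetM (jS i) jG).
 have jQ := jetD jP (jetZid (2 / tau0) (jetM (jetM jG (jetB (jetM (jS i) (jS i)) (jS i))) jG)).
 have jE : jet (fun e => Sg e + (2 / tau1 * e) *: (Sg e *m (1%:M - S i e) *m Sg e)) _ _ := jL.
 have hz e : `|e| < rho -> Sg e *m S i e *m invmx (A i) *m (S i e *m Sg e) +
 (2 / tau0 * e) *: (Sg e *m (S i e *m S i e - S i e) *m Sg e) =
 Sg e + (2 / tau1 * e) *: (Sg e *m (1%:M - S i e) *m Sg e).
 move=> he; apply/esym/match_poly; [exact/sympd_unit/(star_Sg (st he))|exact/sympd_unit/(star_S (st he))|].
 exact: star_match (st he) i.
 have [_] := jet_unique jE (jet_ext rho0 hz jQ).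
 have J0 : invmx (A i) = invmx (S i 0) *m invmx (Sg 0) *m invmx (S i 0).
 by rewrite -(mS i) !invmx_mulmx ?unitmx_mul ?uS ?uG// !mulmxA.
 have e1 : Sg 0 *m S i 0 *m invmx (A i) = invmx (S i 0).
 by rewrite J0 !mulmxA mulmxK// mulmxV// mul1mx.
 have e2 : invmx (A i) *m (S i 0 *m Sg 0) = invmx (S i 0).
 by rewrite J0 !mulmxA mulmxKV// mulmxKV.
 rewrite mulmx0 add0r e1 -[_ *m invmx (A i) *m (S i 0 *m Sg 0)]mulmxA e2.
 rewrite (mulmxDr _ (S i 0 *m Sg1)) (mulmxDl (Sg 0 *m S1 i)) mulKmx// mulmxK// /Y -/(K i) mulmxA.
 move: (_ *: _) (_ *: _) => y1 y0 e3; rewrite /lyap.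
 have e4 : y0 = invmx (S i 0) *m S1 i *m Sg 0 + Sg 0 *m S1 i *m invmx (S i 0) + Sg1 + y1.
 by apply: (addrI Sg1); rewrite e3 !addrA.
 by rewrite e4 addrK opprB addrK.
- move=> h H sH.
 have er i : r1 i = - m1 - (2 / tau0) *: (A i *m dl i) - (2 / tau1) *: (Sg 0 *m dl i).
 have j1 := jetD (jetD (jr i) (jetZid (2 / tau0) (jetM (jet_cst (A i)) (jr i)))) (jetZid (2 / tau1) (jetM jG (jr i))).
 have j2 := jetB (jet_cst (mi i)) jm.
 have [_] := jet_unique j1 (jet_ext rho0 (fun e he => esym (star_r (st he) i)) j2).
 by rewrite sub0r => <-; rewrite addrAC addrK addrK.
 have eN i : N1 i = - S1 i - (2 / tau1) *: (K i *m Sg 0 *m K i).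
 have j1 := jetD (jN i) (jetZid (2 / tau1) (jetM (jetM (jN i) jG) (jetB (jet_cst 1%:M) (jS i)))).
 have j2 := jetB (jet_cst 1%:M) (jS i).
 have [_] := jet_unique j1 (jet_ext rho0 (fun e he => esym (star_N (st he) i)) j2).
 by rewrite sub0r => <-; rewrite addrK.
 have em : \sum_i (c i *: r1 i + (- (c i * W i / s)) *: dl i) = 0.
 have j1 := jet_sum (fun i => jetZ (w_jet i) (jr i)).
 by have [_] := jet_unique j1 (jet_ext rho0 (fun e he => esym (star_sum_m (st he))) (jet_cst 0)).
 pose M1 := \sum_i (c i *: (N1 i - (2 / tau1) *: (dl i *m (dl i)^T)) + (- (c i * W i / s)) *: K i).
 have eM : M1 + M1^T = 0.
 have j1 := jet_sum (fun i => jetZ (w_jet i) (jetB (jN i) (jetZid (2 / tau1) (jetM (jr i) (jet_trmx (jr i)))))).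
 have j2 := jetD j1 (jet_trmx j1).
 have hz e : `|e| < rho -> 0 = (\sum_i w i e *: (N i e - (2 / tau1 * e) *: (r i e *m (r i e)^T))) +
 (\sum_i w i e *: (N i e - (2 / tau1 * e) *: (r i e *m (r i e)^T)))^T.
 move=> he; have := star_sum_Sg (st he); rewrite /symm => /eqP; rewrite scaler_eq0 invr_eq0.
 by rewrite pnatr_eq0/= => /eqP ->.
 have [_] := jet_unique j2 (jet_ext rho0 hz (jet_cst 0)).
 by under eq_bigr do rewrite subr0.
 have tM : \tr (M1 *m H) = 0 by rewrite -tr_symm_mul// /symm eM scaler0 mul0mx linear0.
 have dm : \sum_i (c i * dotc (r1 i) h - c i * W i / s * dotc (dl i) h) = 0.
 transitivity (dotc (\sum_i (c i *: r1 i + (- (c i * W i / s)) *: dl i)) h); last by rewrite em dotc0l.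
 rewrite (big_morph (fun v => dotc v h) (fun u v => dotcDl u v h) (dotc0l h)); apply: eq_bigr => i _.
 by rewrite (dotcDl (c i *: r1 i)) !dotcZl mulNr.
 have dM : \sum_i (c i * (\tr (N1 i *m H) - 2 / tau1 * dotc (dl i) (H *m dl i)) -
 c i * W i / s * \tr (K i *m H)) = 0.
 transitivity (\tr (M1 *m H)); last exact: tM.
 rewrite /M1 mulmx_suml [RHS]linear_sum/=; apply: eq_bigr => i _.
 rewrite mxtrace_combination mulNr.
 by congr (_ * (_ - _ * _) - _); rewrite dotc_tr -mulmxA mxtrace_mulC.
 apply/eqP; rewrite -subr_eq0; apply/eqP.
 transitivity (- 2 * (\sum_i (c i * dotc (r1 i) h - c i * W i / s * dotc (dl i) h)) +
 \sum_i (c i * (\tr (N1 i *m H) - 2 / tau1 * dotc (dl i) (H *m dl i)) - c i * W i / s * \tr (K i *m H)));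
 last by rewrite dm dM mulr0 addr0.
 rewrite [2 * _ * _]mulrAC [_ * \sum_i c i]mulr_sumr !mulr_sumr -!sumrB -big_split/=; apply: eq_bigr => i _.
 have dr : dotc (r1 i) h = - dotc m1 h - 2 / tau0 * dotc (A i *m dl i) h - 2 / tau1 * dotc (Sg 0 *m dl i) h.
 by rewrite er !dotcBl dotcNl !dotcZl.
 have tN : \tr (N1 i *m H) = - \tr (S1 i *m H) - 2 / tau1 * \tr (K i *m Sg 0 *m K i *m H).
 by rewrite eN -opprD mulNmx (mulmxDl (S1 i)) linearN/= mxtraceD -scalemxAl mxtraceZ opprD.
 rewrite dr tN; move: (dotc _ _) (dotc _ _) (dotc _ _) (dotc _ _) (dotc _ _) (\tr _) (\tr _) (\tr _) => *.
 by field; rewrite !gt_eqF.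
Qed.

End star_linear.

(** * Differentials of [Phi_inf] and [Phi1] at the barycenter, and their form in a chart *)

Section barycenter_calculus.
Context {R : realType} {d n : nat}.
Variables (tau0 tau1 : R) (lam : 'I_n -> R) (a : 'I_n -> {posnum R}) (mu : 'I_n -> gparam R d).
Hypotheses (hn : (0 < n)%N) (t00 : 0 < tau0) (t10 : 0 < tau1) (lam0 : forall i, 0 < lam i).
Hypotheses (hmu : forall i, Gd (mu i)).
Variables (b : gparam R d) (S : 'I_n -> 'M[R]_d).
Let c := cw tau0 tau1 lam a.
Hypotheses (pG : sympd b.2) (pS : forall i, sympd (S i)) (eS : forall i, S i *m b.2 *m S i = (mu i).2).
Hypotheses (sm : \sum_i c i *: ((mu i).1 - b.1) = 0) (sS : \sum_i c i *: (1%:M - S i) = 0).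
Variable LL : 'I_n -> 'M[R]_d -> 'M[R]_d.
Hypotheses (linLL : forall i, linW (LL i)) (hLL : forall i H, lyap b.2 (invmx (S i)) (LL i H) = - H)
 (uLL : forall i X H, lyap b.2 (invmx (S i)) X = - H -> X = LL i H)
 (saLL : forall i X Y, \tr (LL i X *m Y) = \tr (X *m LL i Y)).

Let s := tau0 + tau1.
Let G := b.2.
Let A i := (mu i).2.
Let K i := 1%:M - S i.
Let dl i := (mu i).1 - b.1.
Let W i := Wass (mu i) b.
Let Zc := Z0 tau0 tau1 lam a.
Let Zp := Zc `^ ((theta tau0 tau1)^-1 - 1).
Let Y i := (2 / tau1) *: (G *m K i *m G) - (2 / tau0) *: (G *m (S i *m S i - S i) *m G).

Definition dinf (q xi : gparam R d) : R := Zp * \sum_i c i * dWass (mu i) q (gm (mu i).2 q.2) xi.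
(** The second differential of [Phi_inf] at the barycenter up to the factor [Zp]; [LL i] is the
    derivative of [gm] in the covariance. *)
Definition Qform (xi eta : gparam R d) : R := 2 * Zc * dotc xi.1 eta.1 - \sum_i c i * \tr (LL i xi.2 *m eta.2).
Definition dC i (xi : gparam R d) : R := 4 / tau0 * dotc (A i *m dl i) xi.1 + 4 / tau1 * dotc (G *m dl i) xi.1
 - 2 / tau1 * \tr (K i *m G *m K i *m xi.2) - 2 / tau1 * dotc (dl i) (xi.2 *m dl i) + \tr (Y i *m LL i xi.2).
(** The term in [M1 ^+ 2] contributes nothing, since the differential of [M1] vanishes at the
    barycenter. *)
Definition dPhi1 (xi : gparam R d) : R := Zp * \sum_i c i * dC i xi - Zp / s * \sum_i c i * (W i * dWass (mu i) b (S i) xi).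

Let c0 i : 0 < c i. Proof. exact: cw_gt0. Qed.
Let Zc0 : 0 < Zc. Proof. exact: sum_gt0. Qed.
Let Zp0 : 0 < Zp. Proof. exact: powR_gt0. Qed.

Lemma gmS i : gm (mu i).2 b.2 = S i.
Proof. by symmetry; exact: gm_unique (hmu i) pG (pS i) (eS i). Qed.

Lemma dWass_bound p q (T : 'M[R]_d) : exists k : R, forall xi, `|dWass p q T xi| <= k * `|xi|.
Proof.
exists (2 * (d%:R * `|p.1 - q.1|) + d%:R ^+ 2 * `|1%:M - T|) => xi; have [n1 n2] := pair_norm_le xi.
apply: normD_leM.
 rewrite normrM normrN (@ger0_norm _ (2 : R))// -[leRHS]mulrA ler_wpM2l//.
 by apply: le_trans (dotc_norm _ _) _; rewrite ler_wpM2l// mulr_ge0.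
by apply: le_trans (tr_mxM_norm _ _) _; rewrite ler_wpM2l// mulr_ge0 ?sqr_ge0.
Qed.

Lemma qexp_Wass p q T : Gd p -> Gd q -> sympd T -> T *m q.2 *m T = p.2 ->
 qexp Gd (Wass p : gparam R d -> R^o) q (dWass p q T).
Proof.
move=> hp hq pT eT; split; first exact: dWass_bound.
have [C [r [C0 r0 h]]] := Wass_expand hp hq pT eT.
by exists C, r; split => // y hy yr; apply: h => //; exact: ltW.
Qed.

Lemma qexp_Phi_inf q : Gd q ->
 qexp Gd (Phi_inf tau0 tau1 lam a mu : gparam R d -> R^o) q (dinf q).
Proof.
move=> hq; have h i : qexp Gd (Wass (mu i) : gparam R d -> R^o) q
 (dWass (mu i) q (gm (mu i).2 q.2)).
 by have [pT eT] := gmP (hmu i) hq; exact: qexp_Wass.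
exact: (qexpZ Zp (qexp_sum hq (fun i => qexpZ (c i) (h i)))).
Qed.

Lemma sum_dWass_b xi : \sum_i c i * dWass (mu i) b (S i) xi = 0.
Proof.
rewrite (eq_bigr (fun i => - 2 * (c i * dotc (dl i) xi.1) + c i * \tr (K i *m xi.2))); last first.
 by move=> i _; rewrite /dWass -/(K i) -/(dl i); ring.
rewrite big_split/= -mulr_sumr.
have -> : \sum_i c i * dotc (dl i) xi.1 = 0.
 transitivity (dotc (\sum_i c i *: dl i) xi.1); last by rewrite sm dotc0l.
 rewrite (big_morph (fun v => dotc v xi.1) (fun u v => dotcDl u v xi.1) (dotc0l xi.1)).
 by apply: eq_bigr => i _; rewrite dotcZl.
have -> : \sum_i c i * \tr (K i *m xi.2) = 0.
 transitivity (\tr ((\sum_i c i *: K i) *m xi.2)); last by rewrite sS mul0mx linear0.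
 by rewrite mulmx_suml [RHS]linear_sum/=; apply: eq_bigr => i _; rewrite -scalemxAl mxtraceZ.
by rewrite mulr0 addr0.
Qed.

Lemma dinf_b xi : dinf b xi = 0.
Proof. by rewrite /dinf; under eq_bigr do rewrite gmS; rewrite sum_dWass_b mulr0. Qed.

Lemma LL_bound i : exists k : R, 0 <= k /\ forall H, `|LL i H| <= k * `|H|.
Proof.
have [k k0 hk] := lyap_bound pG (sympd_inv (pS i)); exists k; split => // H.
by have := hk _ _ (hLL i H); rewrite normrN.
Qed.

Lemma qexp_gm i : qexp Gd (fun q => gm (mu i).2 q.2) b (fun xi => LL i xi.2).
Proof.
split.
 have [k [k0 hk]] := LL_bound i; exists k => v; apply: le_trans (hk _) _.
 by rewrite ler_wpM2l//; have [] := pair_norm_le v.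
have [C [r [C0 r0 h]]] := gm_expand (hmu i) pG (pS i) (eS i) (hLL i) (linLL i).
exists C, r; split => // y hy yr; have [pT eT] := gmP (hmu i) hy; rewrite gmS.
have [_ n2] := pair_norm_le (y - b).
apply: le_trans (h _ _ hy pT eT _) _; first by apply: le_trans n2 _; exact: ltW.
by rewrite ler_wpM2l// lerXn2r// nnegrE.
Qed.

Lemma dinf_expand : exists C r : R, 0 < r /\ forall q xi, Gd q -> `|q - b| < r ->
 `|dinf q xi - Zp * Qform (q - b) xi| <= C * `|q - b| ^+ 2 * `|xi|.
Proof.
have hq i := (qexp_gm i).2; have [C hC] := choice hq; have [r hr] := choice hC.
exists (`|Zp| * \sum_i `|c i| * (d%:R ^+ 2 * `|C i|)), (\big[Num.min/1]_i r i); split.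
 by apply: lt_bigmin => // i _; have [] := hr i.
move=> q xi gq qr.
have -> : dinf q xi - Zp * Qform (q - b) xi = Zp * \sum_i c i *
 (- \tr ((gm (mu i).2 q.2 - gm (mu i).2 b.2 - LL i (q - b).2) *m xi.2)).
 rewrite -mulrBr; congr (_ * _); rewrite /Qform /Zc /Z0 mulr_sumr mulr_suml.
 have e0 (x : R) : x = x - \sum_i c i * dWass (mu i) b (S i) xi by rewrite sum_dWass_b subr0.
 have trB (P Q : 'M[R]_d) : \tr (P - Q) = \tr P - \tr Q by rewrite linearB.
 rewrite [LHS]e0 -!sumrB; apply: eq_bigr => i _.
 rewrite gmS /dWass !mulmxBl !trB !dotcBl -/(c i).
 do ?[move: (\tr _) => ?]; do ?[move: (dotc _ _) => ?]; move: (c i) => ?; ring.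
rewrite normrM -mulrA -mulrA ler_wpM2l// mulr_suml; apply: le_trans (ler_norm_sum _ _ _) _.
apply: ler_sum => i _; rewrite normrM normrN -mulrA ler_wpM2l//.
have [n1 n2] := pair_norm_le xi.
apply: le_trans (tr_mxM_norm _ _) _; rewrite -[leLHS]mulrA.
have -> : d%:R ^+ 2 * `|C i| * (`|q - b| ^+ 2 * `|xi|) = d%:R ^+ 2 * (`|C i| * `|q - b| ^+ 2 * `|xi|) by ring.
rewrite ler_wpM2l ?sqr_ge0// ler_pM//.
have [_ h] := hr i; apply: le_trans (h q gq _) _; last by rewrite ler_wpM2r ?sqr_ge0// ler_norm.
by apply: lt_le_trans qr _; exact: bigmin_le_cond.
Qed.

Lemma qexp_Ci i : qexp Gd (Ci tau0 tau1 mu i : gparam R d -> R^o) b (dC i).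
Proof.
pose Sq (q : gparam R d) := gm (mu i).2 q.2; have hS := qexp_gm i; rewrite -/Sq in hS.
have c1 (V : nmodT R) (v : V) := @qexp_cst R (gparam R d) V Gd v b.
have h1 := @qexp_id1 R _ _ Gd b; have h2 := @qexp_id2 R _ _ Gd b.
have hdl := qexpB (pG : Gd b) (c1 _ (mu i).1) h1.
(* [(1 - S) Sg S] is rewritten as [Sg S - A], where [A] is constant, which shortens the product
   rule. *)
have hM := qexpB (pG : Gd b) (qexp_mx h2 hS) (c1 _ (A i)).
have hN := qexp_mx (qexpB (pG : Gd b) (c1 _ (1%:M : 'M[R]_d)) hS) h2.
have q1 := qexp_dotc (pG : Gd b) hdl (qexp_mx (c1 _ (A i)) hdl).
have q2 := qexp_tr (qexp_mx hM hM).
have q3 := qexp_dotc (pG : Gd b) hdl (qexp_mx h2 hdl).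
have q4 := qexp_tr (qexp_mx hN hN).
have q := qexpD (qexpZ (- (2 * tau0)^-1) (qexpD (qexpZ 4 q1) (qexpZ 2 q2)))
 (qexpZ (- (2 * tau1)^-1) (qexpD (qexpZ 4 q3) (qexpZ 2 q4))).
apply: (qexp_ext (pG : Gd b) _ _ q) => [y hy|xi].
 have [pT eT] := gmP (hmu i) hy; rewrite -/(Sq y) in pT eT.
 rewrite (Ci_formula tau0 tau1 (hmu i) hy pT eT) /GRing.scale/= -[in RHS]mulNr; congr (_ * (_ + _ * _) + _ * (_ + _ * _)).
 have -> : y.2 *m Sq y - A i = (1%:M - Sq y) *m y.2 *m Sq y by rewrite !mulmxBl !mul1mx eT.
 by rewrite !mulmxA.
 by rewrite !mulmxA.
have uS := sympd_unit (pS i); rewrite /Sq gmS -/G -/(A i) /GRing.scale/=; set X := LL i xi.2.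
(* Expressing the direction through its Lyapunov solution [X] makes the derivative of [Sg S]
   collapse to a single product. *)
have eX : xi.2 = - lyap G (invmx (S i)) X by rewrite hLL opprK.
have sA : (A i)^T = A i by exact: sympd_sym (hmu i).
have e1 : \tr ((G *m S i - A i) *m (G *m X + xi.2 *m S i - 0) + (G *m X + xi.2 *m S i - 0) *m (G *m S i - A i))
 = 2 * \tr (G *m (S i *m S i - S i) *m G *m X).
 rewrite linearD/= [\tr ((_ - 0) *m _)]mxtrace_mulC -mulr2n mulr_natl; congr (_ *+ _); rewrite subr0.
 have -> : G *m X + xi.2 *m S i = - (invmx (S i) *m X *m G *m S i).
 by rewrite eX /lyap mulNmx mulmxDl -!mulmxA mulVmx// mulmx1 opprD addrC -addrA addNr addr0.
 have -> : G *m S i - A i = (1%:M - S i) *m G *m S i by rewrite !mulmxBl !mul1mx eS.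
 rewrite mulmxN linearN/= !mulmxA mulmxK//.
 rewrite -[_ *m G *m S i]mulmxA mxtrace_mulC -/(K i).
 have -> : S i *m S i - S i = - (S i *m K i) by rewrite mulmxBr mulmx1 opprB.
 by rewrite mulmxN !mulNmx linearN/= !mulmxA.
have e2 : \tr ((1%:M - S i) *m G *m ((1%:M - S i) *m xi.2 + (0 - X) *m G) +
 ((1%:M - S i) *m xi.2 + (0 - X) *m G) *m ((1%:M - S i) *m G)) =
 2 * (\tr (K i *m G *m K i *m xi.2) - \tr (G *m K i *m G *m X)).
 rewrite linearD/= [\tr ((_ + _) *m (_ *m _))]mxtrace_mulC -mulr2n mulr_natl; congr (_ *+ _).
 rewrite sub0r mulNmx -/(K i) mulmxBr linearB/= !mulmxA; congr (_ - _).
 by rewrite [RHS]mxtrace_mulC mulmxA [RHS]mxtrace_mulC !mulmxA -[RHS]mxtrace_mulC !mulmxA.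
have eY : \tr (Y i *m X) = 2 / tau1 * \tr (G *m K i *m G *m X) - 2 / tau0 * \tr (G *m (S i *m S i - S i) *m G *m X).
 by rewrite /Y mulmxBl -!scalemxAl linearB/= !mxtraceZ.
have e3 : dotc ((mu i).1 - b.1) (A i *m (0 - xi.1) + 0 *m ((mu i).1 - b.1)) + dotc (0 - xi.1) (A i *m ((mu i).1 - b.1)) = - 2 * dotc (A i *m dl i) xi.1.
 rewrite mul0mx addr0 !sub0r mulmxN dotcNr dotcNl -/(dl i) (dotcC xi.1) [dotc (dl i) _]dotc_mulmx sA; ring.
have e4 : dotc ((mu i).1 - b.1) (b.2 *m (0 - xi.1) + xi.2 *m ((mu i).1 - b.1)) + dotc (0 - xi.1) (b.2 *m ((mu i).1 - b.1)) = - 2 * dotc (G *m dl i) xi.1 + dotc (dl i) (xi.2 *m dl i).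
 rewrite !sub0r mulmxN dotcDr dotcNr dotcNl -/(dl i) -/G (dotcC xi.1) [dotc (dl i) (G *m _)]dotc_mulmx (sympd_sym pG); ring.
rewrite e1 e2 e3 e4 /dC -/X eY.
do ?[move: (\tr _) => ?]; do ?[move: (dotc _ _) => ?].
by field; rewrite !gt_eqF.
Qed.

Lemma qexp_Phi1 : qexp Gd (Phi1 tau0 tau1 lam a mu : gparam R d -> R^o) b dPhi1.
Proof.
have gb : Gd b := pG.
have hW i := qexp_Wass (hmu i) gb (pS i) (eS i).
have hC := qexp_sum gb (fun i => qexpZ (c i) (qexp_Ci i)).
have hM1 := qexp_sum gb (fun i => qexpZ (c i) (hW i)).
have hM2 := qexp_sum gb (fun i => qexpZ (c i) (qexp_R (hW i) (hW i))).
have h := qexpB gb (qexpB gb (qexpZ Zp hC) (qexpZ (Zp / (2 * sbar tau0 tau1)) hM2))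
 (qexpZ (((theta tau0 tau1)^-1 - 1) / (2 * sbar tau0 tau1) * Zc `^ ((theta tau0 tau1)^-1 - 2)) (qexp_R hM1 hM1)).
apply: (qexp_ext gb _ _ h) => [y hy|xi].
 have e2 : \sum_i c i *: (Wass (mu i) y * Wass (mu i) y : R^o) = M2 tau0 tau1 lam a mu y.
 by apply: eq_bigr => i _; rewrite -expr2.
 by rewrite e2 /Phi1 expr2.
have -> : \sum_i c i *: dWass (mu i) b (S i) xi = 0 :> R^o by exact: sum_dWass_b.
rewrite mulr0 mul0r addr0 scaler0 subr0 /dPhi1 /GRing.scale/=; congr (_ - _).
rewrite !mulr_sumr; apply: eq_bigr => i _; rewrite -/(W i) /sbar -/s.
by field; rewrite gt_eqF// addr_gt0.
Qed.

Lemma Qform_sym xi eta : Qform xi eta = Qform eta xi.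
Proof.
rewrite /Qform dotcC; congr (_ - _); apply: eq_bigr => i _.
by rewrite saLL mxtrace_mulC.
Qed.

Lemma Qform_lin eta : linW (fun xi => Qform xi eta : R^o).
Proof.
move=> k u v; rewrite /Qform dotcDl dotcZl /GRing.scale/= mulrBr.
have -> : \sum_i c i * \tr (LL i (k *: u.2 + v.2) *m eta.2) =
 k * (\sum_i c i * \tr (LL i u.2 *m eta.2)) + \sum_i c i * \tr (LL i v.2 *m eta.2).
 rewrite mulr_sumr -big_split/=; apply: eq_bigr => i _.
 by rewrite linLL mulmxDl linearD/= -scalemxAl mxtraceZ; ring.
by ring.
Qed.

Lemma Qform_gt0 xi : tangent xi -> xi != 0 -> 0 < Qform xi xi.
Proof.
move=> txi xi0.
have sX i : (LL i xi.2)^T = LL i xi.2.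
 apply: uLL; have := hLL i xi.2 => /(congr1 trmx); rewrite linearN/= (txi : xi.2^T = xi.2) => <-.
 by rewrite /lyap linearD/= !trmx_mul (sympd_sym pG) (sympd_sym (sympd_inv (pS i))) addrC !mulmxA.
have hk i : exists k : R, 0 < k /\ k * `|LL i xi.2| ^+ 2 <= - \tr (LL i xi.2 *m xi.2).
 have [k k0 hk] := lyap_coercive pG (sympd_inv (pS i)); exists k; split => //.
 by apply: le_trans (hk _) _; rewrite hLL sX mulmxN linearN.
have tr0 i : 0 <= - \tr (LL i xi.2 *m xi.2).
 by have [k [k0 h]] := hk i; apply: le_trans h; rewrite mulr_ge0 ?sqr_ge0// ltW.
rewrite /Qform -sumrN.
have s0 : 0 <= \sum_i - (c i * \tr (LL i xi.2 *m xi.2)).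
 by apply: sumr_ge0 => i _; rewrite -mulrN mulr_ge0// ltW.
have [e1|n1] := eqVneq xi.1 0; last first.
 by rewrite ltr_pwDl// mulr_gt0 ?mulr_gt0// dotc_gt0.
rewrite e1 dotc0l mulr0 add0r (bigD1 (Ordinal hn))//= ltr_pwDl//; last first.
 by apply: sumr_ge0 => i _; rewrite -mulrN mulr_ge0// ltW.
rewrite -mulrN mulr_gt0//; have [k [k0 h]] := hk (Ordinal hn); apply: lt_le_trans h.
rewrite mulr_gt0// exprn_gt0// normr_gt0; apply: contra xi0 => /eqP X0.
have e2 : xi.2 = 0.
 by apply: oppr_inj; rewrite -(hLL (Ordinal hn)) X0 /lyap !mulmx0 !mul0mx addr0 oppr0.
by apply/eqP; rewrite (surjective_pairing xi) e1 e2.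
Qed.

(** The slope of the maps is [LL i (Sg1 - Y i)]. Self-adjointness of [LL i] moves the part in [Y i]
    onto the test direction, where it becomes the last term of [dC]. *)
Lemma critical_direction (Sg1 : 'M[R]_d) (m1 : 'cV[R]_d) (S1 : 'I_n -> 'M[R]_d) :
 (forall i, lyap G (invmx (S i)) (S1 i) = - (Sg1 - Y i)) ->
 (forall h H, H^T = H -> 2 * (\sum_i c i) * dotc m1 h - \sum_i c i * \tr (S1 i *m H) =
 s^-1 * (\sum_i c i * wcost (mu i) b (S i) * (- 2 * dotc (dl i) h + \tr (K i *m H))) -
 \sum_i c i * (4 / tau0 * dotc (A i *m dl i) h + 4 / tau1 * dotc (G *m dl i) h
 - 2 / tau1 * \tr (K i *m G *m K i *m H) - 2 / tau1 * dotc (dl i) (H *m dl i))) ->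
 forall xi, tangent xi -> Zp * Qform (m1, Sg1) xi = - dPhi1 xi.
Proof.
move=> hS1 h xi txi; have {}h := h xi.1 xi.2 txi.
have eS1 i : S1 i = LL i (Sg1 - Y i) by exact: uLL.
have eW i : W i = wcost (mu i) b (S i) by exact: Wass_eq.
have e1 : \sum_i c i * \tr (S1 i *m xi.2) =
 \sum_i c i * \tr (LL i Sg1 *m xi.2) - \sum_i c i * \tr (Y i *m LL i xi.2).
 rewrite -sumrB; apply: eq_bigr => i _; rewrite -mulrBr eS1 (linW_B Sg1 (Y i) (linLL i)).
 by rewrite (mulmxBl (LL i Sg1)) linearB/= [\tr (LL i (Y i) *m _)]saLL.
rewrite e1 in h; rewrite /Qform /dPhi1 /dC /Zc /Z0 /=.
have e3 : \sum_i c i * (W i * dWass (mu i) b (S i) xi) =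
 \sum_i c i * wcost (mu i) b (S i) * (- 2 * dotc (dl i) xi.1 + \tr (K i *m xi.2)).
 by apply: eq_bigr => i _; rewrite eW /dWass mulrA.
rewrite e3 -/c; under [X in _ = - (_ * X - _)]eq_bigr do rewrite mulrDr; rewrite big_split/=.
move: h; move: (\sum_i c i * \tr (LL i Sg1 *m xi.2)) (\sum_i c i * \tr (Y i *m LL i xi.2)) => s1 s2 h.
have -> : 2 * (\sum_i c i) * dotc m1 xi.1 - s1 = (2 * (\sum_i c i) * dotc m1 xi.1 - (s1 - s2)) - s2 by ring.
by rewrite h; do ?[move: (\sum_i _) => ?]; ring.
Qed.

Section chart.
Variables (N : nat) (U : set (gparam R d)) (x : gparam R d -> 'cV[R]_N) (xinv : 'cV[R]_N -> gparam R d).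
Hypotheses (hx : analytic_chart U x xinv) (Ub : U b).

Let V : set 'cV[R]_N := x @` U.
Let f := Phi_inf tau0 tau1 lam a mu \o xinv.
Let f1 := Phi1 tau0 tau1 lam a mu \o xinv.

Lemma chart_sub : U `<=` Gd.
Proof. by case: hx => -[D _ e] *; rewrite e; exact: subIsetr. Qed.

Lemma chart_inv p : U p -> xinv (x p) = p.
Proof. by have [_ _ h _ _] := hx; move=> Up; apply: h; rewrite inE. Qed.

Lemma chart_inv_in v : V v -> U (xinv v).
Proof. by move=> [p Up <-]; rewrite chart_inv. Qed.

Lemma chartK v : V v -> x (xinv v) = v.
Proof. by move=> [p Up <-]; rewrite chart_inv. Qed.

Lemma Qform_bound : exists2 k : R, 0 <= k & forall xi eta, `|Qform xi eta| <= k * `|xi| * `|eta|.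
Proof.
have [k hk] := choice LL_bound.
exists (2 * Zc * d%:R + \sum_i c i * (d%:R ^+ 2 * k i)).
 rewrite addr_ge0//; first by rewrite !mulr_ge0// ltW.
 apply: sumr_ge0 => i _; have [k0 _] := hk i.
 by rewrite mulr_ge0 ?(ltW (c0 i))// mulr_ge0 ?sqr_ge0.
move=> xi eta; have [x1 x2] := pair_norm_le xi; have [y1 y2] := pair_norm_le eta.
rewrite /Qform -[leRHS]mulrA (mulrDl (2 * Zc * d%:R)); apply: le_trans (ler_normB _ _) _; apply: lerD.
 rewrite normrM (gtr0_norm (mulr_gt0 (ltr0n _ 2) Zc0)) -[leRHS]mulrA ler_wpM2l ?mulr_ge0 ?(ltW Zc0)//.
 by apply: le_trans (dotc_norm _ _) _; rewrite -mulrA ler_wpM2l// ler_pM.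
rewrite mulr_suml; apply: le_trans (ler_norm_sum _ _ _) _; apply: ler_sum => i _.
have [k0 hi] := hk i; rewrite normrM gtr0_norm// -[leRHS]mulrA ler_wpM2l ?(ltW (c0 i))//.
apply: le_trans (tr_mxM_norm _ _) _; rewrite -[leLHS]mulrA -[leRHS]mulrA ler_wpM2l ?sqr_ge0// mulrA ler_pM//.
by apply: le_trans (hi _) _; rewrite ler_wpM2l.
Qed.

(** As [dinf] vanishes at the barycenter, second derivatives of the chart do not enter: the Hessian
    is [Zp * Qform] pulled back by the differential [P] of the inverse chart. *)
Lemma chart_hessian : exists (P : 'cV[R]_N -> gparam R d) (Qx : gparam R d -> 'cV[R]_N),
 [/\ linW P, linW Qx, qexp V xinv (x b) P, qexp Gd x b Qx & forall h, tangent (P h)] /\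
 [/\ twice_differentiable f (x b), differentiable f1 (x b),
 forall j, gradient f1 (x b) j 0 = dPhi1 (P (delta_mx j 0)),
 forall j, linW (fun v => Zp * Qform (P v) (P (delta_mx j 0)) : R^o) /\
 forall v, (hessian f (x b) *m v) j 0 = Zp * Qform (P v) (P (delta_mx j 0)) &
 sympd (hessian f (x b))].
Proof.
have [_ oV _ anx anxi] := hx; have Vb : V (x b) by exists b.
have gb : Gd b := pG.
have [Qx [Cx [rx [linQ rx0 Cx0 bQ sQ]]]] := analytic_strong (anx b Ub).
have qx := strong_qexp gb rx0 bQ sQ.
have hP v : exists L : 'cV[R]_N -> gparam R d, V v -> linW L /\ qexp setT xinv v L.
 have [Vv|nV] := pselect (V v); last by exists (fun=> 0).
 have [L [C [r [linL r0 C0 bL sL]]]] := analytic_strong (anxi v Vv).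
 by exists L => _; split => //; exact: (strong_qexp _ r0 bL sL).
have [P' hP'] := choice hP.
have [P [C [r [linP r0 C0 bP sP]]]] := analytic_strong (anxi (x b) Vb).
have qP : qexp setT xinv (x b) P by exact: (strong_qexp _ r0 bP sP).
have qPV := qexpW (@subsetT _ V) qP.
exists P, Qx.
have e_inv : xinv (x b) = b by exact: chart_inv.
have gV v : V v -> Gd (xinv v) by move=> Vv; apply: chart_sub; exact: chart_inv_in.
(* The inverse chart takes values in symmetric covariances on an open set, so its differential does
   as well, by uniqueness of expansions. *)
have tanP v h : V v -> forall L, linW L -> qexp setT xinv v L -> tangent (L h).
 move=> Vv L linL qL; pose F (q : gparam R d) := q.2^T - q.2.
 have q1 : qexp V (fun y => F (xinv y)) v (fun h => F (L h)).
 apply: (@qexp_lin _ _ _ _ _ F 2 _ _ _ _ _ (qexpW (@subsetT _ V) qL)).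
 by move=> u w; rewrite /F /= linearB/= opprD addrACA [in RHS]opprD.
 move=> u; have [_ n2] := pair_norm_le u; apply: le_trans (ler_normB _ _) _.
 by rewrite mx_normT -mulr2n -[leLHS]mulr_natl ler_wpM2l.
 have q2 : qexp V (fun y => F (xinv y)) v (fun=> 0).
 apply: (qexp_ext Vv _ _ (qexp_cst V (0 : 'M[R]_d) v)) => // y Vy.
 by rewrite /F (sympd_sym (gV y Vy)) subrr.
 have lF : linW (fun h => F (L h)).
 move=> k u w; rewrite /F linL /= linearP/= scalerBr opprD addrACA; congr (_ + _).
 have l0 : linW (fun _ : 'cV[R]_N => 0 : 'M[R]_d) by move=> k u w; rewrite scaler0 addr0.
 have /eqP := qexp_unique oV Vv lF l0 q1 q2 h.
 by rewrite subr_eq0 => /eqP.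
split; first by split => // h; exact: (tanP _ _ Vb _ linP qP).
(* From [x (xinv y) = y] the differentials compose to the identity; this transfers positivity from
   [Qform] to the Hessian. *)
have injP h : P h = 0 -> h = 0.
 have q1 : qexp V (fun y => x (xinv y)) (x b) (fun h => Qx (P h)).
 apply: (@qexp_comp _ _ _ _ _ V x xinv _ Qx P _ Vb gV _ qPV) => [u v|].
 exact: linW_B.
 by rewrite e_inv.
 have q2 : qexp V (fun y => x (xinv y)) (x b) id.
 split; first by exists 1 => v; rewrite mul1r.
 by exists 0, 1; split => // y Vy _; rewrite !chartK// subrr normr0 mul0r.
 have lQP : linW (fun h => Qx (P h)) by move=> k u w; rewrite linP linQ.
 have := qexp_unique oV Vb lQP _ q1 q2 h => e P0; rewrite -e; last by move=> k u w.
 by rewrite P0 (linW0 linQ).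
have dinf_lin q : linW (fun xi => dinf q xi : R^o).
 move=> k u w; rewrite /dinf /GRing.scale/= [k * _]mulrCA -mulrDr; congr (_ * _).
 rewrite mulr_sumr -big_split/=; apply: eq_bigr => i _; rewrite /dWass/= dotcDr dotcZr mulmxDr -scalemxAr mxtraceD mxtraceZ; ring.
have dP1_lin : linW (fun xi => dPhi1 xi : R^o).
 have lc (F : 'I_n -> gparam R d -> R) : (forall i, linW (F i : gparam R d -> R^o)) ->
 linW (fun xi => \sum_i c i * F i xi : R^o).
 move=> hF k u w; rewrite /GRing.scale/= mulr_sumr -big_split/=; apply: eq_bigr => i _.
 by rewrite hF /GRing.scale/=; ring.
 have l1 i : linW (dC i : gparam R d -> R^o).
 move=> k u w; rewrite /dC /= linLL; move: (Y i) (K i *m G *m K i) (dl i) => YY KK di.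
 rewrite !mulmxDr -!scalemxAr !mulmxDl -!scalemxAl.
 rewrite !dotcDr !dotcZr !mxtraceD !mxtraceZ /GRing.scale/=; ring.
 have l2 i : linW (fun xi => Wass (mu i) b * dWass (mu i) b (S i) xi : R^o).
 move=> k u w; rewrite /dWass/= dotcDr dotcZr mulmxDr -scalemxAr mxtraceD mxtraceZ /GRing.scale/=; ring.
 move=> k u w; rewrite /dPhi1 (lc _ l1) (lc _ l2) /GRing.scale/=; ring.
have df v : V v -> differentiable f v /\ forall h, 'D_h f v = dinf (xinv v) (P' v h).
 move=> Vv; have [linL qL] := hP' v Vv.
 have q1 : qexp V (f : _ -> R^o) v (fun h => dinf (xinv v) (P' v h)).
 apply: (@qexp_comp _ _ _ _ Gd V _ xinv _ _ (P' v) _ Vv gV _ (qexpW (@subsetT _ V) qL)) => [u w|].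
 exact: (linW_B _ _ (dinf_lin _)).
 by apply: qexp_Phi_inf => //; exact: gV.
 by apply: (qexp_differentiable oV Vv _ q1) => k u w; rewrite linL dinf_lin.
have df1 : differentiable f1 (x b) /\ forall h, 'D_h f1 (x b) = dPhi1 (P h).
 have q1 : qexp V (f1 : _ -> R^o) (x b) (fun h => dPhi1 (P h)).
 apply: (@qexp_comp _ _ _ _ Gd V _ xinv _ _ P _ Vb gV _ qPV) => [u w|].
 exact: (linW_B _ _ dP1_lin).
 by rewrite e_inv; exact: qexp_Phi1.
 by apply: (qexp_differentiable oV Vb _ q1) => k u w; rewrite linP dP1_lin.
have linH eta : linW (fun v => Zp * Qform (P v) eta : R^o).
 move=> k u w; rewrite linP Qform_lin /GRing.scale/=; ring.
have [KQ KQ0 bdQ] := Qform_bound.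
have [Cd [rd [rd0 hd]]] := dinf_expand.
have [Kl [rl [Kl0 rl0 hl]]] := qexp_lipschitz qPV.
have [_ [C2 [r2 [r20 h2]]]] := qPV.
have qg j : qexp V (fun y => gradient f y j 0 : R^o) (x b) (fun v => Zp * Qform (P v) (P (delta_mx j 0))).
 pose ej : 'cV[R]_N := delta_mx j 0; rewrite -/ej.
 pose g y := dinf (xinv y) (P' y ej).
 have e2 : g (x b) = 0 by rewrite /g e_inv dinf_b.
 apply: (@qexp_ext _ _ _ V (g : _ -> R^o) _ _ (fun v => Zp * Qform (P v) (P ej)) _ Vb) => [y Vy|//|].
 by rewrite mxE (df y Vy).2.
 split.
 exists (Zp * (KQ * (C * `|P ej|))) => v; rewrite normrM gtr0_norm// -mulrA ler_wpM2l ?(ltW Zp0)//.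
 apply: le_trans (bdQ _ _) _; have -> : KQ * (C * `|P ej|) * `|v| = KQ * (C * `|v|) * `|P ej| by ring.
 by rewrite ler_wpM2r// ler_wpM2l.
 pose B : R := `|P ej| + C * `|ej|.
 exists (`|Cd| * Kl ^+ 2 * B + Zp * (KQ * `|C2| * B + KQ * C * (C * `|ej|))),
 (Num.min (Num.min (Num.min r rl) (Num.min r2 1)) (rd / (Kl + 1))); split.
 by rewrite !lt_min r0 rl0 r20 ltr01 divr_gt0// ltr_wpDl.
 move=> y Vy; rewrite !lt_min => /andP[/andP[/andP[y1 y2] /andP[y3 y4]] y5].
 have [linL qL] := hP' y Vy; set xi := P' y ej.
 rewrite e2 subr0 /g -/xi; pose q : gparam R d := xinv y - b.
 have hxi : `|xi - P ej| <= C * `|y - x b| * `|ej|.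
 apply: (strong_derivative_lip C0 linP linL _ y1 qL) => u w m; exact: sP.
 have xiB : `|xi| <= B.
 have -> : xi = xi - P ej + P ej by rewrite subrK.
 apply: le_trans (ler_normD _ _) _; rewrite /B addrC lerD2l; apply: le_trans hxi _.
 by rewrite ler_wpM2r// ler_piMr// ltW.
 have hq : `|q| <= Kl * `|y - x b| by have := hl y Vy y2; rewrite e_inv.
 have hq2 : `|q - P (y - x b)| <= `|C2| * `|y - x b| ^+ 2.
 have := h2 y Vy y3; rewrite e_inv => /le_trans; apply.
 by rewrite ler_wpM2r ?sqr_ge0// ler_norm.
 have qd : `|q| < rd.
 apply: le_lt_trans hq _; rewrite ltr_pdivlMr ?ltr_wpDl// in y5; apply: le_lt_trans y5.
 by rewrite mulrC ler_wpM2l// lerDl.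
 have h3 := hd (xinv y) xi (gV y Vy) qd.
 (* Three errors, each quadratic: the expansion of [dinf], that of the inverse chart in the first
    slot, and in the second slot the variation of its differential, multiplied by a first-order
    quantity. *)
 have eQ : dinf (xinv y) xi - Zp * Qform (P (y - x b)) (P ej) =
 dinf (xinv y) xi - Zp * Qform q xi +
 Zp * (Qform (q - P (y - x b)) xi + Qform (P (y - x b)) (xi - P ej)).
 have QB u w z : Qform (u - w) z = Qform u z - Qform w z := linW_B u w (Qform_lin z).
 by rewrite (QB q (P (y - x b)) xi) (Qform_sym _ (xi - P ej)) (QB xi (P ej)) (Qform_sym xi) (Qform_sym (P ej)); ring.
 rewrite eQ; apply: normD_leM.
 apply: le_trans h3 _; apply: (@le_trans _ _ (`|Cd| * `|q| ^+ 2 * `|xi|)).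
 by rewrite ler_wpM2r// ler_wpM2r ?sqr_ge0// ler_norm.
 have -> : `|Cd| * Kl ^+ 2 * B * `|y - x b| ^+ 2 = `|Cd| * (Kl * `|y - x b|) ^+ 2 * B by ring.
 rewrite ler_pM ?mulr_ge0 ?sqr_ge0// ler_wpM2l//; apply: lerXn2r; rewrite ?nnegrE//; exact: mulr_ge0.
 rewrite normrM (gtr0_norm Zp0) -[leRHS]mulrA ler_wpM2l ?(ltW Zp0)//.
 apply: normD_leM.
 apply: le_trans (bdQ _ _) _.
 have -> : KQ * `|C2| * B * `|y - x b| ^+ 2 = KQ * (`|C2| * `|y - x b| ^+ 2) * B by ring.
 by rewrite ler_pM ?mulr_ge0// ler_wpM2l.
 apply: le_trans (bdQ _ _) _.
 have -> : KQ * C * (C * `|ej|) * `|y - x b| ^+ 2 = KQ * (C * `|y - x b|) * (C * `|y - x b| * `|ej|) by ring.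
 by rewrite ler_pM ?mulr_ge0// ler_wpM2l.
have hD j := qexp_differentiable oV Vb (linH _) (qg j).
have hH i j : hessian f (x b) i j = Zp * Qform (P (delta_mx i 0)) (P (delta_mx j 0)).
 by rewrite mxE (hD j).2.
have hv j v : (hessian f (x b) *m v) j 0 = Zp * Qform (P v) (P (delta_mx j 0)).
 rewrite mxE (linW_sum_delta (linH _) v); apply: eq_bigr => k _.
 by rewrite hH Qform_sym mulrC.
split; [| | |by move=> j; split; [exact: linH|exact: hv]|].
- split; first by near=> y; apply: (df y _).1; near: y; exact: open_nbhs_nbhs.
 have q := qexp_col qg.
 have -> : gradient f = fun y => \col_j gradient f y j 0.
 by apply/funext => y; apply/matrixP => i k; rewrite !mxE.
 apply: (qexp_differentiable oV Vb _ q).1 => k u w; apply/matrixP => i l.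
 by rewrite !mxE linH.
- exact: df1.1.
- by move=> j; rewrite mxE df1.2.
- apply: sympdP; first by apply/matrixP => i j; rewrite mxE !hH Qform_sym.
 move=> v v0; have e : dotc v (hessian f (x b) *m v) = Zp * Qform (P v) (P v).
 rewrite dotcE [RHS](linW_sum_delta (linH (P v)) v); apply: eq_bigr => i _.
 by rewrite hv [Qform _ (P v)]Qform_sym.
 rewrite e; apply: mulr_gt0; first exact: Zp0.
 apply: Qform_gt0.
 exact: (tanP _ _ Vb _ linP qP).
 by apply: contra v0 => /eqP /injP ->.
Unshelve. all: by end_near. Qed.

End chart.

End barycenter_calculus.

(** * The unique minimizer of [Phi_inf] *)

Section barycenter_argmin.
Context {R : realType} {d n : nat}.

(** Strict convexity in the form needed: the distance lies above its tangent by the square of the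
    mean displacement and the gap of [gm_gap]. If both vanish the maps agree, hence so do the
    covariances. *)
Lemma Wass_gt (p q q' : gparam R d) (S : 'M[R]_d) : Gd p -> Gd q -> Gd q' ->
 sympd S -> S *m q.2 *m S = p.2 -> q' != q -> Wass p q + dWass p q S (q' - q) < Wass p q'.
Proof.
move=> hp hq hq' pS eS ne; have eW := Wass_eq hp hq pS eS; have sh := wcost_shift p q q' S.
have [pT eT] := gmP hp hq'; set T := gm p.2 q'.2 in pT eT.
have uS := sympd_unit pS; have uT := sympd_unit pT.
have gap : Wass p q' - wcost p q' S = \tr ((T - S) *m invmx S *m (T - S) *m q'.2).
 have eA (M Q : 'M[R]_d) : M \in unitmx -> M *m Q *m M = p.2 -> \tr (p.2 *m invmx M) = \tr (M *m Q).
 by move=> uM <-; rewrite mulmxK.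
 rewrite (gm_gap uS (etrans eT (esym eS))) (Wass_eq hp hq' pT eT) /wcost !mulmxBr !mulmx1 !linearB/=.
 rewrite (eA _ _ uS eS) (eA _ _ uT eT) ![\tr (q'.2 *m _)]mxtrace_mulC.
 do ?[move: (\tr _) => ?]; ring.
have [k k0 hk] := tr_PXQ_ge (sympd_inv pS) hq'.
have sTS : (T - S)^T = T - S by rewrite linearB/= (sympd_sym pT) (sympd_sym pS).
have {}hk : k * fro (T - S) <= Wass p q' - wcost p q' S by rewrite gap -[X in X *m invmx S]sTS.
clear gap.
have f0 : 0 <= k * fro (T - S) by rewrite mulr_ge0 ?fro_ge0// ltW.
have h0 := dotc_ge0 (q'.1 - q.1); rewrite lt_neqAle; apply/andP; split; last first.
 by move: sh hk f0 h0; rewrite eW; move: (dotc _ _) (dWass _ _ _ _) (wcost p q S) (wcost p q' S) (Wass p q') (k * _) => *; lra.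
apply: contra ne => /eqP e; have [d0 fz] : dotc (q'.1 - q.1) (q'.1 - q.1) <= 0 /\ k * fro (T - S) <= 0.
 by move: sh hk f0 h0 e; rewrite eW; move: (dotc _ _) (dWass _ _ _ _) (wcost p q S) (wcost p q' S) (Wass p q') (k * _) => *; lra.
have /eqP : T - S = 0 by apply: fro_eq0; rewrite -(ler_pM2l k0) mulr0.
rewrite subr_eq0 => /eqP eTS; rewrite eTS -eS in eT.
have e2 : q'.2 = q.2.
 by apply: (can_inj (mulKmx uS)); apply: (can_inj (mulmxK uS)).
have [/eqP|n1] := eqVneq (q'.1 - q.1) 0; last by move: d0; rewrite leNgt dotc_gt0.
by rewrite subr_eq0 => /eqP e1; apply/eqP; case: (q) (q') e1 e2 => ? ? [? ?] /= -> ->.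
Qed.

Lemma argmin_Phi_inf (tau0 tau1 : R) (lam : 'I_n -> R) (a : 'I_n -> {posnum R}) (mu : 'I_n -> gparam R d)
 (b : gparam R d) (S : 'I_n -> 'M[R]_d) : (0 < n)%N -> (forall i, 0 < lam i) ->
 (forall i, Gd (mu i)) -> sympd b.2 -> (forall i, sympd (S i)) ->
 (forall i, S i *m b.2 *m S i = (mu i).2) ->
 \sum_i cw tau0 tau1 lam a i *: ((mu i).1 - b.1) = 0 -> \sum_i cw tau0 tau1 lam a i *: (1%:M - S i) = 0 ->
 argmin Gd (Phi_inf tau0 tau1 lam a mu) = [set b].
Proof.
move=> hn lam0 hmu pG pS eS sm sS; set c := cw _ _ _ _ in sm sS *.
have c0 i : 0 < c i by exact: cw_gt0.
have Z0p : 0 < Z0 tau0 tau1 lam a by exact: sum_gt0.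
have lt q : Gd q -> q != b -> Phi_inf tau0 tau1 lam a mu b < Phi_inf tau0 tau1 lam a mu q.
 move=> hq nq; rewrite /Phi_inf ltr_pM2l ?powR_gt0// -[ltLHS]addr0.
 rewrite -(sum_dWass_b sm sS (q - b)) /M1 -big_split/= -subr_gt0 -sumrB.
 have pos i : 0 < c i * Wass (mu i) q - (c i * Wass (mu i) b + c i * dWass (mu i) b (S i) (q - b)).
 by rewrite subr_gt0 -mulrDr ltr_pM2l//; exact: Wass_gt.
 by rewrite (bigD1 (Ordinal hn))//= ltr_pwDl ?pos// sumr_ge0// => i _; exact: ltW (pos i).
apply/seteqP; split => [q [hq hm]|q ->] /=; last first.
 split; first exact: pG.
 by move=> q' hq'; case: (eqVneq q' b) => [->|nq]; [done|exact: ltW (lt _ hq' nq)].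
by apply/eqP/negPn/negP => nq; have := hm b pG; rewrite leNgt (lt q hq nq).
Qed.

End barycenter_argmin.

(** * Expansion of the minimizer and of its mass in [1 / kappa] *)

Lemma near_pinfty_inv {R : realType} (r : R) : 0 < r -> \forall k \near +oo, 0 < k^-1 < r.
Proof.
move=> r0; near=> k; have k1 : r^-1 < k by near: k; apply: nbhs_pinfty_gt; exact: num_real.
have k0 : 0 < k by apply: lt_trans k1; rewrite invr_gt0.
by rewrite invr_gt0 k0 invf_plt ?posrE.
Unshelve. all: by end_near. Qed.

Theorem theorem6p9 (R : realType) (d n : nat) (tau0 tau1 : R)
    (lam : 'I_n -> R) (a : 'I_n -> {posnum R}) (mu : 'I_n -> gparam R d)
    (hd : (0 < d)%N) (hn : (0 < n)%N) (htau0 : 0 < tau0) (htau1 : 0 < tau1)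
    (hlam : forall i, 0 < lam i) (hlam1 : \sum_(i < n) lam i = 1)
    (hmu : forall i, gaussians R d (mu i)) :
  exists nuBW : gparam R d,
    argmin (gaussians R d) (Phi_inf tau0 tau1 lam a mu) = [set nuBW] /\
    forall (N : nat) (U : set (gparam R d)) (x : gparam R d -> 'cV[R]_N)
        (xinv : 'cV[R]_N -> gparam R d),
      analytic_chart U x xinv -> U nuBW ->
      let xBW := x nuBW in
      let fInf := Phi_inf tau0 tau1 lam a mu \o xinv in
      let f1 := Phi1 tau0 tau1 lam a mu \o xinv in
      let Hinf := hessian fInf xBW in
      let th := theta tau0 tau1 in
      [/\ twice_differentiable fInf xBW,
          differentiable f1 xBW,
          sympd Hinf &
          exists (kstar : R) (nu : R -> gparam R d) (X : R -> 'cV[R]_N),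
            [/\ 0 < kstar,
                forall k, kstar <= k ->
                  argmin (gaussians R d) (Phi tau0 tau1 lam a mu k)
                    = [set nu k],
                forall k, kstar <= k ->
                  exists2 b : {posnum R},
                    b%:num = bmass tau0 tau1 lam a mu k (nu k) &
                    argmin (setT `*` gaussians R d)
                      (Fobj tau0 tau1 lam a mu k) = [set (b, nu k)],
                (\forall e \near 0, analytic_within setT X e) /\
                (\forall k \near +oo, U (nu k) /\ x (nu k) = X k^-1) &
                (exists C : R, \forall k \near +oo,
                  `|x (nu k) -
                    (xBW - k^-1 *: (invmx Hinf *m gradient f1 xBW))|
                  <= C * k ^- 2) /\
                (exists C : R, \forall k \near +oo,
                  `|bmass tau0 tau1 lam a mu k (nu k) -
                    (Z0 tau0 tau1 lam a `^ th^-1 -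
                     Z0 tau0 tau1 lam a `^ (th^-1 - 1) / (tau0 * k) *
                       M1 tau0 tau1 lam a mu nuBW)|
                  <= C * k ^- 2)]].
Proof.
have [rho [Sg [m [S [N0 [r [w [e0 [e0r st [pSg pm] pp opt]]]]]]]]] :=
 @star_optimal R d n tau0 tau1 lam a mu hn htau0 htau1 hlam hlam1 hmu.
have [e00 er] : 0 < e0 /\ e0 <= rho by move/andP: e0r.
have rho0 : 0 < rho := lt_le_trans e00 er.
have [[pG pS mS hN hr] [hw sm sS]] := star0 hmu rho0 st.
have wj := w_jet htau0 htau1 hmu rho0 st pSg pm pp.
have [Sg1 [m1 [S1 [jSg jm sSg1 hS1 lin1]]]] := star_linearized htau0 htau1 hmu rho0 st pSg pm pp.
set b : gparam R d := (m 0, Sg 0).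
have z0 : `|0 : R| < rho by rewrite normr0.
exists b; split.
 exact: (argmin_Phi_inf hn hlam hmu (b := b) (S := fun i => S i 0) pG pS mS sm sS).
move=> N U x xinv hx Ub xBW fInf f1 Hinf th.
have hLL i : exists LL : 'M[R]_d -> 'M[R]_d,
 [/\ linW LL, forall H, lyap b.2 (invmx (S i 0)) (LL H) = - H,
 (forall X H, lyap b.2 (invmx (S i 0)) X = - H -> X = LL H) &
 forall X Y, \tr (LL X *m Y) = \tr (X *m LL Y)] by apply: lyap_inverse => //; exact: sympd_inv.
have [LL hLL'] := choice hLL.
have linLL i : linW (LL i) by have [] := hLL' i.
have eLL i H : lyap b.2 (invmx (S i 0)) (LL i H) = - H by have [_ h _ _] := hLL' i.
have uLL i X H : lyap b.2 (invmx (S i 0)) X = - H -> X = LL i H.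
 by have [_ _ h _] := hLL' i; exact: h.
have saLL i X Y : \tr (LL i X *m Y) = \tr (X *m LL i Y) by have [_ _ _ h] := hLL' i.
have [P [Qx [[linP linQ qP qQ tP] [tw df1 gr1 hH pH]]]] :=
 @chart_hessian R d n tau0 tau1 lam a mu hn htau0 htau1 hlam hmu b (fun i => S i 0) pG pS mS sm sS
 LL linLL eLL uLL saLL N U x xinv hx Ub.
split => //.
pose c e : gparam R d := (m e, Sg e).
have gc e : `|e| < rho -> Gd (c e) by move=> he; exact: star_Sg (st e he).
have [B oB eU] : exists2 B, open B & U = B `&` Gd by case: (hx).
pose xi1 : gparam R d := (m1, Sg1).
have jc : qexp [set e : R | `|e| < rho] c 0 (fun t => t *: xi1).
 apply: (qexpW (@subsetT _ _)); have [C1 [r1 [r10 h1]]] := jSg; have [C2 [r2 [r20 h2]]] := jm.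
 apply: (proj2 (proj1 (jetP c b xi1) _)); exists (Num.max C1 C2), (Num.min r1 r2); split; first by rewrite lt_min r10.
 move=> e; rewrite lt_min => /andP[e1 e2]; rewrite prod_normE ge_max/=; apply/andP; split.
 by apply: le_trans (h2 e e2) _; rewrite ler_wpM2r ?sqr_ge0// le_max lexx orbT.
 by apply: le_trans (h1 e e1) _; rewrite ler_wpM2r ?sqr_ge0// le_max lexx.
(* A radius on which the curve stays in the chart domain, which is open relative to the Gaussian
   parameters only; the Lipschitz bound of the curve provides it. *)
have [r2 [r20 r2rho hU]] : exists r2 : R, [/\ 0 < r2, r2 <= rho & forall e, `|e| < r2 -> U (c e)].
 have [K [s [K0 s0 hl]]] := qexp_lipschitz jc.
 have Bb : B b by move: Ub; rewrite eU => -[].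
 have [t t0 ht] : exists2 t : R, 0 < t & forall y, `|y - b| < t -> B y.
 have /nbhs_ballP[t /= t0 ht] : nbhs b B by exact: open_nbhs_nbhs.
 by exists t => // y yt; apply: ht; rewrite -ball_normE /ball_/= distrC.
 exists (Num.min (Num.min rho s) (t / (K + 1))); split.
 - by rewrite !lt_min rho0 s0 divr_gt0// ltr_wpDl.
 - by rewrite !ge_min lexx.
 - move=> e; rewrite !lt_min => /andP[/andP[e1 e2] e3]; rewrite eU; split; last exact: gc.
 apply: ht; have := hl e e1; rewrite subr0 => /(_ e2) h; apply: le_lt_trans h _.
 rewrite ltr_pdivlMr ?ltr_wpDl// in e3; apply: le_lt_trans e3.
 by rewrite mulrC ler_wpM2l// lerDl.
pose E : set R := [set e | `|e| < r2].
have oE : open E.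
 rewrite (_ : E = ball 0 r2); first exact: ball_open.
 by apply/seteqP; split => e; rewrite -ball_normE /ball_/= sub0r normrN.
have E0 : E 0 by rewrite /E/= normr0.
have Erho e : E e -> `|e| < rho by move=> h; exact: lt_le_trans r2rho.
have jcE : qexp E c 0 (fun t => t *: xi1) by apply: qexpW jc => e; exact: Erho.
have linc : linW (fun t : R => t *: xi1) by move=> k u v; rewrite scalerDl scalerA.
pose X e := x (c e); pose X1 := Qx xi1.
have QZ t : Qx (t *: xi1) = t *: X1 by have := linQ t xi1 0; rewrite !addr0 (linW0 linQ) addr0.
have qX : qexp E X 0 (fun t => Qx (t *: xi1)).
 apply: (@qexp_comp _ _ _ _ Gd E x c 0 Qx (fun t => t *: xi1) _ E0 _ qQ jcE) => [u v|e Ee].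
 exact: linW_B.
 by apply: gc; exact: Erho.
(* Differentiating [xinv (x (c e)) = c e]: the velocity in the chart is sent back to the velocity of
   the parameters. *)
have PX : P X1 = xi1.
 have q1 : qexp E (fun e => xinv (X e)) 0 (fun t => P (Qx (t *: xi1))).
 apply: (@qexp_comp _ _ _ _ (x @` U) E xinv X 0 P _ _ E0 _ qP qX) => [u v|e Ee]; first exact: linW_B.
 by exists (c e) => //; exact: hU.
 have q2 : qexp E (fun e => xinv (X e)) 0 (fun t => t *: xi1).
 by apply: (qexp_ext E0 _ _ jcE) => // e Ee; rewrite (chart_inv hx)//; exact: hU.
 have l1 : linW (fun t : R => P (Qx (t *: xi1))) by move=> k u v; rewrite linc linQ linP.
 by have := qexp_unique oE E0 l1 linc q1 q2 1; rewrite !scale1r.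
have eX1 : X1 = - (invmx Hinf *m gradient f1 xBW).
 (* [critical_direction] tested on the images of the coordinate vectors, which are tangent, gives
    the equation row by row. *)
 have key : Hinf *m X1 = - gradient f1 xBW.
 apply/matrixP => j k; rewrite ord1 [RHS]mxE gr1 (hH j).2 PX.
 exact: (critical_direction (mu := mu) (b := b) (S := fun i => S i 0) hmu pG pS mS linLL uLL saLL hS1 lin1 (tP _)).
 by rewrite -mulmxN -key mulmxA mulVmx ?mul1mx// sympd_unit.
have s0 : 0 < tau0 + tau1 by rewrite addr_gt0.
have jw : jet (fun e => \sum_i w i e : R^o) (Z0 tau0 tau1 lam a)
 (- (M1 tau0 tau1 lam a mu b / (tau0 + tau1))).
 apply: (jet_conv (jet_sum wj) rho0) => //; rewrite -mulNr -sumrN mulr_suml; apply: eq_bigr => i _.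
 by rewrite mulNr (@Wass_eq _ _ (mu i) b (S i 0)) //.
have Zc0 : 0 < Z0 tau0 tau1 lam a by apply: sum_gt0 => // i; exact: cw_gt0.
have jb := jet_powR th^-1 Zc0 jw.
(* The factor 2 turns [kstar <= k] into the strict inequality [k^-1 < e0] under which the curve is
   optimal. *)
have inv_lt k : 2 / e0 <= k -> 0 < k^-1 /\ k^-1 < e0.
 move=> hk; have k0 : 0 < k by apply: lt_le_trans hk; rewrite divr_gt0.
 split; rewrite ?invr_gt0// invf_plt ?posrE//; apply: lt_le_trans hk.
 by rewrite ltr_pMl ?invr_gt0// ltr1n.
exists (2 / e0), (fun k => c k^-1), X; split.
- by rewrite divr_gt0.
- by move=> k /inv_lt[k0 ke]; have [h _ _] := opt _ k0 ke; rewrite invrK in h.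
- by move=> k /inv_lt[k0 ke]; have [_ h _] := opt _ k0 ke; rewrite invrK in h.
- split.
 apply/nbhs_ballP; exists r2 => // e; rewrite -ball_normE /ball_/= sub0r normrN => ee.
 apply: (@chart_curve_analytic _ _ _ x rho _ _ e (Erho _ ee) pSg pm gc).
 by have [_ _ _ h _] := hx; exact: h (hU _ ee).
 apply: filterS (near_pinfty_inv r20) => k /andP[kp kl]; split => //.
 by apply: hU; rewrite gtr0_norm.
- split.
 have [_ [C [s [sp hs]]]] := qX; exists C.
 have sr : 0 < Num.min s r2 by rewrite lt_min sp.
 apply: filterS (near_pinfty_inv sr) => k; rewrite lt_min -exprVn => /andP[kp /andP[e1 e2]].
 have Ek : E k^-1 by rewrite /E/= gtr0_norm.
 have := hs _ Ek; rewrite subr0 gtr0_norm// => /(_ e1); rewrite QZ eX1 scalerN opprK.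
 by rewrite /X -/xBW opprB addrA addrAC.
 have [C [s [sp hs]]] := jb; exists C.
 have sr : 0 < Num.min s e0 by rewrite lt_min sp.
 apply: filterS (near_pinfty_inv sr) => k; rewrite lt_min => /andP[ep /andP[e1 e2]].
 have [_ _ eb] := opt _ ep e2; rewrite invrK in eb.
 have k0 : 0 < k by rewrite -invr_gt0.
 rewrite eb -exprVn; have := hs k^-1; rewrite gtr0_norm// => /(_ e1); apply: le_trans.
 (* The slope of the power carries [1 / theta] and that of the sum [1 / s]; their product is
    [1 / tau0], the constant of the statement. *)
 set v := k^-1 *: _; have -> : v = - (Z0 tau0 tau1 lam a `^ (th^-1 - 1) / (tau0 * k) * M1 tau0 tau1 lam a mu b).
 rewrite /v /GRing.scale/= /th /theta /sbar; move: (_ `^ _) (M1 _ _ _ _ _ _) => ? ?.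
 by field; rewrite !gt_eqF.
 by rewrite opprK opprB addrA addrAC.
Qed.
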